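(* Let $\sigma,\tau\in\mathbb N$ with $\sigma\le\tau$ and let $T_0=(t_0,t_1,\ldots,t_\tau)$ be a list of steps with $0\le t_0<\dots<t_\tau=N$. Assume $t_h-t_{h-1}$ is an odd natural number $2n_h+1$ for every $h\in\{1,\ldots,\sigma\}$, and set $T_h=(t_h,\ldots,t_\tau)$ for $h\in\{1,\dots,\sigma\}$. Let $D$ be as in the context and assume $\Omega_D$ is a domain. Then for every strongly $T_0$-regular function $f\in\mathcal{SR}_{T_0}(\Omega_D,A)$, the function $\Delta_{T_\sigma}^{n_\sigma}\cdots\Delta_{T_2}^{n_2}\Delta_{T_1}^{n_1}f$ (the $\sigma$-th Fueter transform of $f$) is a strongly $T_\sigma$-regular function and is still a $T_0$-function; in symbols, it belongs to $\mathcal{SR}_{T_\sigma}(\Omega_D,A)\cap\mathcal{S}^\omega_{T_0}(\Omega_D,A)$.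
   Context: Setting. $A$ is a finite-dimensional associative real algebra with unit $1$ and a $*$-involution $x\mapsto x^c$ (an involutive real-linear antiautomorphism). Let $\mathbb S_A=\{x\in A: x+x^c=0,\ xx^c=1\}$, assumed nonempty. $V\subseteq A$ is a real subspace with a hypercomplex basis $\mathcal B=(v_0,\dots,v_N)$, $N\ge1$: $v_0=1$, $v_s\in\mathbb S_A$ for $s\geq1$, $v_sv_t=-v_tv_s$ for distinct $s,t\ge1$, and $V\subseteq\bigcup_{J\in\mathbb S_A}(\mathbb R+J\mathbb R)$. Complete $\mathcal B$ to a real basis of $A$ and give $A$ the Euclidean norm $\|\cdot\|$ making that basis orthonormal; write $x=\sum_{s=0}^Nx_sv_s$. For $0\le\ell<m\le N$, $\mathbb R_{\ell,m}=\mathrm{Span}_{\mathbb R}(v_\ell,\dots,v_m)$ and $\mathbb S_{\ell,m}$ is its unit sphere. A list of steps $T=(t_0,\dots,t_\tau)$ ($\tau\in\mathbb N$, $0\le t_0<\dots<t_\tau=N$) has torus $\mathbb T=\mathbb S_{t_0+1,t_1}\times\cdots\times\mathbb S_{t_{\tau-1}+1,t_\tau}$ (for $\tau=0$ one uses the single index $J=\emptyset$ with $\beta J=0$). Each $x\in V$ decomposes uniquely as $x=x^0+\dots+x^\tau$ with $x^h=\sum_{s=t_{h-1}+1}^{t_h}x_sv_s$ ($t_{-1}=-1$). For $J\in\mathbb T$, $\beta\in\mathbb R^\tau$, $\beta J=\sum_h\beta_hJ_h$; $\mathscr P(\tau)$ is the power set of $\{1,\dots,\tau\}$; $J_\emptyset=1$,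 $J_K=J_{k_1}\cdots J_{k_p}$ for $K=\{k_1<\dots<k_p\}$; $\overline\beta^h$ is $\beta$ with $\beta_h$ replaced by $-\beta_h$. $T$-functions (for the list $T_0$, with $T=T_0$). $D\subseteq\mathbb R_{0,t_0}\times\mathbb R^\tau$ is open and invariant under $(\alpha,\beta)\mapsto(\alpha,\overline\beta^h)$ for each $h$, and $\Omega_D=\{\alpha+\beta J:(\alpha,\beta)\in D,J\in\mathbb T\}$ is open in $V$. A $T$-stem function is $F=\sum_{K\in\mathscr P(\tau)}E_KF_K:D\to A\otimes\mathbb R^{2^\tau}$ with $F_K(\alpha,\overline\beta^h)=F_K(\alpha,\beta)$ if $h\notin K$ and $=-F_K(\alpha,\beta)$ if $h\in K$. It induces $\mathcal I(F)(\alpha+\beta J)=\sum_KJ_KF_K(\alpha,\beta)$; $\mathcal I$ is a well-defined injective right $A$-linear map onto the class $\mathcal S_T(\Omega_D,A)$ of $T$-functions; $\mathcal S^p_T$ is the image of stems with $C^p$ components ($p\in\mathbb N\cup\{\infty,\omega\}$, $\omega$ = real analytic). Regularity. For $J\in\mathbb T$, $\mathbb R_J=\mathrm{Span}(v_0,\dots,v_{t_0},J_1,\dots,J_\tau)$; for $\phi$ on an open subset of $\mathbb R_J$, $\overline\partial_J\phi=\sum_{s=0}^{t_0}v_s\partial_s\phi+\sum_{u=1}^\tau J_u\partial_{t_0+u}\phi$ where $\partial_s,\partial_{t_0+u}$ are directional derivatives along $v_s,J_u$. A function $f$ on a domain $\Omega\subseteq V$ is $T$-regular if $\overline\partial_J(f|_{\Omega\cap\mathbb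 R_J})\equiv0$ for all $J\in\mathbb T$. If $\Omega_D$ is a domain, $\mathcal{SR}_T(\Omega_D,A)$ is the set of $T$-functions that are $T$-regular (strongly $T$-regular functions); they are real analytic. Laplacian. Writing $\alpha=\sum_{s=0}^{t_0}x_sv_s$, for a $C^2$ $T$-stem $F$, $(\Delta_TF)_K=\sum_{s=0}^{t_0}\partial_{x_s}^2F_K+\sum_{h=1}^\tau\partial_{\beta_h}^2F_K$ and $\Delta_T\mathcal I(F)=\mathcal I(\Delta_TF)$. The same definitions apply to any list of steps. Sub-lists. For $1\le h\le\tau$, $T_h=(t_h,\dots,t_\tau)$ is a list of steps with mirror $\mathbb R_{0,t_h}$, and $\Omega_D=\Omega_{D^h}$ for $T_h$ where $D^h=\{(\alpha+x^1+\dots+x^h,\beta_{h+1},\dots,\beta_\tau):x^v\in\mathbb R_{t_{v-1}+1,t_v},(\alpha,\|x^1\|,\dots,\|x^h\|,\beta_{h+1},\dots,\beta_\tau)\in D\}$. Every element of $\mathcal S^p_{T_0}(\Omega_D,A)$ (and more generally of $\mathcal S^p_{T_j}$, $j<h$), $p\in\{\infty,\omega\}$, is an element of $\mathcal S^p_{T_h}(\Omega_D,A)$, and $\Delta_{T_h}$ is applied to it in that sense. *)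

(* Defs.v *)
From HB Require Import structures.
From mathcomp Require Import all_boot all_order all_algebra all_field.
From mathcomp Require Import all_classical all_reals all_analysis.
Unset Implicit Arguments. Unset Strict Implicit. Unset Printing Implicit Defensive.
Import Order.TTheory GRing.Theory Num.Theory.
Import numFieldNormedType.Exports.
Local Open Scope classical_set_scope.
Local Open Scope ring_scope.

Definition star_involution {R : realType} {A : falgType R} (conj : A -> A) : Prop :=
  [/\ forall (a : R) (x y : A), conj (a *: x + y) = a *: conj x + conj y,
      forall x y : A, conj (x * y) = conj y * conj x
    & forall x : A, conj (conj x) = x].

Definition SA {R : realType} {A : falgType R} (conj : A -> A) : set A :=
  [set x | x + conj x = 0 /\ x * conj x = 1].

Definition toA {R : realType} {A : falgType R} {N : nat} (v : 'I_N.+1 -> A)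
  (x : 'rV[R]_N.+1) : A := \sum_(s < N.+1) x ord0 s *: v s.

Definition hypercomplex_basis {R : realType} {A : falgType R} (conj : A -> A)
  {N : nat} (v : 'I_N.+1 -> A) : Prop :=
  [/\ v ord0 = 1,
      forall s : 'I_N.+1, s != ord0 -> SA conj (v s),
      forall s t : 'I_N.+1, s != ord0 -> t != ord0 -> s != t ->
        v s * v t = - (v t * v s),
      forall c : 'I_N.+1 -> R, \sum_(s < N.+1) c s *: v s = 0 -> forall s, c s = 0
    &
      forall x : 'rV[R]_N.+1, exists J, SA conj J /\
        exists a b : R, toA v x = a%:A + b *: J].

(* nat-indexed access to the basis / to row vectors (0 out of range) *)
Definition vn {R : realType} {A : falgType R} {N : nat} (v : 'I_N.+1 -> A)
  (i : nat) : A := oapp v 0 (insub i).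
Definition rowat {R : realType} {n : nat} (y : 'rV[R]_n) (i : nat) : R :=
  oapp (fun k : 'I_n => y ord0 k) 0 (insub i).

Definition is_steps (N : nat) (T : seq nat) : Prop :=
  [/\ T != [::], sorted ltn T & last 0%N T = N].

Definition t0 (T : seq nat) : nat := head 0%N T.
Definition tau (T : seq nat) : nat := (size T).-1.
Definition tstep (T : seq nat) (h : nat) : nat := nth 0%N T h.
(* dimension of R_{0,t_0} x R^tau, where stem functions live *)
Definition sdim (T : seq nat) : nat := (t0 T).+1 + tau T.

(* index s belongs to the (h+1)-th block  t_h < s <= t_{h+1}   (h 0-based) *)
Definition inblock (T : seq nat) (h s : nat) : bool :=
  (tstep T h < s <= tstep T h.+1)%N.

(* An element J = (J_1, ..., J_tau) of the torus is encoded by a coordinate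
   vector j : J_{h+1} = sum_{s in block h} j_s v_s, with unit norm.      *)
Definition inTorus {R : realType} {N : nat} (T : seq nat) (j : 'rV[R]_N.+1) : Prop :=
  forall h, (h < tau T)%N -> \sum_(s < N.+1 | inblock T h s) (j ord0 s) ^+ 2 = 1.

Definition Jc {R : realType} {A : falgType R} {N : nat} (v : 'I_N.+1 -> A)
  (T : seq nat) (j : 'rV[R]_N.+1) (h : nat) : A :=
  \sum_(s < N.+1 | inblock T h s) j ord0 s *: v s.

Definition JK {R : realType} {A : falgType R} {N : nat} (v : 'I_N.+1 -> A)
  (T : seq nat) (j : 'rV[R]_N.+1) (K : {set 'I_(tau T)}) : A :=
  \prod_(u < tau T | u \in K) Jc v T j u.

(* coordinates of alpha + beta J, where y = (alpha, beta) *)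
Definition pt {R : realType} {N : nat} (T : seq nat) (j : 'rV[R]_N.+1)
  (y : 'rV[R]_(sdim T)) : 'rV[R]_N.+1 :=
  \row_(s < N.+1) (if (s <= t0 T)%N then rowat y s
     else \sum_(h < tau T | inblock T h s) rowat y ((t0 T).+1 + h) * j ord0 s).

(* Omega_D, as a set of coordinate vectors of V *)
Definition Om {R : realType} (N : nat) (T : seq nat) (D : set 'rV[R]_(sdim T))
  : set 'rV[R]_N.+1 :=
  [set x | exists y, D y /\ exists j, inTorus T j /\ x = pt T j y].

(* (alpha, beta) |-> (alpha, overline{beta}^{u+1}) *)
Definition refl {R : realType} (T : seq nat) (u : 'I_(tau T)) (y : 'rV[R]_(sdim T))
  : 'rV[R]_(sdim T) :=
  \row_(i < sdim T) (if i == rshift (t0 T).+1 u then - y ord0 i else y ord0 i).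

Definition D_admissible {R : realType} (N : nat) (T : seq nat)
  (D : set 'rV[R]_(sdim T)) : Prop :=
  [/\ open D, forall (u : 'I_(tau T)) y, D y -> D (refl T u y)
    & open (Om N T D)].

Definition stemT {R : realType} (A : falgType R) (T : seq nat) : Type :=
  {set 'I_(tau T)} -> 'rV[R]_(sdim T) -> A.

Definition is_stem {R : realType} {A : falgType R} (T : seq nat)
  (D : set 'rV[R]_(sdim T)) (F : stemT A T) : Prop :=
  forall K (u : 'I_(tau T)) y, D y ->
    F K (refl T u y) = (if u \in K then - F K y else F K y).

Definition represents {R : realType} {A : falgType R} {N : nat} (v : 'I_N.+1 -> A)
  (T : seq nat) (D : set 'rV[R]_(sdim T)) (F : stemT A T)
  (f : 'rV[R]_N.+1 -> A) : Prop :=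
  forall y, D y -> forall j, inTorus T j ->
    f (pt T j y) = \sum_(K : {set 'I_(tau T)}) JK v T j K * F K y.

(* coordinates of A w.r.t. a fixed basis (only used to transport the
   topology / derivatives of R^d to A; any basis gives the same notions) *)
Definition acoord {R : realType} {A : falgType R} (a : A) : 'rV[R]_(\dim (fullv : {vspace A})) :=
  \row_(i < \dim (fullv : {vspace A})) coord (vbasis fullv) i a.
Definition afromc {R : realType} {A : falgType R} (r : 'rV[R]_(\dim (fullv : {vspace A}))) : A :=
  \sum_(i < \dim (fullv : {vspace A})) r ord0 i *: (vbasis (fullv : {vspace A}))`_i.

Definition pd {R : realType} {A : falgType R} {n : nat} (i : 'I_n)
  (g : 'rV[R]_n -> A) : 'rV[R]_n -> A :=
  fun y => afromc (derive (fun z => acoord (g z)) y (delta_mx 0 i)).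

Fixpoint Ck {R : realType} {A : falgType R} {n : nat} (p : nat)
  (D : set 'rV[R]_n) (g : 'rV[R]_n -> A) : Prop :=
  (forall y, D y -> {for y, continuous (fun z => acoord (g z))}) /\
  match p with
  | 0%N => True
  | p'.+1 => (forall y (i : 'I_n), D y ->
                derivable (fun z => acoord (g z)) y (delta_mx 0 i)) /\
             (forall i : 'I_n, Ck p' D (pd i g))
  end.

Definition mono {R : realType} {n : nat} (a x : 'rV[R]_n) (al : {ffun 'I_n -> nat}) : R :=
  \prod_(i < n) (x ord0 i - a ord0 i) ^+ al i.

Definition psum {R : realType} {n m : nat} (c : {ffun 'I_n -> nat} -> 'rV[R]_m)
  (a x : 'rV[R]_n) (k : nat) : 'rV[R]_m :=
  \sum_(al : {ffun 'I_n -> 'I_k.+1} | (\sum_(i < n) nat_of_ord (al i) <= k)%N)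
     mono a x [ffun i => nat_of_ord (al i)] *: c [ffun i => nat_of_ord (al i)].

Definition apsum {R : realType} {n m : nat} (c : {ffun 'I_n -> nat} -> 'rV[R]_m)
  (a x : 'rV[R]_n) (k : nat) : R :=
  \sum_(al : {ffun 'I_n -> 'I_k.+1} | (\sum_(i < n) nat_of_ord (al i) <= k)%N)
     `|mono a x [ffun i => nat_of_ord (al i)]| * `|c [ffun i => nat_of_ord (al i)]|.

Definition analytic_on {R : realType} {n m : nat} (D : set 'rV[R]_n)
  (g : 'rV[R]_n -> 'rV[R]_m) : Prop :=
  forall a, D a -> exists r : R, 0 < r /\
    exists c : {ffun 'I_n -> nat} -> 'rV[R]_m, forall x, `|x - a| < r ->
      (exists M : R, forall k, apsum c a x k <= M) /\
      ((fun k => psum c a x k) @ \oo --> g x).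

Definition Tfun {R : realType} {A : falgType R} {N : nat} (v : 'I_N.+1 -> A)
  (T : seq nat) (D : set 'rV[R]_(sdim T)) (f : 'rV[R]_N.+1 -> A) : Prop :=
  exists F : stemT A T, is_stem T D F /\ represents v T D F f.

Definition Sp {R : realType} {A : falgType R} {N : nat} (v : 'I_N.+1 -> A)
  (T : seq nat) (D : set 'rV[R]_(sdim T)) (p : nat) (f : 'rV[R]_N.+1 -> A) : Prop :=
  exists F : stemT A T, [/\ is_stem T D F, represents v T D F f
                          & forall K, Ck p D (F K)].

Definition Somega {R : realType} {A : falgType R} {N : nat} (v : 'I_N.+1 -> A)
  (T : seq nat) (D : set 'rV[R]_(sdim T)) (f : 'rV[R]_N.+1 -> A) : Prop :=
  exists F : stemT A T, [/\ is_stem T D F, represents v T D F f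
                          & forall K, analytic_on D (fun y => acoord (F K y))].

(* the coefficients of dbar_J : v_0, ..., v_{t_0}, J_1, ..., J_tau *)
Definition wJ {R : realType} {A : falgType R} {N : nat} (v : 'I_N.+1 -> A)
  (T : seq nat) (j : 'rV[R]_N.+1) (i : 'I_(sdim T)) : A :=
  if (i <= t0 T)%N then vn v i else Jc v T j (i - (t0 T).+1).

(* T-regularity on Om: for every J, f restricted to Om cap R_J (parametrized
   linearly by the coordinates w.r.t. v_0..v_{t_0},J_1..J_tau) is real
   differentiable and dbar_J of it vanishes *)
Definition Treg {R : realType} {A : falgType R} {N : nat} (v : 'I_N.+1 -> A)
  (T : seq nat) (Om : set 'rV[R]_N.+1) (f : 'rV[R]_N.+1 -> A) : Prop :=
  forall j, inTorus T j -> forall y : 'rV[R]_(sdim T), Om (pt T j y) ->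
    differentiable (fun z => acoord (f (pt T j z))) y /\
    \sum_(i < sdim T) wJ v T j i * pd i (fun z => f (pt T j z)) y = 0.

Definition SR {R : realType} {A : falgType R} {N : nat} (v : 'I_N.+1 -> A)
  (T : seq nat) (D : set 'rV[R]_(sdim T)) (f : 'rV[R]_N.+1 -> A) : Prop :=
  Tfun v T D f /\ Treg v T (Om N T D) f.

Definition LapS {R : realType} (A : falgType R) (T : seq nat) (F : stemT A T)
  : stemT A T :=
  fun K y => \sum_(i < sdim T) pd i (pd i (F K)) y.

Definition LapRel {R : realType} {A : falgType R} {N : nat} (v : 'I_N.+1 -> A)
  (T : seq nat) (D : set 'rV[R]_(sdim T)) (g g' : 'rV[R]_N.+1 -> A) : Prop :=
  exists G : stemT A T, [/\ is_stem T D G, forall K, Ck 2 D (G K),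
                           represents v T D G g & represents v T D (LapS A T G) g'].

Fixpoint LapIter {R : realType} {A : falgType R} {N : nat} (v : 'I_N.+1 -> A)
  (T : seq nat) (D : set 'rV[R]_(sdim T)) (n : nat) (g g' : 'rV[R]_N.+1 -> A)
  : Prop :=
  match n with
  | 0%N => g' = g
  | n'.+1 => exists g1, LapIter v T D n' g g1 /\ LapRel v T D g1 g'
  end.

(* (alpha + x^1 + ... + x^h, beta_{h+1..tau}) |->
   (alpha, ||x^1||, ..., ||x^h||, beta_{h+1}, ..., beta_tau) *)
Definition liftD {R : realType} (T : seq nat) (h : nat)
  (y : 'rV[R]_(sdim (drop h T))) : 'rV[R]_(sdim T) :=
  \row_(i < sdim T)
    (if (i <= t0 T)%N then rowat y i
     else if (i - (t0 T).+1 < h)%N then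
       Num.sqrt (\sum_(s < (t0 (drop h T)).+1 | inblock T (i - (t0 T).+1) s)
                   (rowat y s) ^+ 2)
     else rowat y ((t0 (drop h T)).+1 + (i - (t0 T).+1 - h))).

Definition Dh {R : realType} (T : seq nat) (D : set 'rV[R]_(sdim T)) (h : nat)
  : set 'rV[R]_(sdim (drop h T)) :=
  [set y | D (liftD T h y)].

Fixpoint FueterRel {R : realType} {A : falgType R} {N : nat} (v : 'I_N.+1 -> A)
  (T : seq nat) (D : set 'rV[R]_(sdim T)) (n : nat -> nat) (k : nat)
  (f g : 'rV[R]_N.+1 -> A) : Prop :=
  match k with
  | 0%N => g = f
  | k'.+1 => exists g1, FueterRel v T D n k' f g1 /\
               LapIter v (drop k'.+1 T) (Dh T D k'.+1) (n k'.+1) g1 g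
  end.

(* Main.v *)
(** On a slice, a [T]-regular function solves a Dirac equation whose coefficients
    anticommute. Its double Steklov mean is a [C^2] solution (Goursat's lemma for fluxes
    through cubes), hence harmonic; so the function is locally a uniform limit of harmonic
    functions, and the gradient estimate given by the maximum principle yields factorial
    bounds for all derivatives, hence analyticity. Stem components are even or odd parts
    of slices, so they are analytic as well.

    To absorb the first torus block, of dimension [d], write a slice as
    [a + J_1 z b] with [a, b] even in the radial variable [z], and put [L = z^-1 d/dz].
    With [P] the Dirac operator in the other variables, regularity reads
    [P a = b + z^2 L b], [Pbar b = - L a]; as [L] commutes with [P], applying [L^k] gives
    [P L^k a = (2k+1) L^k b + z^2 L^(k+1) b] and [Pbar L^k b = - L^(k+1) a].
    Hence [phi_k = L^k a + x L^k b], where [x] is the block variable, satisfies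
    [Dirac phi_k = (2k+1-d) L^k b] and [conj(Dirac) (L^k b) = - phi_(k+1)], so that
    [Delta phi_k = (d-2k-1) phi_(k+1)], and [phi_n] is regular when [d = 2n+1].

    The passage from [phi_k] to [phi_(k+1)] is induced by an operator on functions on [V]
    ([Sop]) that maps stems to stems for every list having the given block in its torus;
    this is why the transform remains a [T_0]-function. *)

Require Import Defs.
From HB Require Import structures.
From mathcomp Require Import all_boot all_order all_algebra all_field.
From mathcomp Require Import all_classical all_reals all_analysis.
From mathcomp Require Import ring lra zify.
Import Order.TTheory GRing.Theory Num.Theory.
Import numFieldNormedType.Exports.
Local Open Scope classical_set_scope.
Local Open Scope ring_scope.

(** * Scalar calculus on row vectors *)

(** Regularity supplies only real differentiability of each slice: neither the partial derivatives
    nor the stem are known to be continuous. Each Steklov mean gains one derivative in every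
    coordinate direction, so two means give the second derivatives that a Laplacian needs. The other
    obstacle is the hyperplane [z = 0], where [L] divides by [z]. Quotients [w / z^m], with [w]
    vanishing to order [m], form a family closed under differentiation; hence [L] preserves smooth
    even functions. For [k < n] the function [phi_k] need not be regular: what is handed from one
    step to the next is the pair of equations for [L^k a] and [L^k b]. The Fueter transform is a
    relation whose values are determined on [Omega_D] only. One explicit representative, a real
    multiple of an iterated [Sop] at each stage, is constructed, and any other one is compared with
    it on [Omega_D]. *)

Lemma rV_norm_lt (R : realType) (n : nat) (x : 'rV[R]_n) (r : R) :
  0 < r -> (forall j, `|x ord0 j| < r) -> `|x| < r.
Proof.
move=> r0 H; rewrite /Num.Def.normr/= mx_normrE.
apply: bigmax_lt => //= -[i j] _ /=; rewrite (ord1 i); exact: H.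
Qed.

Lemma rV_norm_le (R : realType) (n : nat) (x : 'rV[R]_n) (r : R) :
  0 <= r -> (forall j, `|x ord0 j| <= r) -> `|x| <= r.
Proof.
move=> r0 H; rewrite /Num.Def.normr/= mx_normrE.
apply: bigmax_le => //= -[i j] _ /=; rewrite (ord1 i); exact: H.
Qed.

Lemma coord_le_norm (R : realType) (n : nat) (x : 'rV[R]_n) j : `|x ord0 j| <= `|x|.
Proof.
rewrite [leRHS]/Num.Def.normr/= mx_normrE.
exact: (le_bigmax _ _ (ord0, j)).
Qed.

Lemma norm_delta (R : realType) (n : nat) (t : R) (i : 'I_n) :
  `|t *: delta_mx 0 i : 'rV[R]_n| = `|t|.
Proof.
apply/eqP; rewrite eq_le; apply/andP; split.
  apply: rV_norm_le => // j; rewrite !mxE eqxx /=.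
  by case: eqP => _; rewrite ?mulr1 ?mulr0 ?normr0.
apply: le_trans (coord_le_norm _ _ _ i).
by rewrite !mxE !eqxx mulr1.
Qed.

Lemma row_delta_sum (R : realType) (n : nat) (x : 'rV[R]_n) :
  x = \sum_i x ord0 i *: delta_mx 0 i.
Proof. by rewrite [LHS]matrix_sum_delta big_ord1. Qed.

Section eps.
Context {R : realType} {V : normedModType R}.

Lemma cont_eps (g : V -> R) x : {for x, continuous g} <->
  forall e : R, 0 < e -> exists2 d : R, 0 < d & forall y, `|y - x| < d -> `|g y - g x| < e.
Proof.
split=> [/cvgrPdist_lt H e e0|H].
  have /nbhs_ballP[d d0 Hd] := H _ e0.
  exists d => // y yx; rewrite distrC; apply: Hd.
  by rewrite -ball_normE /= distrC.
apply/cvgrPdist_lt => e e0; have [d d0 Hd] := H _ e0.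
apply/nbhs_ballP; exists d => // y; rewrite -ball_normE /= distrC => yx.
by rewrite distrC; apply: Hd.
Qed.

Lemma open_eps (U : set V) x : open U -> U x ->
  exists2 d : R, 0 < d & forall y, `|y - x| < d -> U y.
Proof.
move=> oU Ux; have /nbhs_ballP[d d0 Hd] := open_nbhs_nbhs (conj oU Ux).
by exists d => // y yx; apply: Hd; rewrite -ball_normE /= distrC.
Qed.

Lemma openP_eps (U : set V) : (forall x, U x ->
  exists2 d : R, 0 < d & forall y, `|y - x| < d -> U y) -> open U.
Proof.
move=> H; rewrite openE => x /H[d d0 Hd]; apply/nbhs_ballP; exists d => // y.
by rewrite -ball_normE /= distrC => /Hd.
Qed.

Lemma near_eps (P : set V) x : (\forall y \near x, P y) <->
  exists2 d : R, 0 < d & forall y, `|y - x| < d -> P y.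
Proof.
split=> [/nbhs_ballP[d d0 Hd]|[d d0 Hd]].
  by exists d => // y yx; apply: Hd; rewrite -ball_normE /= distrC.
by apply/nbhs_ballP; exists d => // y; rewrite -ball_normE /= distrC => /Hd.
Qed.

(** With the denominator cleared the estimate also holds at [t = 0], so later arguments need no
    punctured neighbourhoods. *)
Lemma is_derive_eps (g : V -> R) x v (l : R) : is_derive x v g l <->
  forall e : R, 0 < e -> exists2 d : R, 0 < d &
    forall t : R, `|t| < d -> `|g (x + t *: v) - g x - t * l| <= e * `|t|.
Proof.
split=> [[dg <-] e e0|H].
  have /cvgrPdist_lt /(_ _ e0) : (fun h => h^-1 *: ((g \o shift x) (h *: v) - g x))
      @ 0^' --> 'D_v g x by exact: dg.
  move=> [d /= d0 Hd]; exists d => // t td.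
  have [->|t0] := eqVneq t 0.
    by rewrite scale0r addr0 subrr mul0r subr0 normr0 mulr0.
  have := Hd t; rewrite /= sub0r normrN => /(_ td t0) /ltW.
  rewrite [x + _]addrC.
  rewrite -normr_gt0 in t0.
  move=> K; rewrite -ler_pdivrMr //; apply: le_trans K.
  rewrite ler_pdivrMr // -normrM mulrBl distrC.
  by rewrite -[_ *: (_ - _)]/(_ * _) mulrAC mulVf ?mul1r -?normr_gt0 // [t * _]mulrC.
suff K : (fun h => h^-1 *: ((g \o shift x) (h *: v) - g x)) @ 0^' --> l.
  apply: DeriveDef; first by apply/cvg_ex; exists l.
  exact/cvg_lim.
apply/cvgrPdist_le => e e0; have [d d0 Hd] := H _ e0.
exists d => // t /=; rewrite sub0r normrN => td t0.
have := Hd t td; rewrite -ler_pdivrMr ?normr_gt0 //; apply: le_trans.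
rewrite ler_pdivlMr ?normr_gt0 // -normrM mulrBl distrC [t *: _ + _]addrC.
by rewrite -[_ *: (_ - _)]/(_ * _) mulrAC mulVf ?mul1r // [l * _]mulrC.
Qed.

End eps.

Section line.
Context {R : realType} {V : normedModType R}.

Lemma is_derive_line (g : V -> R) x v t l : is_derive (x + t *: v) v g l <->
  is_derive t 1 (fun s : R => g (x + s *: v)) l.
Proof.
split=> /is_derive_eps H; apply/is_derive_eps => e e0; have [d d0 Hd] := H _ e0; exists d => // s sd;
  by have := Hd s sd; rewrite [s *: 1]mulr1 scalerDl addrA.
Qed.

Lemma is_derive_scale (g : V -> R) x v (c l : R) :
  is_derive x v g l -> is_derive x (c *: v) g (c * l).
Proof.
rewrite !is_derive_eps => H e e0.
have c0 : 0 < `|c| + 1 by rewrite ltr_wpDl.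
have [d d0 Hd] := H _ (divr_gt0 e0 c0); exists (d / (`|c| + 1)); first exact: divr_gt0.
move=> t td; have ct : `|t * c| <= `|t| * (`|c| + 1).
  by rewrite normrM ler_wpM2l // lerDl.
have := Hd (t * c); rewrite scalerA mulrA => K.
apply: le_trans (K _) _.
  by apply: le_lt_trans ct _; rewrite -ltr_pdivlMr.
by rewrite mulrAC ler_pdivrMr // -mulrA ler_wpM2l // ltW.
Qed.

(** The intermediate parameter is located only by [|t| <= |h|], which treats both signs of [h] at
    once and suits estimates on balls. *)
Lemma MVT_line (g : V -> R) x v (dg : R -> R) (h : R) :
  (forall t : R, `|t| <= `|h| -> is_derive (x + t *: v) v g (dg t)) ->
  exists2 t, `|t| <= `|h| & g (x + h *: v) - g x = h * dg t.
Proof.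
move=> H; pose G (s : R) := g (x + s *: v).
have dG (s : R) : `|s| <= `|h| -> is_derive s 1 G (dg s) by move=> /H /is_derive_line.
have cG (a b : R) : (forall s, s \in `[a, b] -> `|s| <= `|h|) -> {within `[a, b], continuous G}.
  move=> K; apply: derivable_within_continuous => s sab; have [] := dG s (K s sab).
  by [].
have [h0|h0] := leP 0 h.
  have K s : s \in `[0, h] -> `|s| <= `|h|.
    by rewrite in_itv /= => /andP[s0 sh]; rewrite !ger0_norm.
  have [|c ch E] := @MVT_segment _ G dg 0 h h0 _ (cG _ _ K).
    by move=> s sab; apply/dG/K; apply: subset_itv_oo_cc sab.
  by exists c; [exact: K|move: E; rewrite /G scale0r addr0 subr0 mulrC].
have K s : s \in `[h, 0] -> `|s| <= `|h|.
  by rewrite in_itv /= => /andP[s0 sh]; rewrite !ler0_norm ?lerN2 // ltW.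
have [|c ch E] := @MVT_segment _ G dg h 0 (ltW h0) _ (cG _ _ K).
  by move=> s sab; apply/dG/K; apply: subset_itv_oo_cc sab.
exists c; first exact: K.
move: E; rewrite /G scale0r addr0 sub0r => E.
by rewrite -[LHS]opprB E; ring.
Qed.

End line.

(** * Functions of class C^p through iterated partial derivatives *)

Section Cp.
Context {R : realType} {n : nat}.
Local Notation E := 'rV[R]_n.
Local Notation "''e_' i" := (delta_mx 0 i : 'rV[R]_n) (at level 8, i at level 2).

(** The scalar counterpart of [Ck]. Continuity is demanded at every order, since existence of
    partial derivatives does not yield it. *)
Fixpoint CR (p : nat) (U : set E) (g : E -> R) : Prop :=
  (forall y, U y -> {for y, continuous g}) /\
  match p with
  | 0%N => True
  | p'.+1 => (forall y i, U y -> derivable g y 'e_i) /\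
             (forall i, CR p' U (fun y => 'D_('e_i) g y))
  end.

Definition smooth (U : set E) (g : E -> R) := forall p, CR p U g.

Lemma CR_cont p (U : set E) (g : E -> R) (y : E) : CR p U g -> U y -> {for y, continuous g}.
Proof. by case: p => [|p] [H _]; apply: H. Qed.

Lemma CR_der p (U : set E) (g : E -> R) : CR p.+1 U g ->
  forall y i, U y -> is_derive y 'e_i g ('D_('e_i) g y).
Proof. by move=> [_ [H _]] y i Uy; apply: derivableP; apply: H. Qed.

Lemma CR_D1 p (U : set E) (g : E -> R) (i : 'I_n) : CR p.+1 U g -> CR p U (fun y => 'D_('e_i) g y).
Proof. by move=> [_ [_ H]]; exact: (H i). Qed.

Lemma CR_ext p (U : set E) (g : E -> R) g' : open U -> (forall y, U y -> g y = g' y) ->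
  CR p U g -> CR p U g'.
Proof.
move=> oU; elim: p g g' => [|p IH] g g' gg' H.
  split=> // y Uy; apply/cont_eps => e e0.
  have [d d0 Hd] := (cont_eps _ _).1 (CR_cont _ _ _ _ H Uy) e e0.
  have [d' d'0 Hd'] := open_eps _ _ oU Uy.
  exists (Num.min d d'); first by rewrite lt_min d0.
  by move=> z; rewrite lt_min => /andP[zd zd']; rewrite -!gg' ?Hd //; apply: Hd'.
have nr y : U y -> \forall z \near y, g z = g' z.
  move=> Uy; apply/near_eps; have [d d0 Hd] := open_eps _ _ oU Uy.
  by exists d => // z /Hd /gg'.
split; last split.
- move=> y Uy; apply/cont_eps => e e0.
  have [d d0 Hd] := (cont_eps _ _).1 (CR_cont _ _ _ _ H Uy) e e0.
  have [d' d'0 Hd'] := open_eps _ _ oU Uy.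
  exists (Num.min d d'); first by rewrite lt_min d0.
  by move=> z; rewrite lt_min => /andP[zd zd']; rewrite -!gg' ?Hd //; apply: Hd'.
- move=> y i Uy; case: H => _ [H _].
  by apply: near_eq_derivable (H y i Uy); exact: nr.
- move=> i; case: H => _ [_ H]; apply: IH (H i) => y Uy.
  by apply: near_eq_derive; exact: nr.
Qed.

(** The form used in inductions on the order: the partial derivatives may be given by any formulas
    [dg] valid on [U]. *)
Lemma CR_S p (U : set E) (g : E -> R) (dg : 'I_n -> E -> R) : open U ->
  (forall y, U y -> {for y, continuous g}) ->
  (forall y i, U y -> is_derive y 'e_i g (dg i y)) ->
  (forall i, CR p U (dg i)) -> CR p.+1 U g.
Proof.
move=> oU cg dgP H; split => //; split.
  by move=> y i Uy; case: (dgP y i Uy).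
move=> i; apply: CR_ext (H i) => // y Uy.
by case: (dgP y i Uy).
Qed.

Lemma CR_leS p (U : set E) (g : E -> R) : CR p.+1 U g -> CR p U g.
Proof.
elim: p g => [|p IH] g; first by case.
move=> [H [H1 H2]]; split => //; split => // i; exact: IH.
Qed.

Lemma CR_le p q U g : (p <= q)%N -> CR q U g -> CR p U g.
Proof.
elim: q p => [|q IH] p; first by rewrite leqn0 => /eqP ->.
rewrite leq_eqVlt => /orP[/eqP -> //|]; rewrite ltnS => pq /CR_leS; exact: IH.
Qed.

Lemma CR_sub p (U U' : set E) g : U' `<=` U -> CR p U g -> CR p U' g.
Proof.
move=> UU'; elim: p g => [|p IH] g; first by case=> H _; split => // y /UU'; exact: H.
case=> H [H1 H2]; split; first by move=> y /UU'; exact: H.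
by split=> [y i /UU'|i]; [exact: H1|apply: IH; exact: (H2 i)].
Qed.

Lemma CR_loc p (U : set E) g :
  (forall x, U x -> exists2 d : R, 0 < d & CR p [set y | `|y - x| < d] g) -> CR p U g.
Proof.
elim: p g => [|p IH] g H.
  split=> // y /H[d d0 [K _]]; apply: K => /=; by rewrite subrr normr0.
split; first by move=> y /H[d d0 [K _]]; apply: K => /=; by rewrite subrr normr0.
split; first by move=> y i /H[d d0 [_ [K _]]]; apply: K => /=; by rewrite subrr normr0.
by move=> i; apply: IH => x /H[d d0 [_ [_ K]]]; exists d => //; exact: (K i).
Qed.

Lemma contD_for (f g : E -> R) y : {for y, continuous f} -> {for y, continuous g} ->
  {for y, continuous (fun z => f z + g z)}.
Proof. by move=> ? ?; apply: continuousD. Qed.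

Lemma contM_for (f g : E -> R) y : {for y, continuous f} -> {for y, continuous g} ->
  {for y, continuous (fun z => f z * g z)}.
Proof. by move=> ? ?; apply: continuousM. Qed.

Lemma cst_cont (c : R) y : {for y, continuous (fun _ : E => c)}.
Proof. exact: cst_continuous. Qed.

Lemma CR_cst p U (c : R) : open U -> CR p U (fun _ => c).
Proof.
move=> oU; elim: p c => [|p IH] c; first by split => // y _; exact: cst_cont.
apply: (CR_S _ _ _ (fun _ _ => 0)) => //; by move=> y _; exact: cst_cont.
Qed.

Lemma is_deriveD_fun (f g : E -> R) x v (a b : R) : is_derive x v f a -> is_derive x v g b ->
  is_derive x v (fun z => f z + g z) (a + b).
Proof. by move=> H1 H2; have : is_derive x v (f + g) (a + b) by apply: is_deriveD. Qed.

Lemma is_deriveM_fun (f g : E -> R) x v (a b : R) : is_derive x v f a -> is_derive x v g b ->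
  is_derive x v (fun z => f z * g z) (f x * b + g x * a).
Proof.
by move=> H1 H2; have : is_derive x v (f * g) (f x *: b + g x *: a) by apply: is_deriveM.
Qed.

Lemma is_deriveX_fun (f : E -> R) m x v (a : R) : is_derive x v f a ->
  is_derive x v (fun z => f z ^+ m) (m%:R * f x ^+ m.-1 * a).
Proof.
move=> H; have -> : (fun z => f z ^+ m) = f ^+ m by apply/funext => z; rewrite fctE.
by have : is_derive x v (f ^+ m) ((m%:R * f x ^+ m.-1) *: a) by apply: is_deriveX.
Qed.

Lemma is_deriveZ_fun (f : E -> R) (c : R) x v (a : R) : is_derive x v f a ->
  is_derive x v (fun z => c * f z) (c * a).
Proof. by move=> H; have : is_derive x v (c *: f) (c *: a) by apply: is_deriveZ. Qed.

Lemma is_deriveB_fun (f g : E -> R) x v (a b : R) : is_derive x v f a -> is_derive x v g b ->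
  is_derive x v (fun z => f z - g z) (a - b).
Proof. by move=> H1 H2; have : is_derive x v (f - g) (a - b) by apply: is_deriveB. Qed.

Lemma is_deriveV_fun (f : E -> R) x v (a : R) : f x != 0 -> is_derive x v f a ->
  is_derive x v (fun z => (f z)^-1) (- (f x) ^- 2 * a).
Proof.
move=> fx [H <-]; apply: DeriveDef; first exact: derivableV.
exact: (deriveV fx H).
Qed.

Lemma CR_add p U f g : open U -> CR p U f -> CR p U g -> CR p U (fun y => f y + g y).
Proof.
move=> oU; elim: p f g => [|p IH] f g Hf Hg.
  by split => // y Uy; apply: contD_for; [apply: CR_cont Hf _|apply: CR_cont Hg _].
apply: (CR_S _ _ _ (fun i y => 'D_('e_i) f y + 'D_('e_i) g y)) => //.
- by move=> y Uy; apply: contD_for; [apply: CR_cont Hf _|apply: CR_cont Hg _].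
- by move=> y i Uy; apply: is_deriveD_fun; [apply: CR_der Hf _ _ _|apply: CR_der Hg _ _ _].
- by move=> i; apply: IH; exact: CR_D1.
Qed.

Lemma CR_mul p U f g : open U -> CR p U f -> CR p U g -> CR p U (fun y => f y * g y).
Proof.
move=> oU; elim: p f g => [|p IH] f g Hf Hg.
  by split => // y Uy; apply: contM_for; [apply: CR_cont Hf _|apply: CR_cont Hg _].
apply: (CR_S _ _ _ (fun i y => f y * 'D_('e_i) g y + g y * 'D_('e_i) f y)) => //.
- by move=> y Uy; apply: contM_for; [apply: CR_cont Hf _|apply: CR_cont Hg _].
- by move=> y i Uy; apply: is_deriveM_fun; [apply: CR_der Hf _ _ _|apply: CR_der Hg _ _ _].
- by move=> i; apply: CR_add => //; apply: IH; (try exact: CR_D1); exact: CR_leS.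
Qed.

Lemma CR_scale p U (c : R) f : open U -> CR p U f -> CR p U (fun y => c * f y).
Proof. by move=> oU Hf; apply: CR_mul => //; exact: CR_cst. Qed.

Lemma CR_sum (I : Type) (r : seq I) (P : pred I) p U (F : I -> E -> R) : open U ->
  (forall i, P i -> CR p U (F i)) -> CR p U (fun y => \sum_(i <- r | P i) F i y).
Proof.
move=> oU H; elim: r => [|i r IH].
  by apply: (CR_ext _ _ (fun _ => 0)) (CR_cst _ _ _ _) => // y _; rewrite big_nil.
case Pi : (P i).
  apply: (CR_ext _ _ (fun y => F i y + \sum_(j <- r | P j) F j y)) => //.
    by move=> y _; rewrite big_cons Pi.
  by apply: CR_add => //; exact: H.
by apply: (CR_ext _ _ _ _ _ _ IH) => // y _; rewrite big_cons Pi.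
Qed.

Lemma coord_cont (j : 'I_n) (y : E) : {for y, continuous (fun z : E => z ord0 j)}.
Proof. exact: coord_continuous. Qed.

Lemma is_derive_coord (j : 'I_n) (y v : E) :
  is_derive y v (fun z : E => z ord0 j) (v ord0 j).
Proof.
apply/is_derive_eps => e e0; exists 1 => // t _.
rewrite !mxE [X in `|X - _|]addrC addKr subrr normr0.
by rewrite mulr_ge0 // ltW.
Qed.

Lemma CR_coord p U (j : 'I_n) : open U -> CR p U (fun z => z ord0 j).
Proof.
move=> oU; case: p => [|p]; first by split => // y _; exact: coord_cont.
apply: (CR_S _ _ _ (fun i _ => ('e_i) ord0 j)) => //.
- by move=> y _; exact: coord_cont.
- by move=> y i _; exact: is_derive_coord.
- by move=> i; exact: CR_cst.
Qed.

Lemma differentiable_eps (g : E -> R) x : differentiable g x <->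
  exists l : 'I_n -> R, forall e : R, 0 < e -> exists2 d : R, 0 < d & forall h : E,
    `|h| < d -> `|g (x + h) - g x - \sum_i h ord0 i * l i| <= e * `|h|.
Proof.
split=> [dg|[l Hl]].
  exists (fun i => 'd g x ('e_i)) => e e0.
  have /eqaddoP /(_ _ e0) := diff_locally dg.
  move=> /near_eps[d d0 Hd]; exists d => // h hd.
  have := Hd h; rewrite subr0 => /(_ hd); rewrite !fctE /= [h + x]addrC.
  rewrite opprD addrA {2}(row_delta_sum _ _ h) linear_sum.
  by under [X in _ - X]eq_bigr do rewrite linearZ.
pose dl (h : E) : R := \sum_i h ord0 i * l i.
have lin : linear dl.
  move=> c u w; rewrite /dl /= scaler_sumr -big_split /=; apply: eq_bigr => i _.
  by rewrite !mxE mulrDl -mulrA.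
pose L : {linear E -> R} := HB.pack dl (GRing.isLinear.Build _ _ _ _ dl lin).
have cL : continuous L.
  move=> y; have : CR 0 setT dl.
    apply: CR_sum; first exact: openT.
    move=> i _; apply: CR_mul; [exact: openT|apply: CR_coord|apply: CR_cst]; exact: openT.
  by case=> /(_ y I).
have E1 : g \o shift x = cst (g x) + L +o_ 0 id.
  apply/eqaddoP => e e0; have [d d0 Hd] := Hl e e0.
  apply/nbhs_ballP; exists d => // h; rewrite -ball_normE /= sub0r normrN => hd.
  by have := Hd h hd; rewrite !fctE /= [h + x]addrC opprD addrA.
have dE := diff_unique cL E1.
by apply/diff_locallyP; rewrite dE.
Qed.

Lemma fin_eps (I : finType) (P : I -> set E) (x : E) :
  (forall i, exists2 d : R, 0 < d & forall y, `|y - x| < d -> P i y) ->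
  exists2 d : R, 0 < d & forall i y, `|y - x| < d -> P i y.
Proof.
move=> H; have : \forall y \near x, forall i, P i y.
  apply: (@filter_forall E I P (nbhs x) _ _) => i.
  exact: ((near_eps (P i) x).2 (H i)).
by move/near_eps => [d d0 Hd]; exists d => // i y /Hd.
Qed.

(** The increment [h] is built up one coordinate at a time. Each elementary step is a mean value,
    and continuity of the partial derivatives compares it with the derivative at [x]. *)
Lemma C1_eps (U : set E) (g : E -> R) (x : E) : open U -> CR 1 U g -> U x ->
  forall e : R, 0 < e -> exists2 d : R, 0 < d & forall h : E, `|h| < d ->
    `|g (x + h) - g x - \sum_i h ord0 i * 'D_('e_i) g x| <= e * `|h|.
Proof.
move=> oU Hg Ux e e0.
have n0 : 0 < n.+1%:R :> R by [].
(* The [n] coordinate steps share the tolerance; [n.+1] keeps the denominator nonzero in dimension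
   0. *)
have en0 : 0 < e / n.+1%:R by exact: divr_gt0.
have [d d0 Hd] : exists2 d : R, 0 < d & forall i y, `|y - x| < d ->
    U y /\ `|'D_('e_i) g y - 'D_('e_i) g x| < e / n.+1%:R.
  apply: fin_eps => i; have [d1 d10 H1] := open_eps _ _ oU Ux.
  have := CR_cont _ _ _ _ (CR_D1 _ _ _ i Hg) Ux.
  move=> /cont_eps /(_ _ en0) [d2 d20 H2].
  exists (Num.min d1 d2); first by rewrite lt_min d10.
  by move=> y; rewrite lt_min => /andP[/H1 ? /H2].
exists d => // h hd.
(* [tr k] keeps the first [k] coordinates of [h], so the increments between consecutive [tr k]
   telescope from [0] to [h]. *)
pose tr k : E := \row_i (if (i < k)%N then h ord0 i else 0).
have trP (k : 'I_n) : exists2 p : E, `|p - x| < d &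
    g (x + tr k.+1) - g (x + tr k) = h ord0 k * 'D_('e_k) g p.
  have bd t : `|t| <= `|h ord0 k| -> `|x + tr k + t *: 'e_k - x| < d.
    move=> th; apply: le_lt_trans hd; apply: rV_norm_le => // j.
    rewrite !mxE eqxx /= addrAC [x ord0 j + _]addrC addrK.
    have [ejk|njk] := eqVneq j k.
      by rewrite ejk ltnn add0r mulr1 (le_trans th) // coord_le_norm.
    rewrite mulr0 addr0; case: ifP => _; last by rewrite normr0.
    exact: coord_le_norm.
  have [t th Et] := @MVT_line _ _ g (x + tr k) ('e_k)
     (fun t => 'D_('e_k) g (x + tr k + t *: 'e_k)) (h ord0 k)
     (fun t th => CR_der _ _ _ Hg _ _ (Hd k _ (bd t th)).1).
  exists (x + tr k + t *: 'e_k); first exact: bd.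
  rewrite -Et; congr (g _ - _); rewrite -addrA; congr (_ + _); apply/rowP => j.
  rewrite !mxE eqxx /= ltnS leq_eqVlt.
  have [->|njk] := eqVneq j k; first by rewrite eqxx ltnn add0r mulr1.
  by rewrite mulr0 addr0 (inj_eq val_inj) (negbTE njk).
have E1 : g (x + h) - g x = \sum_(k < n) (g (x + tr k.+1) - g (x + tr k)).
  rewrite -(big_mkord xpredT (fun k => g (x + tr k.+1) - g (x + tr k))).
  rewrite telescope_sumr //; congr (g _ - g _).
    by congr (_ + _); apply/rowP => j; rewrite mxE ltn_ord.
  rewrite -[LHS]addr0; congr (_ + _); apply/rowP => j; by rewrite !mxE.
rewrite E1 -sumrB; apply: le_trans (ler_norm_sum _ _ _) _.
apply: (@le_trans _ _ (\sum_(i < n) (`|h| * (e / n.+1%:R)))).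
  apply: ler_sum => k _; have [p pd ->] := trP k.
  rewrite -mulrBr normrM; apply: ler_pM => //; first exact: coord_le_norm.
  by apply: ltW; case: (Hd k p pd).
rewrite sumr_const card_ord -[X in X <= _]mulr_natr -mulrA [e * `|h|]mulrC.
by apply: ler_wpM2l => //; rewrite mulrAC ler_pdivrMr // ler_wpM2l ?ler_nat // ltW.
Qed.

Lemma C1_differentiable (U : set E) (g : E -> R) (x : E) : open U -> CR 1 U g -> U x -> differentiable g x.
Proof.
move=> oU Hg Ux; apply/differentiable_eps; exists (fun i => 'D_('e_i) g x).
exact: C1_eps oU Hg Ux.
Qed.

Lemma C1_derive (U : set E) (g : E -> R) (x : E) (v : E) : open U -> CR 1 U g -> U x ->
  is_derive x v g (\sum_i v ord0 i * 'D_('e_i) g x).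
Proof.
move=> oU Hg Ux; apply/is_derive_eps => e e0.
have v0 : 0 < `|v| + 1 by rewrite ltr_wpDl.
have [d d0 Hd] := C1_eps _ _ _ oU Hg Ux _ (divr_gt0 e0 v0).
exists (d / (`|v| + 1)); first exact: divr_gt0.
move=> t td; have tv : `|t *: v| <= `|t| * (`|v| + 1).
  by rewrite normrZ ler_wpM2l // lerDl.
have := Hd (t *: v); rewrite mulr_sumr.
under eq_bigr do rewrite mxE -mulrA.
move=> K; apply: le_trans (K _) _.
  by apply: le_lt_trans tv _; rewrite -ltr_pdivlMr.
by rewrite mulrAC ler_pdivrMr // -mulrA ler_wpM2l // ltW.
Qed.

Lemma is_derive_shiftV (g : E -> R) (z c v : E) (l : R) : is_derive (z + c) v g l ->
  is_derive z v (fun w => g (w + c)) l.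
Proof.
move=> /is_derive_eps H; apply/is_derive_eps => e e0; have [d d0 Hd] := H e e0.
by exists d => // t td; rewrite [z + _ + c]addrAC; exact: Hd.
Qed.

Lemma dist_half (P a b e : R) : `|P - a| < e / 2 -> `|P - b| < e / 2 -> `|a - b| <= e.
Proof.
by rewrite !ltr_norml ler_norml => /andP[? ?] /andP[? ?]; apply/andP; split; lra.
Qed.

(** Two mean values: one in direction [i] for the [j]-increment [G], one in direction [j] for the
    [i]-th derivative. The left side is symmetric in [i] and [j], the right side is not. *)
Lemma second_diff (U : set E) (g : E -> R) (y : E) (i j : 'I_n) (d s : R) : CR 2 U g ->
  (forall z, `|z - y| < d -> U z) -> 2 * `|s| < d ->
  exists2 p, `|p - y| <= 2 * `|s| &
    g (y + s *: 'e_i + s *: 'e_j) - g (y + s *: 'e_i) - g (y + s *: 'e_j) + g y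
      = s * (s * 'D_('e_j) (fun z => 'D_('e_i) g z) p).
Proof.
move=> Hg HU sd.
have bd (a b : R) : `|a| <= `|s| -> `|b| <= `|s| ->
    `|y + a *: 'e_i + b *: 'e_j - y| <= 2 * `|s|.
  move=> Ha Hb; rewrite addrAC [y + _]addrC addrK.
  apply: le_trans (ler_normD _ _) _; rewrite !norm_delta.
  by rewrite mulr_natl mulr2n lerD.
have bdU (a b : R) : `|a| <= `|s| -> `|b| <= `|s| -> U (y + a *: 'e_i + b *: 'e_j).
  by move=> Ha Hb; apply: HU; apply: le_lt_trans sd; exact: bd.
have bdU0 (a : R) : `|a| <= `|s| -> U (y + a *: 'e_i).
  by move=> Ha; have := bdU a 0 Ha; rewrite scale0r addr0 normr0; apply.
pose G z := g (z + s *: 'e_j) - g z.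
have [t ts Et] := @MVT_line _ _ G y 'e_i (fun t => 'D_('e_i) g (y + t *: 'e_i + s *: 'e_j)
   - 'D_('e_i) g (y + t *: 'e_i)) s (fun t ts =>
   is_deriveB (is_derive_shiftV _ _ _ _ _ (CR_der _ _ _ Hg _ _ (bdU t s ts (lexx _))))
     (CR_der _ _ _ Hg _ _ (bdU0 t ts))).
have [u us Eu] := @MVT_line _ _ (fun z => 'D_('e_i) g z) (y + t *: 'e_i) 'e_j
   (fun u => 'D_('e_j) (fun z => 'D_('e_i) g z) (y + t *: 'e_i + u *: 'e_j)) s
   (fun u us => CR_der _ _ _ (CR_D1 _ _ _ i Hg) _ _ (bdU t u ts us)).
exists (y + t *: 'e_i + u *: 'e_j); first exact: bd.
by rewrite -Eu -Et /G; ring.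
Qed.

(** By symmetry of the second difference, one mixed derivative at a point near [y] equals the other
    one at another point near [y]; continuity brings both points to [y]. *)
Lemma Schwarz (U : set E) (g : E -> R) (y : E) (i j : 'I_n) : open U -> CR 2 U g -> U y ->
  'D_('e_j) (fun z => 'D_('e_i) g z) y = 'D_('e_i) (fun z => 'D_('e_j) g z) y.
Proof.
move=> oU Hg Uy; apply/eqP; rewrite -subr_eq0 -normr_le0; apply/ler_addgt0Pr => e e0; rewrite add0r.
have e20 : 0 < e / 2 by rewrite divr_gt0.
have /cont_eps /(_ _ e20) [d1 d10 H1] :=
  CR_cont _ _ _ _ (CR_D1 _ _ _ j (CR_D1 _ _ _ i Hg)) Uy.
have /cont_eps /(_ _ e20) [d2 d20 H2] :=
  CR_cont _ _ _ _ (CR_D1 _ _ _ i (CR_D1 _ _ _ j Hg)) Uy.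
have [d0 d00 H0] := open_eps _ _ oU Uy.
pose d := Num.min d0 (Num.min d1 d2).
have dgt0 : 0 < d by rewrite !lt_min d00 d10.
pose s := d / 3.
have s0 : 0 < s by rewrite divr_gt0.
have sd : 2 * `|s| < d by rewrite gtr0_norm // /s; lra.
have HU z : `|z - y| < d -> U z by rewrite lt_min => /andP[/H0].
have [p1 Hp1 E1] := second_diff U g y i j d s Hg HU sd.
have [p2 Hp2 E2] := second_diff U g y j i d s Hg HU sd.
have := E1; rewrite [y + _ + _]addrAC [_ - _ - _]addrAC E2.
move/(mulfI (lt0r_neq0 s0))/(mulfI (lt0r_neq0 s0)) => Ep.
have := le_lt_trans Hp1 sd; rewrite !lt_min => /and3P[_ /H1 K1 _].
have := le_lt_trans Hp2 sd; rewrite !lt_min => /and3P[_ _ /H2 K2].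
by rewrite Ep in K2; exact: dist_half K1 K2.
Qed.

Lemma smooth_D1 (U : set E) (g : E -> R) (i : 'I_n) :
  smooth U g -> smooth U (fun y => 'D_('e_i) g y).
Proof. by move=> H p; exact: CR_D1 (H p.+1). Qed.

Lemma smooth_ext (U : set E) (g g' : E -> R) : open U ->
  (forall y, U y -> g y = g' y) -> smooth U g -> smooth U g'.
Proof. by move=> oU H K p; exact: CR_ext oU H (K p). Qed.

Lemma derive_ext (U : set E) (g g' : E -> R) (x v : E) : open U ->
  (forall y, U y -> g y = g' y) -> U x -> 'D_v g x = 'D_v g' x.
Proof.
move=> oU H Ux; apply: near_eq_derive; apply/near_eps.
by have [d d0 Hd] := open_eps _ _ oU Ux; exists d => // z /Hd /H.
Qed.

Lemma is_derive_ext (U : set E) (g g' : E -> R) (x v : E) (l : R) : open U ->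
  (forall y, U y -> g y = g' y) -> U x -> is_derive x v g l -> is_derive x v g' l.
Proof.
move=> oU H Ux; apply: near_eq_is_derive; apply/near_eps.
by have [d d0 Hd] := open_eps _ _ oU Ux; exists d => // z /Hd /H.
Qed.

End Cp.

(** * Smooth quotients by powers of a coordinate *)

Section div.
Context {R : realType} {n : nat}.
Local Notation E := 'rV[R]_n.
Local Notation "''e_' i" := (delta_mx 0 i : 'rV[R]_n) (at level 8, i at level 2).
Variables (U : set E) (q : 'I_n).
Hypothesis oU : open U.
Implicit Types (w : E -> R) (z : E).

Definition Dq i w : E -> R := iter i (fun u y => 'D_('e_q) u y) w.

Lemma DqS i w : Dq i.+1 w = Dq i (fun y => 'D_('e_q) w y).
Proof. by rewrite /Dq iterSr. Qed.

Lemma smooth_Dq i w : smooth U w -> smooth U (Dq i w).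
Proof. by move=> H; elim: i => [|i IH] //=; exact: smooth_D1. Qed.

(** Vanishing to order [m] on the hyperplane [x_q = 0], expressed by the normal derivatives;
    tangential derivation preserves it by [vanish_D]. *)
Definition vanish m w := forall i z, (i < m)%N -> U z -> z ord0 q = 0 -> Dq i w z = 0.

Definition setq z (t : R) : E := z + t *: 'e_q.

Lemma setqq z t : (setq z t) ord0 q = z ord0 q + t.
Proof. by rewrite !mxE !eqxx mulr1. Qed.

(** Taylor's formula in direction [q]. The mean value theorem for [w - c x_q^(m+1)] reduces order
    [m+1] for [w] to order [m] for its [q]-derivative, with [c] replaced by [c (m+1)]. *)
Lemma vanish_bound m w z (c eta : R) : smooth U w -> vanish m w ->
  z ord0 q = 0 -> forall T : R,
  (forall t : R, `|t| <= `|T| -> U (setq z t) /\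
      `|Dq m w (setq z t) - m`!%:R * c| <= eta) ->
  `|w (setq z T) - c * T ^+ m| <= eta * `|T| ^+ m.
Proof.
elim: m w c => [|m IH] w c sw vw zq T HT.
  by have [_] := HT T (lexx _); rewrite fact0 mul1r !expr0 !mulr1.
have vw' : vanish m (fun y => 'D_('e_q) w y).
  by move=> i y im Uy yq; have := vw i.+1 y; rewrite DqS; apply.
have sw' := smooth_D1 _ _ q sw.
have Uz : U z by have [] := HT 0; rewrite ?normr0 // /setq scale0r addr0.
pose f y := w y - c * (y ord0 q) ^+ m.+1.
have df (t : R) : `|t| <= `|T| -> is_derive (z + t *: 'e_q) 'e_q f
    ('D_('e_q) w (setq z t) - c * (m.+1%:R * t ^+ m)).
  move=> tT; have [Ut _] := HT t tT.
  have d1 := CR_der _ _ _ (sw 1%N) _ q Ut.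
  have d2 := is_derive_coord q (setq z t) 'e_q.
  have d3 := is_deriveB_fun _ _ _ _ _ _ d1 (is_deriveZ_fun _ c _ _ _ (is_deriveX_fun _ m.+1 _ _ _ d2)).
  by apply: is_derive_eq d3 _; rewrite setqq zq add0r !mxE !eqxx /= mulr1.
have [t tT Et] := MVT_line f z 'e_q _ T df.
have fz : f z = 0.
  by rewrite /f zq expr0n /= mulr0 subr0; have := vw 0%N z; apply.
have -> : w (setq z T) - c * T ^+ m.+1 = f (z + T *: 'e_q) - f z.
  by rewrite fz subr0 /f -/(setq z T) setqq zq add0r.
rewrite Et normrM exprS [eta * _]mulrCA; apply: ler_wpM2l => //.
have := IH _ (c * m.+1%:R) sw' vw' zq t; rewrite -mulrA => K.
apply: le_trans (K _) _.
  move=> s st; have [Us H] := HT s (le_trans st tT); split => //.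
  have -> : m`!%:R * (c * m.+1%:R) = (m.+1)`!%:R * c :> R by rewrite factS natrM; ring.
  by rewrite -DqS.
have eta0 : 0 <= eta by have [_] := HT T (lexx _); apply: le_trans.
by apply: ler_wpM2l => //; apply: lerXn2r; rewrite ?nnegrE.
Qed.

(** The quotient [w / x_q^m], continued to the hyperplane by its limit there, the [m]-th Taylor
    coefficient in [x_q]. *)
Definition Qm m w z : R :=
  if z ord0 q == 0 then Dq m w z / m`!%:R else w z / (z ord0 q) ^+ m.

Lemma Qm_cont m w z : smooth U w -> vanish m w -> U z -> {for z, continuous (Qm m w)}.
Proof.
move=> sw vw Uz; have [zq|zq] := eqVneq (z ord0 q) 0; last first.
  pose U' := [set y | U y /\ y ord0 q != 0].
  have oU' : open U'.
    apply: openP_eps => y [Uy yq]; have [d d0 Hd] := open_eps _ _ oU Uy.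
    exists (Num.min d `|y ord0 q|); first by rewrite lt_min d0 normr_gt0.
    move=> x; rewrite lt_min => /andP[/Hd Ux xy]; split => //.
    apply: contraTneq xy => x0; rewrite -leNgt.
    by have := coord_le_norm _ _ (x - y) q; rewrite !mxE x0 sub0r normrN.
  have : CR 0 U' (Qm m w).
    apply: (CR_ext _ _ (fun y => w y * (y ord0 q) ^- m)) => //.
      by move=> y [_ yq]; rewrite /Qm (negbTE yq).
    split=> // y [Uy yq]; apply: contM_for; first exact: CR_cont (sw 0%N) Uy.
    apply: continuousV; first by rewrite expf_neq0.
    have : CR 0 setT (fun x : E => x ord0 q ^+ m).
      elim: m {vw} => [|k IH]; first exact: CR_cst openT.
      apply: (CR_ext _ _ (fun x => x ord0 q * x ord0 q ^+ k)) => //; first exact: openT.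
        by move=> x _; rewrite exprS.
      by apply: CR_mul => //; [exact: openT|apply: CR_coord; exact: openT].
    by move=> H; exact: CR_cont H I.
  by move=> H; exact: CR_cont H (conj Uz zq).
pose c := Dq m w z / m`!%:R.
have f0 : (m`!%:R : R) != 0 by rewrite pnatr_eq0 -lt0n fact_gt0.
have f1 : 1 <= (m`!%:R : R) by rewrite ler1n fact_gt0.
have f00 := lt_le_trans ltr01 f1.
apply/cont_eps => e e0.
have e20 : 0 < e / 2 by rewrite divr_gt0.
have /cont_eps /(_ _ e20) [d1 d10 H1] := CR_cont _ _ _ _ (smooth_Dq m _ sw 0%N) Uz.
have [d2 d20 H2] := open_eps _ _ oU Uz.
exists (Num.min d1 d2); first by rewrite lt_min d10.
move=> y; rewrite lt_min => /andP[yd1 yd2].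
have -> : Qm m w z = c by rewrite /Qm zq eqxx.
apply: (@le_lt_trans _ _ (e / 2)); last by rewrite ltr_pdivrMr // ltr_pMr // ltr1n.
have [yq|yq] := eqVneq (y ord0 q) 0.
  rewrite /Qm yq eqxx -mulrBl normrM normfV [`|m`!%:R|]gtr0_norm //.
  rewrite ler_pdivrMr //; apply: le_trans (ltW (H1 _ yd1)) _.
  by rewrite ler_peMr // ltW.
pose y0 := setq y (- y ord0 q).
have y0q : y0 ord0 q = 0 by rewrite setqq subrr.
have yE : y = setq y0 (y ord0 q).
  by rewrite /y0 /setq -addrA -scalerDl addNr scale0r addr0.
have near0 (t : R) : `|t| <= `|y ord0 q| -> `|setq y0 t - z| <= `|y - z|.
  move=> ty; apply: rV_norm_le => // j; have [->|jq] := eqVneq j q.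
    rewrite mxE setqq y0q add0r mxE zq subr0; apply: le_trans ty _.
    by have := coord_le_norm _ _ (y - z) q; rewrite !mxE zq subr0.
  rewrite !mxE !eqxx /= (negbTE jq) !mulr0 !addr0.
  by have := coord_le_norm _ _ (y - z) j; rewrite !mxE.
have K := vanish_bound m w y0 c (e / 2) sw vw y0q (y ord0 q).
rewrite /Qm (negbTE yq).
have yqm : 0 < `|y ord0 q ^+ m| by rewrite normr_gt0 expf_neq0.
rewrite -(ler_pM2r yqm) -normrM mulrBl mulfVK ?expf_neq0 // normrX {1}yE.
apply: K => t ty; have tz := near0 t ty; split.
  by apply: H2; apply: le_lt_trans tz _.
by rewrite /c mulrCA mulfV // mulr1; apply: ltW; apply: H1; apply: le_lt_trans tz _.
Qed.

(** A derivative in a direction other than [q] sees only the hyperplane through [z] on which [x_q]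
    is constant, so the two branches of [Qm] can be differentiated separately. *)
Lemma flat_derive (u u' : E -> R) z j (l : R) : j != q -> U z ->
  (forall y, U y -> y ord0 q = z ord0 q -> u y = u' y) ->
  is_derive z 'e_j u l -> is_derive z 'e_j u' l.
Proof.
move=> jq Uz uu' /is_derive_eps H; apply/is_derive_eps => e e0.
have [d d0 Hd] := H e e0; have [d' d'0 Hd'] := open_eps _ _ oU Uz.
exists (Num.min d d'); first by rewrite lt_min d0.
move=> t; rewrite lt_min => /andP[td td'].
rewrite -!uu' ?Hd //; first by apply: Hd'; rewrite addrC addKr norm_delta.
by rewrite !mxE eqxx /= eq_sym (negbTE jq) mulr0 addr0.
Qed.

Lemma Dq_comm i w z j : smooth U w -> U z ->
  Dq i (fun y => 'D_('e_j) w y) z = 'D_('e_j) (Dq i w) z.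
Proof.
move=> sw; elim: i z => [|i IH] z Uz //=.
rewrite (derive_ext _ _ _ _ _ oU IH Uz).
exact: Schwarz oU (smooth_Dq i _ sw 2) Uz.
Qed.

Lemma vanish_D j m w : j != q -> smooth U w -> vanish m w ->
  vanish m (fun y => 'D_('e_j) w y).
Proof.
move=> jq sw vw i z im Uz zq; rewrite Dq_comm //.
have : is_derive z 'e_j (Dq i w) 0.
  apply: (@flat_derive (fun _ => 0)) => // y Uy; rewrite zq => yq.
  by rewrite vw.
by case.
Qed.

(** The numerator in [D_q (w / x_q^m) = (x_q D_q w - m w) / x_q^(m+1)]. It vanishes to order [m+1]
    when [w] vanishes to order [m], so the family [Qm] is closed under differentiation. *)
Definition eul m w : E -> R := fun y => y ord0 q * 'D_('e_q) w y - m%:R * w y.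

Lemma smooth_eul m w : smooth U w -> smooth U (eul m w).
Proof.
move=> sw p; apply: (CR_ext _ _ (fun y => y ord0 q * 'D_('e_q) w y + (- m%:R) * w y)) => //.
  by move=> y _; rewrite mulNr.
apply: CR_add => //; last by apply: CR_scale => //.
by apply: CR_mul => //; [exact: CR_coord|exact: smooth_D1].
Qed.

Lemma Dq_eul i m w z : smooth U w -> U z ->
  Dq i (eul m w) z = z ord0 q * Dq i.+1 w z + (i%:R - m%:R) * Dq i w z.
Proof.
move=> sw; elim: i z => [|i IH] z Uz; first by rewrite /= sub0r mulNr.
rewrite [LHS]/= (derive_ext _ _ _ _ _ oU IH Uz).
have d1 := CR_der _ _ _ (smooth_Dq i _ sw 1%N) z q Uz.
have d2 := CR_der _ _ _ (smooth_Dq i.+1 _ sw 1%N) z q Uz.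
have d3 := is_deriveD_fun _ _ _ _ _ _ (is_deriveM_fun _ _ _ _ _ _ (is_derive_coord q z 'e_q) d2)
  (is_deriveM_fun _ _ _ _ _ _ (is_derive_cst (i%:R - m%:R : R) z 'e_q) d1).
rewrite (@derive_val _ _ _ _ _ _ _ d3) !mxE !eqxx /= -natr1; ring.
Qed.

Lemma vanish_eul m w : smooth U w -> vanish m w -> vanish m.+1 (eul m w).
Proof.
move=> sw vw i z; rewrite ltnS leq_eqVlt => im Uz zq.
rewrite Dq_eul // zq mul0r add0r; case/orP: im => [/eqP ->|im].
  by rewrite subrr mul0r.
by rewrite vw // mulr0.
Qed.

Lemma Qm_der_other m w z j : j != q -> smooth U w -> U z ->
  is_derive z 'e_j (Qm m w) (Qm m (fun y => 'D_('e_j) w y) z).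
Proof.
move=> jq sw Uz; rewrite {2}/Qm; have [zq|zq] := eqVneq (z ord0 q) 0.
  rewrite Dq_comm //.
  apply: (@flat_derive (fun y => Dq m w y * m`!%:R^-1)) => //.
    by move=> y Uy yz; rewrite /Qm yz zq eqxx.
  have H := is_deriveM_fun _ _ _ _ _ _ (CR_der _ _ _ (smooth_Dq m _ sw 1%N) z j Uz)
    (is_derive_cst (m`!%:R^-1 : R) z 'e_j).
  by apply: is_derive_eq H _; rewrite mulr0 add0r mulrC.
apply: (@flat_derive (fun y => w y * (z ord0 q ^+ m)^-1)) => //.
  by move=> y Uy yz; rewrite /Qm yz (negbTE zq).
have H := is_deriveM_fun _ _ _ _ _ _ (CR_der _ _ _ (sw 1%N) z j Uz)
    (is_derive_cst ((z ord0 q ^+ m)^-1 : R) z 'e_j).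
by apply: is_derive_eq H _; rewrite mulr0 add0r mulrC.
Qed.

Lemma Uq_open : open [set y | U y /\ y ord0 q != 0].
Proof.
apply: openP_eps => y [Uy yq]; have [d d0 Hd] := open_eps _ _ oU Uy.
exists (Num.min d `|y ord0 q|); first by rewrite lt_min d0 normr_gt0.
move=> x; rewrite lt_min => /andP[/Hd Ux xy]; split => //.
apply: contraTneq xy => x0; rewrite -leNgt.
by have := coord_le_norm _ _ (x - y) q; rewrite !mxE x0 sub0r normrN.
Qed.

Lemma Qm_der_q0 m w z : smooth U w -> U z -> z ord0 q != 0 ->
  is_derive z 'e_q (Qm m w) (Qm m.+1 (eul m w) z).
Proof.
move=> sw Uz zq.
apply: (is_derive_ext [set y | U y /\ y ord0 q != 0]
  (fun y => w y * (y ord0 q ^+ m)^-1)) => //; first exact: Uq_open.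
  by move=> y [_ yq]; rewrite /Qm (negbTE yq).
have d2 := is_deriveX_fun _ m _ _ _ (is_derive_coord q z 'e_q).
have d3 := is_deriveV_fun _ _ _ _ (expf_neq0 m zq) d2.
have d4 := is_deriveM_fun _ _ _ _ _ _ (CR_der _ _ _ (sw 1%N) z q Uz) d3.
apply: is_derive_eq d4 _; rewrite /Qm (negbTE zq) /eul !mxE !eqxx mulr1.
case: m {d2 d3} => [|m] /=; first by field.
rewrite !exprS expr0 mulr1; have := expf_neq0 m zq; move: zq.
move: (z ord0 q) (z ord0 q ^+ m) => x P x0 P0; field; by rewrite x0 P0.
Qed.

(** On the hyperplane, the derivative already known off it has a continuous extension, and the mean
    value theorem, which asks for derivatives only inside the interval, carries it over to the end
    point. *)
Lemma Qm_der_q m w z : smooth U w -> vanish m w -> U z ->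
  is_derive z 'e_q (Qm m w) (Qm m.+1 (eul m w) z).
Proof.
move=> sw vw Uz; have [zq|zq] := eqVneq (z ord0 q) 0; last exact: Qm_der_q0.
have se := smooth_eul m _ sw; have ve := vanish_eul _ _ sw vw.
apply/is_derive_eps => e e0.
have /cont_eps /(_ _ e0) [d d0 Hd] := Qm_cont _ _ _ se ve Uz.
have [d' d'0 Hd'] := open_eps _ _ oU Uz.
exists (Num.min d d'); first by rewrite lt_min d0.
move=> t; rewrite lt_min => /andP[td td'].
pose f (s : R) := Qm m w (z + s *: 'e_q).
pose df (s : R) := Qm m.+1 (eul m w) (z + s *: 'e_q).
have zs (s : R) : `|z + s *: 'e_q - z| = `|s| by rewrite addrC addKr norm_delta.
have fc (a b : R) : (forall s, s \in `[a, b] -> `|s| <= `|t|) -> {within `[a, b], continuous f}.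
  move=> K; apply: continuous_in_subspaceT => s; rewrite inE => /K st.
  have Us : U (z + s *: 'e_q) by apply: Hd'; rewrite zs; apply: le_lt_trans td'.
  have /cont_eps H := Qm_cont _ _ _ sw vw Us.
  apply/cont_eps => r r0; have [k k0 Hk] := H r r0; exists k => // s' ss'.
  by apply: Hk; rewrite opprD addrACA subrr add0r -scalerBl norm_delta.
have fd (s : R) : s != 0 -> `|s| <= `|t| -> is_derive s 1 f (df s).
  move=> s0 st; have Us : U (z + s *: 'e_q).
    by apply: Hd'; rewrite zs; apply: le_lt_trans td'.
  have sq : (z + s *: 'e_q) ord0 q != 0 by rewrite -/(setq z s) setqq zq add0r.
  have H := Qm_der_q0 m w _ sw Us sq.
  exact: (proj1 (is_derive_line (Qm m w) z 'e_q s _) H).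
have fin s : `|s| <= `|t| -> f t - f 0 = df s * t ->
    `|Qm m w (z + t *: 'e_q) - Qm m w z - t * Qm m.+1 (eul m w) z| <= e * `|t|.
  rewrite /f scale0r addr0 => st ->; rewrite mulrC -mulrBr normrM mulrC ler_wpM2r //.
  by apply: ltW; apply: Hd; rewrite zs; apply: le_lt_trans td.
have [t0|t0|->] := ltgtP t 0; last first.
- by rewrite scale0r addr0 subrr mul0r subrr normr0 mulr0.
- have K (s : R) : s \in `[0, t] -> `|s| <= `|t|.
    by rewrite in_itv /= => /andP[s0 sh]; rewrite !ger0_norm // ltW.
  have [|c ch E1] := @MVT _ f df 0 t t0 _ (fc _ _ K).
    move=> s; rewrite in_itv /= => /andP[s0 st]; apply: fd; first by rewrite gt_eqF.
    by rewrite !gtr0_norm // ltW.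
  rewrite subr0 in E1; apply: fin E1; apply: K; exact: subset_itv_oo_cc ch.
- have K (s : R) : s \in `[t, 0] -> `|s| <= `|t|.
    by rewrite in_itv /= => /andP[s0 sh]; rewrite !ler0_norm ?lerN2 // ltW.
  have [|c ch E1] := @MVT _ f df t 0 t0 _ (fc _ _ K).
    move=> s; rewrite in_itv /= => /andP[s0 st]; apply: fd; first by rewrite lt_eqF.
    by rewrite !ltr0_norm ?lerN2 // ltW.
  apply: (fin c); first by apply: K; exact: subset_itv_oo_cc ch.
  by rewrite -[LHS]opprB E1 sub0r mulrN opprK.
Qed.

Lemma Qm_smooth m w : smooth U w -> vanish m w -> smooth U (Qm m w).
Proof.
move=> sw vw p; elim: p m w sw vw => [|p IH] m w sw vw.
  by split => // y Uy; exact: Qm_cont.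
apply: (CR_S _ _ _ (fun j => if j == q then Qm m.+1 (eul m w)
    else Qm m (fun y => 'D_('e_j) w y))) => //.
- by move=> y Uy; exact: Qm_cont.
- move=> y i Uy; case: eqP => [->|/eqP iq]; first exact: Qm_der_q.
  exact: Qm_der_other.
- move=> j; case: eqP => [_|/eqP jq].
    by apply: IH; [exact: smooth_eul|exact: vanish_eul].
  by apply: IH; [exact: smooth_D1|exact: vanish_D].
Qed.

End div.

(** * Steklov means and Goursat's lemma *)

Section Int.
Context {R : realType}.
Implicit Types (h : R -> R) (e : R).

(** The integral starts at [-1], so that [0] is an interior point and the primitive has a two-sided
    derivative at both ends of [[0, e]]. *)
Definition prim h (t : R) : R := (\int[lebesgue_measure]_(s in [set` `[(-1)%R, t]]) h s)%R.
Definition Int h e : R := prim h e - prim h 0.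

Lemma prim_derive h : continuous h -> forall t : R, -1 < t -> is_derive t 1 (prim h) (h t).
Proof.
move=> ch t t1; have [||||H1 H2] := @continuous_FTC1_closed R h (-1) t (t + 1).
- by rewrite ltrDl.
- apply: continuous_compact_integrable; first exact: segment_compact.
  exact: continuous_subspaceT.
- exact: t1.
- exact: ch.
apply: DeriveDef; first exact: H1.
by rewrite -derive1E; exact: H2.
Qed.

Lemma MVT2 (F dF : R -> R) (a b : R) :
  (forall t, Num.min a b <= t <= Num.max a b -> is_derive t 1 F (dF t)) ->
  exists2 t, Num.min a b <= t <= Num.max a b & F b - F a = dF t * (b - a).
Proof.
wlog ab : a b / a <= b => [H|].
  case/orP: (le_total a b) => [ab|ba]; first exact: H.
  rewrite minC maxC => K; have [t tab E] := H b a ba K; exists t => //.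
  by rewrite -opprB E; ring.
rewrite min_l // max_r // => K.
have [||c cab E] := @MVT_segment _ F dF a b ab.
- by move=> x; rewrite in_itv /= => /andP[? ?]; apply: K; rewrite !ltW.
- apply: derivable_within_continuous => x; rewrite in_itv /= => xab.
  by case: (K x xab).
by exists c => //; rewrite in_itv in cab.
Qed.

Lemma prim_bound h (c K s t : R) : continuous h -> -1 < s -> -1 < t ->
  (forall r, Num.min s t <= r <= Num.max s t -> `|h r - c| <= K) ->
  `|prim h t - prim h s - c * (t - s)| <= K * `|t - s|.
Proof.
move=> ch s1 t1 H.
have [|r rst E] := MVT2 (prim h) h s t.
  move=> r /andP[r1 r2]; apply: prim_derive => //; apply: lt_le_trans r1.
  by rewrite lt_min s1.
by rewrite E -mulrBl normrM ler_wpM2r //; exact: H.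
Qed.

Lemma Int_bound h (c K e : R) : continuous h -> 0 <= e ->
  (forall r : R, 0 <= r <= e -> `|h r - c| <= K) -> `|Int h e - c * e| <= K * e.
Proof.
move=> ch e0 H; have m1 : -1 < 0 :> R by rewrite ltrN10.
have K1 := prim_bound h c K 0 e ch m1 (lt_le_trans m1 e0).
move: K1; rewrite subr0 [X in _ <= _ * X]ger0_norm //; apply => r.
by rewrite (min_l e0) (max_r e0); exact: H.
Qed.

Lemma Int_char h (G : R -> R) e : continuous h -> 0 <= e ->
  (forall t, 0 <= t <= e -> is_derive t 1 G (h t)) -> Int h e = G e - G 0.
Proof.
move=> ch e0 HG; pose F t := prim h t - G t.
have [|t _ E] := MVT2 F (fun _ => 0) 0 e.
  rewrite min_l // max_r // => t te; have /andP[t0 _] := te.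
  have t1 : -1 < t by apply: lt_le_trans t0; rewrite ltrN10.
  have d1 := prim_derive h ch t t1; have d2 := HG t te.
  have : is_derive t 1 (prim h - G) (h t - h t) by apply: is_deriveB.
  by rewrite subrr.
by move: E; rewrite mul0r /F /Int => E; lra.
Qed.

End Int.

(** * Integrals over boxes and fluxes through cubes *)

Section BUC.
Context {R : realType} {n : nat}.
Local Notation E := 'rV[R]_n.
Local Notation "''e_' i" := (delta_mx 0 i : 'rV[R]_n) (at level 8, i at level 2).
Implicit Types (g f : E -> R) (x y : E).

(** Bounded and uniformly continuous on the whole space: means are then defined everywhere and stay
    in the class, without tracking domains. *)
Definition BUC g := (exists K : R, forall x, `|g x| <= K) /\
  forall e : R, 0 < e -> exists2 d : R, 0 < d & forall x y, `|x - y| < d -> `|g x - g y| <= e.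

Lemma BUC_cont g x : BUC g -> {for x, continuous g}.
Proof.
move=> [_ H]; apply/cont_eps => e e0; have [d d0 Hd] := H (e / 2) (divr_gt0 e0 (ltr0Sn _ 1)).
exists d => // y /Hd K; apply: le_lt_trans K _; by rewrite ltr_pdivrMr // ltr_pMr // ltr1n.
Qed.

Lemma BUC_line g x v : BUC g -> continuous (fun t : R => g (x + t *: v)).
Proof.
move=> bg t; apply/cont_eps => e e0.
have /cont_eps /(_ e e0) [d d0 Hd] := BUC_cont g (x + t *: v) bg.
have v0 : 0 < `|v| + 1 by rewrite ltr_wpDl.
exists (d / (`|v| + 1)); first exact: divr_gt0.
move=> s st; apply: Hd; rewrite opprD addrACA subrr add0r -scalerBl normrZ.
move: st; rewrite ltr_pdivlMr //; apply: le_lt_trans.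
by rewrite ler_wpM2l // lerDl.
Qed.

Lemma BUC_add f g : BUC f -> BUC g -> BUC (fun x => f x + g x).
Proof.
move=> [[K1 H1] F] [[K2 H2] G]; split.
  by exists (K1 + K2) => x; apply: le_trans (ler_normD _ _) _; apply: lerD.
move=> e e0; have e20 : 0 < e / 2 by rewrite divr_gt0.
have [d1 d10 D1] := F _ e20; have [d2 d20 D2] := G _ e20.
exists (Num.min d1 d2); first by rewrite lt_min d10.
move=> x y; rewrite lt_min => /andP[/D1 A /D2 B].
rewrite opprD addrACA; apply: le_trans (ler_normD _ _) _.
by rewrite [e]splitr lerD.
Qed.

Lemma BUC_scale (c : R) g : BUC g -> BUC (fun x => c * g x).
Proof.
move=> [[K1 H1] F]; split.
  by exists (`|c| * K1) => x; rewrite normrM ler_wpM2l.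
move=> e e0; have c0 : 0 < `|c| + 1 by rewrite ltr_wpDl.
have [d d0 Hd] := F _ (divr_gt0 e0 c0); exists d => // x y /Hd.
rewrite ler_pdivlMr // -mulrBr normrM mulrC => K; apply: le_trans K.
by apply: ler_wpM2r => //; rewrite lerDl.
Qed.

Lemma BUC_cst (c : R) : BUC (fun _ => c).
Proof.
split; first by exists `|c|.
by move=> e e0; exists 1 => // x y _; rewrite subrr normr0 ltW.
Qed.

Lemma BUC_sum (I : Type) (r : seq I) (F : I -> E -> R) :
  (forall i, BUC (F i)) -> BUC (fun x => \sum_(i <- r) F i x).
Proof.
move=> H; elim: r => [|i r IH].
  by under eq_fun do rewrite big_nil; exact: BUC_cst.
by under eq_fun do rewrite big_cons; exact: BUC_add.
Qed.

Lemma BUC_tr c g : BUC g -> BUC (fun x => g (x + c)).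
Proof.
move=> [[K H] F]; split; first by exists K => x.
move=> e e0; have [d d0 Hd] := F e e0; exists d => // x y xy; apply: Hd.
by rewrite opprD addrACA subrr addr0.
Qed.

Definition S (i : 'I_n) (e : R) g : E -> R := fun x => Int (fun t => g (x + t *: 'e_i)) e.

Lemma S_char i (e : R) g x (G : R -> R) : BUC g -> 0 <= e ->
  (forall t : R, 0 <= t <= e -> is_derive t 1 G (g (x + t *: 'e_i))) ->
  S i e g x = G e - G 0.
Proof. by move=> bg e0 H; apply: Int_char => //; exact: BUC_line. Qed.

Lemma S_tr i e c g x : S i e g (x + c) = S i e (fun y => g (y + c)) x.
Proof. by rewrite /S; congr Int; apply/funext => t; rewrite addrAC. Qed.

Lemma S_bound i e g x (c K : R) : BUC g -> 0 <= e ->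
  (forall t : R, 0 <= t <= e -> `|g (x + t *: 'e_i) - c| <= K) ->
  `|S i e g x - c * e| <= K * e.
Proof. by move=> bg e0 H; apply: Int_bound => //; exact: BUC_line. Qed.

Lemma S_addf i e f g : BUC f -> BUC g -> 0 <= e ->
  S i e (fun x => f x + g x) = fun x => S i e f x + S i e g x.
Proof.
move=> bf bg e0; apply/funext => x.
have cf := BUC_line f x 'e_i bf; have cg := BUC_line g x 'e_i bg.
pose G t := prim (fun t => f (x + t *: 'e_i)) t + prim (fun t => g (x + t *: 'e_i)) t.
suff H t : 0 <= t <= e -> is_derive t 1 G (f (x + t *: 'e_i) + g (x + t *: 'e_i)).
  rewrite (S_char i e _ x G (BUC_add _ _ bf bg) e0 H) /G.
  by rewrite /S /Int; ring.
move=> /andP[t0 _]; have t1 : -1 < t by apply: lt_le_trans t0; rewrite ltrN10.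
have d1 := prim_derive _ cf t t1; have d2 := prim_derive _ cg t t1.
exact: (is_deriveD d1 d2).
Qed.

Lemma S_scalef i e (c : R) g : BUC g -> 0 <= e ->
  S i e (fun x => c * g x) = fun x => c * S i e g x.
Proof.
move=> bg e0; apply/funext => x; have cg := BUC_line g x 'e_i bg.
pose G t := c * prim (fun t => g (x + t *: 'e_i)) t.
suff H t : 0 <= t <= e -> is_derive t 1 G (c * g (x + t *: 'e_i)).
  rewrite (S_char i e _ x G (BUC_scale c _ bg) e0 H) /G.
  by rewrite /S /Int; ring.
move=> /andP[t0 _]; have t1 : -1 < t by apply: lt_le_trans t0; rewrite ltrN10.
have d2 := prim_derive _ cg t t1.
exact: (is_deriveZ c d2).
Qed.

Lemma S_BUC i e g : BUC g -> 0 <= e -> BUC (S i e g).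
Proof.
move=> bg e0; have [[K HK] H] := bg; split.
  exists (K * e) => x; have := S_bound i e g x 0 K bg e0; rewrite mul0r subr0.
  by apply => t _; rewrite subr0.
move=> r r0; have e1 : 0 < e + 1 by rewrite ltr_wpDl.
have [d d0 Hd] := H _ (divr_gt0 r0 e1); exists d => // x y xy.
have by' := BUC_scale (-1) _ (BUC_tr (y - x) _ bg).
have -> : S i e g x - S i e g y = S i e (fun z => g z + -1 * g (z + (y - x))) x.
  rewrite S_addf // S_scalef // ?mulN1r -?S_tr ?[x + _]addrC ?subrK //.
  exact: BUC_tr.
have := S_bound i e _ x 0 (r / (e + 1)) (BUC_add _ _ bg by') e0.
rewrite mul0r subr0 => K1; apply: le_trans (K1 _) _.
  move=> t _; rewrite subr0 mulN1r; apply: Hd.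
  rewrite opprD addrA subrr sub0r; move: xy; by rewrite opprB.
by rewrite mulrAC ler_pdivrMr // ler_wpM2l ?lerDl // ltW.
Qed.

(** Moving the base point along the integration direction shifts both ends of the interval. This is
    the gain of one derivative, whose value is a difference of [g]. *)
Lemma S_derive i e g x : BUC g -> 0 <= e ->
  is_derive x 'e_i (S i e g) (g (x + e *: 'e_i) - g x).
Proof.
move=> bg e0; have cg := BUC_line g x 'e_i bg.
pose h t := g (x + t *: 'e_i); pose F := prim h.
have SF (s : R) : -1 < s -> S i e g (x + s *: 'e_i) = F (s + e) - F s.
  move=> s1; have := S_char i e _ (x + s *: 'e_i) (fun t => F (t + s)) bg e0.
  rewrite add0r [e + s]addrC; apply => t /andP[t0 _].
  have : -1 < t + s by apply: lt_le_trans s1 _; rewrite lerDr.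
  move/(prim_derive h cg) => /is_derive_eps H; apply/is_derive_eps => r r0.
  have [d d0 Hd] := H r r0; exists d => // u ud; have := Hd u ud.
  by rewrite /h -[x + _ + _]addrA -scalerDl [s + t]addrC [t + _ + s]addrAC.
have m1 : -1 < 0 :> R by rewrite ltrN10.
have m2 : -1 < e by apply: lt_le_trans e0.
have /is_derive_eps H1 := prim_derive h cg 0 m1.
have /is_derive_eps H2 := prim_derive h cg e m2.
apply/is_derive_eps => r r0; have r20 : 0 < r / 2 by rewrite divr_gt0.
have [d1 d10 D1] := H1 _ r20; have [d2 d20 D2] := H2 _ r20.
exists (Num.min 1 (Num.min d1 d2)); first by rewrite !lt_min ltr01 d10.
move=> t; rewrite !lt_min => /and3P[t1 /D1 A /D2 B].
have -> : S i e g x = F e - F 0 by have := SF 0 m1; rewrite scale0r addr0 add0r.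
rewrite SF; last by move: t1; rewrite ltr_norml => /andP[].
move: A B; rewrite /h scale0r addr0 [0 + _]add0r ![t *: 1]mulr1 [e + t]addrC => A B.
rewrite -/F in A B.
have -> : F (t + e) - F t - (F e - F 0) - t * (g (x + e *: 'e_i) - g x) =
  (F (t + e) - F e - t * g (x + e *: 'e_i)) - (F t - F 0 - t * g x) by ring.
apply: le_trans (ler_normB _ _) _; rewrite [r]splitr mulrDl.
exact: lerD.
Qed.

Lemma S_plus i (a b : R) g x : BUC g -> 0 <= a -> 0 <= b ->
  S i (a + b) g x = S i a g x + S i b g (x + a *: 'e_i).
Proof.
move=> bg a0 b0; have cg := BUC_line g x 'e_i bg.
pose h t := g (x + t *: 'e_i); pose F := prim h.
have -> : S i b g (x + a *: 'e_i) = F (a + b) - F a.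
  have := S_char i b _ (x + a *: 'e_i) (fun t => F (t + a)) bg b0.
  rewrite add0r [b + a]addrC; apply => t /andP[t0 _].
  have : -1 < t + a.
    by apply: (@lt_le_trans _ _ 0); rewrite ?ltrN10 ?addr_ge0.
  move/(prim_derive h cg) => /is_derive_eps H; apply/is_derive_eps => r r0.
  have [d d0 Hd] := H r r0; exists d => // u ud; have := Hd u ud.
  by rewrite /h -[x + _ + _]addrA -scalerDl [a + t]addrC [t + _ + a]addrAC.
by rewrite /S /Int -/h -/F; ring.
Qed.

(* Both sides, as functions of the length of the j-side, have the same derivative; the
   base point is moved back by one so that this length stays positive. *)
Lemma S_comm i j (e : R) g x : BUC g -> 0 <= e -> S i e (S j e g) x = S j e (S i e g) x.
Proof.
move=> bg e0; have b1 (b : R) : -1 < b -> 0 <= 1 + b by rewrite -subr_gt0 opprK addrC => /ltW.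
pose y0 := x + (-1) *: 'e_j.
pose A (b : R) := S i e (S j (1 + b) g) y0.
have bS (b : R) : -1 < b -> BUC (S j (1 + b) g) by move=> /b1 ?; exact: S_BUC.
have e1 : -1 < e by apply: lt_le_trans e0; rewrite ltrN10.
have dA (b : R) : 0 <= b <= e -> is_derive b 1 A (S i e g (x + b *: 'e_j)).
  move=> /andP[b0 be]; have bm : -1 < b by apply: lt_le_trans b0; rewrite ltrN10.
  have -> : S i e g (x + b *: 'e_j) = S i e (fun y => g (y + (1 + b) *: 'e_j)) y0.
    by rewrite -S_tr /y0 -addrA -scalerDl addrA addNr add0r.
  apply/is_derive_eps => r r0; have ee : 0 < e + 1 by rewrite ltr_wpDl.
  have [d d0 Hd] := bg.2 _ (divr_gt0 r0 ee).
  exists (Num.min 1 d); first by rewrite lt_min ltr01.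
  move=> t; rewrite lt_min [t *: 1]mulr1 => /andP[t1 td].
  have bt : -1 < b + t by move: t1; rewrite ltr_norml => /andP[? ?]; lra.
  have bu1 := BUC_tr ((1 + b) *: 'e_j) _ bg.
  have bu2 := BUC_scale (-1) _ (bS b bm).
  have bu3 := BUC_scale (- t) _ bu1.
  have -> : A (b + t) - A b - t * S i e (fun y => g (y + (1 + b) *: 'e_j)) y0 =
      S i e (fun y => S j (1 + (b + t)) g y + -1 * S j (1 + b) g y
         + - t * g (y + (1 + b) *: 'e_j)) y0.
    rewrite (S_addf i e _ _ (BUC_add _ _ (bS _ bt) bu2) bu3 e0).
    rewrite (S_addf i e _ _ (bS _ bt) bu2 e0) (S_scalef i e (-1) _ (bS b bm) e0).
    by rewrite (S_scalef i e (- t) _ bu1 e0) mulN1r mulNr.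
  have := S_bound i e _ y0 0 (r / (e + 1) * `|t|)
    (BUC_add _ _ (BUC_add _ _ (bS _ bt) bu2) bu3) e0.
  rewrite mul0r subr0 => K; apply: le_trans (K _) _; last first.
    rewrite mulrAC ler_wpM2r // mulrAC ler_pdivrMr // ler_wpM2l ?lerDl //; exact: ltW.
  move=> s _; rewrite subr0; move: (y0 + s *: _) => y.
  have -> : S j (1 + (b + t)) g y + -1 * S j (1 + b) g y + - t * g (y + (1 + b) *: 'e_j) =
    prim (fun s => g (y + s *: 'e_j)) (1 + (b + t))
    - prim (fun s => g (y + s *: 'e_j)) (1 + b)
    - g (y + (1 + b) *: 'e_j) * (1 + (b + t) - (1 + b)) by rewrite /S /Int; ring.
  have -> : `|t| = `|1 + (b + t) - (1 + b)| by congr (`|_|); ring.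
  apply: prim_bound; [exact: BUC_line|lra|lra|].
  move=> u ut; apply: Hd; rewrite opprD addrACA subrr add0r -scalerBl norm_delta.
  apply: le_lt_trans td; move: ut; rewrite ge_min le_max.
  by clear; rewrite ler_norml; have [t0|t0] := leP 0 t;
    [rewrite ger0_norm|rewrite ltr0_norm] => // /andP[/orP[] ? /orP[] ?];
    apply/andP; split; lra.
rewrite (S_char j e _ x A (S_BUC _ _ _ bg e0) e0 dA) /A addr0.
have m10 : -1 < 0 :> R by rewrite ltrN10.
have bb0 := BUC_scale (-1) _ (bS 0 m10); rewrite addr0 in bb0.
have -> : S i e (S j (1 + e) g) y0 - S i e (S j 1 g) y0 =
   S i e (fun y => S j (1 + e) g y + -1 * S j 1 g y) y0.
  have b11 : BUC (S j 1 g) by exact: S_BUC.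
  by rewrite (S_addf _ _ _ _ (bS e e1) bb0 e0) (S_scalef _ _ _ _ b11 e0) mulN1r.
have -> : (fun y => S j (1 + e) g y + -1 * S j 1 g y) = (fun y => S j e g (y + 1 *: 'e_j)).
  by apply/funext => y; rewrite S_plus // mulN1r addrAC subrr add0r.
by rewrite -S_tr /y0 -addrA -scalerDl addNr scale0r addr0.
Qed.

(** The unnormalized integral over the box spanned by the directions in [l]; by [S_comm] their order
    is immaterial. *)
Fixpoint SL (l : seq 'I_n) (e : R) g : E -> R :=
  if l is i :: l' then S i e (SL l' e g) else g.

Lemma SL_BUC l (e : R) g : BUC g -> 0 <= e -> BUC (SL l e g).
Proof. by move=> bg e0; elim: l => [|i l IH] //=; exact: S_BUC. Qed.

Lemma SL_addf l (e : R) f g : BUC f -> BUC g -> 0 <= e ->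
  SL l e (fun x => f x + g x) = fun x => SL l e f x + SL l e g x.
Proof.
move=> bf bg e0; elim: l => [|i l IH] //=.
by rewrite IH S_addf //; exact: SL_BUC.
Qed.

Lemma SL_scalef l (e : R) (c : R) g : BUC g -> 0 <= e ->
  SL l e (fun x => c * g x) = fun x => c * SL l e g x.
Proof.
move=> bg e0; elim: l => [|i l IH] //=.
by rewrite IH S_scalef //; exact: SL_BUC.
Qed.

Lemma SL_tr l (e : R) c g x : SL l e g (x + c) = SL l e (fun y => g (y + c)) x.
Proof.
elim: l x => [|i l IH] x //=; rewrite S_tr; congr (S _ _ _ _).
by apply/funext => y; rewrite IH.
Qed.

Lemma SL_S l i (e : R) g : BUC g -> 0 <= e -> SL l e (S i e g) = S i e (SL l e g).
Proof.
move=> bg e0; elim: l => [|j l IH] //=; rewrite IH; apply/funext => x.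
by apply: S_comm => //; exact: SL_BUC.
Qed.

Lemma SL_SL l l' (e : R) g : BUC g -> 0 <= e -> SL l e (SL l' e g) = SL l' e (SL l e g).
Proof.
move=> bg e0; elim: l' => [|j l' IH] //=; rewrite SL_S ?IH //; exact: SL_BUC.
Qed.

Lemma SL_rem l i (e : R) g : BUC g -> 0 <= e -> i \in l ->
  SL l e g = S i e (SL (rem i l) e g).
Proof.
move=> bg e0; elim: l => [|j l IH] //=; rewrite inE.
have [->//|ij] := eqVneq j i => /= il.
rewrite (IH il) /=; apply/funext => x; apply: S_comm => //; exact: SL_BUC.
Qed.

Definition cube x (l : seq 'I_n) (e : R) y :=
  forall j, x ord0 j <= y ord0 j <= x ord0 j + (if j \in l then e else 0).

Lemma SL_bound l (e : R) g x (c K : R) : BUC g -> 0 <= e -> uniq l ->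
  (forall y, cube x l e y -> `|g y - c| <= K) ->
  `|SL l e g x - c * e ^+ size l| <= K * e ^+ size l.
Proof.
move=> bg e0; elim: l x => [|i l IH] x /=.
  move=> _ H; rewrite expr0 !mulr1; apply: H => j /=; by rewrite addr0 lexx.
move=> /andP[il ul] H; rewrite exprSr !mulrA.
apply: S_bound => //; first exact: SL_BUC.
move=> t /andP[t0 te]; apply: IH => // y cy; apply: H => j.
have := cy j; rewrite !mxE eqxx /= inE; have [->|ji] := eqVneq j i.
  rewrite (negbTE il) mulr1 addr0 /= => /andP[a b]; apply/andP; split.
    by apply: le_trans a; rewrite lerDl.
  by apply: le_trans b _; rewrite lerD2l.
by rewrite mulr0 addr0.
Qed.

(** The sum over the [2^|l|] corners of a box of side [e]. These are the base points of the boxes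
    into which a box of side [2 e] is cut. *)
Fixpoint AL (l : seq 'I_n) (e : R) g : E -> R :=
  if l is i :: l' then fun x => AL l' e g x + AL l' e g (x + e *: 'e_i) else g.

Lemma SL_double l (e : R) g : BUC g -> 0 <= e -> SL l (e + e) g = AL l e (SL l e g).
Proof.
move=> bg e0; elim: l => [|i l IH] //=; rewrite IH.
have bA f : BUC f -> BUC (AL l e f).
  move=> bf; elim: (l) => [|k l' IH'] //=; apply: BUC_add => //; exact: BUC_tr.
have AS f : BUC f -> S i e (AL l e f) = AL l e (S i e f).
  move=> bf; elim: (l) => [|k l' IH'] //=.
  have bA' : BUC (AL l' e f).
    elim: (l') => [|k' l'' IH''] //=; apply: BUC_add => //; exact: BUC_tr.
  rewrite S_addf //; last exact: BUC_tr.
  by apply/funext => x; rewrite -!IH' S_tr.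
have bS := SL_BUC l e g bg e0.
apply/funext => x; rewrite S_plus //; last exact: bA.
by rewrite !AS.
Qed.

Lemma AL_tr l (e : R) g c : AL l e (fun x => g (x + c)) = fun x => AL l e g (x + c).
Proof.
elim: l => [|i l IH] //=; apply/funext => x; rewrite IH; congr (_ + AL _ _ _ _).
by rewrite addrAC.
Qed.

Lemma AL_add l (e : R) f g : AL l e (fun x => f x + g x) = fun x => AL l e f x + AL l e g x.
Proof.
by elim: l => [|i l IH] //=; apply/funext => x; rewrite IH; ring.
Qed.

Lemma AL_rem l i (e : R) g : i \in l ->
  AL l e g = AL (rem i l) e (fun x => g x + g (x + e *: 'e_i)).
Proof.
elim: l => [|j l IH] //=; rewrite inE; have [->|ji] := eqVneq j i.
  by move=> _; rewrite AL_add AL_tr.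
by move=> /= il; rewrite (IH il).
Qed.

Lemma AL_sum (I : Type) (r : seq I) l (e : R) (F : I -> E -> R) :
  AL l e (fun x => \sum_(i <- r) F i x) = fun x => \sum_(i <- r) AL l e (F i) x.
Proof.
elim: l => [|i l IH] //=; apply/funext => x; by rewrite IH -big_split.
Qed.

Lemma AL_pigeon l (e c : R) g x : 0 <= e -> uniq l -> c * 2 ^+ size l <= `|AL l e g x| ->
  exists2 y, cube x l e y & c <= `|g y|.
Proof.
move=> e0; elim: l x => [|i l IH] x /=.
  by move=> _; rewrite expr0 mulr1 => H; exists x => // j /=; rewrite addr0 lexx.
move=> /andP[il ul]; rewrite exprS mulrCA => H.
have : c * 2 ^+ size l <= `|AL l e g x| \/ c * 2 ^+ size l <= `|AL l e g (x + e *: 'e_i)|.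
  have [|h] := leP (c * 2 ^+ size l) `|AL l e g x|; first by left.
  right; have := le_trans H (ler_normD _ _); lra.
case=> /IH -/(_ ul) [y cy gy]; exists y => // j; have /andP[a b] := cy j; rewrite inE.
  have [eji|ji] := eqVneq j i => /=; last by rewrite a b.
  rewrite a; move: b; rewrite eji (negbTE il) addr0 => b.
  by apply: le_trans b _; rewrite lerDl.
move: a b; rewrite !mxE eqxx /=; have [->|ji] := eqVneq j i => /=.
  rewrite (negbTE il) mulr1 addr0 => a b; rewrite b andbT; apply: le_trans a.
  by rewrite lerDl.
by rewrite mulr0 addr0 => -> ->.
Qed.

Definition dl i (e : R) g : E -> R := fun y => g (y + e *: 'e_i) + -1 * g y.

Lemma dl_BUC i (e : R) g : BUC g -> BUC (dl i e g).
Proof. by move=> bg; apply: BUC_add; [exact: BUC_tr|exact: BUC_scale]. Qed.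

(** The outward flux of [X] through the cube with lowest corner [x]: for each [i], the difference of
    [X_i] on two opposite faces is integrated over the face, whose directions are all but [i]. *)
Definition Flux (e : R) (X : 'I_n -> E -> R) : E -> R :=
  fun x => \sum_i SL (rem i (enum 'I_n)) e (dl i e (X i)) x.

(** When a cube is cut in halves, the fluxes through interior faces cancel; here this is the
    splitting of [dl i (e + e)] into two consecutive differences. *)
Lemma Flux_double (e : R) X : (forall i, BUC (X i)) -> 0 <= e ->
  Flux (e + e) X = AL (enum 'I_n) e (Flux e X).
Proof.
move=> bX e0; rewrite /Flux AL_sum; apply/funext => x; apply: eq_bigr => i _.
have bd := dl_BUC i e _ (bX i); have bt := BUC_tr (e *: 'e_i) _ bd.
have -> : dl i (e + e) (X i) = fun y => dl i e (X i) y + dl i e (X i) (y + e *: 'e_i).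
  by apply/funext => y; rewrite /dl scalerDl addrA; ring.
rewrite SL_double //; last exact: BUC_add.
rewrite [AL (enum 'I_n) _ _](AL_rem _ i) ?mem_enum //; congr (AL _ _ _ _).
rewrite (SL_addf _ _ _ _ bd bt e0).
by apply/funext => y; rewrite SL_tr.
Qed.

Lemma diff_eps (g : E -> R) x : differentiable g x ->
  forall e : R, 0 < e -> exists2 d : R, 0 < d & forall h : E, `|h| < d ->
    `|g (x + h) - g x - \sum_j h ord0 j * 'D_('e_j) g x| <= e * `|h|.
Proof.
move=> /differentiable_eps[l Hl] e e0.
have lE j : l j = 'D_('e_j) g x.
  suff : is_derive x 'e_j g (l j) by case.
  apply/is_derive_eps => r r0; have [d d0 Hd] := Hl r r0; exists d => // t td.
  have := Hd (t *: 'e_j); rewrite norm_delta => /(_ td).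
  rewrite (bigD1 j) //= big1 ?addr0 ?mxE ?eqxx ?mulr1 // => k kj.
  by rewrite !mxE eqxx (negbTE kj) mulr0 mul0r.
have [d d0 Hd] := Hl e e0; exists d => // h /Hd.
by under eq_bigr do rewrite lE.
Qed.

(** Repeated halving keeps a cube whose flux is at least [c] times its volume, whereas the linear
    approximation at the common point of these cubes, together with divergence zero there, makes the
    flux small compared with the volume. *)
Lemma goursat X x0 (e0 : R) : 0 < e0 -> (forall i, BUC (X i)) ->
  (forall y, cube x0 (enum 'I_n) e0 y ->
     (forall i, differentiable (X i) y) /\ \sum_i 'D_('e_i) (X i) y = 0) ->
  Flux e0 X x0 = 0.
Proof.
move=> e00 bX HX; apply/eqP/negPn/negP => F0.
pose L := enum 'I_n; have sL : size L = n by rewrite size_enum_ord.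
pose ek k := e0 / 2 ^+ k.
have p2 k : 0 < 2 ^+ k :> R by exact: exprn_gt0.
have ek0 k : 0 < ek k by exact: divr_gt0.
have ekS k : ek k = ek k.+1 + ek k.+1.
  by rewrite /ek exprS; field; rewrite lt0r_neq0.
pose c := `|Flux e0 X x0| / e0 ^+ n.
have c0 : 0 < c by rewrite divr_gt0 ?normr_gt0 ?exprn_gt0.
(* The cube of side [ek k] with lowest corner [x] lies in the initial cube and has flux density at
   least [c]. *)
pose P k x := c * ek k ^+ n <= `|Flux (ek k) X x| /\
  forall j, x0 ord0 j <= x ord0 j /\ x ord0 j + ek k <= x0 ord0 j + e0.
have P0 : P 0%N x0.
  split; last by move=> j; rewrite /ek expr0 divr1 !lexx.
  by rewrite /ek expr0 divr1 /c mulfVK // expf_neq0 // lt0r_neq0.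
have step k x : P k x -> exists2 x', P k.+1 x' & forall j, x ord0 j <= x' ord0 j
     /\ x' ord0 j + ek k.+1 <= x ord0 j + ek k.
  move=> [H1 H2]; rewrite (ekS k) (Flux_double _ _ bX (ltW (ek0 k.+1))) in H1.
  have [|x' cx' Hx'] := AL_pigeon L (ek k.+1) (c * ek k.+1 ^+ n) (Flux (ek k.+1) X) x
    (ltW (ek0 k.+1)) (enum_uniq _).
    apply: le_trans H1; rewrite sL -mulrA -exprMn mulr_natr mulr2n //.
  have K j : x ord0 j <= x' ord0 j /\ x' ord0 j + ek k.+1 <= x ord0 j + ek k.
    have := cx' j; rewrite mem_enum /= => /andP[a b]; split => //.
    by rewrite (ekS k) addrA lerD2r.
  exists x' => //; split => // j; have [a b] := K j; have [a' b'] := H2 j.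
  by split; [exact: le_trans a|exact: le_trans b'].
pose next k (s : {x | P k x}) : {x | P k.+1 x} :=
  let: exist x Px := s in let: exist2 x' Px' _ := cid2 (step k x Px) in exist _ x' Px'.
pose fix xs k : {x | P k x} := if k is k'.+1 then next k' (xs k') else exist _ x0 P0.
pose u k := sval (xs k).
have uP k : P k (u k) by exact: svalP.
have uS k j : u k ord0 j <= u k.+1 ord0 j
     /\ u k.+1 ord0 j + ek k.+1 <= u k ord0 j + ek k.
  rewrite /u /=; case: (xs k) => x Px /=; by case: cid2.
have umono k m j : (k <= m)%N -> u k ord0 j <= u m ord0 j
     /\ u m ord0 j + ek m <= u k ord0 j + ek k.
  elim: m => [|m IH]; first by rewrite leqn0 => /eqP ->; rewrite !lexx.
  rewrite leq_eqVlt => /orP[/eqP ->|]; first by rewrite !lexx.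
  rewrite ltnS => /IH[a b]; have [a' b'] := uS m j.
  by split; [exact: le_trans a'|exact: le_trans b].
(* The lowest corners increase coordinatewise, so their supremum is the common point of the nested
   cubes. *)
pose xx : E := \row_j sup (range (fun k => u k ord0 j)).
have xxP k j : u k ord0 j <= xx ord0 j <= u k ord0 j + ek k.
  have ub : ubound (range (fun k => u k ord0 j)) (u k ord0 j + ek k).
    move=> _ [m _ <-]; have [mk|/ltnW km] := leqP m k.
      by apply: le_trans (umono _ _ j mk).1 _; rewrite lerDl ltW.
    by apply: le_trans (umono _ _ j km).2; rewrite lerDl ltW.
  rewrite mxE; apply/andP; split.
    by apply: ub_le_sup; [exists (u k ord0 j + ek k)|exists k].
  by apply: ge_sup => //; exists (u k ord0 j), k.
have xxc : cube x0 L e0 xx.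
  move=> j; rewrite mem_enum /=; have := xxP 0%N j; rewrite /u /= /ek expr0 divr1; done.
have [dX divX] := HX xx xxc.
have n1 : 0 < (2 * n%:R + 1 : R) by rewrite ltr_wpDl // mulr_ge0.
(* Each of the [n] pairs of faces of a cube of side [s] contributes an error of at most [2 r s^n],
   and [c = 2 n r + r] leaves a strict gap. *)
pose r := c / (2 * n%:R + 1).
have r0 : 0 < r by exact: divr_gt0.
have [d d0 Hd] : exists2 d : R, 0 < d & forall (i : 'I_n) (y : E), `|y - 0| < d ->
   `|X i (xx + y) - X i xx - \sum_j y ord0 j * 'D_('e_j) (X i) xx| <= r * `|y|.
  apply: (fin_eps _ (fun i y => `|X i (xx + y) - X i xx
    - \sum_j y ord0 j * 'D_('e_j) (X i) xx| <= r * `|y|)) => i.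
  have [d d0 Hd] := diff_eps _ _ (dX i) _ r0; exists d => // y; rewrite subr0; exact: Hd.
have [k kd] : exists k, ek k < d.
  exists (Num.Def.archi_bound (e0 / d)); rewrite /ek ltr_pdivrMr // mulrC -ltr_pdivrMr //.
  exact: upper_nthrootP.
have bnd i : `|SL (rem i L) (ek k) (dl i (ek k) (X i)) (u k)
    - (ek k * 'D_('e_i) (X i) xx) * ek k ^+ n.-1| <= (2 * r * ek k) * ek k ^+ n.-1.
  have sr : size (rem i L) = n.-1 by rewrite size_rem ?mem_enum // sL.
  rewrite -sr; apply: SL_bound; [exact: dl_BUC|exact: ltW|exact/rem_uniq/enum_uniq|].
  move=> y cy; have cy' j : u k ord0 j <= y ord0 j <= u k ord0 j + (if j == i then 0 else ek k).
    have := cy j; rewrite mem_rem_uniq ?enum_uniq // inE mem_enum andbT /=.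
    by case: (j == i).
  have ney : `|y - xx| <= ek k.
    apply: rV_norm_le; first exact: ltW.
    move=> j; rewrite !mxE; have /andP[a b] := cy' j; have /andP[a' b'] := xxP k j.
    have e2 := ek0 k; move: a' b'; rewrite !mxE => a' b'.
    by rewrite ler_norml; apply/andP; split; move: b; case: (j == i) => b; lra.
  have ney' : `|y + ek k *: 'e_i - xx| <= ek k.
    apply: rV_norm_le; first exact: ltW.
    move=> j; have /andP[a b] := cy' j; have /andP[a' b'] := xxP k j.
    have e2 := ek0 k; move: a b a' b'; rewrite !mxE eqxx /= => a b a' b'.
    rewrite ler_norml; move: a a' b' b; have [->|ji] := eqVneq j i => a a' b' b;
      rewrite ?mulr1 ?mulr0; by apply/andP; split; lra.
  have := Hd i (y - xx); rewrite subr0 => /(_ (le_lt_trans ney kd)) A.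
  have := Hd i (y + ek k *: 'e_i - xx); rewrite subr0 => /(_ (le_lt_trans ney' kd)) B.
  rewrite [xx + _]addrC subrK in A; rewrite [xx + _]addrC subrK in B.
  have EB : \sum_j (y + ek k *: 'e_i - xx) ord0 j * 'D_('e_j) (X i) xx =
      \sum_j (y - xx) ord0 j * 'D_('e_j) (X i) xx + ek k * 'D_('e_i) (X i) xx.
    have <- : \sum_(j < n) (ek k *: ('e_i : E)) ord0 j * 'D_('e_j) (X i) xx = ek k * 'D_('e_i) (X i) xx.
      rewrite (bigD1 i) //= big1 ?addr0 ?mxE ?eqxx ?mulr1 // => j ji.
      by rewrite !mxE eqxx (negbTE ji) mulr0 mul0r.
    by rewrite -big_split /=; apply: eq_bigr => j _; rewrite !mxE; ring.
  rewrite EB in B; rewrite /dl mulN1r.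
  move: A B; move: (\sum_j _) => s A B.
  have A' := le_trans A (ler_wpM2l (ltW r0) ney).
  have B' := le_trans B (ler_wpM2l (ltW r0) ney').
  move: A' B'; rewrite !ler_norml => /andP[a1 a2] /andP[b1 b2].
  by clear -a1 a2 b1 b2; apply/andP; split; lra.
have n0 : (0 < n)%N.
  case: (posnP n) => // n0; move: F0; rewrite /Flux big1 ?eqxx // => i _.
  by exfalso; have := leq_ltn_trans (leq0n i) (ltn_ord i); rewrite n0.
have [H1 _] := uP k; move: H1; apply/negP; rewrite -ltNge.
(* The subtracted terms add up to a multiple of the divergence at [xx], which is zero. *)
have -> : Flux (ek k) X (u k) = \sum_i (SL (rem i L) (ek k) (dl i (ek k) (X i)) (u k)
    - (ek k * 'D_('e_i) (X i) xx) * ek k ^+ n.-1).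
  by rewrite sumrB -mulr_suml -mulr_sumr divX mulr0 mul0r subr0.
apply: le_lt_trans (ler_norm_sum _ _ _) _.
apply: le_lt_trans (ler_sum _ (fun i _ => bnd i)) _.
rewrite sumr_const card_ord -[X in X < _]mulr_natr -[in ltRHS](prednK n0) exprS.
have ekn : 0 < ek k ^+ n.-1 by exact: exprn_gt0.
have -> : c = r * (2 * n%:R + 1) by rewrite /r mulfVK // lt0r_neq0.
have e2 := ek0 k; have rr : 0 < r * (ek k * ek k ^+ n.-1) := mulr_gt0 r0 (mulr_gt0 e2 ekn).
move: rr; clear; move: (n%:R : R) (ek k ^+ n.-1) (ek k) r => N Q e r H.
by rewrite -subr_gt0; have -> : r * (2 * N + 1) * (e * e ^+ n.-1) - 2 * r * e * e ^+ n.-1 * N = r * (e * e ^+ n.-1) by ring.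
Qed.

End BUC.

(** * Limits of harmonic functions *)

Section harmonic.
Context {R : realType} {n : nat}.
Local Notation E := 'rV[R]_n.
Local Notation "''e_' i" := (delta_mx 0 i : 'rV[R]_n) (at level 8, i at level 2).
Implicit Types (g f h : E -> R) (x y z a : E).

Lemma second_test (g g1 : R -> R) (d g2 : R) : 0 < d ->
  (forall t : R, `|t| < d -> is_derive t 1 g (g1 t)) -> is_derive (0 : R) 1 g1 g2 ->
  (forall t : R, `|t| < d -> g t <= g 0) -> g2 <= 0.
Proof.
move=> d0 dg dg1 gm; rewrite leNgt; apply/negP => g20.
have g10 : g1 0 = 0.
  have d00 : `|0 : R| < d by rewrite normr0.
  have [_ <-] := dg 0 d00.
  have dd : - d <= d by rewrite (@le_trans _ _ 0) // ?oppr_le0 ltW.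
  suff : is_derive (0 : R) 1 g 0 by case.
  apply: (@derive1_at_max _ g (- d) d 0) => //.
  - move=> t; rewrite in_itv /= -ltr_norml => /dg; by case.
  - by rewrite in_itv /= oppr_lt0 d0.
  - by move=> t; rewrite in_itv /= -ltr_norml => /gm.
have g220 : 0 < g2 / 2 by rewrite divr_gt0.
have /is_derive_eps /(_ _ g220) [r r0 Hr] := dg1.
pose t := Num.min r d / 2.
have t0 : 0 < t by rewrite divr_gt0 // lt_min r0.
have tm : t < Num.min r d by rewrite ltr_pdivrMr // ltr_pMr ?ltr1n // lt_min r0.
have [tr td] : t < r /\ t < d by move: tm; rewrite lt_min => /andP[].
have [||c] := @MVT _ g g1 0 t t0.
- move=> s; rewrite in_itv /= => /andP[s0 st]; apply: dg.
  by rewrite gtr0_norm //; apply: lt_trans td.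
- apply: derivable_within_continuous => s; rewrite in_itv /= => /andP[s0 st].
  have /dg [] // : `|s| < d by rewrite ger0_norm //; apply: le_lt_trans td.
rewrite in_itv /= => /andP[c0 ct] Ec.
have := gm t; rewrite gtr0_norm // => /(_ td); rewrite -subr_le0 Ec subr0.
have := Hr c; rewrite gtr0_norm // => /(_ (lt_trans ct tr)).
rewrite add0r [c *: 1]mulr1 g10 subr0 ler_norml => /andP[A _].
have : 0 < g1 c * t; last by move=> B /(lt_le_trans B); rewrite ltxx.
rewrite mulr_gt0 //; have : 0 < c * g2 / 2 by rewrite divr_gt0 // mulr_gt0.
by move: A; clear; lra.
Qed.

(** At an interior maximum every pure second derivative is at most zero, against the strict sign of
    their sum; so the maximum over the compact box is on its boundary. *)
Lemma max_principle g (g1 g2 : 'I_n -> E -> R) (lo hi : 'I_n -> R) :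
  (forall j, lo j < hi j) ->
  (forall z, (forall j, lo j <= z ord0 j <= hi j) -> {for z, continuous g}) ->
  (forall z, (forall j, lo j < z ord0 j < hi j) ->
     (forall j, is_derive z 'e_j g (g1 j z) /\ is_derive z 'e_j (g1 j) (g2 j z)) /\
     0 < \sum_j g2 j z) ->
  (forall z, (forall j, lo j <= z ord0 j <= hi j) ->
     (exists j, z ord0 j = lo j \/ z ord0 j = hi j) -> g z <= 0) ->
  forall z, (forall j, lo j <= z ord0 j <= hi j) -> g z <= 0.
Proof.
move=> lohi cg dg bg z Bz.
pose B := [set z : E | forall j, (z ord0 j) \in `[lo j, hi j]].
have cB : compact B.
  by apply: (@rV_compact _ _ (fun j => `[lo j, hi j]%classic)) => j; exact: segment_compact.
have B0 : B !=set0 by exists z => j; rewrite in_itv /=; exact: Bz.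
have cgB : {within B, continuous g}.
  apply: continuous_in_subspaceT => y; rewrite inE => By; apply: cg => j.
  by have := By j; rewrite in_itv.
have [c cB' cmax] := EVT_max_rV B0 cB cgB.
have Bc : forall j, lo j <= c ord0 j <= hi j.
  by move=> j; have := cB'; rewrite inE => /(_ j); rewrite in_itv.
apply: (@le_trans _ _ (g c)).
  by apply: cmax; rewrite inE => j; rewrite in_itv /=; exact: Bz.
have [[j Hj]|H] := pselect (exists j, c ord0 j = lo j \/ c ord0 j = hi j).
  by apply: bg => //; exists j.
have Ic j : lo j < c ord0 j < hi j.
  have /andP[a1 a2] := Bc j; rewrite !lt_neqAle a1 a2 !andbT eq_sym.
  by apply/andP; split; apply/eqP => K; apply: H; exists j; [left|right].
have [D S0] := dg c Ic.
suff : \sum_j g2 j c <= 0 by move=> K; have := lt_le_trans S0 K; rewrite ltxx.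
apply: sumr_le0 => j _.
have [d d0 Hd] : exists2 d : R, 0 < d & forall (k : 'I_n) y, `|y - c| < d ->
    lo k < y ord0 k < hi k.
  apply: (fin_eps _ (fun k : 'I_n => [set y : E | lo k < y ord0 k < hi k])) => k.
  have /andP[a1 a2] := Ic k.
  exists (Num.min (c ord0 k - lo k) (hi k - c ord0 k)); first by rewrite lt_min !subr_gt0 a1.
  move=> y yc; have := le_lt_trans (coord_le_norm _ _ _ k) yc; rewrite !mxE.
  rewrite lt_min !ltr_norml => /andP[/andP[A1 A2] /andP[A3 A4]].
  by apply/andP; split; lra.
have near t : `|t| < d -> forall k, lo k < (c + t *: 'e_j) ord0 k < hi k.
  by move=> td k; apply: Hd; rewrite addrC addKr norm_delta.
apply: (@second_test (fun t => g (c + t *: 'e_j)) (fun t => g1 j (c + t *: 'e_j)) d) => //.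
- move=> t td; have [K _] := dg _ (near t td); have [K' _] := K j.
  exact: (is_derive_line _ _ _ _ _).1 K'.
- apply: (is_derive_line _ _ _ _ _).1; rewrite scale0r addr0; exact: (D j).2.
- move=> t td; rewrite scale0r addr0; apply: cmax; rewrite inE => k.
  by rewrite in_itv /=; have /andP[a1 a2] := near t td k; rewrite !ltW.
Qed.

(** Only pure second derivatives are mentioned. Their uniform bound [K] makes difference quotients
    converge uniformly to first derivatives. Balls are those of the sup norm, that is, cubes. *)
Definition harm a (d : R) h := (forall x, `|x - a| < d -> {for x, continuous h}) /\
  exists (h1 h2 : 'I_n -> E -> R) (K : R), forall x, `|x - a| < d ->
    (forall i, [/\ is_derive x 'e_i h (h1 i x), is_derive x 'e_i (h1 i) (h2 i x)
       & `|h2 i x| <= K]) /\ \sum_i h2 i x = 0.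

Definition refl1 (i : 'I_n) x z : E := z + (2 * (x ord0 i - z ord0 i)) *: 'e_i.

Lemma refl1_line i x z (t : R) j : refl1 i x (z + t *: 'e_j) =
  refl1 i x z + ((if j == i then - t else t) *: 'e_j).
Proof.
apply/rowP => k; rewrite !mxE !eqxx /=; have [->|ji] := eqVneq j i.
  by rewrite mulr1; case: (k == i) => /=; ring.
by case: (k == j); case: (k == i) => /=; ring.
Qed.

Lemma is_derive_refl1 g i x z j (l : R) : is_derive (refl1 i x z) 'e_j g l ->
  is_derive z 'e_j (fun z => g (refl1 i x z)) ((if j == i then -1 else 1) * l).
Proof.
move=> H; pose c : R := if j == i then -1 else 1.
have /is_derive_eps H' := is_derive_scale _ _ _ c _ H.
apply/is_derive_eps => e e0; have [d d0 Hd] := H' e e0; exists d => // t td.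
rewrite refl1_line; have := Hd t td; rewrite scalerA /c.
by case: (j == i); rewrite ?mulrN1 ?mulr1.
Qed.

Lemma refl1_ball i x z (r : R) : `|z - x| <= r -> `|refl1 i x z - x| <= r.
Proof.
move=> zr; apply: rV_norm_le; first exact: le_trans zr.
move=> j; have := le_trans (coord_le_norm _ _ _ j) zr; rewrite !mxE eqxx /=.
have [->|ji] := eqVneq j i; last by rewrite mulr0 addr0.
by rewrite mulr1 distrC; apply: le_trans; rewrite le_eqVlt; apply/orP; left; apply/eqP; congr (`|_|); ring.
Qed.

(** Terms of a barrier on the half cube [0 <= t <= r], [|z_j - x_j| <= r], where [t = z_i - x_i]:
    their sum is [t ((n+1) r - n t)] plus the squares of the other [z_j - x_j]. It is nonnegative,
    at least [r^2] on all faces but [t = 0], and its Laplacian [-2 n + 2 (n-1) = -2] is strictly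
    negative. *)
Definition qb (i : 'I_n) x (r : R) (j : 'I_n) z : R :=
  if j == i then (z ord0 i - x ord0 i) * (n.+1%:R * r - n%:R * (z ord0 i - x ord0 i))
  else (z ord0 j - x ord0 j) ^+ 2.
Definition qb1 (i : 'I_n) x (r : R) (j : 'I_n) z : R :=
  if j == i then n.+1%:R * r - 2 * n%:R * (z ord0 i - x ord0 i)
  else 2 * (z ord0 j - x ord0 j).
Definition qb2 (i j : 'I_n) : R := if j == i then - (2 * n%:R) else 2.

Lemma is_derive_coordB (j k : 'I_n) x z :
  is_derive z 'e_k (fun z => z ord0 j - x ord0 j) (j == k)%:R.
Proof.
have := is_deriveB_fun _ _ _ _ _ _ (is_derive_coord j z 'e_k) (is_derive_cst (x ord0 j : R) z 'e_k).
by move=> H; apply: is_derive_eq H _; rewrite !mxE eqxx subr0.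
Qed.

Lemma qb_derive i x (r : R) (j k : 'I_n) z :
  is_derive z 'e_k (qb i x r j) (if j == k then qb1 i x r j z else 0).
Proof.
rewrite /qb /qb1; have [->|ji] := eqVneq j i.
  have H := is_derive_coordB i k x z.
  have H1 := is_deriveB_fun _ _ _ _ _ _ (is_derive_cst (n.+1%:R * r : R) z 'e_k) (is_deriveZ_fun _ n%:R _ _ _ H).
  have H2 := is_deriveM_fun _ _ _ _ _ _ H H1.
  by apply: is_derive_eq H2 _; case: (i == k) => /=; ring.
have H2 := is_deriveX_fun _ 2 _ _ _ (is_derive_coordB j k x z).
by apply: is_derive_eq H2 _; rewrite /= expr1; case: (j == k); rewrite ?mulr1 ?mulr0.
Qed.

Lemma qb1_derive i x (r : R) (j : 'I_n) z : is_derive z 'e_j (qb1 i x r j) (qb2 i j).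
Proof.
rewrite /qb1 /qb2; have [->|ji] := eqVneq j i.
  have H := is_deriveB_fun _ _ _ _ _ _ (is_derive_cst (n.+1%:R * r : R) z 'e_i)
    (is_deriveZ_fun _ (2 * n%:R) _ _ _ (is_derive_coordB i i x z)).
  by apply: is_derive_eq H _; rewrite eqxx mulr1 sub0r.
have H := is_deriveZ_fun _ 2 _ _ _ (is_derive_coordB j j x z).
by apply: is_derive_eq H _; rewrite eqxx mulr1.
Qed.

Lemma qbs_derive i x (r : R) (k : 'I_n) z :
  is_derive z 'e_k (fun z => \sum_j qb i x r j z) (qb1 i x r k z).
Proof.
have H : is_derive z 'e_k (\sum_(j < n) qb i x r j) (\sum_j (if j == k then qb1 i x r j z else 0)).
  by apply: is_derive_sum => j; exact: qb_derive.
rewrite -big_mkcond big_pred1_eq in H.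
suff -> : (fun z => \sum_j qb i x r j z) = \sum_(j < n) qb i x r j by [].
by apply/funext => y; rewrite fct_sumE.
Qed.

(** The odd part of [h] under reflection in [z_i = x_i] vanishes on that hyperplane and is at most
    [M] elsewhere, so [M / r^2] times the barrier dominates it on the half cube. Near [x] the
    barrier is linear in the distance to the hyperplane, which bounds the derivative. *)
Lemma grad_est a (d : R) h (h1 h2 : 'I_n -> E -> R) (K M r : R) x (i : 'I_n) :
  (forall x, `|x - a| < d -> {for x, continuous h}) ->
  (forall x, `|x - a| < d ->
    (forall i, [/\ is_derive x 'e_i h (h1 i x), is_derive x 'e_i (h1 i) (h2 i x)
       & `|h2 i x| <= K]) /\ \sum_i h2 i x = 0) ->
  0 < M -> (forall x, `|x - a| < d -> `|h x| <= M) -> 0 < r -> `|x - a| + r < d ->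
  `|h1 i x| <= n.+1%:R * M / r.
Proof.
move=> ch Hh M0 hM r0 xr.
have inb z : `|z - x| <= r -> `|z - a| < d.
  move=> zx; apply: le_lt_trans xr.
  have -> : z - a = (z - x) + (x - a) by rewrite addrA subrK.
  by apply: le_trans (ler_normD _ _) _; rewrite addrC lerD2l.
pose kap := M / r ^+ 2.
have kap0 : 0 < kap by rewrite divr_gt0 ?exprn_gt0.
pose lo j := if j == i then x ord0 i else x ord0 j - r.
pose hi j := x ord0 j + r.
have boxb z : (forall j, lo j <= z ord0 j <= hi j) -> `|z - x| <= r.
  move=> Bz; apply: rV_norm_le; first exact: ltW.
  move=> j; have := Bz j; rewrite /lo /hi !mxE ler_norml.
  have [->|ji] := eqVneq j i => /andP[A1 A2]; apply/andP; split; lra.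
(* The two signs [s] bound the odd part from above and from below. *)
have main (s : R) : `|s| = 1 -> forall z, (forall j, lo j <= z ord0 j <= hi j) ->
   s / 2 * (h z - h (refl1 i x z)) - kap * \sum_j qb i x r j z <= 0.
  move=> s1; apply: (max_principle _ (fun j z => s / 2 * (h1 j z - (if j == i then -1 else 1) *
      h1 j (refl1 i x z)) - kap * qb1 i x r j z) (fun j z => s / 2 * (h2 j z - h2 j (refl1 i x z))
      - kap * qb2 i j) lo hi).
  - by move=> j; rewrite /lo /hi; case: eqP => [->|_]; lra.
  - move=> z /boxb zb; have zb' := refl1_ball i x z r zb.
    have cz := ch _ (inb _ zb); have cz' := ch _ (inb _ zb').
    apply: continuousB.
      apply: contM_for; first exact: cst_cont.
      apply: continuousB; first exact: cz.
      apply/cont_eps => e e0; have /cont_eps /(_ e e0) [dd dd0 Hdd] := cz'.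
      exists (dd / 3); first by rewrite divr_gt0.
      move=> y yz; apply: Hdd.
      have -> : refl1 i x y - refl1 i x z = (y - z) + (2 * (z ord0 i - y ord0 i)) *: 'e_i.
        by apply/rowP => j; rewrite !mxE; ring.
      apply: le_lt_trans (ler_normD _ _) _; rewrite norm_delta normrM ger0_norm //.
      have := coord_le_norm _ _ (y - z) i; rewrite !mxE distrC => Hi.
      by rewrite ltr_pdivlMr // in yz; move: Hi yz; clear; lra.
    apply: contM_for; first exact: cst_cont.
    have : CR 0 setT (fun z => \sum_j qb i x r j z).
      apply: CR_sum; first exact: openT.
      move=> j _; split => // y _.
      have cB (k : 'I_n) : {for y, continuous (fun z : E => z ord0 k - x ord0 k)}.
        by apply: continuousB; [exact: coord_cont|exact: cst_cont].
      rewrite /qb; case: (j == i).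
        apply: contM_for; first exact: cB.
        apply: continuousB; first exact: cst_cont.
        by apply: contM_for; [exact: cst_cont|exact: cB].
      have -> : (fun z : E => (z ord0 j - x ord0 j) ^+ 2) =
          fun z => (z ord0 j - x ord0 j) * (z ord0 j - x ord0 j).
        by apply/funext => u; rewrite expr2.
      by apply: contM_for; exact: cB.
    by case=> /(_ z I).
  - move=> z Iz; have Bz : forall j, lo j <= z ord0 j <= hi j.
      by move=> j; have /andP[A1 A2] := Iz j; rewrite !ltW.
    have zb := boxb z Bz; have zb' := refl1_ball i x z r zb.
    have [Hz Sz] := Hh _ (inb _ zb); have [Hz' Sz'] := Hh _ (inb _ zb'); split.
      move=> j; have [A1 A2 _] := Hz j; have [B1 B2 _] := Hz' j; split.
        have := is_deriveB_fun _ _ _ _ _ _ (is_deriveZ_fun _ (s / 2) _ _ _ (is_deriveB_fun _ _ _ _ _ _ A1 (is_derive_refl1 _ _ _ _ _ _ B1)))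
          (is_deriveZ_fun _ kap _ _ _ (qbs_derive i x r j z)).
        by [].
      have := is_deriveB_fun _ _ _ _ _ _ (is_deriveZ_fun _ (s / 2) _ _ _ (is_deriveB_fun _ _ _ _ _ _ A2
         (is_deriveZ_fun _ (if j == i then -1 else 1) _ _ _ (is_derive_refl1 _ _ _ _ _ _ B2))))
          (is_deriveZ_fun _ kap _ _ _ (qb1_derive i x r j z)).
      move=> H; apply: is_derive_eq H _; by case: (j == i); ring.
    rewrite sumrB -mulr_sumr sumrB Sz Sz' subrr mulr0 sub0r -mulr_sumr -mulrN.
    apply: mulr_gt0 => //; rewrite (bigD1 i) //= {1}/qb2 eqxx.
    rewrite (eq_bigr (fun _ => 2)); last by move=> j ji; rewrite /qb2 (negbTE ji).
    rewrite sumr_const; have -> : #|[pred j : 'I_n | j != i]| = n.-1.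
      by rewrite cardC1 card_ord.
    have n0 : (0 < n)%N by apply: leq_ltn_trans (ltn_ord i).
    have nE : n%:R = n.-1%:R + 1 :> R by rewrite natr1 prednK.
    by rewrite -mulr_natr nE; lra.
  - move=> z Bz [j Hj]; have zb := boxb z Bz; have zb' := refl1_ball i x z r zb.
    rewrite subr_le0; have q0 k : 0 <= qb i x r k z.
      rewrite /qb; case: eqP => _; last exact: sqr_ge0.
      have := Bz i; rewrite /lo /hi eqxx => /andP[A1 A2]; apply: mulr_ge0; first lra.
      rewrite subr_ge0 -natr1 mulrDl mul1r.
      have : n%:R * (z ord0 i - x ord0 i) <= n%:R * r by rewrite ler_wpM2l //; lra.
      by move: r0; clear; lra.
    have [Hji|Hji] := pselect (z ord0 i = x ord0 i).
      have -> : refl1 i x z = z by rewrite /refl1 Hji subrr mulr0 scale0r addr0.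
      rewrite subrr mulr0 mulr_ge0 //; first exact: ltW.
      exact: sumr_ge0.
    apply: (@le_trans _ _ M).
      apply: le_trans (ler_norm _) _; rewrite normrM normrM s1 mul1r ger0_norm //.
      have := le_trans (ler_normB (h z) (h (refl1 i x z))) (lerD (hM _ (inb _ zb)) (hM _ (inb _ zb'))).
      by clear; lra.
    have qj : r ^+ 2 <= qb i x r j z.
      move: Hj; rewrite /qb /lo /hi; have [->|ji] := eqVneq j i.
        case=> // ->; rewrite addrC addKr expr2; apply: ler_wpM2l; first exact: ltW.
        by rewrite -natr1; clear; lra.
      by case=> ->; rewrite le_eqVlt; apply/orP; left; apply/eqP; ring.
    have : r ^+ 2 <= \sum_j qb i x r j z.
      by rewrite (bigD1 j) //=; apply: ler_wpDr => //; exact: sumr_ge0.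
    rewrite /kap => K1; rewrite -mulrA -[X in X <= _]mulr1; apply: ler_wpM2l; first exact: ltW.
    by rewrite mulrC ler_pdivlMr ?exprn_gt0 // mul1r.
have diffb (t : R) : 0 <= t <= r ->
    `|h (x + t *: 'e_i) - h (x - t *: 'e_i)| <= 2 * (n.+1%:R * M / r) * t.
  move=> /andP[t0 tr]; set z := x + t *: 'e_i.
  have zi : z ord0 i = x ord0 i + t by rewrite !mxE !eqxx mulr1.
  have Bz j : lo j <= z ord0 j <= hi j.
    rewrite /lo /hi; have [->|ji] := eqVneq j i; first by rewrite zi; apply/andP; split; lra.
    by rewrite !mxE (negbTE ji) mulr0 addr0; apply/andP; split; lra.
  have rz : refl1 i x z = x - t *: 'e_i.
    by rewrite /refl1 zi; apply/rowP => j; rewrite !mxE; ring.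
  have Qz : kap * \sum_j qb i x r j z <= n.+1%:R * M / r * t.
    rewrite (bigD1 i) //= big1 ?addr0; last first.
      by move=> j ji; rewrite /qb (negbTE ji) !mxE (negbTE ji) mulr0 addr0 subrr expr0n.
    rewrite /qb eqxx zi [x ord0 i + t]addrC addrK.
    (* Dropping [- n t] in the second factor leaves a bound linear in [t], of slope
       [(n+1) M / r]. *)
    apply: (@le_trans _ _ (kap * (t * (n.+1%:R * r)))).
      apply: ler_wpM2l; first exact: ltW.
      by apply: ler_wpM2l => //; rewrite lerBlDr lerDl mulr_ge0.
    rewrite /kap le_eqVlt; apply/orP; left; apply/eqP; field; exact: lt0r_neq0.
  have m1 := main 1 (normr1 _) z Bz.
  have m2 := main (-1) (etrans (normrN1 _) erefl) z Bz.
  rewrite rz in m1 m2; rewrite ler_norml -mulrA; move: m1 m2 Qz.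
  move: (h z) (h (x - _)) (kap * _) (n.+1%:R * M / r * t) => A B C DD m1 m2 Qz.
  by apply/andP; split; lra.
have xa : `|x - a| < d by apply: lt_trans xr; rewrite ltrDl.
have [/(_ i) [d1 _ _] _] := Hh x xa.
apply/ler_addgt0Pr => e e0.
have /is_derive_eps /(_ _ e0) [dd dd0 Hd] := d1.
pose t := Num.min dd r / 2.
have t0 : 0 < t by rewrite divr_gt0 // lt_min dd0.
have tm : t < Num.min dd r by rewrite ltr_pdivrMr // ltr_pMr ?ltr1n // lt_min dd0.
have [td tr] : t < dd /\ t < r by move: tm; rewrite lt_min => /andP[].
have := Hd t; rewrite gtr0_norm // => /(_ td) A.
have := Hd (- t); rewrite normrN gtr0_norm // => /(_ td); rewrite scaleNr => B.
have := diffb t; rewrite (ltW t0) (ltW tr) => /(_ isT) C.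
rewrite -(ler_pM2r t0) -{1}(gtr0_norm t0) -normrM.
move: A B C; rewrite mulNr !ler_norml; move: (h _) (h _) (h x) (h1 i x) => p q0 s u.
by move: (n.+1%:R * M / r) => v; clear -t0; move=> /andP[? ?] /andP[? ?] /andP[? ?]; apply/andP; split; lra.
Qed.

Lemma harm_lin a (d : R) h k (c c' : R) : harm a d h -> harm a d k ->
  harm a d (fun x => c * h x + c' * k x).
Proof.
move=> [ch [h1 [h2 [K Hh]]]] [fueter_coef [k1 [k2 [L Hk]]]]; split.
  move=> x xd; apply: contD_for; apply: contM_for; (try exact: cst_cont); [exact: ch|exact: fueter_coef].
exists (fun i x => c * h1 i x + c' * k1 i x), (fun i x => c * h2 i x + c' * k2 i x).
exists (`|c| * K + `|c'| * L) => x xd; have [A SA] := Hh x xd; have [B SB] := Hk x xd; split.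
  move=> i; have [A1 A2 A3] := A i; have [B1 B2 B3] := B i; split.
  - by apply: is_deriveD_fun; exact: is_deriveZ_fun.
  - by apply: is_deriveD_fun; exact: is_deriveZ_fun.
  - apply: le_trans (ler_normD _ _) _; rewrite !normrM.
    by apply: lerD; apply: ler_wpM2l.
by rewrite big_split /= -!mulr_sumr SA SB !mulr0 addr0.
Qed.

Lemma harm_tr a (d d' : R) h v : `|v| + d' <= d -> harm a d h ->
  harm a d' (fun x => h (x + v)).
Proof.
move=> vd [ch [h1 [h2 [K Hh]]]].
have inb x : `|x - a| < d' -> `|x + v - a| < d.
  move=> xd; apply: lt_le_trans vd; rewrite addrAC; apply: le_lt_trans (ler_normD _ _) _.
  by rewrite [X in X < _]addrC ltrD2l.
split.
  move=> x /inb /ch /cont_eps H; apply/cont_eps => e e0; have [r r0 Hr] := H e e0.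
  by exists r => // y yx; apply: Hr; rewrite opprD addrACA subrr addr0.
exists (fun i x => h1 i (x + v)), (fun i x => h2 i (x + v)), K => x /inb /Hh[A SA].
by split => // i; have [A1 A2 A3] := A i; split => //; exact: is_derive_shiftV.
Qed.

Lemma harm_sub a (d d' : R) h : d' <= d -> harm a d h -> harm a d' h.
Proof.
move=> dd /(harm_tr a d d' h 0); rewrite normr0 add0r => /(_ dd).
by under eq_fun do rewrite addr0.
Qed.

(** Uniform limits of harmonic functions on a fixed ball. The class is closed under uniform limits
    and, on smaller balls, under differentiation; smoothness follows from these two closure
    properties. *)
Definition Hc a (d : R) h := forall eta : R, 0 < eta ->
  exists2 k, harm a d k & forall x, `|x - a| < d -> `|h x - k x| <= eta.

Lemma Hc_harm a (d : R) h : harm a d h -> Hc a d h.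
Proof. by move=> H eta e0; exists h => // x _; rewrite subrr normr0 ltW. Qed.

Lemma Hc_sub a (d d' : R) h : d' <= d -> Hc a d h -> Hc a d' h.
Proof.
move=> dd H eta e0; have [k hk Hk] := H _ e0; exists k; first exact: harm_sub hk.
by move=> x xd; apply: Hk; apply: lt_le_trans dd.
Qed.

Lemma Hc_lim a (d : R) h : (forall eta : R, 0 < eta ->
  exists2 k, Hc a d k & forall x, `|x - a| < d -> `|h x - k x| <= eta) -> Hc a d h.
Proof.
move=> H eta e0; have e20 : 0 < eta / 2 by rewrite divr_gt0.
have [k hk Hk] := H _ e20; have [k' hk' Hk'] := hk _ e20; exists k' => // x xd.
have -> : h x - k' x = (h x - k x) + (k x - k' x) by ring.
by apply: le_trans (ler_normD _ _) _; rewrite [eta]splitr lerD // ?Hk ?Hk'.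
Qed.

Lemma Hc_ext a (d : R) h h' : (forall x, `|x - a| < d -> h x = h' x) -> Hc a d h -> Hc a d h'.
Proof.
move=> E1 H eta e0; have [k hk Hk] := H _ e0; exists k => // x xd.
by rewrite -E1 // Hk.
Qed.

Lemma Hc_lin a (d : R) h k (c c' : R) : Hc a d h -> Hc a d k ->
  Hc a d (fun x => c * h x + c' * k x).
Proof.
move=> Hh Hk eta e0; have c0 : 0 < `|c| + `|c'| + 1 by rewrite ltr_wpDl // addr_ge0.
have e1 := divr_gt0 e0 c0.
have [h' hh' A] := Hh _ e1; have [k' hk' B] := Hk _ e1.
exists (fun x => c * h' x + c' * k' x); first exact: harm_lin.
move=> x xd; have -> : c * h x + c' * k x - (c * h' x + c' * k' x) =
  c * (h x - h' x) + c' * (k x - k' x) by ring.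
apply: le_trans (ler_normD _ _) _; rewrite !normrM.
apply: (@le_trans _ _ ((`|c| + `|c'|) * (eta / (`|c| + `|c'| + 1)))).
  by rewrite mulrDl; apply: lerD; apply: ler_wpM2l => //; [exact: A|exact: B].
by rewrite mulrA ler_pdivrMr // mulrC ler_wpM2l ?lerDl // ltW.
Qed.

Lemma Hc_cst0 a (d : R) : Hc a d (fun _ => 0).
Proof.
apply: Hc_harm; split; first by move=> x _; exact: cst_cont.
exists (fun _ _ => 0), (fun _ _ => 0), 0 => x _; split; last by rewrite big1.
by move=> i; split; rewrite ?normr0 //; exact: is_derive_cst.
Qed.

Lemma Hc_sum a (d : R) (c : 'I_n -> R) (H : 'I_n -> E -> R) : (forall i, Hc a d (H i)) ->
  Hc a d (fun x => \sum_i c i * H i x).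
Proof.
move=> HH; elim: (index_enum _) => [|i r IH].
  by under eq_fun do rewrite big_nil; exact: Hc_cst0.
apply: (Hc_ext _ _ (fun x => c i * H i x + 1 * \sum_(j <- r) c j * H j x)).
  by move=> x _; rewrite big_cons mul1r.
exact: Hc_lin.
Qed.

Lemma Hc_cont a (d : R) h x : Hc a d h -> `|x - a| < d -> {for x, continuous h}.
Proof.
move=> H xd; apply/cont_eps => e e0; have e30 : 0 < e / 4 by rewrite divr_gt0.
have [k [fueter_coef _] Hk] := H _ e30; have /cont_eps /(_ _ e30) [r r0 Hr] := fueter_coef x xd.
exists (Num.min r (d - `|x - a|)); first by rewrite lt_min r0 subr_gt0.
move=> y; rewrite lt_min => /andP[yr yd].
have ya : `|y - a| < d.
  have -> : y - a = (y - x) + (x - a) by rewrite addrA subrK.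
  by apply: le_lt_trans (ler_normD _ _) _; rewrite -ltrBrDr.
have A := Hk x xd; have B := Hk y ya; have C := Hr y yr.
move: A B C; rewrite !ler_norml !ltr_norml; clear -e0.
by move=> /andP[? ?] /andP[? ?] /andP[? ?]; apply/andP; split; lra.
Qed.

(** Difference quotients of a harmonic function are harmonic on a slightly smaller ball, and the
    bound on second derivatives makes them converge uniformly. *)
Lemma harm_D_Hc a (d d' : R) h (h1 h2 : 'I_n -> E -> R) (K : R) i :
  (forall x, `|x - a| < d -> {for x, continuous h}) ->
  (forall x, `|x - a| < d ->
    (forall i, [/\ is_derive x 'e_i h (h1 i x), is_derive x 'e_i (h1 i) (h2 i x)
       & `|h2 i x| <= K]) /\ \sum_i h2 i x = 0) ->
  d' < d -> Hc a d' (h1 i).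
Proof.
move=> ch Hh dd eta e0.
have K0 : 0 < `|K| + 1 by rewrite ltr_wpDl.
pose t := Num.min ((d - d') / 2) (eta / (`|K| + 1)).
have t0 : 0 < t by rewrite lt_min !divr_gt0 ?subr_gt0.
have td : t + d' <= d.
  have : t <= (d - d') / 2 by rewrite ge_min lexx.
  by move: dd; clear; lra.
have hh : harm a d h by split => //; exists h1, h2, K.
exists (fun x => t^-1 * h (x + t *: 'e_i) + (- t^-1) * h x).
  apply: harm_lin; last by apply: harm_sub hh; exact: ltW.
  by apply: harm_tr hh; rewrite norm_delta gtr0_norm.
move=> x xd.
have inb (s : R) : `|s| <= `|t| -> `|x + s *: 'e_i - a| < d.
  rewrite (gtr0_norm t0) => st; apply: lt_le_trans td; rewrite addrAC [t + _]addrC.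
  by apply: le_lt_trans (ler_normD _ _) _; rewrite norm_delta; exact: ltr_leD.
have [s st Es] := MVT_line h x 'e_i (fun s => h1 i (x + s *: 'e_i)) t
  (fun s st => match (Hh _ (inb s st)).1 i with And3 A _ _ => A end).
have inb2 (u : R) : `|u| <= `|s| -> `|u| <= `|t| by move=> /le_trans; apply.
have [u us Eu] := MVT_line (h1 i) x 'e_i (fun s => h2 i (x + s *: 'e_i)) s
  (fun s st => match (Hh _ (inb s (inb2 _ st))).1 i with And3 _ A _ => A end).
have -> : t^-1 * h (x + t *: 'e_i) + - t^-1 * h x = h1 i (x + s *: 'e_i).
  by rewrite mulNr -mulrBr Es mulKf // lt0r_neq0.
rewrite distrC Eu normrM.
have [_ _ A] := (Hh _ (inb u (inb2 _ us))).1 i.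
apply: (@le_trans _ _ (t * (`|K| + 1))).
  apply: ler_pM => //; first by move: st; rewrite (gtr0_norm t0).
  by apply: le_trans A _; apply: le_trans (ler_norm _) _; rewrite lerDl.
by rewrite -ler_pdivlMr // ge_min lexx orbT.
Qed.

(** The gradient estimate for the difference of two approximants makes their derivatives uniformly
    Cauchy away from the boundary. The limit is the derivative of [h] and inherits the gradient
    estimate. *)
Lemma Hc_D a (d d' : R) h (i : 'I_n) : 0 < d' -> d' < d -> Hc a d h ->
  exists g, [/\ Hc a d' g, forall x, `|x - a| < d' -> is_derive x 'e_i h (g x) &
    forall (M r : R) x, 0 < M -> (forall x, `|x - a| < d -> `|h x| <= M) ->
      0 < r -> `|x - a| + r < d -> `|x - a| < d' -> `|g x| <= n.+1%:R * M / r].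
Proof.
move=> d'0 dd H.
have /choice[K HK] : forall eta : R, exists k, 0 < eta -> harm a d k /\
    forall x, `|x - a| < d -> `|h x - k x| <= eta.
  move=> eta; have [e0|e0] := ltP 0 eta; last by exists h.
  by have [k hk Hk] := H _ e0; exists k.
have /choice[K1 HK1] : forall eta : R, exists k1 : 'I_n -> E -> R, 0 < eta ->
   exists (k2 : 'I_n -> E -> R) L, forall x, `|x - a| < d ->
    (forall i, [/\ is_derive x 'e_i (K eta) (k1 i x), is_derive x 'e_i (k1 i) (k2 i x)
       & `|k2 i x| <= L]) /\ \sum_i k2 i x = 0.
  move=> eta; have [e0|e0] := ltP 0 eta; last by exists (fun _ => h).
  by have [[_ [k1 [k2 [L Hk]]]] _] := HK _ e0; exists k1; exists k2, L.
have cK (eta : R) : 0 < eta -> forall x, `|x - a| < d -> {for x, continuous (K eta)}.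
  by move=> /HK[[]].
pose rr := (d - d') / 2; have rr0 : 0 < rr by rewrite divr_gt0 ?subr_gt0.
have rrd x : `|x - a| < d' -> `|x - a| + rr < d by rewrite /rr; move: dd; clear; lra.
have dd' x : `|x - a| < d' -> `|x - a| < d by move=> /lt_trans; apply.
pose C := n.+1%:R / rr; have C0 : 0 < C by rewrite divr_gt0.
have Cau (e e' : R) x : 0 < e -> 0 < e' -> `|x - a| < d' ->
    `|K1 e i x - K1 e' i x| <= C * (e + e').
  move=> e0 e'0 xd; have [k2 [L Hk]] := HK1 e e0; have [k2' [L' Hk']] := HK1 e' e'0.
  have := @grad_est a d (fun x => K e x - K e' x) (fun i x => K1 e i x - K1 e' i x)
    (fun i x => k2 i x - k2' i x) (L + L') (e + e') rr x i.
  rewrite mulrAC; apply => //; last exact: rrd.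
  - by move=> y yd; apply: continuousB; exact: cK.
  - move=> y yd; have [A SA] := Hk y yd; have [B SB] := Hk' y yd; split; last first.
      by rewrite sumrB SA SB subr0.
    move=> j; have [A1 A2 A3] := A j; have [B1 B2 B3] := B j; split.
    + exact: is_deriveB_fun.
    + exact: is_deriveB_fun.
    + by apply: le_trans (ler_normB _ _) _; exact: lerD.
  - exact: addr_gt0.
  - move=> y yd; have A := (HK e e0).2 y yd; have B := (HK e' e'0).2 y yd.
    move: A B; rewrite !ler_norml; clear => /andP[? ?] /andP[? ?].
    by apply/andP; split; lra.
(* The limit of [K1 e i x] as [e] tends to [0], obtained without a sequence: by [Cau], each
   [K1 e i x - C e] lies below every [K1 e' i x + C e']. *)
pose g x := sup [set K1 e i x - C * e | e in [set e : R | 0 < e]].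
have gP (e : R) x : 0 < e -> `|x - a| < d' -> `|K1 e i x - g x| <= C * e.
  move=> e0 xd.
  have ub (e' : R) : 0 < e' -> ubound [set K1 e i x - C * e | e in [set e : R | 0 < e]]
      (K1 e' i x + C * e').
    move=> e'0 _ [u /= u0 <-]; have := Cau u e' x u0 e'0 xd.
    rewrite ler_norml mulrDr; clear => /andP[? ?]; lra.
  have A1 : K1 e i x - C * e <= g x.
    by apply: ub_le_sup; [exists (K1 e i x + C * e); exact: ub|exists e].
  have A2 : g x <= K1 e i x + C * e.
    by apply: ge_sup; [exists (K1 e i x - C * e), e|exact: ub].
  by move: A1 A2; rewrite ler_norml; clear => ? ?; apply/andP; split; lra.
exists g; split.
- apply: Hc_lim => eta e0; exists (K1 (eta / C) i).
    have ec0 : 0 < eta / C by exact: divr_gt0.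
    have [k2 [L Hk]] := HK1 _ ec0; exact: harm_D_Hc (cK _ ec0) Hk dd.
  move=> x xd; rewrite distrC; apply: le_trans (gP _ _ _ xd) _; first exact: divr_gt0.
  by rewrite mulrC mulfVK // lt0r_neq0.
- move=> x xd; apply/is_derive_eps => e e0.
  pose eta := e / 3 / C; have eta0 : 0 < eta by apply: divr_gt0 => //; exact: divr_gt0.
  have Ce : C * eta = e / 3 by rewrite mulrC mulfVK // lt0r_neq0.
  have [k2 [L Hk]] := HK1 _ eta0.
  have [/(_ i) [A1 _ _] _] := Hk x (dd' x xd).
  have e30 : 0 < e / 3 by rewrite divr_gt0.
  have /is_derive_eps /(_ _ e30) [dl dl0 Hdl] := A1.
  exists (Num.min dl (d' - `|x - a|)); first by rewrite lt_min dl0 subr_gt0.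
  move=> t; rewrite lt_min => /andP[tl td].
  have inb (s : R) : `|s| <= `|t| -> `|x + s *: 'e_i - a| < d'.
    move=> st; rewrite addrAC; apply: le_lt_trans (ler_normD _ _) _.
    by rewrite norm_delta -ltrBrDl; exact: le_lt_trans st td.
  (* The increment of [h - K eta] is a limit of increments of [K e' - K eta], and these are
     controlled by [|t|] through the mean value theorem and [Cau]. *)
  have B1 : `|(h (x + t *: 'e_i) - K eta (x + t *: 'e_i)) - (h x - K eta x)| <= `|t| * (e / 3).
    apply/ler_addgt0Pr => ep ep0.
    pose e' := ep / (`|t| * C + 2); have tC : 0 < `|t| * C + 2.
      by rewrite ltr_wpDl // mulr_ge0 // ltW.
    have e'0 : 0 < e' by exact: divr_gt0.
    have [k2' [L' Hk']] := HK1 _ e'0.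
    have [s st Es] := MVT_line (fun y => K e' y - K eta y) x 'e_i
       (fun s => K1 e' i (x + s *: 'e_i) - K1 eta i (x + s *: 'e_i)) t (fun s st => is_deriveB_fun _ _ _ _ _ _
         (match (Hk' _ (dd' _ (inb s st))).1 i with And3 A _ _ => A end)
         (match (Hk _ (dd' _ (inb s st))).1 i with And3 A _ _ => A end)).
    have C1 := Cau e' eta _ e'0 eta0 (inb s st).
    have D1 := (HK _ e'0).2 x (dd' x xd).
    have D2 := (HK _ e'0).2 _ (dd' _ (inb t (lexx _))).
    have F1 : `|K e' (x + t *: 'e_i) - K eta (x + t *: 'e_i) - (K e' x - K eta x)|
        <= `|t| * (C * (e' + eta)).
      by rewrite Es normrM ler_wpM2l.
    have F2 : `|t| * (C * (e' + eta)) + 2 * e' = `|t| * (e / 3) + ep.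
      rewrite mulrDr Ce mulrDr [X in X + _ = _]addrC -addrA; congr (_ + _).
      have -> : `|t| * (C * e') + 2 * e' = e' * (`|t| * C + 2) by ring.
      by rewrite mulfVK // lt0r_neq0.
    rewrite -F2; move: D1 D2 F1; rewrite !ler_norml; clear.
    by move=> /andP[? ?] /andP[? ?] /andP[? ?]; apply/andP; split; lra.
  have B2 := Hdl t tl.
  have B3 : `|t * K1 eta i x - t * g x| <= `|t| * (e / 3).
    by rewrite -mulrBr normrM ler_wpM2l // -Ce gP.
  move: B1 B2 B3; rewrite !ler_norml; clear.
  by move=> /andP[? ?] /andP[? ?] /andP[? ?]; apply/andP; split; lra.
- move=> M r x M0 hM r0 xr xd; apply/ler_addgt0Pr => e e0.
  pose N1 := n.+1%:R / r; have N0 : 0 < N1 by rewrite divr_gt0.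
  pose eta := e / (N1 + C); have eta0 : 0 < eta by rewrite divr_gt0 // addr_gt0.
  have [k2 [L Hk]] := HK1 _ eta0.
  have A := @grad_est a d (K eta) (K1 eta) k2 L (M + eta) r x i (cK _ eta0) Hk.
  have B : `|K1 eta i x| <= n.+1%:R * (M + eta) / r.
    apply: A => //; first exact: addr_gt0.
    move=> y yd; have := (HK _ eta0).2 y yd; have := hM y yd; rewrite !ler_norml; clear.
    by move=> /andP[? ?] /andP[? ?]; apply/andP; split; lra.
  have F : n.+1%:R * (M + eta) / r + C * eta = n.+1%:R * M / r + e.
    have -> : n.+1%:R * (M + eta) / r + C * eta = n.+1%:R * M / r + eta * (N1 + C).
      by rewrite /N1; field; exact: lt0r_neq0.
    by rewrite mulfVK // lt0r_neq0 // addr_gt0.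
  rewrite -F; move: B (gP _ _ eta0 xd); rewrite !ler_norml; clear.
  by move=> /andP[? ?] /andP[? ?]; apply/andP; split; lra.
Qed.

Lemma nball_open a (d : R) : open [set x | `|x - a| < d].
Proof.
apply: openP_eps => x /= xd; exists (d - `|x - a|); first by rewrite subr_gt0.
move=> y yx /=; have -> : y - a = (y - x) + (x - a) by rewrite addrA subrK.
by apply: le_lt_trans (ler_normD _ _) _; rewrite -ltrBrDr.
Qed.

Lemma mid_lt (u d : R) : u < d -> exists2 d', u < d' & d' < d.
Proof. by move=> ud; exists ((u + d) / 2); lra. Qed.

Lemma Hc_derive a (d : R) h (i : 'I_n) x : Hc a d h -> `|x - a| < d ->
  is_derive x 'e_i h ('D_('e_i) h x).
Proof.
move=> H xd; have [d' xd' dd] := mid_lt _ _ xd.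
have d'0 : 0 < d' by apply: le_lt_trans xd'.
have [g [_ D _]] := Hc_D a d d' h i d'0 dd H.
by apply: derivableP; case: (D x xd').
Qed.

Lemma Hc_D1 a (d d' : R) h (i : 'I_n) : d' < d -> Hc a d h ->
  Hc a d' (fun x => 'D_('e_i) h x).
Proof.
move=> dd H; have [d'0|d'0] := ltP 0 d'.
  have [g [Hg D _]] := Hc_D a d d' h i d'0 dd H.
  by apply: Hc_ext Hg => x xd; case: (D x xd).
apply: (Hc_ext _ _ (fun _ => 0)) (Hc_cst0 _ _) => x xd.
by have := lt_le_trans xd d'0; rewrite normr_lt0.
Qed.

Lemma Hc_CR p a (d : R) h : Hc a d h -> CR p [set x | `|x - a| < d] h.
Proof.
elim: p d h => [|p IH] d h H; first by split => // y /=; exact: Hc_cont.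
split; first by move=> y /=; exact: Hc_cont.
split; first by move=> y i /= yd; case: (Hc_derive _ _ _ i _ H yd).
move=> i; apply: CR_loc => x /= xd; have [d' xd' dd] := mid_lt _ _ xd.
exists (d' - `|x - a|); first by rewrite subr_gt0.
apply: CR_sub (IH d' _ (Hc_D1 a d d' h i dd H)) => y /= yx.
have -> : y - a = (y - x) + (x - a) by rewrite addrA subrK.
by apply: le_lt_trans (ler_normD _ _) _; rewrite -ltrBrDr.
Qed.

Lemma Hc_deriveV a (d : R) h v x : Hc a d h -> `|x - a| < d ->
  is_derive x v h (\sum_i v ord0 i * 'D_('e_i) h x).
Proof.
by move=> H xd; apply: (C1_derive [set x | `|x - a| < d]) => //; [exact: nball_open|exact: Hc_CR].
Qed.

Lemma Hc_DV a (d d' : R) h v : d' < d -> Hc a d h -> Hc a d' (fun x => 'D_v h x).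
Proof.
move=> dd H; apply: (Hc_ext _ _ (fun x => \sum_i v ord0 i * 'D_('e_i) h x)).
  by move=> x xd; have [] := Hc_deriveV _ _ _ v _ H (lt_trans xd dd).
by apply: Hc_sum => i; exact: Hc_D1 dd H.
Qed.

Lemma Hc_DV_bound a (d M r : R) h v x : Hc a d h -> 0 < M ->
  (forall x, `|x - a| < d -> `|h x| <= M) -> 0 < r -> `|x - a| + r < d ->
  `|'D_v h x| <= (n%:R * n.+1%:R + 1) * `|v| * M / r.
Proof.
move=> H M0 hM r0 xr.
have xd : `|x - a| < d by apply: lt_trans xr; rewrite ltrDl.
have [_ ->] := Hc_deriveV _ _ _ v _ H xd.
have B i : `|'D_('e_i) h x| <= n.+1%:R * M / r.
  have [d' xd' dd] := mid_lt _ _ xd.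
  have d'0 : 0 < d' by apply: le_lt_trans xd'.
  have [g [_ D Bg]] := Hc_D a d d' h i d'0 dd H.
  by have [_ ->] := D x xd'; exact: Bg.
apply: le_trans (ler_norm_sum _ _ _) _.
apply: (@le_trans _ _ (\sum_(i < n) `|v| * (n.+1%:R * M / r))).
  by apply: ler_sum => i _; rewrite normrM; apply: ler_pM => //; exact: coord_le_norm.
rewrite sumr_const card_ord -[X in X <= _]mulr_natr -subr_ge0.
have -> : (n%:R * n.+1%:R + 1) * `|v| * M / r - `|v| * (n.+1%:R * M / r) * n%:R = `|v| * M / r.
  by field; exact: lt0r_neq0.
by rewrite divr_ge0 ?mulr_ge0 // ltW.
Qed.

Definition Dw (w : seq E) h : E -> R := foldr (fun v u => fun y => 'D_v u y) h w.

Lemma Hc_Dw a (d d' : R) h w : d' < d -> Hc a d h -> Hc a d' (Dw w h).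
Proof.
move=> dd H; elim: w d' dd => [|v w IH] d' dd /=; first by apply: Hc_sub H; exact: ltW.
have [d1 A B] := mid_lt _ _ dd; exact: Hc_DV A (IH _ B).
Qed.

(** The gradient estimate is iterated, each derivative giving up a width [r] of the ball. The factor
    [n (n+1) + 1] belongs to one derivative along an arbitrary vector; its [+ 1] keeps it positive
    in dimension 0. *)
Lemma Hc_Dw_bound a (d M r V : R) h w x : Hc a d h -> 0 < M ->
  (forall x, `|x - a| < d -> `|h x| <= M) -> 0 < r -> 0 < V ->
  (forall v, v \in w -> `|v| <= V) -> `|x - a| + (size w)%:R * r < d ->
  `|Dw w h x| <= M * ((n%:R * n.+1%:R + 1) * V / r) ^+ size w.
Proof.
move=> H M0 hM r0 V0; set A := _ + 1; have A0 : 0 < A by rewrite ltr_wpDl // mulr_ge0.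
elim: w x => [|v w IH] x /= HV xd.
  by rewrite expr0 mulr1 hM //; rewrite mul0r addr0 in xd.
have xd1 : `|x - a| + r < d - (size w)%:R * r.
  by move: xd; rewrite -natr1 mulrDl mul1r; clear; lra.
have [d1 xd1' d1d] := mid_lt _ _ xd1.
have d1d' : d1 < d by apply: lt_le_trans d1d _; rewrite gerBl mulr_ge0 // ltW.
have := Hc_DV_bound a d1 (M * (A * V / r) ^+ size w) r (Dw w h) v x (Hc_Dw _ _ _ _ w d1d' H).
have AV : 0 < A * V / r by rewrite divr_gt0 // mulr_gt0.
rewrite -/A => K; apply: le_trans (K _ _ _ _) _ => //.
- by rewrite mulr_gt0 // exprn_gt0.
- move=> y yd; apply: IH; first by move=> u uw; apply: HV; rewrite inE uw orbT.
  by rewrite -ltrBrDr; apply: lt_trans d1d.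
- have := HV v (mem_head _ _) => vV; rewrite exprS.
  move: (exprn_ge0 (size w) (ltW AV)); move: (_ ^+ size w) => Q Q0.
  have -> : A * `|v| * (M * Q) / r = (A * M * Q / r) * `|v| by ring.
  have -> : M * (A * V / r * Q) = (A * M * Q / r) * V by ring.
  by apply: ler_wpM2l => //; rewrite divr_ge0 ?mulr_ge0 // ltW.
Qed.

End harmonic.

(** * Factorial bounds and power series *)

Lemma ffact_ge (n k : nat) : (n.+1 ^ k <= (n + k) ^_ k)%N.
Proof.
elim: k => [|k IH]; first by rewrite ffactn0.
by rewrite addnS ffactSS expnS leq_mul // ltnS leq_addr.
Qed.

Lemma bin_2k_le (k : nat) : ('C(k + k, k) <= 4 ^ k)%N.
Proof.
have -> : (4 ^ k)%N = ((1 + 1) ^ (k + k))%N by rewrite [(k + k)%N]addnn -mul2n expnM.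
rewrite expnDn.
have kk : (k < (k + k).+1)%N by rewrite ltnS leq_addr.
rewrite (bigD1 (Ordinal kk)) //= !exp1n !muln1; exact: leq_addr.
Qed.

(** A crude Stirling bound: [(k+1)^k] is at most [(2k)! / k!], which is a central binomial
    coefficient times [k!]. *)
Lemma pow_le_fact (k : nat) : (k.+1 ^ k <= 4 ^ k * k`!)%N.
Proof.
apply: leq_trans (ffact_ge k k) _; rewrite -bin_ffact leq_mul2r bin_2k_le orbT //.
Qed.

Section analytic.
Context {R : realType} {n : nat}.
Local Notation E := 'rV[R]_n.
Local Notation "''e_' i" := (delta_mx 0 i : 'rV[R]_n) (at level 8, i at level 2).
Implicit Types (g f h : E -> R) (x y z a : E).

(** Words of arbitrary vectors, not only of basis vectors, make the factorial bounds stable under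
    linear substitution, and slices and reflections are linear. The first clause makes each further
    derivative linear in its direction. *)
Definition ana a (d M C : R) g := [/\ 0 < d, 0 < M, 0 < C &
  forall x, `|x - a| < d -> forall w : seq E,
    (forall v, is_derive x v (Dw w g) (\sum_i v ord0 i * 'D_('e_i) (Dw w g) x)) /\
    forall V : R, 0 < V -> (forall v, v \in w -> `|v| <= V) ->
      `|Dw w g x| <= M * (C * V) ^+ size w * (size w)`!%:R].

Lemma ana_weaken a (d M C d' M' C' : R) g : 0 < d' -> d' <= d -> M <= M' -> C <= C' ->
  ana a d M C g -> ana a d' M' C' g.
Proof.
move=> d'0 dd MM CC [d0 M0 C0 H]; split => //; [exact: lt_le_trans MM|exact: lt_le_trans CC|].
move=> x xd w; have [A B] := H x (lt_le_trans xd dd) w; split => // V V0 HV.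
apply: le_trans (B V V0 HV) _; apply: ler_wpM2r => //.
apply: ler_pM => //; first exact: ltW.
  by rewrite exprn_ge0 // mulr_ge0 // ltW.
apply: lerXn2r; rewrite ?nnegrE ?mulr_ge0 //; try exact: ltW.
  by apply: ltW; apply: lt_le_trans CC.
by apply: ler_wpM2r => //; exact: ltW.
Qed.

Lemma Hc_ana a (d M : R) h : 0 < d -> 0 < M -> Hc a d h ->
  (forall x, `|x - a| < d -> `|h x| <= M) ->
  ana a (d / 2) M (4 * ((n%:R * n.+1%:R + 1) * 2 / d)) h.
Proof.
move=> d0 M0 H hM; set A := _ + 1; have A0 : 0 < A by rewrite ltr_wpDl // mulr_ge0.
split => //; [exact: divr_gt0|by rewrite mulr_gt0 // divr_gt0 // mulr_gt0|].
move=> x xd w; have dd : d / 2 < d by lra.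
have [d1 xd1 d1d] := mid_lt _ _ xd; split.
  move=> v; have Hw := Hc_Dw a d (d / 2) h w dd H.
  exact: Hc_deriveV Hw xd.
(* The [k] derivatives use up a width [k r], at most [d / 2]. The resulting factor [(k+1)^k] is
   absorbed into [4^k k!] by [pow_le_fact]. *)
move=> V V0 HV; set k := size w; pose r := d / (2 * k.+1%:R).
have k0 : 0 < k.+1%:R :> R by [].
have r0 : 0 < r by rewrite divr_gt0 // mulr_gt0.
have := Hc_Dw_bound a d M r V h w x H M0 hM r0 V0 HV.
rewrite -/A -/k => K; apply: le_trans (K _) _.
  have : k%:R * r <= d / 2.
    have -> : k%:R * r = d / 2 * (k%:R / k.+1%:R).
      by rewrite /r; field; rewrite !lt0r_neq0.
    by rewrite ger_pMr ?divr_gt0 // ler_pdivrMr // mul1r ler_nat.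
  by move: xd; clear; lra.
rewrite -[X in _ <= X]mulrA; apply: ler_wpM2l; first exact: ltW.
have -> : A * V / r = (A * 2 / d * V) * k.+1%:R.
  by rewrite /r; field; rewrite !lt0r_neq0 //.
have -> : 4 * (A * 2 / d) * V = (A * 2 / d * V) * 4 by ring.
rewrite !exprMn -!mulrA; do !(apply: ler_wpM2l; first by rewrite ?exprn_ge0 ?invr_ge0 // ltW).
by rewrite -!natrX -natrM ler_nat pow_le_fact.
Qed.

Lemma Dw_lin a (d M C M' C' : R) f g (c c' : R) w x : ana a d M C f -> ana a d M' C' g ->
  `|x - a| < d -> Dw w (fun y => c * f y + c' * g y) x = c * Dw w f x + c' * Dw w g x.
Proof.
move=> [_ _ _ Hf] [_ _ _ Hg]; elim: w x => [|v w IH] x xd //=.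
rewrite (derive_ext _ _ _ x v (nball_open a d) IH xd).
have [A _] := Hf x xd w; have [B _] := Hg x xd w.
have [_ ->] := is_deriveD_fun _ _ _ _ _ _ (is_deriveZ_fun _ c _ _ _ (A v)) (is_deriveZ_fun _ c' _ _ _ (B v)).
by have [_ ->] := A v; have [_ ->] := B v.
Qed.

Lemma ana_lin a (d M C : R) f g (c c' : R) : ana a d M C f -> ana a d M C g ->
  ana a d ((`|c| + `|c'| + 1) * M) C (fun y => c * f y + c' * g y).
Proof.
move=> Hf Hg; have [d0 M0 C0 Kf] := Hf; have [_ _ _ Kg] := Hg; split => //.
  by rewrite mulr_gt0 // ltr_wpDl // addr_ge0.
move=> x xd w; have [A1 A2] := Kf x xd w; have [B1 B2] := Kg x xd w; split.
  have K v := is_deriveD_fun _ _ _ _ _ _ (is_deriveZ_fun _ c _ _ _ (A1 v)) (is_deriveZ_fun _ c' _ _ _ (B1 v)).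
  have K' v := is_derive_ext _ _ (Dw w (fun y => c * f y + c' * g y)) x v _ (nball_open a d)
    (fun y yd => esym (Dw_lin a d M C M C f g c c' w y Hf Hg yd)) xd (K v).
  move=> v; apply: is_derive_eq (K' v) _; rewrite !mulr_sumr -big_split /=.
  apply: eq_bigr => i _; have [_ ->] := K' 'e_i; have [_ E1] := A1 'e_i; have [_ E2] := B1 'e_i.
  by rewrite -E1 -E2; ring.
move=> V V0 HV; rewrite (Dw_lin a d M C M C) //.
have A := A2 V V0 HV; have B := B2 V V0 HV.
apply: le_trans (ler_normD _ _) _; rewrite !normrM -2!mulrA.
rewrite -mulrA in A; rewrite -mulrA in B.
apply: (@le_trans _ _ ((`|c| + `|c'|) * (M * ((C * V) ^+ size w * (size w)`!%:R)))).
  by rewrite mulrDl; apply: lerD; apply: ler_wpM2l.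
apply: ler_wpM2r; last by rewrite lerDl.
by rewrite mulr_ge0 // ?mulr_ge0 ?exprn_ge0 ?mulr_ge0 // ltW.
Qed.

End analytic.

Section analytic_comp.
Context {R : realType} {n m : nat}.

Lemma Dw_comp (B : 'M[R]_(m, n)) (g : 'rV[R]_n -> R) (w : seq 'rV[R]_m) :
  Dw w (fun y => g (y *m B)) = fun y => Dw [seq v *m B | v <- w] g (y *m B).
Proof.
elim: w => [|v w IH] //=; rewrite IH; apply/funext => y.
rewrite /derive; set u := Dw _ g.
suff -> : (fun h : R => h^-1 *: (((fun y0 : 'rV[R]_m => u (y0 *m B)) \o shift y) (h *: v)
    - u (y *m B))) = (fun h => h^-1 *: ((u \o shift (y *m B)) (h *: (v *m B)) - u (y *m B))) by [].
by apply/funext => t; rewrite /= mulmxDl -scalemxAl.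
Qed.

Lemma mulmx_norm_le (B : 'M[R]_(m, n)) :
  exists2 c : R, 0 < c & forall v : 'rV[R]_m, `|v *m B| <= c * `|v|.
Proof.
exists (\sum_i \sum_j `|B i j| + 1).
  by rewrite ltr_wpDl // sumr_ge0 // => i _; rewrite sumr_ge0.
move=> v; apply: rV_norm_le.
  by rewrite mulr_ge0 // addr_ge0 // sumr_ge0 // => i _; rewrite sumr_ge0.
move=> j; rewrite mxE; apply: le_trans (ler_norm_sum _ _ _) _.
rewrite mulrDl mul1r mulr_suml; apply: ler_wpDr => //.
apply: ler_sum => i _; rewrite normrM mulrC; apply: ler_pM => //; last exact: coord_le_norm.
by rewrite (bigD1 j) //= lerDl sumr_ge0.
Qed.

(** A derivative of [y |-> g (y B)] along [v] is a derivative of [g] along [v B], so only the length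
    of the vectors changes, by a constant factor depending on [B]. *)
Lemma ana_comp (B : 'M[R]_(m, n)) (g : 'rV[R]_n -> R) (a : 'rV[R]_m) (d M C : R) :
  ana (a *m B) d M C g ->
  exists d' C', ana a d' M C' (fun y => g (y *m B)).
Proof.
move=> [d0 M0 C0 H]; have [c c0 Hc] := mulmx_norm_le B.
exists (d / c), (C * c); split => //; [exact: divr_gt0|exact: mulr_gt0|].
move=> x xd w.
have xd' : `|x *m B - a *m B| < d.
  rewrite -mulmxBl; apply: le_lt_trans (Hc _) _.
  by rewrite mulrC -ltr_pdivlMr.
have [A1 A2] := H _ xd' [seq v *m B | v <- w]; rewrite Dw_comp; split.
  have K v : is_derive x v (fun y => Dw [seq v *m B | v <- w] g (y *m B))
     (\sum_j (v *m B) ord0 j * 'D_(delta_mx 0 j) (Dw [seq v *m B | v <- w] g) (x *m B)).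
    apply/is_derive_eps => e e0; have /is_derive_eps /(_ e e0) [r r0 Hr] := A1 (v *m B).
    by exists r => // t tr; rewrite mulmxDl -scalemxAl; exact: Hr.
  move=> v; apply: is_derive_eq (K v) _.
  transitivity (\sum_(i < m) v ord0 i * \sum_(j < n) ((delta_mx 0 i : 'rV[R]_m) *m B) ord0 j *
       'D_(delta_mx 0 j : 'rV[R]_n) (Dw [seq v *m B | v <- w] g) (x *m B)); last first.
    by apply: eq_bigr => i _; congr (_ * _); have [_ ->] := K (delta_mx 0 i).
  under [RHS]eq_bigr do rewrite mulr_sumr.
  rewrite [RHS]exchange_big /=; apply: eq_bigr => j _; rewrite mxE mulr_suml.
  apply: eq_bigr => i _; rewrite mulrA; congr (_ * _ * _).
  by rewrite -rowE mxE.
move=> V V0 HV; have := A2 (c * V) (mulr_gt0 c0 V0); rewrite size_map mulrA; apply.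
move=> _ /mapP[v vw ->]; apply: le_trans (Hc v) _.
by apply: ler_wpM2l; [exact: ltW|exact: HV].
Qed.

End analytic_comp.

Lemma scaleRE (R : realType) (x y : R) : x *: y = x * y.
Proof. by []. Qed.

(** * Taylor expansion indexed by words *)

Section power_series.
Context {R : realType} {n : nat}.
Local Notation E := 'rV[R]_n.
Local Notation "''e_' i" := (delta_mx 0 i : 'rV[R]_n) (at level 8, i at level 2).
Implicit Types (g f : E -> R) (x y z a h : E).

(** Words expand powers of a directional derivative without multinomial coefficients; they are
    collected by multi-index only in [regroup]. *)
Fixpoint words (j : nat) : seq (seq 'I_n) :=
  if j is j'.+1 then [seq i :: w | i <- enum 'I_n, w <- words j'] else [:: [::]].

Lemma size_words j w : w \in words j -> size w = j.
Proof.
elim: j w => [|j IH] w /=; first by rewrite inE => /eqP ->.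
by move=> /allpairsP[[i u] /= [_ /IH <- ->]].
Qed.

Lemma sum_words (W : nmodType) j (F : seq 'I_n -> W) :
  \sum_(w <- words j.+1) F w = \sum_(i < n) \sum_(w <- words j) F (i :: w).
Proof. by rewrite /= big_allpairs_dep /= big_enum. Qed.

Definition hw h (w : seq 'I_n) : R := \prod_(i <- w) h ord0 i.
Definition ew (w : seq 'I_n) : seq E := [seq 'e_i | i <- w].

Lemma is_derive_sum_fun (I : Type) (r : seq I) (F : I -> E -> R) (dF : I -> R) x v :
  (forall i, is_derive x v (F i) (dF i)) ->
  is_derive x v (fun y => \sum_(i <- r) F i y) (\sum_(i <- r) dF i).
Proof.
move=> H; elim: r => [|i r IH].
  rewrite big_nil; under eq_fun do rewrite big_nil; exact: is_derive_cst.
by rewrite big_cons; under eq_fun do rewrite big_cons; exact: is_deriveD_fun.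
Qed.

Lemma words_power a (d M C : R) g h j x : ana a d M C g -> `|x - a| < d ->
  Dw (nseq j h) g x = \sum_(w <- words j) hw h w * Dw (ew w) g x.
Proof.
move=> Hg; have [d0 _ _ H] := Hg; elim: j x => [|j IH] x xd.
  by rewrite /= big_seq1 /hw big_nil mul1r.
rewrite sum_words /= (derive_ext _ _ _ x h (nball_open a d) IH xd).
have [_ ->] := is_derive_sum_fun _ (words j) (fun w y => hw h w * Dw (ew w) g y) _ x h
  (fun w => is_deriveZ_fun _ _ _ _ _ ((H x xd (ew w)).1 h)).
rewrite exchange_big /=; apply: eq_bigr => w _; rewrite mulr_sumr; apply: eq_bigr => i _.
by rewrite /hw big_cons; ring.
Qed.

(** The Taylor polynomial at the moving point [a + t h], evaluated at [a + h]. It passes from the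
    expansion at [a], for [t = 0], to [g (a + h)], for [t = 1], and its derivative in [t] telescopes
    to one term. *)
Definition tay g a h k (t : R) : R :=
  \sum_(j < k) Dw (nseq j h) g (a + t *: h) * ((1 - t) ^+ j / j`!%:R).

Lemma tay_derive a (d M C : R) g h k (t : R) : ana a d M C g -> `|t *: h| < d ->
  is_derive t 1 (tay g a h k.+1) (Dw (nseq k.+1 h) g (a + t *: h) * ((1 - t) ^+ k / k`!%:R)).
Proof.
move=> [_ _ _ H] td; have xd : `|a + t *: h - a| < d by rewrite addrC addKr.
have du j : is_derive t 1 (fun s : R => Dw (nseq j h) g (a + s *: h))
    (Dw (nseq j.+1 h) g (a + t *: h)).
  have [K _] := H _ xd (nseq j h).
  have K' : is_derive (a + t *: h) h (Dw (nseq j h) g) (Dw (nseq j.+1 h) g (a + t *: h)).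
    by apply: derivableP; case: (K h).
  exact: (proj1 (is_derive_line (Dw (nseq j h) g) a h t _) K').
have d1 : is_derive t 1 (fun s : R => 1 - s) (- 1).
  have := is_deriveB (is_derive_cst (1 : R) t 1) (is_derive_id t (1 : R)).
  by rewrite sub0r.
elim: k => [|k IH].
  rewrite /tay; under eq_fun do rewrite big_ord1 expr0 fact0 divr1 mulr1.
  by rewrite expr0 fact0 divr1 mulr1; exact: du.
have d2 : is_derive t 1 (fun s : R => (1 - s) ^+ k.+1) (k.+1%:R * (1 - t) ^+ k * -1).
  have -> : (fun s : R => (1 - s) ^+ k.+1) = (fun s : R => 1 - s) ^+ k.+1.
    by apply/funext => s; rewrite fctE.
  exact: (is_deriveX k.+1 d1).
have d3 := is_deriveM (du k.+1) (is_deriveM d2 (is_derive_cst (((k.+1)`!%:R)^-1 : R) t 1)).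
have d4 := is_deriveD IH d3.
have -> : tay g a h k.+2 = tay g a h k.+1 + (fun s : R => Dw (nseq k.+1 h) g (a + s *: h)) *
   ((fun s : R => (1 - s) ^+ k.+1) * cst (((k.+1)`!%:R)^-1)).
  by apply/funext => s; rewrite /tay big_ord_recr.
apply: is_derive_eq d4 _; rewrite !scaleRE mulr0 add0r factS natrM.
have k1 : (k.+1%:R : R) != 0 by rewrite pnatr_eq0.
have f1 : (k`!%:R : R) != 0 by rewrite pnatr_eq0 -lt0n fact_gt0.
have -> : ((fun s : R => (1 - s) ^+ k.+1) * cst (k.+1%:R * k`!%:R)^-1) t =
  (1 - t) ^+ k.+1 * (k.+1%:R * k`!%:R)^-1 by [].
rewrite /cst exprS; move: (Dw (nseq k.+1 h) g _) (Dw (nseq k.+2 h) g _) ((1 - t) ^+ k) => u w P.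
move: k1 f1; move: (k.+1%:R) (k`!%:R) => K F k1 f1; by field; rewrite f1 k1.
Qed.

(** The mean value theorem in [t] leaves [M (C rho)^(k+1) (k+1)], and
    [4^-(k+1) (k+1) <= 2^-(k+1)]. *)
Lemma tay_bound a (d M C rho : R) g h k : ana a d M C g -> `|h| <= rho -> 0 < rho ->
  rho < d -> C * rho <= 4^-1 ->
  `|g (a + h) - \sum_(j < k.+1) Dw (nseq j h) g a / j`!%:R| <= M * 2 ^- k.+1.
Proof.
move=> Hg hr r0 rd Cr; have [d0 M0 C0 H] := Hg.
have td (t : R) : 0 <= t <= 1 -> `|t *: h| < d.
  move=> /andP[t0 t1]; rewrite normrZ ger0_norm //; apply: le_lt_trans rd.
  by apply: le_trans hr; rewrite -[X in _ <= X]mul1r ler_wpM2r.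
have [|t] := MVT2 (tay g a h k.+1) (fun t => Dw (nseq k.+1 h) g (a + t *: h) *
   ((1 - t) ^+ k / k`!%:R)) 0 1.
  by rewrite min_l // max_r // => t /td; exact: tay_derive Hg.
rewrite min_l // max_r // subr0 mulr1 => t01 Et.
have -> : g (a + h) = tay g a h k.+1 1.
  rewrite /tay big_ord_recl /= big1 ?addr0 ?expr0 ?fact0 ?divr1 ?mulr1 ?scale1r //.
  by move=> i _; rewrite subrr /bump /= add1n expr0n /= mul0r mulr0.
have -> : \sum_(j < k.+1) Dw (nseq j h) g a / j`!%:R = tay g a h k.+1 0.
  by apply: eq_bigr => j _; rewrite scale0r addr0 subr0 expr1n mul1r.
rewrite Et; have /andP[t0 t1] := t01.
have xd : `|a + t *: h - a| < d by rewrite addrC addKr; exact: td.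
have [_ /(_ rho r0)] := H _ xd (nseq k.+1 h); rewrite size_nseq => K.
rewrite normrM; apply: (@le_trans _ _ (M * (C * rho) ^+ k.+1 * (k.+1)`!%:R * (k`!%:R)^-1)).
  apply: ler_pM => //; first by apply: K => v; rewrite mem_nseq => /andP[_ /eqP ->].
  rewrite normrM normfV [X in _ / X]ger0_norm // -[X in _ <= X]mul1r ler_wpM2r //.
  rewrite ger0_norm ?exprn_ge0 ?subr_ge0 // exprn_ile1 ?subr_ge0 //; lra.
have f0 : (k`!%:R : R) != 0 by rewrite pnatr_eq0 -lt0n fact_gt0.
rewrite factS natrM mulrA mulfK // -mulrA; apply: ler_wpM2l; first exact: ltW.
apply: (@le_trans _ _ (4^-1 ^+ k.+1 * k.+1%:R)).
  apply: ler_wpM2r => //; apply: lerXn2r; rewrite ?nnegrE ?invr_ge0 //.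
  by rewrite mulr_ge0 // ltW.
have -> : 4^-1 = 2^-1 * 2^-1 :> R by rewrite -invfM -natrM.
rewrite exprMn -!exprVn -mulrA -[X in _ <= X]mulr1; apply: ler_wpM2l.
  by rewrite exprn_ge0 // invr_ge0.
rewrite mulrC exprVn ler_pdivrMr ?exprn_gt0 // mul1r -natrX ler_nat ltnW //.
exact: ltn_expl.
Qed.

Definition deg (b : {ffun 'I_n -> nat}) : nat := \sum_i b i.
Definition cont (w : seq 'I_n) : {ffun 'I_n -> nat} := [ffun i => count_mem i w].

Lemma deg_cont w : deg (cont w) = size w.
Proof.
rewrite /deg; under eq_bigr do rewrite ffunE.
elim: w => [|i w IH] /=; first by rewrite big1.
rewrite big_split /= IH (bigD1 i) //= eqxx big1 // => j ji.
by rewrite eq_sym (negbTE ji).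
Qed.

Lemma mono_cont a x w : mono a x (cont w) = hw (x - a) w.
Proof.
transitivity (\prod_j (x ord0 j - a ord0 j) ^+ count_mem j w).
  by apply: eq_bigr => j _; rewrite ffunE.
rewrite /hw; elim: w => [|i w IH] /=; first by rewrite big_nil big1.
rewrite big_cons -IH (eq_bigr (fun j : 'I_n => (x ord0 j - a ord0 j) ^+ (i == j)
    * (x ord0 j - a ord0 j) ^+ count_mem j w)); last by move=> j _; rewrite exprD.
rewrite big_split /=; congr (_ * _); rewrite (bigD1 i) //= eqxx expr1 big1 ?mulr1 ?mxE //.
by move=> j ji; rewrite eq_sym (negbTE ji).
Qed.

Definition nat_ffun k (al : {ffun 'I_n -> 'I_k.+1}) : {ffun 'I_n -> nat} :=
  [ffun i => nat_of_ord (al i)].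

(** A word of length at most [k] has a single content, whose entries are at most [k]; so the words
    are partitioned by the multi-indices of degree at most [k]. *)
Lemma regroup (W : nmodType) k (G : seq 'I_n -> W) :
  \sum_(al : {ffun 'I_n -> 'I_k.+1} | (\sum_i nat_of_ord (al i) <= k)%N)
     \sum_(w <- words (deg (nat_ffun k al)) | cont w == nat_ffun k al) G w
  = \sum_(j < k.+1) \sum_(w <- words j) G w.
Proof.
pose p (w : seq 'I_n) : {ffun 'I_n -> 'I_k.+1} := [ffun i => inord (count_mem i w)].
have dn (al : {ffun 'I_n -> 'I_k.+1}) : (\sum_i nat_of_ord (al i))%N = deg (nat_ffun k al).
  by apply: eq_bigr => i _; rewrite ffunE.
have pE w al : (size w <= k)%N -> (p w == al) = (cont w == nat_ffun k al).
  move=> wk; apply/eqP/eqP => [<-|E1].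
    apply/ffunP => i; rewrite !ffunE inordK // ltnS; apply: leq_trans wk; exact: count_size.
  apply/ffunP => i; rewrite ffunE; apply: val_inj; move/ffunP: E1 => /(_ i).
  by rewrite !ffunE => E1; rewrite /= inordK E1 //.
transitivity (\sum_(j < k.+1) \sum_(al : {ffun 'I_n -> 'I_k.+1})
    \sum_(w <- words j | p w == al) G w); last first.
  apply: eq_bigr => j _; symmetry; exact: partition_big.
rewrite exchange_big /= big_mkcond /=; apply: eq_bigr => al _; rewrite dn.
have zero (j : 'I_k.+1) : nat_of_ord j != deg (nat_ffun k al) ->
    \sum_(w <- words j | p w == al) G w = 0.
  move=> jd; rewrite big_seq_cond big1 // => w /andP[wj].
  rewrite pE; last by rewrite (size_words _ _ wj) -ltnS.
  by move=> /eqP E1; move: jd; rewrite -E1 deg_cont (size_words _ _ wj) eqxx.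
case: ifP => dk.
  have dk' : (deg (nat_ffun k al) < k.+1)%N by [].
  rewrite [RHS](bigD1 (Ordinal dk')) //= [X in _ + X]big1 ?addr0; last first.
    by move=> j jd; apply: zero.
  rewrite big_seq_cond [RHS]big_seq_cond; apply: eq_bigl => w.
  case wj : (w \in _) => //=; rewrite pE // (size_words _ _ wj) //.
rewrite big1 // => j _; apply: zero; apply/eqP => jd.
by have := ltn_ord j; rewrite jd ltnS dk.
Qed.

Lemma hw_bound h (rho : R) w : `|h| <= rho -> `|hw h w| <= rho ^+ size w.
Proof.
move=> hr; rewrite /hw; elim: w => [|i w IH] /=; first by rewrite big_nil normr1 expr0.
rewrite big_cons normrM exprS; apply: ler_pM => //.
by apply: le_trans hr; exact: coord_le_norm.
Qed.

Lemma size_words_n j : size (words j) = (n ^ j)%N.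
Proof.
by elim: j => [|j IH] //=; rewrite size_allpairs size_enum_ord IH expnS.
Qed.

Lemma geo_half k : \sum_(j < k) (2^-1 : R) ^+ j <= 2.
Proof.
suff : \sum_(j < k) (2^-1 : R) ^+ j = 2 - 2 * 2^-1 ^+ k.
  by move=> ->; rewrite gerBl mulr_ge0 // exprn_ge0 // invr_ge0.
elim: k => [|k IH]; first by rewrite big_ord0 expr0 mulr1 subrr.
by rewrite big_ord_recr /= IH exprS; lra.
Qed.

Lemma ana_analytic m (g : E -> 'rV[R]_m) a (d M C : R) :
  (forall l, ana a d M C (fun y => g y ord0 l)) -> 0 < d -> 0 < M -> 0 < C ->
  exists r : R, 0 < r /\ exists c : {ffun 'I_n -> nat} -> 'rV[R]_m,
    forall x, `|x - a| < r ->
      (exists M : R, forall k, apsum c a x k <= M) /\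
      ((fun k => psum c a x k) @ \oo --> g x).
Proof.
move=> Hg d0 M0 C0.
(* The factor [n.+1] pays for the [n^j] words of length [j] in the absolute sums, the factor [4] for
   the remainder in [tay_bound]. *)
pose rho := Num.min (d / 2) (4 * n.+1%:R * C)^-1.
have nC : 0 < 4 * n.+1%:R * C by rewrite !mulr_gt0.
have rho0 : 0 < rho by rewrite lt_min divr_gt0 // invr_gt0.
have rhod : rho < d.
  by apply: (@le_lt_trans _ _ (d / 2)); [rewrite ge_min lexx|lra].
have rhoC : n.+1%:R * (C * rho) <= 4^-1.
  have : rho <= (4 * n.+1%:R * C)^-1 by rewrite ge_min lexx orbT.
  rewrite -(ler_pM2l nC) mulfV ?lt0r_neq0 // -!mulrA.
  by rewrite -ler_pdivlMl // mulr1.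
have Crho0 : 0 <= C * rho by rewrite mulr_ge0 // ltW.
have rhoC1 : C * rho <= 4^-1.
  by apply: le_trans rhoC; rewrite -[X in X <= _]mul1r ler_wpM2r // ler1n.
exists rho; split => //.
(* The usual coefficient [D^b g / b!]: there are [|b|! / b!] words of content [b], each contributing
   the same derivative divided by [|b|!]. *)
pose c (b : {ffun 'I_n -> nat}) : 'rV[R]_m := \row_l
  \sum_(w <- words (deg b) | cont w == b) Dw (ew w) (fun y => g y ord0 l) a / (deg b)`!%:R.
exists c => x xr; have aa : `|a - a| < d by rewrite subrr normr0.
have wb w l : `|Dw (ew w) (fun y => g y ord0 l) a| <= M * C ^+ size w * (size w)`!%:R.
  have [_ _ _ /(_ a aa (ew w)) [_ /(_ 1 ltr01)]] := Hg l; rewrite mulr1 size_map; apply.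
  by move=> v /mapP[i _ ->]; rewrite -[delta_mx 0 i]scale1r norm_delta normr1.
split.
  exists (M * 2) => k; rewrite /apsum.
  apply: (@le_trans _ _ (\sum_(al : {ffun 'I_n -> 'I_k.+1} | (\sum_i nat_of_ord (al i) <= k)%N)
     \sum_(w <- words (deg (nat_ffun k al)) | cont w == nat_ffun k al) M * (C * rho) ^+ size w)).
    apply: ler_sum => al _; rewrite -/(nat_ffun k al).
    have HH : `|c (nat_ffun k al)| <= \sum_(w <- words (deg (nat_ffun k al)) |
        cont w == nat_ffun k al) M * C ^+ size w -> `|mono a x (nat_ffun k al)| *
        `|c (nat_ffun k al)| <= \sum_(w <- words (deg (nat_ffun k al)) | cont w == nat_ffun k al)
           M * (C * rho) ^+ size w.
      move=> Hc; apply: le_trans (ler_wpM2l (normr_ge0 _) Hc) _.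
      rewrite mulr_sumr; apply: ler_sum => w /eqP wE.
      rewrite -wE mono_cont mulrC exprMn mulrA; apply: ler_wpM2l.
        by rewrite mulr_ge0 ?exprn_ge0 // ltW.
      by apply: hw_bound; exact: ltW.
    apply: HH; apply: rV_norm_le.
      by apply: sumr_ge0 => w _; rewrite mulr_ge0 ?exprn_ge0 // ltW.
    move=> l; rewrite mxE; apply: le_trans (ler_norm_sum _ _ _) _.
    apply: ler_sum => w /eqP wE; rewrite -wE deg_cont normrM normfV [X in _ / X]ger0_norm //.
    by rewrite ler_pdivrMr ?ltr0n ?fact_gt0.
  rewrite regroup.
  apply: (@le_trans _ _ (\sum_(j < k.+1) M * 2^-1 ^+ j)); last first.
    by rewrite -mulr_sumr; apply: ler_wpM2l; [exact: ltW|exact: geo_half].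
  apply: ler_sum => j _.
  rewrite big_seq (eq_bigr (fun _ => M * (C * rho) ^+ j)); last first.
    by move=> w /size_words ->.
  rewrite -big_seq big_const_seq count_predT size_words_n iter_addr_0 -[X in X <= _]mulr_natr.
  rewrite natrX -[M * _ * _]mulrA -exprMn; apply: ler_wpM2l; first exact: ltW.
  rewrite [_ * n%:R]mulrC.
  apply: lerXn2r; rewrite ?nnegrE ?invr_ge0 ?mulr_ge0 //; try exact: ltW.
  apply: (@le_trans _ _ 4^-1); last by rewrite lef_pV2 ?posrE // ler_nat.
  by apply: le_trans rhoC; rewrite ler_wpM2r // ler_nat.
have pE k l : psum c a x k ord0 l =
    \sum_(j < k.+1) Dw (nseq j (x - a)) (fun y => g y ord0 l) a / j`!%:R.
  rewrite /psum summxE.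
  transitivity (\sum_(al : {ffun 'I_n -> 'I_k.+1} | (\sum_i nat_of_ord (al i) <= k)%N)
     \sum_(w <- words (deg (nat_ffun k al)) | cont w == nat_ffun k al)
       hw (x - a) w * Dw (ew w) (fun y => g y ord0 l) a / (size w)`!%:R).
    apply: eq_bigr => al _; rewrite -/(nat_ffun k al) mxE mxE mulr_sumr.
    by apply: eq_bigr => w /eqP wE; rewrite -wE mono_cont deg_cont mulrA.
  rewrite regroup; apply: eq_bigr => j _.
  rewrite (words_power a d M C _ (x - a) j a (Hg l) aa) mulr_suml big_seq [RHS]big_seq.
  by apply: eq_bigr => w /size_words ->.
apply/cvgrPdist_le => e e0.
exists (Num.Def.archi_bound (M / e)) => // k /= kN; rewrite distrC.
apply: rV_norm_le; first exact: ltW.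
move=> l; rewrite mxE mxE pE distrC.
have := tay_bound a d M C rho _ (x - a) k (Hg l) (ltW xr) rho0 rhod rhoC1.
rewrite [a + _]addrC subrK => /le_trans; apply.
rewrite ler_pdivrMr ?exprn_gt0 // mulrC -ler_pdivrMr //.
by apply: ltW; apply: upper_nthrootP; apply: leq_trans kN _.
Qed.

End power_series.

(** * Solutions of Dirac equations *)

Section acoord.
Context {R : realType} {A : falgType R}.
Local Notation m := (\dim (fullv : {vspace A})).

Lemma acoordK (a : A) : afromc (acoord a) = a.
Proof.
rewrite /afromc [RHS](coord_vbasis (memvf a)); apply: eq_bigr => i _.
by rewrite mxE.
Qed.

Lemma afromcK (r : 'rV[R]_m) : acoord (afromc r : A) = r.
Proof.
apply/rowP => j; rewrite mxE /afromc coord_sum_free //.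
exact: (basis_free (vbasisP _)).
Qed.

Lemma acoord_inj : injective (@acoord R A).
Proof. by move=> a b E1; rewrite -(acoordK a) E1 acoordK. Qed.

Lemma acoordD (a b : A) : acoord (a + b) = acoord a + acoord b.
Proof. by apply/rowP => j; rewrite !mxE linearD. Qed.

Lemma acoordZ (c : R) (a : A) : acoord (c *: a) = c *: acoord a.
Proof. by apply/rowP => j; rewrite !mxE linearZ. Qed.

Lemma acoord0 : acoord (0 : A) = 0.
Proof. by apply/rowP => j; rewrite !mxE linear0. Qed.

Lemma acoordN (a : A) : acoord (- a) = - acoord a.
Proof. by apply/rowP => j; rewrite !mxE linearN. Qed.

Lemma acoord_sum (I : Type) (r : seq I) (P : pred I) (F : I -> A) :
  acoord (\sum_(i <- r | P i) F i) = \sum_(i <- r | P i) acoord (F i).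
Proof. exact: (big_morph _ acoordD acoord0). Qed.

(** The matrix of left multiplication by [a], which turns equations in [A] into linear relations
    between real coordinates. *)
Definition lm (a : A) (l j : 'I_m) : R := acoord (a * (vbasis (fullv : {vspace A}))`_l) ord0 j.

Lemma acoord_mul (a b : A) j :
  acoord (a * b) ord0 j = \sum_l lm a l j * acoord b ord0 l.
Proof.
rewrite -{1}(acoordK b) /afromc mulr_sumr acoord_sum summxE; apply: eq_bigr => l _.
by rewrite -scalerAr acoordZ mxE mulrC.
Qed.

End acoord.

(** * Extension from a cube to the whole space *)

Section uc.
Context {R : realType} {n : nat}.
Local Notation E := 'rV[R]_n.

Lemma compact_uc (K : set E) (g : E -> R) : compact K ->
  (forall x, K x -> {for x, continuous g}) ->
  forall e : R, 0 < e -> exists2 d : R, 0 < d & forall x y, K x -> `|y - x| < d -> `|g y - g x| <= e.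
Proof.
move=> cK cg e e0.
have e20 : 0 < e / 2 by rewrite divr_gt0.
pose P (d : R) (x : E) : Prop := forall y : E, `|y - x| < d -> `|g y - g x| <= e.
have H x : K x -> \forall x' \near x & d \near (0 : R)^'+, P d x'.
  move=> /cg /cont_eps /(_ _ e20) [d d0 Hd].
  exists ([set y : E | `|y - x| < d / 2], [set t : R | t < d / 2]) => /=.
    split; first by apply: ((near_eps [set y : E | `|y - x| < d / 2] x).2 _); exists (d / 2) => //; rewrite divr_gt0.
    by exists (d / 2); [rewrite /= divr_gt0|move=> t /=; rewrite sub0r normrN => /(le_lt_trans (ler_norm _))].
  move=> [x' t] /= [xx' td] y yx'.
  have A1 := Hd x'; have A2 := Hd y.
  have x'd : `|x' - x| < d by apply: lt_trans xx' _; rewrite ltr_pdivrMr // ltr_pMr // ltr1n.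
  have yd : `|y - x| < d.
    have -> : y - x = (y - x') + (x' - x) by rewrite addrA subrK.
    apply: le_lt_trans (ler_normD _ _) _; rewrite [d]splitr.
    by apply: ltrD => //; apply: lt_trans td.
  move: (A1 x'd) (A2 yd); rewrite !ltr_norml ler_norml; clear.
  by move=> /andP[? ?] /andP[? ?]; apply/andP; split; lra.
have [d /= d0 Hd] := (compact_near_coveringP K).1 cK R _ P _ H.
exists (d / 2); first by rewrite divr_gt0.
move=> x y Kx yx; apply: (Hd (d / 2)) => //; last by rewrite /= divr_gt0.
by rewrite /= sub0r normrN gtr0_norm ?divr_gt0 // ltr_pdivrMr // ltr_pMr // ltr1n.
Qed.

(** The projection onto a cube, 1-Lipschitz for the sup norm. Composition with it turns a function
    continuous on the cube into a [BUC] function. *)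
Definition clamp (a : E) (r : R) (x : E) : E :=
  \row_j Num.min (Num.max (x ord0 j) (a ord0 j - r)) (a ord0 j + r).

Lemma clamp_le a r x : 0 <= r -> `|clamp a r x - a| <= r.
Proof.
move=> r0; apply: rV_norm_le => // j; rewrite !mxE ler_norml.
by case: (leP (x ord0 j) (a ord0 j - r)) => H1; case: (leP _ (a ord0 j + r)) => H2;
  apply/andP; split; lra.
Qed.

Lemma clamp_id a r x : `|x - a| <= r -> clamp a r x = x.
Proof.
move=> xr; apply/rowP => j; have := le_trans (coord_le_norm _ _ _ j) xr.
rewrite !mxE ler_norml => /andP[A B].
by rewrite max_l ?min_l //; lra.
Qed.

Lemma clamp_lip a r x y : 0 <= r -> `|clamp a r x - clamp a r y| <= `|x - y|.
Proof.
move=> r0; apply: rV_norm_le => // j; rewrite !mxE.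
have := coord_le_norm _ _ (x - y) j; rewrite !mxE => H; apply: le_trans H.
move: (x ord0 j) (y ord0 j) (a ord0 j) => u v c.
have H (s : R) : `|Num.max u s - Num.max v s| <= `|u - v|.
  by case: (leP u s) => H1; case: (leP v s) => H2; case: (lerP u v) => H3;
    rewrite ?ler_norml; try (apply/andP; split); lra.
apply: le_trans (H (c - r)); clear H.
move: (Num.max u _) (Num.max v _) (c + r) => u' v' s.
by case: (leP u' s) => H1; case: (leP v' s) => H2; case: (lerP u' v') => H3;
    rewrite ?ler_norml; try (apply/andP; split); lra.
Qed.

Lemma clamp_BUC a (r : R) g : 0 <= r -> (forall x, `|x - a| <= r -> {for x, continuous g}) ->
  BUC (fun x => g (clamp a r x)).
Proof.
move=> r0 cg; pose K := [set x : E | forall j, x ord0 j \in `[a ord0 j - r, a ord0 j + r]].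
have cK : compact K.
  by apply: (@rV_compact _ _ (fun j => `[a ord0 j - r, a ord0 j + r]%classic)) => j;
    exact: segment_compact.
have KE x : K x <-> `|x - a| <= r.
  split=> [Kx|xr j].
    apply: rV_norm_le => // j; have := Kx j; rewrite in_itv /= !mxE ler_norml.
    by move=> /andP[A B]; apply/andP; split; lra.
  have := le_trans (coord_le_norm _ _ _ j) xr; rewrite !mxE ler_norml in_itv /=.
  by move=> /andP[A B]; apply/andP; split; lra.
have cgK x : K x -> {for x, continuous g} by move=> /KE /cg.
split.
  have cw : {within K, continuous (fun x => `|g x|)}.
    apply: continuous_in_subspaceT => x; rewrite inE => /cgK /cont_eps H.
    apply/cont_eps => e e0; have [d d0 Hd] := H e e0; exists d => // y /Hd.
    by apply: le_lt_trans; exact: ler_dist_dist.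
  have K0 : K !=set0 by exists a; apply/KE; rewrite subrr normr0.
  have [c _ Hc] := EVT_max_rV K0 cK cw; exists `|g c| => x.
  by apply: Hc; rewrite inE; apply/KE; exact: clamp_le.
move=> e e0; have [d d0 Hd] := compact_uc K g cK cgK e e0; exists d => // x y xy.
by apply: Hd; [apply/KE; exact: clamp_le|apply: le_lt_trans xy; exact: clamp_lip].
Qed.

End uc.

Section regularity.
Context {R : realType} {A : falgType R} {n : nat}.
Local Notation m := (\dim (fullv : {vspace A})).
Local Notation E := 'rV[R]_n.
Local Notation "''e_' i" := (delta_mx 0 i : 'rV[R]_n) (at level 8, i at level 2).
Variables (w w' : 'I_n -> A).
Hypothesis cliff : forall p i, w' p * w i + w' i * w p = (p == i)%:R *: (2%:R : A).

Definition cf (phi : E -> A) (l : 'I_m) : E -> R := fun y => acoord (phi y) ord0 l.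

(** The [p]-th equation is multiplied by [w' p] and all are added. Symmetry of [H] symmetrizes the
    coefficients, and the Clifford relation keeps the diagonal only. *)
Lemma cliff_laplace (H : 'I_n -> 'I_n -> A) : (forall p i, H p i = H i p) ->
  (forall p, \sum_i w i * H p i = 0) -> \sum_i H i i = 0.
Proof.
move=> sH H0; have E0 : \sum_p \sum_i w' p * w i * H p i = 0.
  rewrite big1 // => p _; under eq_bigr do rewrite -mulrA.
  by rewrite -mulr_sumr H0 mulr0.
have E1 : \sum_p \sum_i w' i * w p * H p i = 0.
  rewrite exchange_big /= -[RHS]E0; apply: eq_bigr => i _; apply: eq_bigr => p _.
  by rewrite sH.
have : \sum_p \sum_i (w' p * w i + w' i * w p) * H p i = 0.
  transitivity (\sum_p \sum_i w' p * w i * H p i + \sum_p \sum_i w' i * w p * H p i).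
    rewrite -big_split /=; apply: eq_bigr => p _.
    by rewrite -big_split /=; apply: eq_bigr => i _; rewrite mulrDl.
  by rewrite E0 E1 addr0.
have -> : \sum_p \sum_i (w' p * w i + w' i * w p) * H p i = 2%:R *: \sum_p H p p.
  rewrite scaler_sumr; apply: eq_bigr => p _.
  rewrite (bigD1 p) //= big1 ?addr0 => [|i ip].
    by rewrite cliff eqxx scale1r mulr_natl scaler_nat.
  by rewrite cliff eq_sym (negbTE ip) scale0r mul0r.
by move/eqP; rewrite scaler_eq0 pnatr_eq0 /= => /eqP.
Qed.

Lemma pd_cf (phi : E -> A) (y : E) (i : 'I_n) l :
  derivable (fun z => acoord (phi z)) y 'e_i ->
  acoord (pd i phi y) ord0 l = 'D_('e_i) (cf phi l) y.
Proof. by move=> H; rewrite /pd afromcK derive_mx // mxE. Qed.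

Lemma diff_cf (phi : E -> A) (y : E) l : differentiable (fun z => acoord (phi z)) y ->
  differentiable (cf phi l) y.
Proof.
move=> H; apply: (@differentiable_comp _ _ _ _ (fun z => acoord (phi z))
  (fun r : 'rV[R]_m => r ord0 l)) => //; exact: differentiable_coord.
Qed.

Lemma differentiable_near (g g' : E -> R) x :
  (exists2 d : R, 0 < d & forall z, `|z - x| < d -> g' z = g z) ->
  differentiable g x -> differentiable g' x.
Proof.
move=> [d d0 Hd] /differentiable_eps[l Hl]; apply/differentiable_eps; exists l => e e0.
have [d' d'0 Hd'] := Hl e e0; exists (Num.min d d'); first by rewrite lt_min d0.
move=> h; rewrite lt_min => /andP[hd hd']; rewrite !Hd ?Hd' //.
  by rewrite subrr normr0.
by rewrite addrC addKr.
Qed.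

Lemma SL_zero (l : seq 'I_n) (e : R) (g : E -> R) x : BUC g -> 0 <= e -> uniq l ->
  (forall y, cube x l e y -> g y = 0) -> SL l e g x = 0.
Proof.
move=> bg e0 ul H; have := SL_bound l e g x 0 0 bg e0 ul; rewrite !mul0r subr0.
move=> K; apply/eqP; rewrite -normr_le0; apply: K => y /H ->; by rewrite subrr normr0.
Qed.

Lemma cube_ball x (l : seq 'I_n) (e : R) y : 0 <= e -> cube x l e y -> `|y - x| <= e.
Proof.
move=> e0 cy; apply: rV_norm_le => // j; rewrite !mxE; have := cy j.
by rewrite ler_norml; case: (j \in l) => /andP[A1 A2]; apply/andP; split; lra.
Qed.

Lemma dl_SL (l : seq 'I_n) i (e : R) (g : E -> R) : BUC g -> 0 <= e ->
  dl i e (SL l e g) = SL l e (dl i e g).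
Proof.
move=> bg e0; rewrite /dl (SL_addf l e _ _ (BUC_tr _ _ bg) (BUC_scale _ _ bg) e0).
by rewrite (SL_scalef l e _ _ bg e0); apply/funext => x; rewrite SL_tr.
Qed.

Lemma dl_comm i j (e : R) (g : E -> R) : dl i e (dl j e g) = dl j e (dl i e g).
Proof. by apply/funext => x; rewrite /dl [x + _ + _]addrAC; ring. Qed.

Lemma SL_sumf (I : Type) (r : seq I) (l : seq 'I_n) (e : R) (c : I -> R) (F : I -> E -> R) :
  (forall i, BUC (F i)) -> 0 <= e ->
  SL l e (fun x => \sum_(i <- r) c i * F i x) = fun x => \sum_(i <- r) c i * SL l e (F i) x.
Proof.
move=> bF e0; elim: r => [|i r IH].
  apply/funext => x; rewrite big_nil; under eq_fun do rewrite big_nil.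
  have := SL_scalef l e 0 (fun _ => 0) (BUC_cst 0) e0.
  rewrite (_ : (fun _ : E => 0 * 0) = fun _ => 0); last by apply/funext => y; rewrite mul0r.
  by move=> /(congr1 (fun f => f x)) ->; rewrite mul0r.
have b1 := BUC_scale (c i) _ (bF i).
have b2 : BUC (fun x => \sum_(j <- r) c j * F j x) by apply: BUC_sum => j; exact: BUC_scale.
have -> : (fun x => \sum_(j <- i :: r) c j * F j x) =
    fun x => c i * F i x + \sum_(j <- r) c j * F j x.
  by apply/funext => x; rewrite big_cons.
rewrite (SL_addf l e _ _ b1 b2 e0) (SL_scalef l e _ _ (bF i) e0) IH.
by apply/funext => x; rewrite big_cons.
Qed.

Lemma dl_sumf (I : Type) (r : seq I) i (e : R) (c : I -> R) (F : I -> E -> R) :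
  dl i e (fun x => \sum_(j <- r) c j * F j x) = fun x => \sum_(j <- r) c j * dl i e (F j) x.
Proof.
apply/funext => x; rewrite /dl mulr_sumr -big_split /=; apply: eq_bigr => j _; ring.
Qed.

(* The double Steklov mean of a solution is a C^2 solution, hence harmonic. *)
Lemma steklov_harm (phi : E -> A) a (r e : R) : 0 < e -> 3 * e < r ->
  (forall l, BUC (cf phi l)) ->
  (forall y, `|y - a| < 2 * r -> (forall l, differentiable (cf phi l) y) /\
     \sum_i w i * pd i phi y = 0) ->
  forall l, harm a r (SL (enum 'I_n) e (SL (enum 'I_n) e (cf phi l))).
Proof.
move=> e0 er bphi Hphi; have e0' := ltW e0.
pose L := enum 'I_n; have uL : uniq L := enum_uniq _.
have iL i : i \in L by rewrite mem_enum.
have ur i : uniq (rem i L) by exact: rem_uniq.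
pose u i l := SL (rem i L) e (dl i e (cf phi l)).
have bu i l : BUC (u i l) by apply: SL_BUC => //; exact: dl_BUC.
(* By [S_derive], the [i]-th derivative of the double mean is the mean of [u i], and the [p]-th
   derivative of the latter is [H p i]. *)
pose H p i l := SL (rem p L) e (dl p e (u i l)).
have bH p i l : BUC (H p i l) by apply: SL_BUC => //; exact: dl_BUC.
have HS p i l : H p i l = H i p l.
  have E1 p' i' : H p' i' l = SL (rem p' L) e (SL (rem i' L) e (dl p' e (dl i' e (cf phi l)))).
    by rewrite /H /u (dl_SL (rem i' L) p' e _ (dl_BUC i' e _ (bphi l)) e0').
  by rewrite !E1 dl_comm SL_SL //; do 2!(apply: dl_BUC).
have d1 x i l : is_derive x 'e_i (SL L e (SL L e (cf phi l))) (SL L e (u i l) x).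
  have bS := SL_BUC L e _ (bphi l) e0'.
  rewrite (SL_rem L i e _ bS e0' (iL i)).
  have := S_derive i e _ x (SL_BUC (rem i L) e _ bS e0') e0'.
  move=> K; apply: is_derive_eq K _.
  have -> : SL (rem i L) e (SL L e (cf phi l)) (x + e *: 'e_i)
     - SL (rem i L) e (SL L e (cf phi l)) x = dl i e (SL (rem i L) e (SL L e (cf phi l))) x.
    by rewrite /dl mulN1r.
  by rewrite SL_SL // dl_SL ?dl_SL //; exact: SL_BUC.
have d2 x i p l : is_derive x 'e_p (SL L e (u i l)) (H p i l x).
  rewrite (SL_rem L p e _ (bu i l) e0' (iL p)).
  have := S_derive p e _ x (SL_BUC (rem p L) e _ (bu i l) e0') e0'.
  move=> K; apply: is_derive_eq K _.
  by rewrite /H -dl_SL // /dl mulN1r.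
pose X (j : 'I_m) (i : 'I_n) : E -> R := fun y => \sum_l lm (w i) l j * cf phi l y.
have bX j i : BUC (X j i) by apply: BUC_sum => l; exact: BUC_scale.
(* For each coordinate [j] of [A], the field with components the [j]-th coordinates of [w i * phi]
   is divergence free. Its vanishing flux is the equation for the [u i]. *)
have FX j x : `|x - a| + e < 2 * r -> Flux e (X j) x = 0.
  move=> xr; apply: goursat => // y cy.
  have yr : `|y - a| < 2 * r.
    apply: le_lt_trans xr; have -> : y - a = (x - a) + (y - x) by rewrite [RHS]addrC addrA subrK.
    by apply: le_trans (ler_normD _ _) _; rewrite lerD2l; exact: cube_ball cy.
  have [dphi eq] := Hphi y yr; split.
    move=> i; have -> : X j i = \sum_(l < m) (lm (w i) l j *: cf phi l).
      by apply/funext => z; rewrite fct_sumE.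
    by apply: differentiable_sum => l; apply: differentiableZ.
  have := congr1 (fun b : A => acoord b ord0 j) eq; rewrite acoord_sum acoord0 summxE mxE => E1; rewrite -[RHS]E1.
  apply: eq_bigr => i _; rewrite acoord_mul.
  have dd i' : derivable (fun z => acoord (phi z)) y 'e_i'.
    by apply/derivable_mxP => k l; rewrite (ord1 k); apply: diff_derivable; exact: dphi.
  have K : is_derive y 'e_i (X j i) (\sum_l lm (w i) l j * 'D_('e_i) (cf phi l) y).
    apply: is_derive_sum_fun => l; apply: is_deriveZ_fun; apply: derivableP; exact: diff_derivable.
  have [_ ->] := K; apply: eq_bigr => l _; by rewrite pd_cf.
have eqH x p : `|x - a| < r -> \sum_i w i * afromc (\row_l H p i l x) = 0 :> A.
  move=> xr; apply: acoord_inj; apply/rowP => j; rewrite acoord_sum acoord0 summxE mxE.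
  transitivity (SL (rem p L) e (dl p e (Flux e (X j))) x); last first.
    apply: SL_zero => //.
      apply: dl_BUC; apply: BUC_sum => i; apply: SL_BUC => //; exact: dl_BUC.
    move=> y /(cube_ball _ _ _ _ e0') yx; rewrite /dl !FX ?mulr0 ?addr0 //.
      have -> : y - a = (y - x) + (x - a) by rewrite addrA subrK.
      have := ler_normD (y - x) (x - a); move: yx xr er e0; clear; lra.
    have -> : y + e *: 'e_p - a = e *: 'e_p + ((y - x) + (x - a)).
      by rewrite [y - x + _]addrA subrK addrA [e *: _ + y]addrC.
    have := ler_normD (e *: 'e_p) ((y - x) + (x - a)); have := ler_normD (y - x) (x - a).
    rewrite norm_delta (gtr0_norm e0); move: yx xr er e0; clear; lra.
  have -> : Flux e (X j) = fun x => \sum_i 1 * SL (rem i L) e (dl i e (X j i)) x.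
    by apply/funext => y; rewrite /Flux; apply: eq_bigr => i _; rewrite mul1r.
  rewrite dl_sumf SL_sumf //; last first.
    by move=> i; apply: dl_BUC; apply: SL_BUC => //; exact: dl_BUC.
  apply: eq_bigr => i _; rewrite mul1r acoord_mul afromcK /X.
  rewrite dl_sumf (SL_sumf _ _ (rem i L) e) //; last by move=> l; exact: dl_BUC.
  rewrite dl_sumf (SL_sumf _ _ (rem p L) e) //; last by move=> l; apply: dl_BUC; exact: bu.
  by apply: eq_bigr => l _; rewrite mxE.
move=> l; split.
  by move=> x _; apply: BUC_cont; do 2!(apply: SL_BUC => //).
have [K HK] : exists K, forall i x, `|H i i l x| <= K.
  have /choice[K HK] : forall i, exists K, forall x, `|H i i l x| <= K.
    by move=> i; case: (bH i i l).
  exists (\sum_i `|K i|) => i x; apply: le_trans (HK i x) _.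
  by rewrite (bigD1 i) //=; apply: le_trans (ler_norm _) _; rewrite lerDl sumr_ge0.
exists (fun i => SL L e (u i l)), (fun i => H i i l), K => x xr; split.
  by move=> i; split => //; exact: d2.
have := cliff_laplace (fun p i => afromc (\row_l H p i l x)).
move=> /(_ _ (fun p => eqH x p xr)) K1.
have K2 : \sum_i afromc (\row_l0 H i i l0 x) = 0 :> A.
  by apply: K1 => p i; congr afromc; apply/rowP => k; rewrite !mxE HS.
have := congr1 (fun b : A => acoord b ord0 l) K2; rewrite acoord_sum acoord0 summxE mxE => E1; rewrite -[RHS]E1.
by apply: eq_bigr => i _; rewrite afromcK mxE.
Qed.

Lemma steklov_approx (g : E -> R) (e eta : R) x : BUC g -> 0 < e ->
  (forall y, `|y - x| <= 2 * e -> `|g y - g x| <= eta) ->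
  `|(e ^+ n * e ^+ n)^-1 * SL (enum 'I_n) e (SL (enum 'I_n) e g) x - g x| <= eta.
Proof.
move=> bg e0 H; have e0' := ltW e0; have en : 0 < e ^+ n by exact: exprn_gt0.
have sL : size (enum 'I_n) = n by rewrite size_enum_ord.
have uL := enum_uniq 'I_n.
have A1 y : `|y - x| <= e -> `|SL (enum 'I_n) e g y - g x * e ^+ n| <= eta * e ^+ n.
  move=> yx; have := SL_bound (enum 'I_n) e g y (g x) eta bg e0' uL; rewrite sL; apply.
  move=> z /(cube_ball _ _ _ _ e0') zy; apply: H.
  have -> : z - x = (z - y) + (y - x) by rewrite addrA subrK.
  by apply: le_trans (ler_normD _ _) _; rewrite mulr_natl mulr2n lerD.
have A2 : `|SL (enum 'I_n) e (SL (enum 'I_n) e g) x - g x * e ^+ n * e ^+ n| <=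
    eta * e ^+ n * e ^+ n.
  have := SL_bound (enum 'I_n) e (SL (enum 'I_n) e g) x (g x * e ^+ n) (eta * e ^+ n).
  rewrite sL; apply => //; first exact: SL_BUC.
  by move=> y /(cube_ball _ _ _ _ e0') /A1.
have ee : 0 < e ^+ n * e ^+ n by exact: mulr_gt0.
rewrite -(ler_pM2l ee) -{1}(gtr0_norm ee) -normrM mulrBr mulrA mulfV ?lt0r_neq0 // mul1r.
have -> : e ^+ n * e ^+ n * g x = g x * e ^+ n * e ^+ n by ring.
by have -> : e ^+ n * e ^+ n * eta = eta * e ^+ n * e ^+ n by ring.
Qed.

(** The function is first cut off with [clamp]. Its normalized double means at a small scale are
    harmonic on the ball, and uniformly close to it by uniform continuity. *)
Theorem regularity (phi : E -> A) (U : set E) a : open U -> U a ->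
  (forall y, U y -> differentiable (fun z => acoord (phi z)) y /\
     \sum_i w i * pd i phi y = 0) ->
  exists2 r : R, 0 < r & (forall y, `|y - a| < r -> U y) /\ forall l, Hc a r (cf phi l).
Proof.
move=> oU Ua Hphi; have [d d0 Hd] := open_eps _ _ oU Ua.
pose r := d / 4; have r0 : 0 < r by rewrite divr_gt0.
have rd : 2 * r < d by rewrite /r; lra.
exists r => //; split; first by move=> y yr; apply: Hd; move: yr; rewrite /r; lra.
have r20 : 0 <= 2 * r by rewrite mulr_ge0 // ltW.
pose psi x := phi (clamp a (2 * r) x).
have psiE y : `|y - a| <= 2 * r -> psi y = phi y by move=> yr; rewrite /psi clamp_id.
have bpsi l : BUC (cf psi l).
  apply: (clamp_BUC a (2 * r) (cf phi l)) => // x xr.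
  apply: differentiable_continuous; apply: diff_cf; apply: (Hphi x _).1.
  by apply: Hd; exact: le_lt_trans rd.
have npsi y : `|y - a| < 2 * r -> \forall z \near y, acoord (psi z) = acoord (phi z).
  move=> yr; apply/near_eps; exists (2 * r - `|y - a|); first by rewrite subr_gt0.
  move=> z zy; rewrite psiE //; have -> : z - a = (z - y) + (y - a) by rewrite addrA subrK.
  by apply: ltW; apply: le_lt_trans (ler_normD _ _) _; rewrite -ltrBrDr.
have Hpsi y : `|y - a| < 2 * r -> (forall l, differentiable (cf psi l) y) /\
     \sum_i w i * pd i psi y = 0.
  move=> yr; have Uy : U y by apply: Hd; exact: lt_trans rd.
  have [dphi eq] := Hphi y Uy; split; last first.
    rewrite -[RHS]eq; apply: eq_bigr => i _; congr (_ * _); rewrite /pd; congr afromc.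
    exact: near_eq_derive (npsi y yr).
  move=> l; apply: differentiable_near (diff_cf _ _ l dphi).
  have /near_eps[d1 d10 Hd1] := npsi y yr; exists d1 => // z zd.
  by rewrite /cf (Hd1 z zd).
move=> l; apply: (Hc_ext _ _ (cf psi l)).
  by move=> x xr; rewrite /cf psiE // ltW // (lt_trans xr) // ltr_pMl // ltr1n.
move=> eta eta0; have [_ H] := bpsi l; have [dd dd0 Hdd] := H eta eta0.
(* The double mean looks as far as [2 e], which [dd / 3] keeps within the modulus of continuity;
   [r / 4] gives the margin [3 e < r] required by [steklov_harm]. *)
pose e := Num.min (dd / 3) (r / 4).
have e0 : 0 < e by rewrite lt_min !divr_gt0.
have er : 3 * e < r.
  have : e <= r / 4 by rewrite ge_min lexx orbT.
  by move: r0; clear; lra.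
have ed : 2 * e < dd.
  have : e <= dd / 3 by rewrite ge_min lexx.
  by move: dd0; clear; lra.
exists (fun x => (e ^+ n * e ^+ n)^-1 * SL (enum 'I_n) e (SL (enum 'I_n) e (cf psi l)) x
   + 0 * SL (enum 'I_n) e (SL (enum 'I_n) e (cf psi l)) x).
  by apply: harm_lin; exact: steklov_harm.
move=> x xr; rewrite mul0r addr0 distrC; apply: steklov_approx => // y yx.
by apply: Hdd; exact: le_lt_trans ed.
Qed.

End regularity.

(** * Division by a coordinate *)

Section radial.
Context {R : realType} {n : nat}.
Local Notation E := 'rV[R]_n.
Local Notation "''e_' i" := (delta_mx 0 i : 'rV[R]_n) (at level 8, i at level 2).
Implicit Types (w a : E -> R) (z : E).

Lemma smooth_der (U : set E) w z i : smooth U w -> U z -> is_derive z 'e_i w ('D_('e_i) w z).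
Proof. by move=> sw Uz; exact: (CR_der 0 U w (sw 1%N) z i Uz). Qed.

Lemma smooth_cont (U : set E) w z : smooth U w -> U z -> {for z, continuous w}.
Proof. by move=> sw; exact: CR_cont (sw 0%N). Qed.

Lemma is_derive_coordM (U : set E) w z i q : smooth U w -> U z ->
  is_derive z 'e_i (fun y => y ord0 q * w y) (z ord0 q * 'D_('e_i) w z + (i == q)%:R * w z).
Proof.
move=> sw Uz; have := is_deriveM_fun _ _ _ _ _ _ (is_derive_coord q z 'e_i) (smooth_der _ _ _ i sw Uz).
by rewrite mxE eqxx /= eq_sym [w z * _]mulrC.
Qed.

Definition rho (i : 'I_n) z : E := \row_k (if k == i then - z ord0 k else z ord0 k).

Lemma rho_lin i z v (t : R) : rho i (z + t *: v) = rho i z + t *: rho i v.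
Proof. by apply/rowP => k; rewrite !mxE; case: ifP => _ //; ring. Qed.

Lemma rho_id i z : z ord0 i = 0 -> rho i z = z.
Proof. by move=> zi; apply/rowP => k; rewrite mxE; case: eqP => // ->; rewrite zi oppr0. Qed.

Definition sgn (k i : 'I_n) : R := if k == i then -1 else 1.

Lemma rho_delta i k : rho i 'e_k = sgn k i *: 'e_k.
Proof.
apply/rowP => l; rewrite !mxE /sgn eqxx /=.
case: (eqVneq l k) => [->|lk]; last by rewrite !mulr0 oppr0 if_same.
by case: (k == i); rewrite ?mulN1r ?mul1r.
Qed.

Lemma is_derive_rho i w z v (l : R) : is_derive (rho i z) (rho i v) w l ->
  is_derive z v (fun y => w (rho i y)) l.
Proof.
move=> /is_derive_eps H; apply/is_derive_eps => e e0; have [d d0 Hd] := H e e0.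
by exists d => // t td; rewrite rho_lin; exact: Hd.
Qed.

Definition par (U : set E) (i : 'I_n) (s : R) w := forall z, U z -> w (rho i z) = s * w z.

Lemma par_D (U : set E) i s w k : open U -> (forall z, U z -> U (rho i z)) -> smooth U w ->
  par U i s w -> par U i (s * sgn k i) (fun z => 'D_('e_k) w z).
Proof.
move=> oU rU sw pw z Uz.
have H1 : is_derive z 'e_k (fun y => w (rho i y)) (sgn k i * 'D_('e_k) w (rho i z)).
  apply: is_derive_rho; rewrite rho_delta; apply: is_derive_scale.
  exact: smooth_der sw (rU z Uz).
have H2 : is_derive z 'e_k (fun y => w (rho i y)) (s * 'D_('e_k) w z).
  apply: (is_derive_ext U (fun y => s * w y)) => //; first by move=> y /pw.
  exact: is_deriveZ_fun (smooth_der _ _ _ _ sw Uz).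
have [_ E1] := H1; have [_ E2] := H2; rewrite E1 in E2.
by move: E2; rewrite /sgn; case: (k == i) => E2; [rewrite mulrN1 mulNr -E2; ring|rewrite mulr1 -E2 mul1r].
Qed.

Variables (U : set E) (q : 'I_n).
Hypothesis oU : open U.
Hypothesis rU : forall z, U z -> U (rho q z).

Definition Q1 w : E -> R := Qm q 1 w.
Definition Lq a : E -> R := Q1 (fun z => 'D_('e_q) a z).

Lemma odd_zero w z : par U q (-1) w -> U z -> z ord0 q = 0 -> w z = 0.
Proof.
move=> pw Uz zq; have := pw z Uz; rewrite rho_id // mulN1r => /eqP.
by rewrite -subr_eq0 opprK -mulr2n mulrn_eq0 /= => /eqP.
Qed.

Lemma odd_vanish w : par U q (-1) w -> vanish U q 1 w.
Proof. by move=> pw [|i] // z _ Uz zq /=; exact: odd_zero. Qed.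

Lemma Q1_mul w z : par U q (-1) w -> U z -> z ord0 q * Q1 w z = w z.
Proof.
move=> pw Uz; rewrite /Q1 /Qm; case: eqP => [zq|/eqP zq]; first by rewrite zq mul0r odd_zero.
by rewrite expr1 mulrC divfK.
Qed.

Lemma Q1_smooth w : smooth U w -> par U q (-1) w -> smooth U (Q1 w).
Proof. by move=> sw pw; apply: Qm_smooth => //; exact: odd_vanish. Qed.

(** Off the hyperplane the factor [x_q] cancels, and every point of the hyperplane is a limit of
    points off it. *)
Lemma eq_off_hyperplane f g z : (forall y, U y -> {for y, continuous f}) -> (forall y, U y -> {for y, continuous g}) ->
  (forall y, U y -> y ord0 q * f y = y ord0 q * g y) -> U z -> f z = g z.
Proof.
move=> cf cg H Uz; case: (eqVneq (z ord0 q) 0) => [zq|zq]; last exact: (mulfI zq (H z Uz)).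
apply/eqP; rewrite -subr_eq0 -normr_le0; apply/ler_addgt0Pr => e e0; rewrite add0r.
have e20 : 0 < e / 2 by rewrite divr_gt0.
have /cont_eps /(_ _ e20) [d1 d10 H1] := cf z Uz.
have /cont_eps /(_ _ e20) [d2 d20 H2] := cg z Uz.
have [d3 d30 H3] := open_eps _ _ oU Uz.
pose d := Num.min d1 (Num.min d2 d3) / 2.
have m0 : 0 < Num.min d1 (Num.min d2 d3) by rewrite !lt_min d10 d20.
have d0 : 0 < d by rewrite divr_gt0.
pose y := z + d *: 'e_q.
have yz : `|y - z| < Num.min d1 (Num.min d2 d3).
  by rewrite /y addrC addKr norm_delta gtr0_norm // /d ltr_pdivrMr // ltr_pMr // ltr1n.
move: yz; rewrite !lt_min => /andP[/H1 A1 /andP[/H2 A2 /H3 Uy]].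
have yq : y ord0 q != 0 by rewrite /y !mxE zq add0r !eqxx mulr1 lt0r_neq0.
have fg := mulfI yq (H y Uy).
apply: (@dist_half _ (f y) (f z) (g z)) => //; by rewrite fg.
Qed.

Lemma Q1_char w u z : smooth U w -> par U q (-1) w -> (forall y, U y -> {for y, continuous u}) ->
  (forall y, U y -> y ord0 q * u y = w y) -> U z -> u z = Q1 w z.
Proof.
move=> sw pw cu H Uz; apply: eq_off_hyperplane => // [y Uy|y Uy].
  exact: smooth_cont (Q1_smooth _ sw pw) Uy.
by rewrite H // Q1_mul.
Qed.

Lemma Q1_parq w : par U q (-1) w -> par U q 1 (Q1 w).
Proof.
move=> pw z Uz; rewrite mul1r; case: (eqVneq (z ord0 q) 0) => zq; first by rewrite rho_id.
rewrite /Q1 /Qm !mxE eqxx oppr_eq0 (negbTE zq) !expr1 pw //.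
by rewrite mulN1r invrN mulrNN.
Qed.

Lemma Q1_par i (s : R) w : i != q -> (forall z, U z -> U (rho i z)) -> smooth U w ->
  par U i s w -> par U i s (Q1 w).
Proof.
move=> iq rUi sw pw z Uz; rewrite /Q1 /Qm !mxE [q == i]eq_sym (negbTE iq).
case: eqP => zq; last by rewrite pw // mulrA.
have := par_D U i s w q oU rUi sw pw z Uz; rewrite /sgn [q == i]eq_sym (negbTE iq) mulr1 /= => ->.
by rewrite mulrA.
Qed.

Lemma par_Dq a : smooth U a -> par U q 1 a -> par U q (-1) (fun z => 'D_('e_q) a z).
Proof. by move=> sa pa; have := par_D U q 1 a q oU rU sa pa; rewrite /sgn eqxx mul1r. Qed.

Lemma Lq_mul a z : smooth U a -> par U q 1 a -> U z -> z ord0 q * Lq a z = 'D_('e_q) a z.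
Proof. by move=> sa pa Uz; rewrite Q1_mul //; exact: par_Dq. Qed.

Lemma Lq_smooth a : smooth U a -> par U q 1 a -> smooth U (Lq a).
Proof. by move=> sa pa; apply: Q1_smooth; [exact: smooth_D1|exact: par_Dq]. Qed.

Lemma Lq_parq a : smooth U a -> par U q 1 a -> par U q 1 (Lq a).
Proof. by move=> sa pa; apply: Q1_parq; exact: par_Dq. Qed.

Lemma Lq_par i (s : R) a : i != q -> (forall z, U z -> U (rho i z)) -> smooth U a ->
  par U i s a -> par U i s (Lq a).
Proof.
move=> iq rUi sa pa; apply: Q1_par => //; first exact: smooth_D1.
by have := par_D U i s a q oU rUi sa pa; rewrite /sgn eq_sym (negbTE iq) mulr1.
Qed.

(** Identities for [Lq] are verified after multiplication by [x_q]; continuity takes care of the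
    hyperplane. *)
Lemma Lq_char a u z : smooth U a -> par U q 1 a -> smooth U u ->
  (forall y, U y -> y ord0 q * u y = 'D_('e_q) a y) -> U z -> u z = Lq a z.
Proof.
move=> sa pa su H Uz; apply: Q1_char => //; [exact: smooth_D1|exact: par_Dq|].
by move=> y; exact: smooth_cont.
Qed.

Lemma Lq_D a i z : i != q -> smooth U a -> par U q 1 a -> U z ->
  'D_('e_i) (Lq a) z = Lq (fun y => 'D_('e_i) a y) z.
Proof.
move=> iq sa pa Uz; have sL := Lq_smooth _ sa pa.
have pDa : par U q 1 (fun y => 'D_('e_i) a y).
  by have := par_D U q 1 a i oU rU sa pa; rewrite /sgn (negbTE iq) mulr1.
apply: (Lq_char _ (fun z => 'D_('e_i) (Lq a) z)) => //; try exact: smooth_D1.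
move=> y Uy.
have H1 := is_derive_coordM _ _ _ i q sL Uy.
rewrite (negbTE iq) mul0r addr0 in H1.
rewrite (Schwarz U a y i q oU (sa 2%N) Uy) -(derive_ext U (fun y => y ord0 q * Lq a y) (fun y => 'D_('e_q) a y)) //.
  by have [_ ->] := H1.
by move=> x Ux; exact: Lq_mul.
Qed.

Lemma Lq_sum (I : Type) (r : seq I) (c : I -> R) (F : I -> E -> R) z :
  (forall i, smooth U (F i)) -> (forall i, par U q 1 (F i)) -> U z ->
  Lq (fun y => \sum_(i <- r) c i * F i y) z = \sum_(i <- r) c i * Lq (F i) z.
Proof.
move=> sF pF Uz; apply/esym.
apply: (Lq_char _ (fun z => \sum_(i <- r) c i * Lq (F i) z)) => //.
- by move=> p; apply: CR_sum => // i _; apply: CR_scale => //; exact: sF.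
- move=> y Uy; rewrite mul1r; apply: eq_bigr => i _; by rewrite pF // mul1r.
- by move=> p; apply: CR_sum => // i _; apply: CR_scale => //; exact: Lq_smooth.
move=> y Uy; rewrite mulr_sumr.
have H : is_derive y 'e_q (fun y => \sum_(i <- r) c i * F i y) (\sum_(i <- r) c i * 'D_('e_q) (F i) y).
  by apply: is_derive_sum_fun => i; apply: is_deriveZ_fun; exact: smooth_der Uy.
have [_ ->] := H; apply: eq_bigr => i _; by rewrite mulrCA Lq_mul.
Qed.

Lemma smooth_zz u : smooth U u -> smooth U (fun z => z ord0 q ^+ 2 * u z).
Proof.
move=> su p; apply: (CR_ext p U (fun z => z ord0 q * (z ord0 q * u z))) => //.
  by move=> y _; rewrite expr2 mulrA.
by do 2!(apply: CR_mul => //; first exact: CR_coord).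
Qed.

Lemma par_zz u : par U q 1 u -> par U q 1 (fun z => z ord0 q ^+ 2 * u z).
Proof. by move=> pu z Uz; rewrite pu // !mxE eqxx sqrrN; ring. Qed.

Lemma Lq_zz u z : smooth U u -> par U q 1 u -> U z ->
  Lq (fun z => z ord0 q ^+ 2 * u z) z = 2 * u z + z ord0 q ^+ 2 * Lq u z.
Proof.
move=> su pu Uz; apply/esym.
apply: (Lq_char _ (fun z => 2 * u z + z ord0 q ^+ 2 * Lq u z)) => //.
- exact: smooth_zz.
- exact: par_zz.
- move=> p; apply: CR_add => //; first by apply: CR_scale.
  exact: smooth_zz (Lq_smooth _ su pu) p.
move=> y Uy.
have szu : smooth U (fun z => z ord0 q * u z) by move=> p; apply: CR_mul => //; exact: CR_coord.
rewrite (derive_ext U _ (fun z => z ord0 q * (z ord0 q * u z))) //; last first.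
  by move=> x _; rewrite expr2 mulrA.
have [_ ->] := is_derive_coordM _ _ _ q q szu Uy.
have [_ ->] := is_derive_coordM _ _ _ q q su Uy.
rewrite -(Lq_mul u) // eqxx !mul1r; ring.
Qed.

Lemma Lq_ext a a' z : (forall y, U y -> a y = a' y) -> U z -> Lq a z = Lq a' z.
Proof.
move=> H Uz; have K y : U y -> 'D_('e_q) a y = 'D_('e_q) a' y by move=> Uy; exact: derive_ext oU H Uy.
rewrite /Lq /Q1 /Qm; case: eqP => _; last by rewrite K.
by rewrite /= (derive_ext U _ (fun z => 'D_('e_q) a' z) z _ oU K Uz).
Qed.

(* The operator acting as [Lq] on even functions and as [z_q (Lq o 1/z_q)] on odd ones. *)
Definition radial_op w z : R := if z ord0 q == 0 then 'D_('e_q) (fun y => 'D_('e_q) w y) z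
  else (z ord0 q ^+ 2)^-1 * (z ord0 q * 'D_('e_q) w z - 2^-1 * (w z - w (rho q z))).

Lemma radial_op_even w z : smooth U w -> par U q 1 w -> U z -> radial_op w z = Lq w z.
Proof.
move=> sw pw Uz; rewrite /radial_op /Lq /Q1 /Qm /=; case: eqP => [_|/eqP zq]; first by rewrite factS fact0 muln1 divr1.
by rewrite pw //; field.
Qed.

(** With [w = x_q B], the numerator of [radial_op] becomes [x_q^2 D_q B]. On the hyperplane the
    second derivative of [w] is [2 D_q B], which is zero because [B] is even. *)
Lemma radial_op_odd w z : smooth U w -> par U q (-1) w -> U z -> radial_op w z = z ord0 q * Lq (Q1 w) z.
Proof.
move=> sw pw Uz; have sB := Q1_smooth _ sw pw; have pB := Q1_parq _ pw.
have H y : U y -> 'D_('e_q) w y = Q1 w y + y ord0 q * 'D_('e_q) (Q1 w) y.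
  move=> Uy; rewrite -(derive_ext U (fun y => y ord0 q * Q1 w y)) //; last by move=> x Ux; rewrite Q1_mul.
  by have [_ ->] := is_derive_coordM _ _ _ q q sB Uy; rewrite eqxx mul1r addrC.
rewrite Lq_mul // /radial_op; case: eqP => [zq|/eqP zq]; last first.
  by rewrite H // pw // -(Q1_mul w z) //; field.
rewrite (derive_ext U _ (fun y => Q1 w y + y ord0 q * 'D_('e_q) (Q1 w) y)) //.
have sD := smooth_D1 _ _ q sB.
have K : is_derive z 'e_q (fun y => Q1 w y + y ord0 q * 'D_('e_q) (Q1 w) y)
  ('D_('e_q) (Q1 w) z + (z ord0 q * 'D_('e_q) (fun y => 'D_('e_q) (Q1 w) y) z
     + (q == q)%:R * 'D_('e_q) (Q1 w) z)).
  exact: (is_deriveD_fun _ _ _ _ _ _ (smooth_der _ _ _ _ sB Uz) (is_derive_coordM _ _ _ q q sD Uz)).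
have [_ ->] := K; rewrite -(Lq_mul (Q1 w)) // zq; ring.
Qed.

Lemma radial_op_smooth w s : s = 1 \/ s = -1 -> smooth U w -> par U q s w -> smooth U (radial_op w).
Proof.
move=> [] -> sw pw.
  by apply: (smooth_ext U (Lq w)) => //; [move=> y Uy; rewrite radial_op_even|exact: Lq_smooth].
apply: (smooth_ext U (fun z => z ord0 q * Lq (Q1 w) z)) => //; first by move=> y Uy; rewrite radial_op_odd.
move=> p; apply: CR_mul => //; first exact: CR_coord.
by apply: Lq_smooth; [exact: Q1_smooth|exact: Q1_parq].
Qed.

Lemma radial_op_parq w s : s = 1 \/ s = -1 -> smooth U w -> par U q s w -> par U q s (radial_op w).
Proof.
move=> [] -> sw pw z Uz; have Uz' := rU _ Uz.
  by rewrite !radial_op_even // Lq_parq.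
rewrite !radial_op_odd // Lq_parq //; [|exact: Q1_smooth|exact: Q1_parq].
by rewrite !mxE eqxx; ring.
Qed.

Lemma radial_op_par w s i s' : s = 1 \/ s = -1 -> smooth U w -> par U q s w ->
  i != q -> (forall z, U z -> U (rho i z)) -> par U i s' w -> par U i s' (radial_op w).
Proof.
move=> [] -> sw pw iq rUi pi z Uz; have Uz' := rUi _ Uz.
  by rewrite !radial_op_even //; exact: Lq_par.
rewrite !radial_op_odd // (Lq_par i s') //; last by apply: Q1_par.
  by rewrite !mxE eq_sym (negbTE iq); ring.
exact: Q1_smooth.
Qed.

Lemma radial_op_sum (I : Type) (r : seq I) (c : I -> R) (F : I -> E -> R) z :
  (forall i, smooth U (F i)) -> U z ->
  radial_op (fun y => \sum_(i <- r) c i * F i y) z = \sum_(i <- r) c i * radial_op (F i) z.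
Proof.
move=> sF Uz.
have H y : U y -> is_derive y 'e_q (fun y => \sum_(i <- r) c i * F i y) (\sum_(i <- r) c i * 'D_('e_q) (F i) y).
  by move=> Uy; apply: is_derive_sum_fun => i; apply: is_deriveZ_fun; exact: smooth_der Uy.
rewrite /radial_op; case: eqP => zq.
  rewrite (derive_ext U _ (fun y => \sum_(i <- r) c i * 'D_('e_q) (F i) y)) //; last first.
    by move=> y Uy; have [_ ->] := H y Uy.
  have K : is_derive z 'e_q (fun y => \sum_(i <- r) c i * 'D_('e_q) (F i) y)
     (\sum_(i <- r) c i * 'D_('e_q) (fun y => 'D_('e_q) (F i) y) z).
    by apply: is_derive_sum_fun => i; apply: is_deriveZ_fun; apply: smooth_der Uz; exact: smooth_D1.
  by have [_ ->] := K.
have [_ ->] := H z Uz; rewrite -sumrB !mulr_sumr -sumrB mulr_sumr; apply: eq_bigr => i _; ring.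
Qed.

End radial.

(** * Algebra-valued functions *)

Section avalued.
Context {R : realType} {A : falgType R} {n : nat}.
Local Notation m := (\dim (fullv : {vspace A})).
Local Notation E := 'rV[R]_n.
Local Notation "''e_' i" := (delta_mx 0 i : 'rV[R]_n) (at level 8, i at level 2).
Implicit Types (g h : E -> A) (D : set E).

Lemma cf_inj (a b : A) : (forall l, acoord a ord0 l = acoord b ord0 l) -> a = b.
Proof. by move=> H; apply: acoord_inj; apply/rowP => l. Qed.

Lemma acoord_lin2 (c d : R) (a b : A) l :
  acoord (c *: a + d *: b) ord0 l = c * acoord a ord0 l + d * acoord b ord0 l.
Proof. by rewrite acoordD !acoordZ mxE [X in X + _]mxE [X in _ + X]mxE. Qed.

Lemma cf_add g h l : cf (fun y => g y + h y) l = fun y => cf g l y + cf h l y.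
Proof. by apply/funext => y; rewrite /cf acoordD mxE. Qed.

Lemma cf_scal (r : E -> R) g l : cf (fun y => r y *: g y) l = fun y => r y * cf g l y.
Proof. by apply/funext => y; rewrite /cf acoordZ mxE. Qed.

Lemma cf_lin (I : Type) (s : seq I) (c : I -> A) (F : I -> E -> A) j :
  cf (fun y => \sum_(i <- s) c i * F i y) j =
  fun y => \sum_(i <- s) 1 * (\sum_l lm (c i) l j * cf (F i) l y).
Proof.
apply/funext => y; rewrite /cf acoord_sum summxE; apply: eq_bigr => i _.
by rewrite acoord_mul mul1r.
Qed.

Definition AC p D g := forall l, CR p D (cf g l).
Definition asm D g := forall l, smooth D (cf g l).

Lemma asm_AC D g p : asm D g -> AC p D g.
Proof. by move=> H l; exact: H. Qed.

Lemma AC_lin p D (I : Type) (s : seq I) (c : I -> A) (F : I -> E -> A) : open D ->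
  (forall i, AC p D (F i)) -> AC p D (fun y => \sum_(i <- s) c i * F i y).
Proof.
move=> oD H j; rewrite cf_lin; apply: CR_sum => // i _; apply: CR_scale => //.
by apply: CR_sum => // l _; apply: CR_scale => //; exact: H.
Qed.

Lemma asm_lin D (I : Type) (s : seq I) (c : I -> A) (F : I -> E -> A) : open D ->
  (forall i, asm D (F i)) -> asm D (fun y => \sum_(i <- s) c i * F i y).
Proof. by move=> oD H j p; move: j; apply: AC_lin => // i l; exact: H. Qed.

Lemma asm_add D g h : open D -> asm D g -> asm D h -> asm D (fun y => g y + h y).
Proof. by move=> oD Hg Hh l p; rewrite cf_add; apply: CR_add => //; [exact: Hg|exact: Hh]. Qed.

Lemma asm_coord D g s : open D -> asm D g -> asm D (fun y => y ord0 s *: g y).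
Proof.
move=> oD Hg l p; rewrite cf_scal; apply: CR_mul => //; [exact: CR_coord|exact: Hg].
Qed.

Lemma asm_mul D g c : open D -> asm D g -> asm D (fun y => c * g y).
Proof.
move=> oD Hg; have := asm_lin D unit [:: tt] (fun _ => c) (fun _ => g) oD (fun _ => Hg).
by under eq_fun do rewrite big_seq1.
Qed.

Lemma asm_ext D g h : open D -> (forall y, D y -> g y = h y) -> asm D g -> asm D h.
Proof. by move=> oD H Hg l; apply: smooth_ext (Hg l) => // y Dy; rewrite /cf H. Qed.

Lemma acoord_row g : (fun z => acoord (g z)) = \sum_l (fun z => cf g l z *: (delta_mx 0 l : 'rV[R]_m)).
Proof.
by apply/funext => z; rewrite fct_sumE {1}(row_delta_sum _ _ (acoord (g z))).
Qed.

Lemma AC_derivable D g y : open D -> AC 1 D g -> D y -> differentiable (fun z => acoord (g z)) y.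
Proof.
move=> oD H Dy; rewrite acoord_row; apply: differentiable_sum => l.
by apply: differentiableZl; exact: C1_differentiable (H l) Dy.
Qed.

Lemma pdE D g i y l : AC 1 D g -> D y -> acoord (pd i g y) ord0 l = 'D_('e_i) (cf g l) y.
Proof.
move=> H Dy; apply: pd_cf; apply/derivable_mxP => k j; rewrite (ord1 k).
by have [K _] := CR_der 0 D _ (H j) y i Dy.
Qed.

Lemma AC_pd p D g i : open D -> AC p.+1 D g -> AC p D (pd i g).
Proof.
move=> oD H l; apply: (CR_ext p D (fun y => 'D_('e_i) (cf g l) y)) => //; last exact: CR_D1.
by move=> y Dy; rewrite /cf (pdE D) // => k; apply: CR_le (H k).
Qed.

Lemma asm_pd D g i : open D -> asm D g -> asm D (pd i g).
Proof. by move=> oD H l p; move: l; apply: AC_pd => //; exact: asm_AC. Qed.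

Lemma pd_ext D g h i y : open D -> (forall y, D y -> g y = h y) -> D y -> pd i g y = pd i h y.
Proof.
move=> oD H Dy; rewrite /pd; congr afromc; apply: near_eq_derive.
have [d d0 Hd] := open_eps _ _ oD Dy; apply/near_eps; exists d => // z /Hd Dz.
by rewrite H.
Qed.

(** One order is given up: continuity and derivability of the coordinate vector come from
    differentiability, obtained from C^1 coordinates. *)
Lemma asm_Ck D g p : open D -> AC p.+1 D g -> Ck p D g.
Proof.
move=> oD; elim: p g => [|p IH] g H; have H1 : AC 1 D g by move=> l; apply: CR_le (H l).
  by split => // y Dy; apply: differentiable_continuous; exact: AC_derivable H1 Dy.
split; first by move=> y Dy; apply: differentiable_continuous; exact: AC_derivable H1 Dy.
split; first by move=> y i Dy; apply: diff_derivable; exact: AC_derivable H1 Dy.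
by move=> i; apply: IH; exact: AC_pd.
Qed.

Lemma Ck_AC D g p : open D -> Ck p D g -> AC p D g.
Proof.
move=> oD; have C q g' : Ck q D g' -> forall y, D y -> forall l, {for y, continuous (cf g' l)}.
  move=> H y Dy l; have Hc : {for y, continuous (fun z => acoord (g' z))}.
    by case: q H => [|q] [+ _]; apply.
  apply: (@continuous_comp _ _ _ (fun z => acoord (g' z)) (fun r : 'rV[R]_m => r ord0 l)) => //.
  exact: coord_continuous.
elim: p g => [|p IH] g H l; first by split => // y Dy; exact: C H _ Dy _.
have [_ [H1 H2]] := H.
apply: (CR_S p D _ (fun i => cf (pd i g) l)) => //.
- by move=> y Dy; exact: C H _ Dy _.
- move=> y i Dy; rewrite /cf pd_cf; last exact: H1.
  by apply: derivableP; have /derivable_mxP/(_ ord0 l) := H1 y i Dy.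
- by move=> i; exact: (IH _ (H2 i) l).
Qed.

(** A scalar operator applied to each coordinate. When it is real linear it commutes with left
    multiplication by constants of [A], see [amap_lin]. *)
Definition amap (Phi : (E -> R) -> E -> R) g : E -> A := fun y => afromc (\row_l Phi (cf g l) y).

Lemma cf_amap Phi g l : cf (amap Phi g) l = Phi (cf g l).
Proof. by apply/funext => y; rewrite /cf /amap afromcK mxE. Qed.

Lemma amapE Phi g l y : acoord (amap Phi g y) ord0 l = Phi (cf g l) y.
Proof. by rewrite /amap afromcK mxE. Qed.

Lemma amap_lin (Phi : (E -> R) -> E -> R) (P : (E -> R) -> Prop) z :
  (forall (I : Type) (r : seq I) (c : I -> R) (F : I -> E -> R), (forall i, P (F i)) ->
     P (fun y => \sum_(i <- r) c i * F i y)) ->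
  (forall (I : Type) (r : seq I) (c : I -> R) (F : I -> E -> R), (forall i, P (F i)) ->
     Phi (fun y => \sum_(i <- r) c i * F i y) z = \sum_(i <- r) c i * Phi (F i) z) ->
  forall (I : Type) (r : seq I) (c : I -> A) (F : I -> E -> A), (forall i l, P (cf (F i) l)) ->
  amap Phi (fun y => \sum_(i <- r) c i * F i y) z = \sum_(i <- r) c i * amap Phi (F i) z.
Proof.
move=> HP HPhi I r c F H; apply: cf_inj => j; rewrite amapE cf_lin.
rewrite (HPhi _ r (fun _ => 1) (fun i y => \sum_l lm (c i) l j * cf (F i) l y)); last first.
  by move=> i; apply: HP.
rewrite acoord_sum summxE; apply: eq_bigr => i _; rewrite mul1r.
by rewrite HPhi // acoord_mul; apply: eq_bigr => l _; rewrite amapE.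
Qed.

Lemma pd_lin D (I : Type) (r : seq I) (c : I -> A) (F : I -> E -> A) i y : open D ->
  (forall k, AC 1 D (F k)) -> D y ->
  pd i (fun y => \sum_(k <- r) c k * F k y) y = \sum_(k <- r) c k * pd i (F k) y.
Proof.
move=> oD H Dy.
have pdA g : AC 1 D g -> pd i g y = amap (fun (u : E -> R) z => 'D_('e_i) u z) g y.
  by move=> Hg; apply: cf_inj => l; rewrite (pdE D) // amapE.
rewrite pdA; last exact: AC_lin.
rewrite (amap_lin _ (CR 1 D)).
- by apply: eq_bigr => k _; rewrite pdA.
- by move=> J s d G HG; apply: CR_sum => // j _; apply: CR_scale.
- move=> J s d G HG.
  have K : is_derive y 'e_i (fun y => \sum_(j <- s) d j * G j y) (\sum_(j <- s) d j * 'D_('e_i) (G j) y).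
    by apply: is_derive_sum_fun => j; apply: is_deriveZ_fun; exact: (CR_der 0 D _ (HG j)).
  by have [_ ->] := K.
- by move=> k l; exact: H.
Qed.

Lemma pd_mul D c g i y : open D -> AC 1 D g -> D y -> pd i (fun y => c * g y) y = c * pd i g y.
Proof.
move=> oD H Dy; have := pd_lin D unit [:: tt] (fun _ => c) (fun _ => g) i y oD (fun _ => H) Dy.
by rewrite big_seq1; under eq_fun do rewrite big_seq1.
Qed.

Lemma pd_add D g h i y : open D -> AC 1 D g -> AC 1 D h -> D y ->
  pd i (fun y => g y + h y) y = pd i g y + pd i h y.
Proof.
move=> oD Hg Hh Dy; have H (b : bool) : AC 1 D (if b then g else h) by case: b.
have := pd_lin D bool [:: true; false] (fun _ => 1) (fun b => if b then g else h) i y oD H Dy.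
rewrite big_cons big_seq1 !mul1r.
by under eq_fun do rewrite big_cons big_seq1 !mul1r.
Qed.

Lemma pd_coord D g s i y : open D -> asm D g -> D y ->
  pd i (fun y => y ord0 s *: g y) y = y ord0 s *: pd i g y + (i == s)%:R *: g y.
Proof.
move=> oD Hg Dy; apply: cf_inj => l.
rewrite (pdE D (fun y => y ord0 s *: g y)) //; last by apply: asm_AC; exact: asm_coord.
rewrite cf_scal; have [_ ->] := is_derive_coordM D _ _ i s (Hg l) Dy.
rewrite -(pdE D) //; last exact: asm_AC.
by rewrite acoord_lin2.
Qed.

Lemma pd_Schwarz D g i j y : open D -> asm D g -> D y -> pd j (pd i g) y = pd i (pd j g) y.
Proof.
move=> oD Hg Dy; apply: cf_inj => l.
have H k : AC 1 D (pd k g) by apply: AC_pd => //; exact: asm_AC.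
have E1 k : forall z, D z -> cf (pd k g) l z = 'D_('e_k) (cf g l) z.
  by move=> z Dz; rewrite /cf (pdE D) //; exact: asm_AC.
apply: etrans (pdE D (pd i g) j y l (H i) Dy) _.
apply: etrans (derive_ext D (cf (pd i g) l) _ _ _ oD (E1 i) Dy) _.
apply/esym; apply: etrans (pdE D (pd j g) i y l (H j) Dy) _.
apply: etrans (derive_ext D (cf (pd j g) l) _ _ _ oD (E1 j) Dy) _.
exact: Schwarz oD (Hg l 2%N) Dy.
Qed.

Lemma lap_lin D (I : Type) (r : seq I) (c : I -> A) (F : I -> E -> A) y : open D ->
  (forall k, AC 2 D (F k)) -> D y ->
  \sum_i pd i (pd i (fun y => \sum_(k <- r) c k * F k y)) y =
  \sum_(k <- r) c k * \sum_i pd i (pd i (F k)) y.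
Proof.
move=> oD H Dy; under [RHS]eq_bigr do rewrite mulr_sumr.
rewrite [RHS]exchange_big /=; apply: eq_bigr => i _.
have H1 k : AC 1 D (F k) by move=> l; apply: CR_le (H k l).
rewrite (pd_ext D _ (fun y => \sum_(k <- r) c k * pd i (F k) y)) //.
  by rewrite (pd_lin D) // => k; exact: AC_pd.
by move=> z Dz; rewrite (pd_lin D).
Qed.

Lemma lap_ext D g h y : open D -> (forall z, D z -> g z = h z) -> D y ->
  \sum_i pd i (pd i g) y = \sum_i pd i (pd i h) y.
Proof.
move=> oD H Dy; apply: eq_bigr => i _; apply: (pd_ext D _ _ i y oD _ Dy) => z Dz.
exact: (pd_ext D _ _ i z oD H Dz).
Qed.

(** The factorization of the Laplacian as conjugate Dirac operator after Dirac operator, at the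
    level of a symmetric matrix of second derivatives. *)
Lemma cliff_sum (w w' : 'I_n -> A) (H : 'I_n -> 'I_n -> A) :
  (forall p i, w' p * w i + w' i * w p = (p == i)%:R *: (2%:R : A)) ->
  (forall p i, H p i = H i p) -> \sum_p w' p * \sum_i w i * H p i = \sum_i H i i.
Proof.
move=> cliff sH; set X := LHS.
have E1 : X = \sum_p \sum_i w' p * w i * H p i.
  by apply: eq_bigr => p _; rewrite mulr_sumr; apply: eq_bigr => i _; rewrite mulrA.
have E2 : X = \sum_p \sum_i w' i * w p * H p i.
  rewrite E1 exchange_big /=; apply: eq_bigr => i _; apply: eq_bigr => p _.
  by rewrite sH.
have E3 : X + X = 2%:R *: \sum_p H p p.
  rewrite {1}E1 E2 -big_split /= scaler_sumr; apply: eq_bigr => p _.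
  rewrite -big_split /= (bigD1 p) //= big1 ?addr0 => [|i ip].
    by rewrite -mulrDl cliff eqxx scale1r mulr_natl scaler_nat.
  by rewrite -mulrDl cliff eq_sym (negbTE ip) scale0r mul0r.
have : 2%:R *: (X - \sum_p H p p) = 0 by rewrite scalerBr -E3 scaler_nat mulr2n subrr.
by move/eqP; rewrite scaler_eq0 pnatr_eq0 /= subr_eq0 => /eqP.
Qed.

End avalued.

(** * Absorbing a radial variable *)

Section lift.
Context {R : realType} {n1 n2 : nat}.
Variables (q : 'I_n1) (blk : pred 'I_n2) (e : 'I_n2 -> 'I_n1) (e' : 'I_n1 -> 'I_n2).
Hypothesis eK : forall s, ~~ blk s -> e s != q /\ e' (e s) = s.
Hypothesis e'K : forall i, i != q -> ~~ blk (e' i) /\ e (e' i) = i.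
Local Notation E1 := 'rV[R]_n1.
Local Notation E2 := 'rV[R]_n2.
Implicit Types (y : E2) (z : E1).

Definition rad y : R := Num.sqrt (\sum_(s | blk s) y ord0 s ^+ 2).
(** Takes a point whose block [blk] lies in the mirror to one where the block is replaced by its
    norm, in coordinate [q]; [e] and [e'] match the remaining coordinates. *)
Definition lft y : E1 := \row_i (if i == q then rad y else y ord0 (e' i)).

Lemma lftq y : lft y ord0 q = rad y.
Proof. by rewrite mxE eqxx. Qed.

Lemma sqsum_ge0 y : 0 <= \sum_(s | blk s) y ord0 s ^+ 2.
Proof. by apply: sumr_ge0 => s _; exact: sqr_ge0. Qed.

Lemma rad_sqr y : rad y ^+ 2 = \sum_(s | blk s) y ord0 s ^+ 2.
Proof. by rewrite sqr_sqrtr // sqsum_ge0. Qed.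

Lemma rad_ge0 y : 0 <= rad y.
Proof. exact: sqrtr_ge0. Qed.

Lemma rad0 y s : rad y = 0 -> blk s -> y ord0 s = 0.
Proof.
move=> r0 bs; have := rad_sqr y; rewrite r0 expr0n /= => /esym /eqP.
rewrite psumr_eq0; last by move=> u _; exact: sqr_ge0.
by move=> /allP /(_ s); rewrite mem_index_enum bs sqrf_eq0 => /(_ isT) /eqP.
Qed.

Lemma lft_other y s (t : R) : ~~ blk s ->
  lft (y + t *: delta_mx 0 s) = lft y + t *: delta_mx 0 (e s).
Proof.
move=> bs; have [esq e's] := eK s bs; apply/rowP => i; rewrite !mxE.
have [->|iq] := eqVneq i q.
  rewrite eq_sym (negbTE esq) mulr0 addr0 /rad; congr Num.sqrt; apply: eq_bigr => u bu.
  rewrite !mxE /=; case: eqP => [us|_]; last by rewrite mulr0 addr0.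
  by move: bs; rewrite -us bu.
have [_ ei] := e'K i iq.
by have -> : (i == e s) = (e' i == s) by apply/eqP/eqP => [->|<-].
Qed.

Lemma lft_blk y s (t : R) : blk s ->
  lft (y + t *: delta_mx 0 s) = lft y + (rad (y + t *: delta_mx 0 s) - rad y) *: delta_mx 0 q.
Proof.
move=> bs; apply/rowP => i; rewrite !mxE eqxx /=.
have [iq|iq] := eqVneq i q; first by rewrite mulr1 addrC subrK.
have [be _] := e'K i iq; rewrite mulr0 addr0; case: eqP => [es|_]; last by rewrite mulr0 addr0.
by move: be; rewrite es bs.
Qed.

Lemma rad_blk y s (t : R) : blk s ->
  rad (y + t *: delta_mx 0 s) = Num.sqrt (rad y ^+ 2 + 2 * t * y ord0 s + t ^+ 2).
Proof.
move=> bs; rewrite rad_sqr /rad; congr Num.sqrt.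
rewrite (bigD1 s) //= [X in _ = X + _ + _](bigD1 s) //= !mxE !eqxx mulr1.
have -> : \sum_(i | blk i && (i != s)) (y + t *: delta_mx 0 s) ord0 i ^+ 2 =
          \sum_(i | blk i && (i != s)) y ord0 i ^+ 2.
  by apply: eq_bigr => u /andP[_ us]; rewrite !mxE (negbTE us) /= mulr0 addr0.
by set S := \sum_(i | _) _; ring.
Qed.

Lemma rad_cont y : {for y, continuous rad}.
Proof.
apply: (@continuous_comp _ _ _ (fun y : E2 => \sum_(s | blk s) y ord0 s ^+ 2) Num.sqrt).
  apply: (CR_cont 0 setT) => //; apply: CR_sum; first exact: openT.
  move=> s _; have oT : open [set: E2] by exact: openT.
  have := CR_mul 0 setT _ _ oT (CR_coord 0 _ s oT) (CR_coord 0 _ s oT).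
  by under eq_fun do rewrite -expr2.
exact: sqrt_continuous.
Qed.

Lemma lft_eps y (d : R) : 0 < d ->
  exists2 d' : R, 0 < d' & forall y', `|y' - y| < d' -> `|lft y' - lft y| < d.
Proof.
move=> d0; have /cont_eps /(_ d d0) [d1 d10 H1] := rad_cont y.
exists (Num.min d1 d); first by rewrite lt_min d10.
move=> y'; rewrite lt_min => /andP[/H1 A1 A2]; apply: rV_norm_lt => // i; rewrite !mxE.
case: eqP => // _; apply: le_lt_trans A2.
by have := coord_le_norm _ _ (y' - y) (e' i); rewrite !mxE.
Qed.

Lemma lft_open (D1 : set E1) : open D1 -> open [set y | D1 (lft y)].
Proof.
move=> oD; apply: openP_eps => y /= Dy; have [d d0 Hd] := open_eps _ _ oD Dy.
by have [d' d'0 Hd'] := lft_eps y d d0; exists d' => // y' /Hd' /Hd.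
Qed.

Lemma lft_cont (u : E1 -> R) y : {for lft y, continuous u} -> {for y, continuous (fun y => u (lft y))}.
Proof.
move=> /cont_eps H; apply/cont_eps => c c0; have [d d0 Hd] := H c c0.
by have [d' d'0 Hd'] := lft_eps y d d0; exists d' => // y' /Hd' /Hd.
Qed.

Variable D1 : set E1.
Hypothesis oD : open D1.
Hypothesis rD : forall z, D1 z -> D1 (rho q z).
Local Notation D2 := [set y | D1 (lft y)].

(** In a block direction the chain rule gives [(y_s / rad) D_q u = y_s L u], which is regular where
    [rad] is not. Where [rad = 0], the lifted point moves by [|t|] and [D_q u] vanishes by evenness,
    so the derivative is zero. *)
Lemma der_lft (u : E1 -> R) y s : smooth D1 u -> par D1 q 1 u -> D1 (lft y) ->
  is_derive y (delta_mx 0 s : E2) (fun y => u (lft y))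
    (if blk s then y ord0 s * Lq q u (lft y) else 'D_(delta_mx 0 (e s)) u (lft y)).
Proof.
move=> su pu Dy; case: ifPn => bs; last first.
  have /is_derive_eps H := smooth_der _ _ _ (e s) su Dy.
  apply/is_derive_eps => c c0; have [d d0 Hd] := H c c0; exists d => // t td.
  by rewrite lft_other //; exact: Hd.
have H := smooth_der _ _ _ q su Dy; have [r0|r0] := eqVneq (rad y) 0.
  have ys := rad0 y s r0 bs; rewrite ys mul0r.
  have z0 : 'D_(delta_mx 0 q) u (lft y) = 0 by rewrite -(Lq_mul D1) // lftq r0 mul0r.
  rewrite z0 in H; move: H => /is_derive_eps H; apply/is_derive_eps => c c0.
  have [d d0 Hd] := H c c0; exists d => // t td.
  rewrite lft_blk // rad_blk // r0 expr0n /= ys mulr0 !add0r sqrtr_sqr subr0 !mulr0.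
  have tq : `|(`|t|)| < d by rewrite normr_id.
  have := Hd _ tq; rewrite !mulr0 normr_id; exact.
have rp : 0 < rad y by rewrite lt_neqAle eq_sym r0 rad_ge0.
have key : is_derive (0 : R) (1 : R)
    ((fun r : R => u (lft y + r *: delta_mx 0 q)) \o
     (fun t => Num.sqrt (rad y ^+ 2 + 2 * t * y ord0 s + t ^+ 2) - rad y))
    ('D_(delta_mx 0 q) u (lft y) * (y ord0 s / rad y)).
  apply: is_derive1_comp.
    have -> : Num.sqrt (rad y ^+ 2 + 2 * 0 * y ord0 s + 0 ^+ 2) - rad y = 0.
      by rewrite mulr0 mul0r !addr0 expr0n /= addr0 sqrtr_sqr ger0_norm ?rad_ge0 // subrr.
    apply: (is_derive_line u (lft y) (delta_mx 0 q) 0 _).1.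
    by rewrite scale0r addr0.
  have K1 : is_derive (0 : R) (1 : R) (fun t => rad y ^+ 2 + 2 * t * y ord0 s + t ^+ 2) (2 * y ord0 s).
    apply/is_derive_eps => c c0; exists c => // t tc.
    have -> : rad y ^+ 2 + 2 * (0 + t *: 1) * y ord0 s + (0 + t *: 1) ^+ 2
       - (rad y ^+ 2 + 2 * 0 * y ord0 s + 0 ^+ 2) - t * (2 * y ord0 s) = t * t.
      by rewrite scaleRE; ring.
    by rewrite normrM; apply: ler_wpM2r => //; exact: ltW.
  have p0 : 0 < rad y ^+ 2 + 2 * 0 * y ord0 s + 0 ^+ 2.
    by rewrite mulr0 mul0r !addr0 expr0n /= addr0 exprn_gt0.
  have K2 := @is_derive1_comp R Num.sqrt (fun t => rad y ^+ 2 + 2 * t * y ord0 s + t ^+ 2) 0 _ _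
    (is_derive1_sqrt p0) K1.
  have K3 : is_derive (0 : R) (1 : R) (fun _ : R => rad y) 0 by exact: is_derive_cst.
  have K4 := is_deriveB K2 K3.
  apply: is_derive_eq K4 _.
  rewrite mulr0 mul0r !addr0 expr0n /= addr0 sqrtr_sqr ger0_norm ?rad_ge0 // subr0.
  by field.
have -> : y ord0 s * Lq q u (lft y) = 'D_(delta_mx 0 q) u (lft y) * (y ord0 s / rad y).
  by rewrite -(Lq_mul D1) // lftq; field.
have L0 : is_derive (y + 0 *: delta_mx 0 s) (delta_mx 0 s : E2) (fun y => u (lft y))
  ('D_(delta_mx 0 q) u (lft y) * (y ord0 s / rad y)).
  apply: (is_derive_line (fun y => u (lft y)) y (delta_mx 0 s) 0 _).2.
  apply: (@eq_ind _ _ (fun f => is_derive (0:R) (1:R) f _) key).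
  by apply/funext => t; rewrite /= lft_blk // rad_blk.
by rewrite scale0r addr0 in L0.
Qed.

(** The partial derivatives of a lifted even function are again lifted even functions, up to a
    coordinate factor, so the induction on the order closes. *)
Lemma smooth_lft (u : E1 -> R) : smooth D1 u -> par D1 q 1 u -> smooth D2 (fun y => u (lft y)).
Proof.
move=> su pu p; have oD2 := lft_open _ oD; elim: p u su pu => [|p IH] u su pu.
  by split => // y Dy; apply: lft_cont; exact: smooth_cont su Dy.
apply: (CR_S p D2 _ (fun s y => if blk s then y ord0 s * Lq q u (lft y)
    else 'D_(delta_mx 0 (e s)) u (lft y))) => //.
- by move=> y Dy; apply: lft_cont; exact: smooth_cont su Dy.
- by move=> y s Dy; exact: der_lft.
move=> s; case: (boolP (blk s)) => bs.
  apply: CR_mul => //; first exact: CR_coord.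
  by apply: IH; [exact: Lq_smooth|exact: Lq_parq].
apply: (IH (fun z => 'D_(delta_mx 0 (e s)) u z)); first exact: smooth_D1.
have := par_D D1 q 1 u (e s) oD rD su pu; have [/negbTE esq _] := eK s bs.
by rewrite /sgn esq mulr1.
Qed.

End lift.

(** * The Dirac operator and the Laplacian on [phi] *)

Section fueter_step.
Context {R : realType} {A : falgType R} {n1 n2 : nat}.
Variables (q : 'I_n1) (blk : pred 'I_n2) (e : 'I_n2 -> 'I_n1) (e' : 'I_n1 -> 'I_n2).
Hypothesis eK : forall s, ~~ blk s -> e s != q /\ e' (e s) = s.
Hypothesis e'K : forall i, i != q -> ~~ blk (e' i) /\ e (e' i) = i.
Local Notation E1 := 'rV[R]_n1.
Local Notation E2 := 'rV[R]_n2.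
Local Notation lift := (@lft R n1 n2 q blk e').
Variable D1 : set E1.
Hypothesis oD : open D1.
Hypothesis rD : forall z, D1 z -> D1 (rho q z).
Local Notation D2 := [set y | D1 (lift y)].
Implicit Types (g a b : E1 -> A) (z : E1).

Definition aev g := forall l, par D1 q 1 (cf g l).
Definition aodd g := forall l, par D1 q (-1) (cf g l).
Definition aL g : E1 -> A := amap (Lq q) g.
Definition aQ g : E1 -> A := amap (Q1 q) g.

Lemma aevP g : aev g <-> forall z, D1 z -> g (rho q z) = g z.
Proof.
split => [H z Dz|H l z Dz]; last by rewrite /cf H // mul1r.
by apply: cf_inj => l; have := H l z Dz; rewrite /cf mul1r.
Qed.

Lemma aoddP g : aodd g <-> forall z, D1 z -> g (rho q z) = - g z.
Proof.
split => [H z Dz|H l z Dz]; last by rewrite /cf H // acoordN mxE mulN1r.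
apply: cf_inj => l; have := H l z Dz; rewrite /cf => ->.
by rewrite mulN1r acoordN [in RHS]mxE.
Qed.

Lemma aL_asm g : asm D1 g -> aev g -> asm D1 (aL g).
Proof. by move=> sg eg l; rewrite cf_amap; exact: Lq_smooth. Qed.

Lemma aL_aev g : asm D1 g -> aev g -> aev (aL g).
Proof. by move=> sg eg l; rewrite cf_amap; exact: Lq_parq. Qed.

Lemma aQ_asm g : asm D1 g -> aodd g -> asm D1 (aQ g).
Proof. by move=> sg eg l; rewrite cf_amap; exact: Q1_smooth. Qed.

Lemma aQ_aev g : aodd g -> aev (aQ g).
Proof. by move=> eg l; rewrite cf_amap; exact: Q1_parq. Qed.

Lemma aQ_mul g z : aodd g -> D1 z -> z ord0 q *: aQ g z = g z.
Proof.
move=> eg Dz; apply: cf_inj => l; rewrite acoordZ mxE amapE.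
exact: Q1_mul (eg l) Dz.
Qed.

Lemma aL_mul g z : asm D1 g -> aev g -> D1 z -> z ord0 q *: aL g z = pd q g z.
Proof.
move=> sg eg Dz; apply: cf_inj => l; rewrite acoordZ mxE amapE (Lq_mul D1) //.
by rewrite (pdE D1) //; exact: asm_AC.
Qed.

Lemma aL_lin (I : Type) (r : seq I) (c : I -> A) (F : I -> E1 -> A) z :
  (forall i, asm D1 (F i)) -> (forall i, aev (F i)) -> D1 z ->
  aL (fun y => \sum_(i <- r) c i * F i y) z = \sum_(i <- r) c i * aL (F i) z.
Proof.
move=> sF eF Dz; apply: (amap_lin _ (fun u => smooth D1 u /\ par D1 q 1 u)).
- move=> J s d G HG; split.
    by move=> p; apply: CR_sum => // j _; apply: CR_scale => //; exact: (HG j).1.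
  by move=> x Dx; rewrite mul1r; apply: eq_bigr => j _; rewrite (HG j).2 // mul1r.
- by move=> J s d G HG; apply: (Lq_sum D1) => // j; [exact: (HG j).1|exact: (HG j).2].
by move=> i l; split; [exact: sF|exact: eF].
Qed.

Lemma aL_ext g g' z : (forall y, D1 y -> g y = g' y) -> D1 z -> aL g z = aL g' z.
Proof.
move=> H Dz; apply: cf_inj => l; rewrite !amapE; apply: (Lq_ext D1) => // y Dy.
by rewrite /cf H.
Qed.

Lemma aL_pd g i z : i != q -> asm D1 g -> aev g -> D1 z -> pd i (aL g) z = aL (pd i g) z.
Proof.
move=> iq sg eg Dz; apply: cf_inj => l; rewrite (pdE D1) //; last by apply: asm_AC; exact: aL_asm.
rewrite cf_amap amapE (Lq_D D1) //; apply: (Lq_ext D1) => // y Dy.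
by rewrite /cf (pdE D1) //; exact: asm_AC.
Qed.

Lemma aev_pd g i : i != q -> asm D1 g -> aev g -> aev (pd i g).
Proof.
move=> iq sg eg l z Dz; rewrite /cf !(pdE D1) //; try exact: asm_AC; last exact: rD.
by have := par_D D1 q 1 _ i oD rD (sg l) (eg l) z Dz; rewrite /sgn (negbTE iq) mulr1.
Qed.

Lemma asm_lft g : asm D1 g -> aev g -> asm D2 (fun y => g (lift y)).
Proof. by move=> sg eg l; apply: (smooth_lft q blk e e' eK e'K D1 oD rD (cf g l)). Qed.

Lemma pd_lft g s (y : E2) : asm D1 g -> aev g -> D2 y ->
  pd s (fun y => g (lift y)) y = if blk s then y ord0 s *: aL g (lift y) else pd (e s) g (lift y).
Proof.
move=> sg eg Dy; apply: cf_inj => l; rewrite (pdE D2) //; last by apply: asm_AC; exact: asm_lft.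
have [_ ->] := der_lft q blk e e' eK e'K D1 oD rD (cf g l) y s (sg l) (eg l) Dy.
case: ifP => _; first by rewrite acoordZ mxE amapE.
by rewrite (pdE D1) //; exact: asm_AC.
Qed.

Variables w w' : 'I_n2 -> A.
Hypothesis cliff : forall p i, w' p * w i + w' i * w p = (p == i)%:R *: (2%:R : A).
Hypothesis wblk : forall s, blk s -> w' s = - w s.
Hypothesis wcomm : forall p s, ~~ blk p -> blk s -> w p * w s = w s * w' p.
Let d : nat := #|blk|.

Definition Xb (y : E2) : A := \sum_(s | blk s) y ord0 s *: w s.
Definition phi a b (y : E2) : A := a (lift y) + Xb y * b (lift y).

Definition pair_ok (k : nat) a b := [/\ asm D1 a, asm D1 b, aev a, aev b &
  forall z, D1 z ->
    \sum_(s | ~~ blk s) w s * pd (e s) a z = (k.*2.+1)%:R *: b z + z ord0 q ^+ 2 *: aL b z /\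
    \sum_(s | ~~ blk s) w' s * pd (e s) b z = - aL a z].

Lemma asm_zz g : asm D1 g -> asm D1 (fun z => z ord0 q ^+ 2 *: g z).
Proof.
by move=> sg l; rewrite cf_scal; apply: smooth_zz.
Qed.

Lemma aL_zz g z : asm D1 g -> aev g -> D1 z ->
  aL (fun z => z ord0 q ^+ 2 *: g z) z = 2%:R *: g z + z ord0 q ^+ 2 *: aL g z.
Proof.
move=> sg eg Dz; apply: cf_inj => l; rewrite amapE cf_scal (Lq_zz D1) // acoord_lin2 amapE.
by [].
Qed.

Lemma aL_comb (k : R) b z : asm D1 b -> aev b -> D1 z ->
  aL (fun z => k *: b z + z ord0 q ^+ 2 *: aL b z) z =
  (k + 2%:R) *: aL b z + z ord0 q ^+ 2 *: aL (aL b) z.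
Proof.
move=> sb eb Dz; have sL := aL_asm _ sb eb; have eL := aL_aev _ sb eb.
pose F (i : bool) := if i then b else fun z => z ord0 q ^+ 2 *: aL b z.
have sF i : asm D1 (F i) by case: i => //; exact: asm_zz.
have eF i : aev (F i) by case: i => //= l; rewrite cf_scal; exact: par_zz.
have := aL_lin bool [:: true; false] (fun i => if i then k *: 1 else 1) F z sF eF Dz.
rewrite big_cons big_seq1 -scalerAl !mul1r (aL_zz (aL b)) // addrA -scalerDl => <-.
apply: aL_ext Dz => x Dx; by rewrite big_cons big_seq1 -scalerAl !mul1r.
Qed.

(** [L] commutes with the derivatives in the other coordinates, and
    [L (z^2 L b) = 2 L b + z^2 L (L b)] raises [2 k + 1] by two. *)
Lemma pair_L k a b : pair_ok k a b -> pair_ok k.+1 (aL a) (aL b).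
Proof.
move=> [sa sb ea eb H]; split; [exact: aL_asm|exact: aL_asm|exact: aL_aev|exact: aL_aev|].
have eq s : ~~ blk s -> e s != q by move=> /eK[].
have comm (W : 'I_n2 -> A) g z : asm D1 g -> aev g -> D1 z ->
  \sum_(s | ~~ blk s) W s * pd (e s) (aL g) z =
  aL (fun z => \sum_(s | ~~ blk s) W s * pd (e s) g z) z.
  move=> sg eg Dz.
  (* Setting the terms with index in the block to [0] makes the whole family smooth and even, as
     [aL_lin] requires. *)
  pose F s := if ~~ blk s then pd (e s) g else fun _ => 0.
  have F0 : asm D1 (fun _ : E1 => (0 : A)).
    move=> l p; apply: (CR_ext p D1 (fun _ => 0)) => //; last exact: CR_cst.
    by move=> y _; rewrite /cf acoord0 mxE.
  have sF s : asm D1 (F s) by rewrite /F; case: ifP => // bs; exact: asm_pd.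
  have eF s : aev (F s).
    rewrite /F; case: ifPn => bs; first by apply: aev_pd => //; exact: eq.
    by apply/aevP.
  rewrite -big_filter; under [in RHS]eq_fun do rewrite -big_filter.
  rewrite -[LHS](_ : \sum_(s <- [seq s <- index_enum _ | ~~ blk s]) W s * aL (F s) z = _).
    rewrite -(aL_lin _ _ W F z sF eF Dz); apply: aL_ext Dz => x Dx.
    by rewrite !big_filter; apply: eq_bigr => s bs; rewrite /F bs.
  rewrite !big_filter; apply: eq_bigr => s bs; rewrite aL_pd //; last exact: eq.
  by rewrite /F bs.
move=> z Dz; split.
  rewrite comm // (aL_ext _ (fun z => (k.*2.+1)%:R *: b z + z ord0 q ^+ 2 *: aL b z)) //; last first.
    by move=> x Dx; have [-> _] := H x Dx.
  by rewrite aL_comb // -natrD doubleS addn2.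
rewrite comm // (aL_ext _ (fun z => \sum_(i <- [:: tt]) (-1) * aL a z)) //; last first.
  by move=> x Dx; have [_ ->] := H x Dx; rewrite big_seq1 mulN1r.
rewrite (aL_lin _ _ (fun _ => -1) (fun _ => aL a)) //; first by rewrite big_seq1 mulN1r.
  by move=> _; exact: aL_asm.
by move=> _; exact: aL_aev.
Qed.

Lemma Xb_lin b (y : E2) : Xb y * b (lift y) =
  \sum_(s <- [seq s <- index_enum _ | blk s]) w s * (y ord0 s *: b (lift y)).
Proof.
rewrite /Xb big_filter mulr_suml; apply: eq_bigr => s _.
by rewrite -scalerAl scalerAr.
Qed.

Lemma asm_Xb b : asm D1 b -> aev b -> asm D2 (fun y => Xb y * b (lift y)).
Proof.
move=> sb eb; have oD2 := lft_open q blk e' _ oD.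
apply: (asm_ext D2 (fun y => \sum_(s <- [seq s <- index_enum _ | blk s]) w s * (y ord0 s *: b (lift y)))) => //.
  by move=> y _; rewrite Xb_lin.
by apply: asm_lin => // s; apply: asm_coord => //; exact: asm_lft.
Qed.

Lemma asm_phi a b : asm D1 a -> asm D1 b -> aev a -> aev b -> asm D2 (phi a b).
Proof.
move=> sa sb ea eb; have oD2 := lft_open q blk e' _ oD.
by apply: asm_add => //; [exact: asm_lft|exact: asm_Xb].
Qed.

Lemma pd_phi a b s (y : E2) : asm D1 a -> asm D1 b -> aev a -> aev b -> D2 y ->
  pd s (phi a b) y = pd s (fun y => a (lift y)) y + Xb y * pd s (fun y => b (lift y)) y +
    (if blk s then w s * b (lift y) else 0).
Proof.
move=> sa sb ea eb Dy; have oD2 := lft_open q blk e' _ oD.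
have sbl := asm_lft _ sb eb.
rewrite (pd_add D2) //; [|by apply: asm_AC; exact: asm_lft|by apply: asm_AC; exact: asm_Xb].
rewrite -addrA; congr (_ + _).
rewrite (pd_ext D2 _ (fun y => \sum_(s <- [seq s <- index_enum _ | blk s]) w s * (y ord0 s *: b (lift y)))) //; last first.
  by move=> x _; rewrite Xb_lin.
rewrite (pd_lin D2) //; last by move=> k; apply: asm_AC; exact: asm_coord.
rewrite /Xb mulr_suml big_filter.
transitivity (\sum_(i | blk i) (y ord0 i *: w i * pd s (fun y => b (lift y)) y +
   (s == i)%:R *: (w i * b (lift y)))).
  by apply: eq_bigr => i _; rewrite (pd_coord D2) // mulrDr -!scalerAr -scalerAl.
rewrite big_split /=; congr (_ + _); case: ifPn => bs.
  rewrite (bigD1 s) //= eqxx scale1r big1 ?addr0 // => i /andP[_ /negbTE].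
  by rewrite eq_sym => ->; rewrite scale0r.
rewrite big1 // => i bi; case: eqP => [si|_]; last by rewrite scale0r.
by move: bs; rewrite si bi.
Qed.

Lemma w_sq s : blk s -> w s * w s = - 1.
Proof.
move=> bs; have := cliff s s; rewrite eqxx scale1r wblk // -mulr2n mulNr => /eqP.
by rewrite mulNrn eqr_oppLR -mulNrn -subr_eq0 -mulrnBl -scaler_nat scaler_eq0 pnatr_eq0 /= subr_eq0 => /eqP.
Qed.

Lemma w_anti s t : blk s -> blk t -> s != t -> w s * w t = - (w t * w s).
Proof.
move=> bs bt st; have := cliff s t; rewrite (negbTE st) scale0r !wblk // !mulNr -opprD => /eqP.
by rewrite oppr_eq0 addr_eq0 => /eqP.
Qed.

(** The double sum is added to its transpose: off-diagonal terms cancel by anticommutation, and each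
    diagonal term is [- y_s^2]. *)
Lemma Xb_sq (y : E2) : Xb y * Xb y = - (rad blk y ^+ 2) *: 1.
Proof.
rewrite /Xb mulr_suml; under eq_bigr do rewrite mulr_sumr.
set X := LHS; pose G s t := y ord0 s *: w s * (y ord0 t *: w t).
have E1 : X = \sum_(s | blk s) \sum_(t | blk t) G t s by rewrite /X exchange_big.
have E2 : X + X = (- 2 * rad blk y ^+ 2) *: 1.
  rewrite {2}E1 /X -big_split /= rad_sqr mulr_sumr scaler_suml; apply: eq_bigr => s bs.
  rewrite -big_split /= (bigD1 s) //= big1 => [|t /andP[bt ts]].
    have Gs : G s s = (- y ord0 s ^+ 2) *: 1.
      by rewrite /G -scalerAl -scalerAr w_sq // scalerA scalerN -expr2 scaleNr.
    by rewrite addr0 -/(G s s) Gs -scalerDl; congr (_ *: _); ring.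
  rewrite /G -!scalerAl -!scalerAr [w t * w s]w_anti // !scalerN !scalerA [y ord0 t * _]mulrC.
  by rewrite subrr.
have : 2%:R *: (X + rad blk y ^+ 2 *: 1) = 0.
  by rewrite scalerDr scaler_nat mulr2n E2 scalerA -scalerDl mulNr addNr scale0r.
move/eqP; rewrite scaler_eq0 pnatr_eq0 /= addr_eq0 => /eqP ->.
by rewrite scaleNr.
Qed.

(** Write [X] for [Xb y]. Outside the block, [wcomm] moves [X] to the front and conjugates the
    coefficients, giving [P a + X Pbar b]. The block gives [X L a + X^2 L b - d b]. The equations of
    the pair cancel the terms in [L a], and [X^2 = - z^2] those in [L b]. *)
Lemma dirac_phi k a b (y : E2) : pair_ok k a b -> D2 y ->
  \sum_s w s * pd s (phi a b) y = (k.*2.+1%:R - d%:R) *: b (lift y).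
Proof.
move=> [sa sb ea eb H] Dy; have [H1 H2] := H _ Dy.
rewrite (bigID blk) /=.
have -> : \sum_(s | ~~ blk s) w s * pd s (phi a b) y =
  \sum_(s | ~~ blk s) w s * pd (e s) a (lift y) + Xb y * \sum_(s | ~~ blk s) w' s * pd (e s) b (lift y).
  rewrite mulr_sumr -big_split /=; apply: eq_bigr => s bs.
  rewrite pd_phi // !pd_lft // (negbTE bs) addr0 mulrDr; congr (_ + _).
  rewrite !mulrA; congr (_ * _); rewrite /Xb mulr_sumr mulr_suml; apply: eq_bigr => t bt.
  by rewrite -scalerAr -scalerAl wcomm.
apply: etrans (congr2 (fun u v => _ + (u + Xb y * v)) H1 H2) _.
have -> : \sum_(s | blk s) w s * pd s (phi a b) y =
  Xb y * aL a (lift y) + Xb y * Xb y * aL b (lift y) - d%:R *: b (lift y).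
  transitivity (\sum_(s | blk s) (y ord0 s *: w s * aL a (lift y) +
      y ord0 s *: w s * (Xb y * aL b (lift y)) - b (lift y))).
    apply: eq_bigr => s bs; rewrite pd_phi // !pd_lft // bs !mulrDr; congr (_ + _ + _).
    - by rewrite -scalerAr -scalerAl.
    - by rewrite -!scalerAr -scalerAl.
    - by rewrite mulrA w_sq // mulN1r.
  rewrite !big_split /= -!mulr_suml mulrA; congr (_ + _).
  by rewrite sumr_const /d scaler_nat mulNrn.
rewrite Xb_sq lftq scaleNr mulNr -scalerAl mul1r mulrN scalerBl.
by rewrite [LHS]addrC !addrA subrK addrK.
Qed.

(** The Dirac operator reduces [phi] to a multiple of [b], on which the conjugate operator gives
    [- (L a + X L b)]: the part outside the block is the second equation of the pair, the block part
    is the chain rule. *)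
Lemma lap_phi k a b (y : E2) : pair_ok k a b -> D2 y ->
  \sum_s pd s (pd s (phi a b)) y = (d%:R - k.*2.+1%:R) *: phi (aL a) (aL b) y.
Proof.
move=> ok Dy; have [sa sb ea eb H] := ok; have [_ H2] := H _ Dy.
have oD2 := lft_open q blk e' _ oD.
have sp := asm_phi _ _ sa sb ea eb; have sbl := asm_lft _ sb eb.
have sym p i : pd p (pd i (phi a b)) y = pd i (pd p (phi a b)) y.
  exact: (pd_Schwarz D2 _ i p y oD2 sp Dy).
apply: etrans (esym (cliff_sum w w' (fun p i => pd p (pd i (phi a b)) y) cliff sym)) _.
have step p : \sum_i w i * pd p (pd i (phi a b)) y =
    (k.*2.+1%:R - d%:R) *: pd p (fun y => b (lift y)) y.
  rewrite -(pd_lin D2 _ (index_enum _) w (fun i => pd i (phi a b))) //; last first.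
    by move=> i; apply: AC_pd => //; exact: asm_AC.
  rewrite (pd_ext D2 _ (fun y => ((k.*2.+1%:R - d%:R) *: 1) * b (lift y)) p y oD2 _ Dy); last first.
    by move=> x Dx; rewrite (dirac_phi k) // -scalerAl mul1r.
  by rewrite (pd_mul D2) // -?scalerAl ?mul1r //; exact: asm_AC.
under eq_bigr do rewrite step -scalerAr.
rewrite -scaler_sumr -opprB scaleNr -scalerN; congr (_ *: _).
rewrite (bigID blk) /=.
have -> : \sum_(i | ~~ blk i) w' i * pd i (fun y => b (lift y)) y = - aL a (lift y).
  by rewrite -H2; apply: eq_bigr => s bs; rewrite pd_lft // (negbTE bs).
have -> : \sum_(i | blk i) w' i * pd i (fun y => b (lift y)) y = - (Xb y * aL b (lift y)).
  rewrite /Xb mulr_suml -sumrN; apply: eq_bigr => s bs; rewrite pd_lft // bs wblk //.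
  by rewrite -scalerAr -scalerAl mulNr scalerN.
by rewrite opprD !opprK addrC.
Qed.

End fueter_step.

(** * Lists of steps and slices *)

Section rowat.
Context {R : realType}.

Lemma rowat_lt n (y : 'rV[R]_n) k (H : (k < n)%N) : rowat y k = y ord0 (Ordinal H).
Proof. by rewrite /rowat insubT. Qed.

Lemma rowat_ord n (y : 'rV[R]_n) (k : 'I_n) : rowat y k = y ord0 k.
Proof. by rewrite (rowat_lt _ _ _ (ltn_ord k)); congr (y _ _); exact: val_inj. Qed.

Lemma rowat_mk n (f : nat -> R) k : rowat (\row_(i < n) f i) k = if (k < n)%N then f k else 0.
Proof.
case: ltnP => H; first by rewrite (rowat_lt _ _ _ H) mxE.
by rewrite /rowat insubF // ltnNge H.
Qed.

Definition liftf (T1 T2 : seq nat) (y : 'rV[R]_(sdim T2)) (i : nat) : R :=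
  if (i <= t0 T1)%N then rowat y i
  else if i == (t0 T1).+1 then
    Num.sqrt (\sum_(s < (t0 T2).+1 | (t0 T1 < s)%N) rowat y s ^+ 2)
  else rowat y ((t0 T2).+1 + (i - (t0 T1).+2)).

(** Written with natural indices, so that it makes sense for any two lists, in particular [drop h T]
    and [drop h.+1 T]. For lists in explicit form [lift1E] identifies it with [lft]. *)
Definition lift1 (T1 T2 : seq nat) (y : 'rV[R]_(sdim T2)) : 'rV[R]_(sdim T1) :=
  \row_(i < sdim T1) liftf T1 T2 y i.

End rowat.

Lemma steps_lt T i k : sorted ltn T -> (i < k < size T)%N -> (tstep T i < tstep T k)%N.
Proof.
move=> sT /andP[ik kT]; apply: (sorted_ltn_nth ltn_trans) => //; rewrite inE //.
exact: ltn_trans kT.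
Qed.

Lemma steps_le T i k : sorted ltn T -> (i <= k < size T)%N -> (tstep T i <= tstep T k)%N.
Proof.
move=> sT /andP[ik kT]; case: (ltngtP i k) ik => // [ik _|-> //].
by apply: ltnW; apply: steps_lt => //; rewrite ik.
Qed.

Lemma t0_drop h T : t0 (drop h T) = tstep T h.
Proof. by rewrite /t0 -nth0 nth_drop addn0. Qed.

Lemma tau_drop h T : tau (drop h T) = (tau T - h)%N.
Proof. rewrite /tau size_drop; lia. Qed.

(** Taking the norms of the first [h + 1] blocks amounts to taking that of the last one and then
    those of the others, so consecutive domains [Dh] differ by a single block. *)
Lemma liftD_step (R : realType) (T : seq nat) h (y : 'rV[R]_(sdim (drop h.+1 T))) :
  sorted ltn T -> (h.+1 < size T)%N ->
  liftD T h.+1 y = liftD T h (lift1 (drop h T) (drop h.+1 T) y).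
Proof.
move=> sT hT; apply/rowP => i; rewrite !mxE.
have ht : (tstep T h < tstep T h.+1)%N by apply: steps_lt => //; lia.
have t0h : (t0 T <= tstep T h)%N.
  by rewrite -{1}(drop0 T) t0_drop; apply: steps_le => //; lia.
have sd : sdim (drop h T) = ((tstep T h).+1 + (tau T - h))%N by rewrite /sdim t0_drop tau_drop.
have rl k : (k < sdim (drop h T))%N -> rowat (lift1 (drop h T) (drop h.+1 T) y) k =
    liftf (drop h T) (drop h.+1 T) y k by rewrite /lift1 rowat_mk => ->.
have hi := ltn_ord i; rewrite {2}/sdim in hi.
have tT : tau T = (size T).-1 by [].
case: ifPn => i0; first by rewrite rl ?sd /liftf ?t0_drop ?ifT //; lia.
case: ifPn => i1; last first.
  rewrite ifF; last by lia.
  rewrite rl ?sd /liftf !t0_drop; last by lia.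
  rewrite ifF; last by lia.
  rewrite ifF; last by apply/eqP; lia.
  by congr (rowat y _); lia.
set u := (i - (t0 T).+1)%N in i1 *.
case: ifPn => i2.
  congr Num.sqrt; rewrite !t0_drop.
  rewrite -(big_mkord (fun s => inblock T u s) (fun s => rowat y s ^+ 2)).
  rewrite -(big_mkord (fun s => inblock T u s) (fun s => rowat (lift1 (drop h T) (drop h.+1 T) y) s ^+ 2)).
  have hh : ((tstep T h).+1 <= (tstep T h.+1).+1)%N by lia.
  rewrite (big_cat_nat (leq0n _) hh) /=.
  rewrite [X in _ + X]big_nat_cond [X in _ + X]big_pred0 ?addr0; last first.
    move=> s; rewrite /inblock; have : (tstep T u.+1 <= tstep T h)%N by apply: steps_le => //; lia.
    lia.
  rewrite big_nat_cond [RHS]big_nat_cond; apply: eq_bigr => s /andP[sh _].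
  by rewrite rl ?sd /liftf ?t0_drop ?ifT //; lia.
have uh : u = h by lia.
rewrite !t0_drop uh rl ?sd; last by lia.
rewrite /liftf !t0_drop subnn addn0 ifF; last by lia.
rewrite eqxx; congr Num.sqrt; apply: eq_bigl => s; rewrite /inblock.
by have /ltnSE -> := ltn_ord s; rewrite andbT.
Qed.

Lemma Dh_step (R : realType) (T : seq nat) (D : set 'rV[R]_(sdim T)) h
  (y : 'rV[R]_(sdim (drop h.+1 T))) : sorted ltn T -> (h.+1 < size T)%N ->
  Dh T D h.+1 y = Dh T D h (lift1 (drop h T) (drop h.+1 T) y).
Proof. by move=> sT hT; rewrite /Dh /mkset liftD_step. Qed.

Lemma inblock_gt T u s : sorted ltn T -> (u < tau T)%N -> inblock T u s -> (t0 T < s)%N.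
Proof.
have -> : t0 T = tstep T 0 by rewrite /t0 -nth0.
move=> sT; rewrite /inblock /tau => uT.
have : (tstep T 0 <= tstep T u)%N by apply: steps_le => //; lia.
lia.
Qed.

Lemma inblock_uniq T u u' s : sorted ltn T -> (u < tau T)%N -> (u' < tau T)%N ->
  inblock T u s -> inblock T u' s -> u = u'.
Proof.
move=> sT; wlog uu : u u' / (u < u')%N.
  move=> H uT uT' b b'; case: (ltngtP u u') => // [uu|uu]; [exact: H|apply/esym; exact: H].
rewrite /inblock /tau => uT uT'; have : (tstep T u.+1 <= tstep T u')%N by apply: steps_le => //; lia.
lia.
Qed.

Section pt.
Context {R : realType} {A : falgType R} {N : nat}.
Variables (v : 'I_N.+1 -> A).
Implicit Types (T : seq nat) (j : 'rV[R]_N.+1).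

Definition ptf T j (i : nat) (s : 'I_N.+1) : R :=
  if (i <= t0 T)%N then (i == s :> nat)%:R else (inblock T (i - (t0 T).+1) s)%:R * j ord0 s.

(** The slice as a linear map: the rows are the coordinates of [v_0, ..., v_t0, J_1, ..., J_tau],
    which are orthonormal by [ptf_orth]. *)
Definition ptM T j : 'M[R]_(sdim T, N.+1) := \matrix_(i, s) ptf T j i s.

Lemma ptE T j y : sorted ltn T -> pt T j y = y *m ptM T j.
Proof.
move=> sT; apply/rowP => s; rewrite !mxE.
have -> : \sum_(i < sdim T) y ord0 i * ptM T j i s =
   \sum_(i < (t0 T).+1 + tau T) rowat y i * ptf T j i s.
  by apply: eq_bigr => i _; rewrite mxE rowat_ord.
rewrite big_split_ord /=.
have H1 : \sum_(i < tau T) rowat y ((t0 T).+1 + i) * ptf T j ((t0 T).+1 + i) s =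
   \sum_(h < tau T | inblock T h s) rowat y ((t0 T).+1 + h) * j ord0 s.
  rewrite [RHS]big_mkcond /=; apply: eq_bigr => i _; rewrite /ptf ifF; last by lia.
  rewrite addKn; case: (inblock T i s); by rewrite ?mul1r // mul0r mulr0.
rewrite H1.
have H2 : \sum_(i < (t0 T).+1) rowat y i * ptf T j i s = if (s <= t0 T)%N then rowat y s else 0.
  case: ifPn => st.
    have st' : (s < (t0 T).+1)%N by [].
    rewrite (bigD1 (Ordinal st')) //= big1 ?addr0 => [|i /eqP ne].
      by rewrite /ptf st eqxx mulr1.
    rewrite /ptf ifT; last by have := ltn_ord i; lia.
    case: eqP => [E|]; last by rewrite mulr0.
    by case: ne; apply: val_inj.
  apply: big1 => i _; rewrite /ptf ifT; last by have := ltn_ord i; lia.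
  case: eqP => [E|]; last by rewrite mulr0.
  by have := ltn_ord i; rewrite E ltnS (negbTE st).
rewrite H2; case: ifPn => st; last by rewrite add0r.
rewrite [X in _ + X]big_pred0 ?addr0 // => h; apply/negP => b.
by have := inblock_gt _ _ _ sT (ltn_ord h) b; rewrite ltnNge st.
Qed.

Lemma ptf_orth T j i p : sorted ltn T -> (t0 T <= N)%N -> inTorus T j ->
  (i < sdim T)%N -> (p < sdim T)%N -> \sum_s ptf T j i s * ptf T j p s = (i == p)%:R.
Proof.
rewrite /sdim => sT tN jT; wlog ip : i p / (i <= p)%N.
  move=> H iT pT; case: (leqP i p) => ip; first exact: H.
  by rewrite eq_sym -H //; [apply: eq_bigr => s _; rewrite mulrC|exact: ltnW].
move=> iT pT; have [i0|i0] := leqP i (t0 T).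
  have iN : (i < N.+1)%N by lia.
  rewrite (bigD1 (Ordinal iN)) //= [X in _ + X]big1 => [|s /eqP ne]; last first.
    rewrite /ptf i0; case: eqP => [E|_]; last by rewrite mul0r.
    by case: ne; apply: val_inj.
  rewrite addr0 /ptf i0 eqxx mul1r; case: ifPn => p0 /=; first by rewrite eq_sym.
  case: (boolP (inblock _ _ _)) => b /=.
    have pt : (p - (t0 T).+1 < tau T)%N by lia.
    by have := inblock_gt _ _ _ sT pt b; rewrite ltnNge i0.
  by rewrite mul0r; case: eqP => // E; move: p0; rewrite -E i0.
have p0 : (t0 T < p)%N by exact: leq_trans ip.
have iu : (i - (t0 T).+1 < tau T)%N by lia.
have pu : (p - (t0 T).+1 < tau T)%N by lia.
rewrite /ptf [(i <= _)%N]leqNgt i0 [(p <= _)%N]leqNgt p0 /=.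
case: eqP => [<-|ne].
  transitivity (\sum_(s < N.+1 | inblock T (i - (t0 T).+1) s) j ord0 s ^+ 2); last exact: jT.
  rewrite [RHS]big_mkcond; apply: eq_bigr => s _.
  by case: (inblock _ _ _); rewrite /= ?mul0r ?mul1r ?expr2.
apply: big1 => s _; case: (boolP (inblock T (i - _) s)) => b; last by rewrite !mul0r.
case: (boolP (inblock T (p - _) s)) => b'; last by rewrite !mul0r mulr0.
by case: ne; have := inblock_uniq _ _ _ _ sT iu pu b b'; lia.
Qed.

Lemma wJE T j (i : 'I_(sdim T)) : (t0 T <= N)%N -> wJ v T j i = \sum_s ptf T j i s *: v s.
Proof.
move=> tN; rewrite /wJ /ptf; case: ifPn => i0.
  have iN : (i < N.+1)%N by lia.
  rewrite (bigD1 (Ordinal iN)) //= eqxx scale1r big1 ?addr0 => [|s /eqP ne].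
    by rewrite /vn insubT.
  case: eqP => [E|_]; last by rewrite scale0r.
  by case: ne; apply: val_inj.
rewrite /Jc big_mkcond /=; apply: eq_bigr => s _.
by case: (inblock _ _ _); rewrite ?mul1r // mul0r scale0r.
Qed.

Definition clifford_basis := [/\ v ord0 = 1, forall s, s != ord0 -> v s * v s = - 1 &
  forall s t, s != ord0 -> t != ord0 -> s != t -> v s * v t = - (v t * v s)].

Definition vc (s : 'I_N.+1) : A := if s == ord0 then v s else - v s.
Definition wc T j (i : nat) : A := \sum_s ptf T j i s *: vc s.

(** The Clifford relation is bilinear, hence passes from the basis to orthonormal combinations of
    it, such as the coefficients of a slice operator. *)
Lemma cliff_bilin (n : nat) (M : 'I_n -> 'I_N.+1 -> R) (a b : 'I_N.+1 -> A) (p i : 'I_n) :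
  (forall s t, a s * b t + a t * b s = (s == t)%:R *: (2%:R : A)) ->
  (forall p i, \sum_s M p s * M i s = (p == i)%:R) ->
  (\sum_s M p s *: a s) * (\sum_s M i s *: b s) + (\sum_s M i s *: a s) * (\sum_s M p s *: b s)
    = (p == i)%:R *: (2%:R : A).
Proof.
move=> H O.
have E1 x y : (\sum_s M x s *: a s) * (\sum_s M y s *: b s) =
    \sum_s \sum_t (M x s * M y t) *: (a s * b t).
  rewrite mulr_suml; apply: eq_bigr => s _; rewrite mulr_sumr; apply: eq_bigr => t _.
  by rewrite -scalerAl -scalerAr scalerA.
rewrite !E1 [X in _ + X]exchange_big -big_split /=.
transitivity (\sum_s (M p s * M i s) *: (2%:R : A)); last by rewrite -scaler_suml O.
apply: eq_bigr => s _; rewrite -big_split /= (bigD1 s) //= [X in _ + X]big1 => [|t ts].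
  by rewrite addr0 [M i s * _]mulrC -scalerDr H eqxx scale1r.
by rewrite [M i t * _]mulrC -scalerDr H eq_sym (negbTE ts) scale0r scaler0.
Qed.

Lemma v_cliff : clifford_basis -> forall s t, vc s * v t + vc t * v s = (s == t)%:R *: (2%:R : A).
Proof.
move=> [v0 vs va] s t; rewrite /vc; case: (eqVneq s t) => [<-|st].
  case: (eqVneq s ord0) => [->|s0]; first by rewrite v0 mulr1 scale1r.
  by rewrite mulNr vs // opprK scale1r.
rewrite scale0r; case: (eqVneq s ord0) st => [->|s0]; case: (eqVneq t ord0) => [->|t0] st.
- by [].
- by rewrite v0 mul1r mulr1 subrr.
- by rewrite v0 mul1r mulr1 addNr.
- by rewrite !mulNr va // opprK subrr.
Qed.

Lemma v_cliff' : clifford_basis -> forall s t, v s * vc t + v t * vc s = (s == t)%:R *: (2%:R : A).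
Proof.
move=> [v0 vs va] s t; rewrite /vc; case: (eqVneq s t) => [<-|st].
  case: (eqVneq s ord0) => [->|s0]; first by rewrite v0 mulr1 scale1r.
  by rewrite mulrN vs // opprK scale1r.
rewrite scale0r; case: (eqVneq s ord0) st => [->|s0]; case: (eqVneq t ord0) => [->|t0] st.
- by [].
- by rewrite v0 mul1r mulr1 addNr.
- by rewrite v0 mul1r mulr1 subrr.
- by rewrite !mulrN va // opprK subrr.
Qed.

Lemma wJ_cliff T j : clifford_basis -> sorted ltn T -> (t0 T <= N)%N -> inTorus T j ->
  forall p i : 'I_(sdim T), wc T j p * wJ v T j i + wc T j i * wJ v T j p = (p == i)%:R *: (2%:R : A).
Proof.
move=> hv sT tN jT p i; rewrite !wJE //.
apply: (cliff_bilin _ (fun p s => ptf T j p s) vc v p i); first exact: v_cliff.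
by move=> x y; rewrite ptf_orth.
Qed.

Lemma wJ_cliff' T j : clifford_basis -> sorted ltn T -> (t0 T <= N)%N -> inTorus T j ->
  forall p i : 'I_(sdim T), wJ v T j p * wc T j i + wJ v T j i * wc T j p = (p == i)%:R *: (2%:R : A).
Proof.
move=> hv sT tN jT p i; rewrite !wJE //.
apply: (cliff_bilin _ (fun p s => ptf T j p s) v vc p i); first exact: v_cliff'.
by move=> x y; rewrite ptf_orth.
Qed.

Lemma wcN T j (i : 'I_(sdim T)) : sorted ltn T -> (t0 T <= N)%N -> (0 < i)%N -> wc T j i = - wJ v T j i.
Proof.
move=> sT tN i0; rewrite wJE // /wc -sumrN; apply: eq_bigr => s _; rewrite /vc.
case: (eqVneq s ord0) => [->|_]; last by rewrite scalerN.
have -> : ptf T j i ord0 = 0; last by rewrite !scale0r oppr0.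
rewrite /ptf; case: ifPn => it; first by rewrite [_ == _]gtn_eqF.
have iu : (i - (t0 T).+1 < tau T)%N by have := ltn_ord i; rewrite {2}/sdim; lia.
case: (boolP (inblock _ _ _)) => b; last by rewrite mul0r.
by have := inblock_gt _ _ _ sT iu b.
Qed.

Lemma Jc_sq T j u : clifford_basis -> sorted ltn T -> (t0 T <= N)%N -> inTorus T j -> (u < tau T)%N ->
  Jc v T j u * Jc v T j u = - 1.
Proof.
move=> hv sT tN jT uT; have iT : ((t0 T).+1 + u < sdim T)%N by rewrite /sdim ltn_add2l.
have := wJ_cliff T j hv sT tN jT (Ordinal iT) (Ordinal iT).
rewrite wcN //= eqxx scale1r.
have -> : wJ v T j (Ordinal iT) = Jc v T j u by rewrite /wJ /= ifF ?addKn //; lia.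
move=> /eqP; rewrite -mulr2n mulNr mulNrn eqr_oppLR -mulNrn -subr_eq0 -mulrnBl.
by rewrite -scaler_nat scaler_eq0 pnatr_eq0 /= subr_eq0 => /eqP.
Qed.

End pt.

(** * An operator on functions on [V] that is radial on slices *)

Section slices.
Context {R : realType} {N : nat}.
Implicit Types (T : seq nat) (j : 'rV[R]_N.+1).

Definition qi T (u : 'I_(tau T)) : 'I_(sdim T) := rshift (t0 T).+1 u.

Lemma reflE T u (y : 'rV[R]_(sdim T)) : refl T u y = rho (qi T u) y.
Proof. by []. Qed.

Lemma qi_inj T : injective (qi T).
Proof. exact: rshift_inj. Qed.

Lemma pt_lin T j (c : R) (w z : 'rV[R]_(sdim T)) : sorted ltn T ->
  pt T j (c *: w + z) = c *: pt T j w + pt T j z.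
Proof. by move=> sT; rewrite !ptE // mulmxDl scalemxAl. Qed.

Lemma pt_mirror T j (z : 'rV[R]_(sdim T)) (s : 'I_N.+1) : (s <= t0 T)%N ->
  pt T j z ord0 s = rowat z s.
Proof. by move=> st; rewrite mxE st. Qed.

Lemma pt_block T j (z : 'rV[R]_(sdim T)) (u : 'I_(tau T)) (s : 'I_N.+1) : sorted ltn T ->
  inblock T u s -> pt T j z ord0 s = z ord0 (qi T u) * j ord0 s.
Proof.
move=> sT b; have st := inblock_gt _ _ _ sT (ltn_ord u) b; rewrite mxE leqNgt st /=.
rewrite (bigD1 u) //= big1 ?addr0 => [|h /andP[bh /eqP hu]]; last first.
  by case: hu; apply: val_inj; exact: inblock_uniq sT (ltn_ord h) (ltn_ord u) bh b.
by rewrite -(rowat_ord _ z (qi T u)).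
Qed.

Lemma pt_delta T j (u : 'I_(tau T)) (s : 'I_N.+1) : sorted ltn T ->
  pt T j (delta_mx 0 (qi T u)) ord0 s = if inblock T u s then j ord0 s else 0.
Proof.
move=> sT; rewrite ptE // -rowE !mxE /ptf ifF; last by rewrite /=; lia.
by rewrite /= addKn; case: (inblock _ _ _); rewrite ?mul1r ?mul0r.
Qed.

Lemma pt_ext T j j' (z : 'rV[R]_(sdim T)) : sorted ltn T ->
  (forall (u : 'I_(tau T)) (s : 'I_N.+1), inblock T u s -> z ord0 (qi T u) != 0 -> j ord0 s = j' ord0 s) ->
  pt T j z = pt T j' z.
Proof.
move=> sT H; apply/rowP => s; rewrite !mxE; case: ifP => // _; apply: eq_bigr => u b.
have -> : rowat z ((t0 T).+1 + u) = z ord0 (qi T u) by rewrite -(rowat_ord _ z (qi T u)).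
by case: (eqVneq (z ord0 (qi T u)) 0) => [->|z0]; rewrite ?mul0r // (H u s b z0).
Qed.

Definition flip (lo hi : nat) (x : 'rV[R]_N.+1) : 'rV[R]_N.+1 :=
  \row_s (if (lo < s <= hi)%N then - x ord0 s else x ord0 s).
Definition xbl (lo hi : nat) (x : 'rV[R]_N.+1) : 'rV[R]_N.+1 :=
  \row_s (if (lo < s <= hi)%N then x ord0 s else 0).
Definition bsq (lo hi : nat) (x : 'rV[R]_N.+1) : R :=
  \sum_(s < N.+1 | (lo < s <= hi)%N) x ord0 s ^+ 2.

(* On every slice this is [radial_op]; at [x] with vanishing block any direction of the block may be used. *)
Definition SopR (lo hi : nat) (G : 'rV[R]_N.+1 -> R) (x : 'rV[R]_N.+1) : R :=
  if bsq lo hi x == 0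
  then 'D_(delta_mx 0 (inord lo.+1)) (fun x' => 'D_(delta_mx 0 (inord lo.+1)) G x') x
  else (bsq lo hi x)^-1 * ('D_(xbl lo hi x) G x - 2^-1 * (G x - G (flip lo hi x))).

Lemma derive_line_eq n n' (G : 'rV[R]_n -> R) (psi : 'rV[R]_n' -> R) x v z w :
  (forall h : R, G (h *: v + x) = psi (h *: w + z)) -> 'D_v G x = 'D_w psi z.
Proof.
move=> H; rewrite /derive.
have -> // : (fun h : R => h^-1 *: ((G \o shift x) (h *: v) - G x)) =
    (fun h : R => h^-1 *: ((psi \o shift z) (h *: w) - psi z)).
apply/funext => h /=; have := H 0; rewrite !scale0r !add0r => ->.
by rewrite /shift /= H.
Qed.

(** On the slice the block component is [z_q J_u]. Differentiation along it is therefore [z_q D_q],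
    its squared norm is [z_q^2], and [flip] is the reflection of [z_q]. *)
Lemma Sop_slice_nz T j (u : 'I_(tau T)) (G : 'rV[R]_N.+1 -> R) (z : 'rV[R]_(sdim T)) : sorted ltn T -> inTorus T j ->
  z ord0 (qi T u) != 0 -> derivable (fun z => G (pt T j z)) z (delta_mx 0 (qi T u)) ->
  SopR (tstep T u) (tstep T u.+1) G (pt T j z) = radial_op (qi T u) (fun z => G (pt T j z)) z.
Proof.
move=> sT jT z0 dz; set q := qi T u.
have bE : bsq (tstep T u) (tstep T u.+1) (pt T j z) = z ord0 q ^+ 2.
  rewrite /bsq (eq_bigr (fun s => z ord0 q ^+ 2 * j ord0 s ^+ 2)) => [|s b].
    by rewrite -mulr_sumr [X in _ * X](jT u (ltn_ord u)) mulr1.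
  by rewrite (pt_block T j z u s sT b) exprMn.
have fE : flip (tstep T u) (tstep T u.+1) (pt T j z) = pt T j (rho q z).
  have -> : rho q z = (- 2 * z ord0 q) *: delta_mx 0 q + z.
    apply/rowP => k; rewrite !mxE eqxx /=; case: eqP => [->|_]; last by rewrite mulr0 add0r.
    by rewrite mulr1; ring.
  rewrite pt_lin //; apply/rowP => s; rewrite [in LHS]mxE [in RHS]mxE [X in _ = X + _]mxE pt_delta //.
  rewrite -/(inblock T u s); case: ifPn => b; last by rewrite mulr0 add0r.
  by rewrite (pt_block T j z u s sT b); ring.
have xE : xbl (tstep T u) (tstep T u.+1) (pt T j z) = z ord0 q *: pt T j (delta_mx 0 q).
  apply/rowP => s; rewrite [in LHS]mxE [in RHS]mxE pt_delta // -/(inblock T u s).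
  by case: ifPn => b; rewrite ?mulr0 // (pt_block T j z u s sT b).
rewrite /SopR bE sqrf_eq0 (negbTE z0) /radial_op (negbTE z0) fE; congr (_ * (_ - _)).
rewrite (derive_line_eq _ _ _ (fun z => G (pt T j z)) _ _ z (z ord0 q *: delta_mx 0 q)).
  by have [_ ->] := is_derive_scale _ _ _ (z ord0 q) _ (derivableP dz).
by move=> h; rewrite xE scalerA -pt_lin // scalerA.
Qed.

(** At [z_q = 0] the point does not determine [J_u]. The assumption that [J_u] is the first basis
    vector of the block matches the direction fixed in [SopR]. *)
Lemma Sop_slice_z T j (u : 'I_(tau T)) (G : 'rV[R]_N.+1 -> R) (z : 'rV[R]_(sdim T)) : sorted ltn T ->
  (tstep T u < N)%N -> (tstep T u < tstep T u.+1)%N ->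
  z ord0 (qi T u) = 0 ->
  (forall s : 'I_N.+1, inblock T u s -> j ord0 s = (s == (tstep T u).+1 :> nat)%:R) ->
  SopR (tstep T u) (tstep T u.+1) G (pt T j z) = radial_op (qi T u) (fun z => G (pt T j z)) z.
Proof.
move=> sT tN tt z0 js; set q := qi T u.
have -> : SopR (tstep T u) (tstep T u.+1) G (pt T j z) =
    'D_(delta_mx 0 (inord (tstep T u).+1)) (fun x' => 'D_(delta_mx 0 (inord (tstep T u).+1)) G x') (pt T j z).
  rewrite /SopR ifT // /bsq big1 // => s b.
  by rewrite (pt_block T j z u s sT b) z0 mul0r expr0n.
have qE : pt T j (delta_mx 0 q) = delta_mx 0 (inord (tstep T u).+1).
  apply/rowP => s; rewrite pt_delta // mxE eqxx /= -val_eqE /= inordK //.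
  case: ifPn => b; first by rewrite js.
  case: eqP => // E; move: b; rewrite /inblock E; lia.
rewrite /radial_op z0 eqxx.
apply: derive_line_eq => h; rewrite -qE -pt_lin //.
by apply: derive_line_eq => k; rewrite -pt_lin.
Qed.

End slices.

Section stems.
Context {R : realType} {A : falgType R} {N : nat}.
Variables (v : 'I_N.+1 -> A).
Implicit Types (T : seq nat) (j : 'rV[R]_N.+1) (g : 'rV[R]_N.+1 -> A).

Definition Sop (lo hi : nat) g : 'rV[R]_N.+1 -> A := amap (SopR lo hi) g.

Definition SmStem T (D : set 'rV[R]_(sdim T)) (F : stemT A T) g :=
  [/\ is_stem T D F, represents v T D F g & forall K, asm D (F K)].

Lemma radial_op_ext n (q : 'I_n) (D : set 'rV[R]_n) (f h : 'rV[R]_n -> R) z : open D ->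
  (forall z, D z -> D (rho q z)) -> (forall z, D z -> f z = h z) -> D z -> radial_op q f z = radial_op q h z.
Proof.
move=> oD rD H Dz.
have K y : D y -> 'D_(delta_mx 0 q) f y = 'D_(delta_mx 0 q) h y by move=> Dy; exact: derive_ext oD H Dy.
rewrite /radial_op; case: eqP => _; first exact: (derive_ext D _ _ z _ oD K Dz).
by rewrite K // !H //; exact: rD.
Qed.

Lemma stem_par T D (F : stemT A T) (K : {set 'I_(tau T)}) (u : 'I_(tau T)) l : is_stem T D F ->
  par D (qi T u) (if u \in K then -1 else 1) (cf (F K) l).
Proof.
move=> sF z Dz; rewrite /cf -reflE sF //; case: ifP => _; last by rewrite mul1r.
by rewrite acoordN mulN1r [in LHS]mxE.
Qed.

Lemma JK_ext T j j' (K : {set 'I_(tau T)}) : (forall (u : 'I_(tau T)) (s : 'I_N.+1), u \in K -> inblock T u s -> j ord0 s = j' ord0 s) ->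
  JK v T j K = JK v T j' K.
Proof.
move=> H; rewrite /JK; apply: eq_bigr => u uK; rewrite /Jc; apply: eq_bigr => s b.
by rewrite (H u s uK b).
Qed.

Lemma slice_asm T D F g j : open D -> SmStem T D F g -> inTorus T j ->
  asm D (fun z => g (pt T j z)).
Proof.
move=> oD [sF rF aF] jT.
apply: (asm_ext D (fun z => \sum_K JK v T j K * F K z)) => //.
  by move=> z Dz; rewrite rF.
exact: asm_lin.
Qed.

(** Linearity passes [radial_op] from the slice to the stem components, and [radial_op] respects
    their parities. The delicate points are those with vanishing block, where [SopR] prescribes a
    direction that [j] need not have. *)
Lemma Sop_stem T D F g (u : 'I_(tau T)) : sorted ltn T -> open D ->
  (forall (u : 'I_(tau T)) y, D y -> D (refl T u y)) -> (tstep T u < N)%N ->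
  SmStem T D F g ->
  SmStem T D (fun K => amap (radial_op (qi T u)) (F K)) (Sop (tstep T u) (tstep T u.+1) g).
Proof.
move=> sT oD rD tN SF; have [sF rF aF] := SF; set q := qi T u.
have rq : forall z, D z -> D (rho q z) by move=> z /(rD u).
have pq K l := stem_par T D F K u l sF.
have s11 (K : {set 'I_(tau T)}) : (if u \in K then -1 else 1 : R) = 1 \/ (if u \in K then -1 else 1 : R) = -1.
  by case: ifP; [right|left].
have aF' K : asm D (amap (radial_op q) (F K)).
  by move=> l; rewrite cf_amap; apply: (radial_op_smooth D q oD rq _ _ (s11 K) (aF K l)); exact: pq.
have uu : (u.+1 < size T)%N by have := ltn_ord u; rewrite {2}/tau; lia.
have tt : (tstep T u < tstep T u.+1)%N by apply: steps_lt => //; lia.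
have sF' : is_stem T D (fun K => amap (radial_op q) (F K)).
  move=> K u' z Dz; have pu' l := stem_par T D F K u' l sF.
  have H l : par D (qi T u') (if u' \in K then -1 else 1) (cf (amap (radial_op q) (F K)) l).
    rewrite cf_amap; case: (eqVneq u' u) => [E|ne].
      by rewrite E; apply: (radial_op_parq D q oD rq _ _ (s11 K) (aF K l)); exact: pq.
    have qq : qi T u' != q by apply/eqP => /qi_inj E; rewrite E eqxx in ne.
    exact: (radial_op_par D q oD rq _ _ (qi T u') _ (s11 K) (aF K l) (pq K l) qq (rD u') (pu' l)).
  apply: cf_inj => l; have := H l z Dz; rewrite /cf -reflE => ->.
  by case: ifP => _; rewrite ?mul1r // acoordN mulN1r [in RHS]mxE.
have lin j z : inTorus T j -> D z ->
    amap (radial_op q) (fun z => g (pt T j z)) z = \sum_K JK v T j K * amap (radial_op q) (F K) z.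
  move=> jT Dz; rewrite -(amap_lin _ (smooth D)).
  - apply: cf_inj => l; rewrite !amapE; apply: (radial_op_ext _ q D) => // y Dy.
    by rewrite /cf rF.
  - by move=> I r c G HG p; apply: CR_sum => // i _; apply: CR_scale => //; exact: HG.
  - by move=> I r c G HG; apply: (radial_op_sum D).
  - by move=> K l; exact: aF.
split => // z Dz j jT.
case: (eqVneq (z ord0 q) 0) => zq; last first.
  rewrite -lin //; apply: cf_inj => l; rewrite !amapE.
  apply: (Sop_slice_nz T j u (cf g l)) => //.
  by have [H _] := smooth_der D _ z q (slice_asm T D F g j oD SF jT l) Dz.
(* Only the block [u] of [j] is changed, into its first basis vector. The point stays the same
   because [z_q = 0], and the components with [u] in [K], the only ones that see the change, vanish
   there by oddness. *)
pose j' : 'rV[R]_N.+1 := \row_s (if inblock T u s then (s == (tstep T u).+1 :> nat)%:R else j ord0 s).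
have jj' (u' : 'I_(tau T)) (s : 'I_N.+1) : u' != u -> inblock T u' s -> j' ord0 s = j ord0 s.
  move=> ne b; rewrite mxE ifF //; apply/negP => b'.
  move: ne; rewrite -val_eqE /= (inblock_uniq _ _ _ _ sT (ltn_ord u') (ltn_ord u) b b') eqxx //.
have j'T : inTorus T j'.
  move=> h hT; case: (eqVneq h u) => [->|ne].
    have s0N : ((tstep T u).+1 < N.+1)%N by [].
    have b0 : inblock T u (Ordinal s0N) by rewrite /inblock /= ltnSn.
    rewrite (bigD1 (Ordinal s0N)) //= big1 => [|s /andP[b ne]].
      by rewrite mxE b0 eqxx expr1n addr0.
    rewrite mxE b; case: eqP => [E|_]; last by rewrite expr0n.
    by case/eqP: ne; apply: val_inj.
  rewrite -[RHS](jT h hT); apply: eq_bigr => s b.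
  by rewrite (jj' (Ordinal hT) s) // -val_eqE.
have -> : pt T j z = pt T j' z.
  apply: pt_ext => // u' s b z0; rewrite (jj' u') //.
  by apply/eqP => E; rewrite E zq eqxx in z0.
have -> : Sop (tstep T u) (tstep T u.+1) g (pt T j' z) = amap (radial_op q) (fun z => g (pt T j' z)) z.
  apply: cf_inj => l; rewrite !amapE; apply: (Sop_slice_z T j' u (cf g l)) => //.
  by move=> s b; rewrite mxE b.
rewrite lin //; apply: eq_bigr => K _; case: (boolP (u \in K)) => uK.
  have -> : amap (radial_op q) (F K) z = 0; last by rewrite !mulr0.
  apply: cf_inj => l; have := stem_par T D _ K u l sF'; rewrite uK => po.
  by rewrite acoord0 [in RHS]mxE; exact: (odd_zero D q _ _ po Dz zq).
congr (_ * _); apply: JK_ext => u' s uK' b; apply: (jj' u') => //.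
by apply/eqP => E; rewrite E (negbTE uK) in uK'.
Qed.

End stems.

(** * Locally analytic functions and recovery of stems *)

Section locally_analytic.
Context {R : realType}.

Lemma Dw_ext n (U : set 'rV[R]_n) (f g : 'rV[R]_n -> R) w x : open U ->
  (forall y, U y -> f y = g y) -> U x -> Dw w f x = Dw w g x.
Proof.
move=> oU H; elim: w x => [|v w IH] x Ux /=; first exact: H.
exact: (derive_ext U _ _ x v oU IH Ux).
Qed.

Lemma ana_ext n (U : set 'rV[R]_n) (f g : 'rV[R]_n -> R) a d M C : open U ->
  (forall y, U y -> f y = g y) -> (forall y, `|y - a| < d -> U y) ->
  ana a d M C f -> ana a d M C g.
Proof.
move=> oU H HU [d0 M0 C0 K]; split => // x xd w; have [A B] := K x xd w.
have Ux := HU x xd; have E y : U y -> Dw w f y = Dw w g y by move=> Uy; exact: (Dw_ext _ U).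
split; last by rewrite -E.
move=> v; have -> : \sum_i v ord0 i * 'D_(delta_mx 0 i) (Dw w g) x =
   \sum_i v ord0 i * 'D_(delta_mx 0 i) (Dw w f) x.
  by apply: eq_bigr => i _; rewrite (derive_ext U _ _ x _ oU E Ux).
exact: (is_derive_ext U _ _ x v _ oU E Ux (A v)).
Qed.

Definition la n (a : 'rV[R]_n) (g : 'rV[R]_n -> R) := exists d M C, ana a d M C g.

Lemma la_ext n (U : set 'rV[R]_n) (f g : 'rV[R]_n -> R) a : open U -> U a ->
  (forall y, U y -> f y = g y) -> la n a f -> la n a g.
Proof.
move=> oU Ua H [d [M [C K]]]; have [d1 d10 Hd] := open_eps _ _ oU Ua.
have d0 : 0 < d by case: K.
exists (Num.min d d1), M, C; apply: (ana_ext _ U f) => //.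
  by move=> y; rewrite lt_min => /andP[_]; exact: Hd.
by apply: ana_weaken K; rewrite // ?lt_min ?d0 // ge_min lexx.
Qed.

Lemma la0 n (a : 'rV[R]_n) : la n a (fun _ => 0).
Proof.
have E w : Dw w (fun _ : 'rV[R]_n => 0 : R) = fun _ => 0.
  by elim: w => //= v w ->; apply/funext => y; exact: derive_cst.
exists 1, 1, 1; split => // x _ w; rewrite E; split.
  move=> v; have -> : \sum_i v ord0 i * 'D_(delta_mx 0 i) (fun _ : 'rV[R]_n => 0 : R) x = 0.
    by apply: big1 => i _; rewrite derive_cst mulr0.
  exact: is_derive_cst.
move=> V V0 _; rewrite normr0 !mulr_ge0 // exprn_ge0 // mul1r; exact: ltW.
Qed.

Lemma la_lin2 n (a : 'rV[R]_n) f g (c c' : R) : la n a f -> la n a g ->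
  la n a (fun y => c * f y + c' * g y).
Proof.
move=> [d [M [C K]]] [d' [M' [C' K']]].
have [d0 M0 C0 _] := K; have [d'0 M'0 C'0 _] := K'.
exists (Num.min d d'), ((`|c| + `|c'| + 1) * (M + M')), (C + C'); apply: ana_lin.
  by apply: ana_weaken K; rewrite ?lt_min ?d0 ?ge_min ?lexx // lerDl ltW.
by apply: ana_weaken K'; rewrite ?lt_min ?d0 ?ge_min ?lexx ?orbT // lerDr ltW.
Qed.

Lemma la_sum n (a : 'rV[R]_n) (I : Type) (r : seq I) (c : I -> R) (F : I -> 'rV[R]_n -> R) :
  (forall i, la n a (F i)) -> la n a (fun y => \sum_(i <- r) c i * F i y).
Proof.
move=> H; elim: r => [|i r IH]; first by under eq_fun do rewrite big_nil; exact: la0.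
have := la_lin2 n a _ _ (c i) 1 (H i) IH.
by congr (la _ _ _); apply/funext => y; rewrite big_cons mul1r.
Qed.

Lemma la_comp n m (B : 'M[R]_(m, n)) g (a : 'rV[R]_m) : la n (a *m B) g -> la m a (fun y => g (y *m B)).
Proof.
by move=> [d [M [C K]]]; have [d' [C' K']] := ana_comp B g a d M C K; exists d', M, C'.
Qed.

(** The bound one order higher makes each [Dw w g] Lipschitz near any point of the ball, hence
    continuous, and its partial derivatives are [Dw] of longer words. *)
Lemma ana_CR n (a : 'rV[R]_n) d M C g p : ana a d M C g -> CR p [set x | `|x - a| < d] g.
Proof.
move=> K; have [d0 M0 C0 H] := K; have oB := nball_open a d.
suff S w : CR p [set x | `|x - a| < d] (Dw w g) by exact: (S [::]).
have cont w' x : `|x - a| < d -> {for x, continuous (Dw w' g)}.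
  move=> xd; apply/cont_eps => e e0.
  pose V := 1 + \sum_(v <- w') `|v|.
  have V1 : 1 <= V by rewrite lerDl sumr_ge0.
  have V0 : 0 < V by exact: lt_le_trans V1.
  have wV v : v \in w' -> `|v| <= V.
    move=> vw; rewrite /V (big_rem v vw) /= addrCA lerDl.
    by rewrite addr_ge0 // sumr_ge0.
  pose k := size w'; pose L := n%:R * (M * (C * V) ^+ k.+1 * (k.+1)`!%:R) + 1.
  have L0 : 0 < L by rewrite ltr_wpDl // !mulr_ge0 // ?exprn_ge0 ?mulr_ge0 //; exact: ltW.
  exists (Num.min (d - `|x - a|) (e / L)); first by rewrite lt_min subr_gt0 xd divr_gt0.
  move=> y; rewrite lt_min => /andP[yx ye].
  have inb t : `|t| <= `|1 : R| -> `|x + t *: (y - x) - a| < d.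
    rewrite normr1 => t1; rewrite addrAC; apply: le_lt_trans (ler_normD _ _) _.
    rewrite normrZ -ltrBrDl; apply: le_lt_trans yx; rewrite -[leRHS]mul1r.
    by apply: ler_wpM2r.
  have [t t1] := MVT_line (Dw w' g) x (y - x) (fun t => \sum_i (y - x) ord0 i * 'D_(delta_mx 0 i) (Dw w' g) (x + t *: (y - x))) 1
    (fun t t1 => (H _ (inb t t1) w').1 (y - x)).
  have -> : x + 1 *: (y - x) = y by rewrite scale1r addrC subrK.
  rewrite mul1r => ->.
  apply: (@le_lt_trans _ _ (`|y - x| * L)).
    apply: le_trans (ler_norm_sum _ _ _) _.
    apply: (@le_trans _ _ (\sum_(i < n) `|y - x| * (M * (C * V) ^+ k.+1 * (k.+1)`!%:R))); last first.
      rewrite sumr_const card_ord -[leLHS]mulr_natl /L; move: (normr_ge0 (y - x)).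
      by move: (M * _ * _) (`|y - x|) => K1 X X0; rewrite mulrDr mulr1 mulrCA lerDl.
    apply: ler_sum => i _; rewrite normrM; apply: ler_pM => //; first exact: coord_le_norm.
    apply: (H _ (inb t t1) (delta_mx 0 i :: w')).2 => // v; rewrite inE => /orP[/eqP ->|/wV //].
    by rewrite -[delta_mx 0 i]scale1r norm_delta normr1.
  by rewrite -ltr_pdivlMr.
elim: p w => [|p IH] w; first by split => // x xd; exact: cont.
apply: (CR_S p _ _ (fun i => Dw (delta_mx 0 i :: w) g)) => //.
- by move=> x xd; exact: cont.
- move=> x i xd; have [A _] := H x xd w; have [D0 _] := A (delta_mx 0 i).
  exact: derivableP.
Qed.

Lemma Hc_la n (a : 'rV[R]_n) d h : 0 < d -> Hc a d h -> la n a h.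
Proof.
move=> d0 H; have ca : {for a, continuous h} by apply: Hc_cont H _; rewrite subrr normr0.
have [d1 d10 Hd] := (cont_eps _ _).1 ca 1 ltr01.
have m0 : 0 < Num.min d d1 by rewrite lt_min d0.
exists (Num.min d d1 / 2), (`|h a| + 1), (4 * ((n%:R * n.+1%:R + 1) * 2 / Num.min d d1)).
have M0 : 0 < `|h a| + 1 by rewrite ltr_wpDl.
have Hm : Hc a (Num.min d d1) h by apply: Hc_sub H; rewrite ge_min lexx.
apply: (Hc_ana a _ _ h m0 M0 Hm) => x; rewrite lt_min => /andP[_ /Hd xa].
have -> : h x = h a + (h x - h a) by rewrite addrC subrK.
by apply: le_trans (ler_normD _ _) _; rewrite lerD2l ltW.
Qed.

Section avalued_la.
Context {A : falgType R}.

Definition LA n (D : set 'rV[R]_n) (g : 'rV[R]_n -> A) := forall a, D a -> forall l, la n a (cf g l).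

Lemma LA_ext n (D : set 'rV[R]_n) (f g : 'rV[R]_n -> A) : open D -> (forall y, D y -> f y = g y) ->
  LA n D f -> LA n D g.
Proof.
move=> oD H Hf a Da l; apply: (la_ext n D (cf f l)) => //; last exact: Hf.
by move=> y Dy; rewrite /cf H.
Qed.

Lemma LA_lin n D (I : Type) (r : seq I) (c : I -> A) (F : I -> 'rV[R]_n -> A) :
  (forall i, LA n D (F i)) -> LA n D (fun y => \sum_(i <- r) c i * F i y).
Proof.
move=> H a Da j; rewrite cf_lin; apply: la_sum => i; apply: la_sum => l; exact: H.
Qed.

Lemma LA_comp n m (B : 'M[R]_(m, n)) D D' (g : 'rV[R]_n -> A) : LA n D g ->
  (forall y, D' y -> D (y *m B)) -> LA m D' (fun y => g (y *m B)).
Proof. by move=> H HD a Da l; exact: (la_comp _ _ B (cf g l) a (H _ (HD a Da) l)). Qed.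

Lemma LA_asm n (D : set 'rV[R]_n) (g : 'rV[R]_n -> A) : LA n D g -> asm D g.
Proof.
move=> H l p; apply: CR_loc => a Da; have [d [M [C K]]] := H a Da l.
by exists d; [case: K|exact: ana_CR K].
Qed.

(** The coordinates of [A] are finitely many, so they share a ball and constants: a minimum of the
    radii and the sums of the constants. *)
Lemma LA_analytic n (D : set 'rV[R]_n) (g : 'rV[R]_n -> A) : LA n D g -> analytic_on D (fun y => acoord (g y)).
Proof.
move=> H a Da; have /choice[d Hd] := H a Da; have /choice[M HM] := Hd; have /choice[C HC] := HM.
have [dd dd0 Hdd] : exists2 dd : R, 0 < dd & forall l, dd <= d l.
  exists (\big[Num.min/1]_l d l).
    by elim/big_ind: _ => // [x y x0 y0|l _]; [rewrite lt_min x0|case: (HC l)].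
  by move=> l; rewrite (bigD1 l) //= ge_min lexx.
have Msum : forall l, M l <= \sum_l M l + 1.
  move=> l; rewrite (bigD1 l) //= -addrA lerDl addr_ge0 // sumr_ge0 // => i _.
  by case: (HC i) => _ /ltW.
have Csum : forall l, C l <= \sum_l C l + 1.
  move=> l; rewrite (bigD1 l) //= -addrA lerDl addr_ge0 // sumr_ge0 // => i _.
  by case: (HC i) => _ _ /ltW.
apply: (ana_analytic _ (fun y => acoord (g y)) a dd (\sum_l M l + 1) (\sum_l C l + 1)) => //.
- by move=> l; apply: ana_weaken (HC l).
- by rewrite ltr_wpDl // sumr_ge0 // => i _; case: (HC i) => _ /ltW.
- by rewrite ltr_wpDl // sumr_ge0 // => i _; case: (HC i) => _ _ /ltW.
Qed.

End avalued_la.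

End locally_analytic.

(** * Stem components from a single slice *)

Section recover.
Context {R : realType} {A : falgType R} {N : nat}.
Variables (v : 'I_N.+1 -> A).
Implicit Types (T : seq nat) (j : 'rV[R]_N.+1) (g : 'rV[R]_N.+1 -> A).

Lemma sdim_case T (i : 'I_(sdim T)) : (i <= t0 T)%N \/ exists u, i = qi T u.
Proof.
case: (leqP i (t0 T)) => it; first by left.
right; have iu : (i - (t0 T).+1 < tau T)%N by have := ltn_ord i; rewrite {2}/sdim; lia.
by exists (Ordinal iu); apply: val_inj; rewrite /= subnKC.
Qed.

(** Induction over the torus indices at which the two points may still differ, with at most one
    reflection for each. *)
Lemma refl_signs T (D : set 'rV[R]_(sdim T)) (y y' : 'rV[R]_(sdim T)) :
  (forall (u : 'I_(tau T)) y, D y -> D (refl T u y)) ->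
  (forall i : 'I_(sdim T), (i <= t0 T)%N -> y ord0 i = y' ord0 i) ->
  (forall u, y ord0 (qi T u) = y' ord0 (qi T u) \/ y ord0 (qi T u) = - y' ord0 (qi T u)) ->
  D y' -> D y.
Proof.
move=> rD H0 H1.
have : forall u, u \notin enum 'I_(tau T) -> y ord0 (qi T u) = y' ord0 (qi T u).
  by move=> u; rewrite mem_enum.
elim: (enum _) y' H0 H1 => [|u us IH] y' H0 H1 H2 Dy'.
  have -> // : y = y'; apply/rowP => i.
  by have [/H0|[u ->]] := sdim_case T i; last exact: H2.
case: (H1 u) => Hu.
  apply: (IH y') => // u' u'us; case: (eqVneq u' u) => [->//|ne].
  by apply: H2; rewrite inE negb_or ne.
have r0 (i : 'I_(sdim T)) : i != qi T u -> refl T u y' ord0 i = y' ord0 i.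
  by move=> /negbTE ne; rewrite mxE -/(qi T u) ne.
have ru : refl T u y' ord0 (qi T u) = - y' ord0 (qi T u) by rewrite mxE eqxx.
have qne u' : u' != u -> qi T u' != qi T u by apply: contra => /eqP /qi_inj ->.
apply: (IH (refl T u y')); last exact: rD.
- move=> i it; rewrite r0; first exact: H0.
  by apply/eqP => E; move: it; rewrite E /=; lia.
- move=> u'; case: (eqVneq u' u) => [->|ne]; first by left; rewrite ru.
  by rewrite r0 ?qne //; exact: H1.
- move=> u' u'us; case: (eqVneq u' u) => [->|ne]; first by rewrite ru.
  by rewrite r0 ?qne //; apply: H2; rewrite inE negb_or ne.
Qed.

Lemma JK_linv T j K : clifford_basis v -> sorted ltn T -> (t0 T <= N)%N -> inTorus T j ->
  exists b, b * JK v T j K = 1.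
Proof.
move=> hv sT tN jT; rewrite /JK; elim/big_ind: _ => [|x y [a ax] [b by_]|u _].
- by exists 1; rewrite mulr1.
- by exists (b * a); rewrite mulrA -(mulrA b a x) ax mulr1.
- by exists (- Jc v T j u); rewrite mulNr Jc_sq // opprK.
Qed.

Lemma rho_mx n (q : 'I_n) (y : 'rV[R]_n) : rho q y = y *m (1%:M - 2%:R *: delta_mx q q).
Proof.
rewrite mulmxBr mulmx1 -scalemxAr; apply/rowP => k; rewrite !mxE.
rewrite (bigD1 q) //= big1 ?addr0 => [|i iq]; last by rewrite mxE (negbTE iq) mulr0.
rewrite mxE eqxx /=; case: eqP => [->|_]; last by rewrite !mulr0 subr0.
by rewrite mulr1; ring.
Qed.

(* Each stem component is an iterated even or odd part of a single slice. *)
Lemma stem_LA T D (F : stemT A T) g j : clifford_basis v -> sorted ltn T -> (t0 T <= N)%N -> inTorus T j ->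
  open D -> (forall (u : 'I_(tau T)) y, D y -> D (refl T u y)) ->
  is_stem T D F -> represents v T D F g ->
  LA _ D (fun y => g (pt T j y)) -> forall K, LA _ D (F K).
Proof.
move=> hv sT tN jT oD rD sF rF Hg H.
(* [cl us K] says that [K] and [H] agree on [us]. Treating one more index keeps, of the current sum,
   the part whose parity in that index is that of [H]; at the end only [H] is left. *)
pose cl us (K : {set 'I_(tau T)}) := all (fun u => (u \in K) == (u \in H)) us.
pose S us y := \sum_(K | cl us K) JK v T j K * F K y.
have HS us : LA _ D (S us).
  elim: us => [|u us IH]; first by apply: LA_ext Hg => // y Dy; rewrite rF.
  pose ep (K : {set 'I_(tau T)}) : R := if u \in K then -1 else 1.
  pose G (b : bool) := if b then S us else fun y => S us (refl T u y).
  have HG b : LA _ D (G b).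
    case: b => //=; apply: (LA_ext _ D (fun y => S us (y *m (1%:M - 2%:R *: delta_mx (qi T u) (qi T u))))) => //.
      by move=> y _; rewrite reflE rho_mx.
    by apply: LA_comp IH _ => y Dy; rewrite -rho_mx; exact: rD.
  apply: (LA_ext _ D (fun y => \sum_(b <- [:: true; false]) ((if b then 2^-1 else 2^-1 * ep H) *: 1) * G b y)) => //;
    last exact: LA_lin.
  move=> y Dy; rewrite big_cons big_seq1 -!scalerAl !mul1r /= /S !scaler_sumr -big_split /=.
  rewrite [RHS]big_mkcond [LHS]big_mkcond; apply: eq_bigr => K _; rewrite /cl /=.
  case: (all _ us); rewrite ?andbF ?andbT //.
  have -> : F K (refl T u y) = ep K *: F K y.
    by rewrite sF // /ep; case: ifP => _; rewrite ?scaleN1r ?scale1r.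
  rewrite -scalerAr scalerA -scalerDl /ep.
  set X := JK v T j K * F K y.
  have -> : (if (u \in K) == (u \in H) then X else 0) = ((u \in K) == (u \in H))%:R *: X.
    by case: (_ == _); rewrite ?scale1r ?scale0r.
  by congr (_ *: _); case: (u \in K); case: (u \in H) => /=; lra.
have [b bJ] := JK_linv T j H hv sT tN jT.
have := LA_lin _ D unit [:: tt] (fun _ => b) (fun _ => S (enum 'I_(tau T))) (fun _ => HS _).
apply: LA_ext => // y Dy; rewrite big_seq1 /S (bigD1 H) /=; last first.
  by rewrite /cl; apply/allP => u _.
rewrite big1 ?addr0 => [|K /andP[/allP cK /eqP ne]]; first by rewrite mulrA bJ mul1r.
by case: ne; apply/setP => u; apply/eqP; apply: cK; rewrite mem_enum.
Qed.

Lemma reg_LA T D g j : clifford_basis v -> sorted ltn T -> (t0 T <= N)%N -> inTorus T j -> open D ->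
  Treg v T (Om N T D) g -> LA _ D (fun y => g (pt T j y)).
Proof.
move=> hv sT tN jT oD Hg a Da l.
have [r r0 [_ Hr]] := regularity (wJ v T j) (fun i => wc v T j i) (wJ_cliff v T j hv sT tN jT)
  (fun y => g (pt T j y)) D a oD Da (fun y Dy => Hg j jT y (ex_intro _ y (conj Dy (ex_intro _ j (conj jT erefl))))).
exact: Hc_la r0 (Hr l).
Qed.

End recover.

(** * Absorbing the first block of a torus *)

(** A set of torus indices of the longer list is a set [K] for the shorter one, together with the
    bit [b] telling whether the first index belongs to it. *)
Definition upK m (b : bool) (K : {set 'I_m}) : {set 'I_m.+1} :=
  [set i : 'I_m.+1 | if unlift ord0 i is Some i' then i' \in K else b]%SET.

Lemma upK0 m b (K : {set 'I_m}) : (ord0 \in upK m b K) = b.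
Proof. by rewrite inE unlift_none. Qed.

Lemma upKl m b (K : {set 'I_m}) i : (lift ord0 i \in upK m b K) = (i \in K).
Proof. by rewrite inE liftK. Qed.

Lemma sum_sets (V : nmodType) m (H : {set 'I_m.+1} -> V) :
  \sum_K H K = \sum_(K : {set 'I_m}) (H (upK m false K) + H (upK m true K)).
Proof.
pose dn (K : {set 'I_m.+1}) : {set 'I_m} := [set i | lift ord0 i \in K]%SET.
have dnK b K : dn (upK m b K) = K by apply/setP => i; rewrite inE upKl.
have updn b (K : {set 'I_m.+1}) : (ord0 \in K) = b -> upK m b (dn K) = K.
  move=> Kb; apply/setP => i; case: (unliftP ord0 i) => [i' ->|->]; last by rewrite upK0.
  by rewrite upKl inE.
rewrite (bigID (fun K : {set 'I_m.+1} => ord0 \in K)) /= addrC big_split /=; congr (_ + _).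
  rewrite (reindex_onto (upK m false) dn) /=; last by move=> K /negbTE; exact: updn.
  by apply: eq_bigl => K; rewrite upK0 dnK eqxx.
rewrite (reindex_onto (upK m true) dn) /=; last by move=> K; exact: updn.
by apply: eq_bigl => K; rewrite upK0 dnK eqxx.
Qed.

Lemma prod_anti (R : realType) (A : falgType R) (I : Type) (r : seq I) (P : pred I) (a : I -> A) (X : A) :
  (forall u, P u -> a u * X = - (X * a u)) ->
  X * (\prod_(u <- r | P u) a u) = (\prod_(u <- r | P u) (-1 : R)) *: ((\prod_(u <- r | P u) a u) * X).
Proof.
move=> H; elim: r => [|u r IH]; first by rewrite !big_nil mulr1 mul1r scale1r.
rewrite !big_cons; case: ifP => Pu //; set p := \prod_(_ <- _ | _) a _ in IH *.
have -> : X * (a u * p) = - (a u * (X * p)) by rewrite !mulrA H // mulNr opprK.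
by rewrite IH -scalerAr mulrA mulN1r scaleNr.
Qed.

(** * Index correspondence for one block *)

Section onestep_index.
Context {R : realType}.
Variables (t t' : nat) (T3 : seq nat).
Hypothesis tt : (t < t')%N.
Notation T2 := (t' :: T3).
Notation T1 := (t :: t' :: T3).

Definition q1 : 'I_(sdim T1) := qi T1 (@ord0 (size T3)).
Definition blk1 : pred 'I_(sdim T2) := fun s => (t < s <= t')%N.
(** For [T1] the index [t + 1] is the radius; for [T2] the block occupies [t + 1, ..., t']. Later
    indices are thus shifted by [t' - t - 1], and the block itself is sent to the radial index. *)
Definition e1 (s : 'I_(sdim T2)) : 'I_(sdim T1) :=
  insubd q1 (if (s <= t)%N then s : nat else s - t' + t.+1)%N.
Definition e1' (i : 'I_(sdim T1)) : 'I_(sdim T2) :=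
  insubd (@ord0 (t' + size T3) : 'I_(sdim T2)) (if (i <= t)%N then i : nat else i - t.+2 + t'.+1)%N.

Lemma sdim1 : sdim T1 = (t.+2 + size T3)%N.
Proof. rewrite /sdim /tau /t0 /=; lia. Qed.

Lemma sdim2 : sdim T2 = (t'.+1 + size T3)%N.
Proof. by []. Qed.

Lemma q1E : q1 = t.+1 :> nat.
Proof. by rewrite /= addn0. Qed.

Lemma val_e1 s : ~~ blk1 s -> e1 s = (if (s <= t)%N then s : nat else s - t' + t.+1)%N :> nat.
Proof.
rewrite /blk1 /e1 => bs; rewrite val_insubd ifT //.
have := ltn_ord s; rewrite {2}sdim2 sdim1 => hs.
by case: ifPn => st; lia.
Qed.

Lemma val_e1' i : i != q1 -> e1' i = (if (i <= t)%N then i : nat else i - t.+2 + t'.+1)%N :> nat.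
Proof.
rewrite -(inj_eq (@ord_inj _)) q1E /e1' => iq; rewrite val_insubd ifT //.
have := ltn_ord i; rewrite {2}sdim1 sdim2 => hi.
by case: ifPn => st; lia.
Qed.

Lemma e1K s : ~~ blk1 s -> e1 s != q1 /\ e1' (e1 s) = s.
Proof.
move=> bs; have ne : e1 s != q1.
  rewrite -(inj_eq (@ord_inj _)) q1E val_e1 //; move: bs; rewrite /blk1; case: ifPn => st; lia.
split => //; apply: ord_inj; rewrite val_e1' // val_e1 //; move: bs; rewrite /blk1.
by case: (leqP s t) => st bs; [rewrite st|rewrite ifF]; lia.
Qed.

Lemma e1'K i : i != q1 -> ~~ blk1 (e1' i) /\ e1 (e1' i) = i.
Proof.
move=> iq; have iq' : (i : nat) <> t.+1.
  by move=> E; case/eqP: iq; apply: ord_inj; rewrite q1E.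
have nb : ~~ blk1 (e1' i) by rewrite /blk1 val_e1' //; case: ifPn => st; lia.
split => //; apply: ord_inj; rewrite val_e1 // val_e1' //.
by case: (leqP i t) => it; [rewrite it|rewrite ifF]; lia.
Qed.

Local Notation lf := (@lft R _ _ q1 blk1 e1').

Lemma rad1S (y : 'rV[R]_(sdim T2)) :
  \sum_(s | blk1 s) y ord0 s ^+ 2 = \sum_(s < t'.+1 | (t < s)%N) rowat y s ^+ 2.
Proof.
rewrite (big_ord_widen_cond (sdim T2) (fun s => (t < s)%N) (fun s => rowat y s ^+ 2)); last first.
  by rewrite sdim2 leq_addr.
by apply: eq_bigr => s _; rewrite rowat_ord.
Qed.

Lemma rad1E (y : 'rV[R]_(sdim T2)) M : (t' < M)%N ->
  rad blk1 y ^+ 2 = \sum_(s < M | (t < s <= t')%N) rowat y s ^+ 2.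
Proof.
move=> tM; rewrite rad_sqr rad1S.
by rewrite (big_ord_widen_cond M (fun s => (t < s)%N) (fun s => rowat y s ^+ 2)).
Qed.

Lemma card_blk : #|blk1| = (t' - t)%N.
Proof.
rewrite -sum1_card; transitivity (\sum_(s < t'.+1 | (t < s)%N) 1)%N.
  rewrite (big_ord_widen_cond (sdim T2) (fun s => (t < s)%N) (fun _ => 1%N)); last first.
    by rewrite sdim2 leq_addr.
  by apply: eq_bigl => s.
rewrite -(big_mkord (fun s => (t < s)%N) (fun _ => 1%N)) (big_cat_nat (leq0n t.+1)) /=; last by lia.
rewrite big_nat_cond big_pred0 ?add0n; last by move=> s; lia.
rewrite big_nat_cond (eq_bigl (fun s => (t < s < t'.+1)%N)); last by move=> s; lia.
by rewrite -big_nat sum_nat_const_nat muln1 subSS.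
Qed.

Lemma lift1E (y : 'rV[R]_(sdim T2)) : lift1 T1 T2 y = lf y.
Proof.
apply/rowP => i; rewrite !mxE /liftf /=; have [iq|iq] := eqVneq i q1.
  by rewrite iq q1E ltnn eqxx /rad rad1S.
have iq' : (i : nat) <> t.+1.
  by move=> E; case/eqP: iq; apply: ord_inj; rewrite q1E.
rewrite -(rowat_ord _ y (e1' i)) val_e1' //; case: ifPn => it //.
by rewrite ifF; [congr rowat; lia|apply/eqP].
Qed.

Lemma rowat_lf (y : 'rV[R]_(sdim T2)) k : (k <= t)%N -> rowat (lf y) k = rowat y k.
Proof.
move=> kt; have kq : (k < sdim T1)%N by rewrite sdim1; lia.
rewrite (rowat_lt _ _ _ kq) mxE ifF; last by apply/eqP => /(congr1 (@nat_of_ord _)); rewrite q1E /=; lia.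
rewrite -(rowat_ord _ y (e1' _)) val_e1' /= ?kt //.
by apply/eqP => /(congr1 (@nat_of_ord _)); rewrite q1E /=; lia.
Qed.

Lemma lf_qi (y : 'rV[R]_(sdim T2)) (u : 'I_(tau T2)) :
  lf y ord0 (qi T1 (lift ord0 u)) = y ord0 (qi T2 u).
Proof.
have ne : qi T1 (lift ord0 u) != q1 by rewrite (inj_eq (qi_inj T1)).
rewrite mxE (negbTE ne); congr (y _ _); apply: ord_inj; rewrite val_e1' //.
rewrite /= ifF; last by rewrite /bump /=; lia.
by rewrite /bump /=; lia.
Qed.

Lemma lf_refl (y : 'rV[R]_(sdim T2)) (u : 'I_(tau T2)) :
  lf (refl T2 u y) = refl T1 (lift ord0 u) (lf y).
Proof.
have ne : qi T1 (lift ord0 u) != q1 by rewrite (inj_eq (qi_inj T1)).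
have tq : ((t0 T2).+1 + u)%N = qi T2 u :> nat by [].
apply/rowP => i; rewrite !mxE -/(qi T1 (lift ord0 u)); case: (eqVneq i q1) => [->|iq].
  rewrite eq_sym (negbTE ne) /rad; congr Num.sqrt; apply: eq_bigr => s bs.
  rewrite mxE ifF //; apply/eqP => /(congr1 (@nat_of_ord _)) E; move: bs; rewrite /blk1 E /=; lia.
rewrite -/(qi T2 u); congr (if _ then _ else _); apply/eqP/eqP => [E|->].
  have [_ <-] := e1'K i iq; rewrite E; apply: ord_inj; rewrite val_e1 /= /bump /=.
    by rewrite ifF; lia.
  by rewrite /blk1 /=; lia.
apply: ord_inj; rewrite val_e1' //= /bump /= ifF; last by lia.
by lia.
Qed.

Context {N : nat}.
Implicit Types (j : 'rV[R]_N.+1).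
Hypothesis sT : sorted ltn T1.
Hypothesis tN : (t' <= N)%N.

Definition setblk j (x : nat -> R) : 'rV[R]_N.+1 :=
  \row_s (if (t < s <= t')%N then x s else j ord0 s).

Lemma setblk_out j x h (s : 'I_N.+1) : (h < tau T2)%N -> inblock T2 h s ->
  setblk j x ord0 s = j ord0 s.
Proof.
move=> hT b; rewrite mxE ifF //=.
have sT2 : sorted ltn T2 by move: sT => /= /andP[_].
by have := inblock_gt T2 h s sT2 hT b; rewrite /=; lia.
Qed.

Lemma torus_setblk j (x : nat -> R) : inTorus T2 j -> \sum_(s < N.+1 | (t < s <= t')%N) x s ^+ 2 = 1 ->
  inTorus T1 (setblk j x).
Proof.
move=> jT x1 [_|h hT].
  rewrite -[RHS]x1; apply: eq_bigr => s; rewrite /inblock /tstep /= => b.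
  by rewrite mxE b.
have hT2 : (h < tau T2)%N by [].
by rewrite -[RHS](jT h hT2); apply: eq_bigr => s b; rewrite (setblk_out j x h).
Qed.

Lemma torus_tail j : inTorus T1 j -> inTorus T2 j.
Proof. by move=> jT h hT; exact: (jT h.+1). Qed.

Lemma sum_tau1 (P : nat -> bool) (F : nat -> R) : \sum_(h < tau T1 | P h) F h =
  (if P 0%N then F 0%N else 0) + \sum_(h < tau T2 | P h.+1) F h.+1.
Proof.
rewrite [LHS]big_mkcond [X in _ + X]big_mkcond.
exact: (big_ord_recl (size T3) (fun h : 'I_(size T3).+1 => if P h then F h else 0)).
Qed.

Lemma pt1E j j' (y : 'rV[R]_(sdim T2)) (z : 'rV[R]_(sdim T1)) :
  (forall k, (k <= t)%N -> rowat y k = rowat z k) ->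
  (forall s : 'I_N.+1, (t < s <= t')%N -> rowat y s = z ord0 q1 * j' ord0 s) ->
  (forall u : 'I_(tau T2), y ord0 (qi T2 u) = z ord0 (qi T1 (lift ord0 u))) ->
  (forall s : 'I_N.+1, (t' < s)%N -> j' ord0 s = j ord0 s) ->
  pt T2 j y = pt T1 j' z.
Proof.
move=> H1 H2 H3 H4; have sT2 : sorted ltn T2 by move: sT => /= /andP[_].
apply/rowP => s; case: (leqP s t') => st'.
  rewrite (pt_mirror T2) //; case: (leqP s t) => st; first by rewrite (pt_mirror T1) // H1.
  have b : inblock T1 (@ord0 (size T3)) s by rewrite /inblock /tstep /= st.
  by rewrite (pt_block T1 j' z (@ord0 (size T3)) s sT b) H2 ?st.
rewrite !mxE /= leqNgt st' /= leqNgt (ltn_trans tt st') /=.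
rewrite (sum_tau1 (fun h => inblock T1 h s) (fun h => rowat z (t.+1 + h) * j' ord0 s)).
rewrite {2}/inblock /tstep /= [(s <= t')%N]leqNgt st' andbF add0r.
apply: eq_bigr => u _; rewrite H4 //; congr (_ * _).
by have := H3 u; rewrite -(rowat_ord _ y (qi T2 u)) -(rowat_ord _ z _).
Qed.

End onestep_index.

(** * Slices, stems and equations after absorbing a block *)

Section onestep.
Context {R : realType} {A : falgType R} {N : nat}.
Variable v : 'I_N.+1 -> A.
Hypothesis hv : clifford_basis v.
Variables (t t' : nat) (T3 : seq nat).
Notation T2 := (t' :: T3).
Notation T1 := (t :: t' :: T3).
Hypothesis sT : sorted ltn T1.
Hypothesis tN : (t' <= N)%N.
Variable D1 : set 'rV[R]_(sdim T1).
Hypothesis oD : open D1.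
Hypothesis rD : forall (u : 'I_(tau T1)) y, D1 y -> D1 (refl T1 u y).
Implicit Types (j : 'rV[R]_N.+1) (g : 'rV[R]_N.+1 -> A).

Local Notation q := (q1 t t' T3).
Local Notation blk := (blk1 t t' T3).
Local Notation e := (e1 t t' T3).
Local Notation e' := (e1' t t' T3).
Local Notation lf := (lft q blk e').
Local Notation D2 := [set y | D1 (lf y)].
Local Notation up := (upK (size T3)).

Let tt : (t < t')%N.
Proof. by move: sT => /= /andP[]. Qed.

Let sT2 : sorted ltn T2.
Proof. by move: sT => /= /andP[_]. Qed.

Let rq : forall z, D1 z -> D1 (rho q z).
Proof. by move=> z /(rD (@ord0 (size T3))). Qed.

Let eK := e1K t t' T3 tt.
Let e'K := e1'K t t' T3 tt.

Definition Xv (y : 'rV[R]_(sdim T2)) : A := \sum_(s | blk s) y ord0 s *: vn v s.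

Lemma Xv_N (y : 'rV[R]_(sdim T2)) : Xv y = \sum_(s < N.+1 | (t < s <= t')%N) rowat y s *: v s.
Proof.
transitivity (\sum_(s < t'.+1 | (t < s)%N) rowat y s *: vn v s).
  rewrite (big_ord_widen_cond (sdim T2) (fun s => (t < s)%N) (fun s => rowat y s *: vn v s)); last first.
    by rewrite sdim2 leq_addr.
  by apply: eq_bigr => s _; rewrite rowat_ord.
rewrite (big_ord_widen_cond N.+1 (fun s => (t < s)%N) (fun s => rowat y s *: vn v s)) //.
by apply: eq_bigr => s _; rewrite /vn valK.
Qed.

Lemma Xb_Xv j y : Xb blk (wJ v T2 j) y = Xv y.
Proof. by apply: eq_bigr => s /andP[_ st]; rewrite /wJ /= st. Qed.

Lemma JK_up j b (K : {set 'I_(tau T2)}) :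
  JK v T1 j (up b K) = (if b then Jc v T1 j 0 else 1) * JK v T2 j K.
Proof.
rewrite /JK big_mkcond [X in _ * X]big_mkcond.
apply: etrans (big_ord_recl (size T3) (fun u : 'I_(size T3).+1 => if u \in up b K then Jc v T1 j u else 1)) _.
rewrite upK0; congr (_ * _); apply: eq_bigr => u _; by rewrite upKl.
Qed.

Lemma JK_setblk j x (K : {set 'I_(tau T2)}) : JK v T2 (setblk t t' j x) K = JK v T2 j K.
Proof.
by apply: JK_ext => u s _ b; rewrite (setblk_out t t' T3 tt sT tN j x u).
Qed.

(** Polar decomposition of the block component of [y]: its norm is the radial coordinate of the
    lifted point, its direction the new first torus element. *)
Lemma pt_lf j y : inTorus T2 j -> exists x,
  [/\ inTorus T1 (setblk t t' j x), pt T2 j y = pt T1 (setblk t t' j x) (lf y) &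
      rad blk y *: Jc v T1 (setblk t t' j x) 0 = Xv y].
Proof.
(* If the block component vanishes, the first basis vector of the block is taken as direction. *)
move=> jT; pose x s : R := if rad blk y == 0 then (s == t.+1)%:R else rowat y s / rad blk y.
have xr s : (t < s <= t')%N -> rad blk y * x s = rowat y s.
  move=> b; rewrite /x; case: eqP => [r0|/eqP r0]; last by rewrite mulrC divfK.
  rewrite r0 mul0r; have sd : (s < sdim T2)%N by rewrite sdim2; lia.
  by rewrite (rowat_lt _ _ _ sd) (rad0 blk y (Ordinal sd) r0).
have x1 : \sum_(s < N.+1 | (t < s <= t')%N) x s ^+ 2 = 1.
  rewrite /x; case: eqP => [r0|/eqP r0].
    have tN1 : (t.+1 < N.+1)%N by rewrite ltnS (leq_trans tt).
    rewrite (bigD1 (Ordinal tN1)) /=; last by rewrite ltnSn.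
    rewrite eqxx expr1n big1 ?addr0 // => s /andP[_ ne]; case: eqP => [E|_]; last by rewrite expr0n.
    by case/eqP: ne; apply: ord_inj.
  under eq_bigr do rewrite expr_div_n.
  by rewrite -mulr_suml -(rad1E t t' T3) // mulfV // sqrf_eq0.
exists x; split.
- exact: torus_setblk.
- apply: pt1E => //.
  + by move=> k kt; rewrite rowat_lf.
  + by move=> s b; rewrite lftq mxE b xr.
  + by move=> u; rewrite lf_qi.
  + by move=> s st; rewrite mxE [(s <= t')%N]leqNgt st andbF.
- rewrite Xv_N /Jc scaler_sumr; apply: eq_bigr => s; rewrite /inblock /tstep /= => b.
  by rewrite scalerA mxE b xr.
Qed.

Section stem.
Variables (F : stemT A T1) (g : 'rV[R]_N.+1 -> A).
Hypothesis SF : SmStem v T1 D1 F g.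

Definition F0 (K : {set 'I_(tau T2)}) : 'rV[R]_(sdim T1) -> A := F (up false K).
(** The components containing [J_1] are odd in the radial variable, hence divisible by it; the
    quotient is the [b] of the decomposition [a + J_1 z b]. *)
Definition F1 (K : {set 'I_(tau T2)}) : 'rV[R]_(sdim T1) -> A := aQ q (F (up true K)).

Lemma F0_asm K : asm D1 (F0 K).
Proof. by case: SF => _ _; apply. Qed.

Lemma F0_aev K : aev q D1 (F0 K).
Proof.
by case: SF => sF _ _; apply/aevP => z Dz; have := sF (up false K) (@ord0 (size T3)) z Dz; rewrite upK0.
Qed.

Lemma Fodd K : aodd q D1 (F (up true K)).
Proof.
by case: SF => sF _ _; apply/aoddP => z Dz; have := sF (up true K) (@ord0 (size T3)) z Dz; rewrite upK0.
Qed.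

Lemma F1_asm K : asm D1 (F1 K).
Proof. by apply: aQ_asm => //; [case: SF => _ _; apply|exact: Fodd]. Qed.

Lemma F1_aev K : aev q D1 (F1 K).
Proof. by apply: aQ_aev; exact: Fodd. Qed.

Definition aj j (z : 'rV[R]_(sdim T1)) : A := \sum_K JK v T2 j K * F0 K z.
Definition bj j (z : 'rV[R]_(sdim T1)) : A := \sum_K JK v T2 j K * F1 K z.

Lemma aj_asm j : asm D1 (aj j).
Proof. by apply: asm_lin => // K; exact: F0_asm. Qed.

Lemma bj_asm j : asm D1 (bj j).
Proof. by apply: asm_lin => // K; exact: F1_asm. Qed.

Lemma aj_aev j : aev q D1 (aj j).
Proof.
by apply/aevP => z Dz; apply: eq_bigr => K _; have /aevP -> := F0_aev K.
Qed.

Lemma bj_aev j : aev q D1 (bj j).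
Proof.
by apply/aevP => z Dz; apply: eq_bigr => K _; have /aevP -> := F1_aev K.
Qed.

Lemma aj_setblk j x z : aj (setblk t t' j x) z = aj j z.
Proof. by apply: eq_bigr => K _; rewrite JK_setblk. Qed.

Lemma bj_setblk j x z : bj (setblk t t' j x) z = bj j z.
Proof. by apply: eq_bigr => K _; rewrite JK_setblk. Qed.

Lemma slice1 j z : inTorus T1 j -> D1 z ->
  g (pt T1 j z) = aj j z + Jc v T1 j 0 * (z ord0 q *: bj j z).
Proof.
move=> jT Dz; case: SF => sF rF aF; rewrite rF // (sum_sets _ (size T3)) big_split /=; congr (_ + _).
  by apply: eq_bigr => K _; rewrite JK_up mul1r.
rewrite /bj scaler_sumr mulr_sumr; apply: eq_bigr => K _; rewrite JK_up /F1 -mulrA; congr (_ * _).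
by rewrite scalerAr (aQ_mul q D1 _ z (Fodd K) Dz).
Qed.

Lemma slice2 j y : inTorus T2 j -> D2 y ->
  g (pt T2 j y) = phi q blk e' (wJ v T2 j) (aj j) (bj j) y.
Proof.
move=> jT Dy; have [x [xT -> xX]] := pt_lf j y jT.
rewrite slice1 // aj_setblk bj_setblk /phi Xb_Xv -xX lftq; congr (_ + _).
by rewrite -scalerAl scalerAr.
Qed.

(** The sign is [(-1)^|K|]. It comes from moving the block variable past [J_K], which a stem
    expansion needs on the left. *)
Definition G2 (K : {set 'I_(tau T2)}) (y : 'rV[R]_(sdim T2)) : A :=
  F0 K (lf y) + (\prod_(u in K) (-1 : R)) *: (Xv y * F1 K (lf y)).

Lemma JK_Xv j y (K : {set 'I_(tau T2)}) : inTorus T2 j ->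
  Xv y * JK v T2 j K = (\prod_(u in K) (-1 : R)) *: (JK v T2 j K * Xv y).
Proof.
move=> jT; apply: prod_anti => u uK; rewrite /Xv mulr_sumr mulr_suml -sumrN; apply: eq_bigr => s bs.
have := wJ_cliff v T2 j hv sT2 tN jT s (qi T2 u).
rewrite !wcN //=; last by move: bs; rewrite /blk1; lia.
have -> : wJ v T2 j s = vn v s by move: bs => /andP[_ st]; rewrite /wJ /= st.
have -> : wJ v T2 j (qi T2 u) = Jc v T2 j u by rewrite /wJ /= ifF ?addKn //; lia.
have -> : (s == qi T2 u) = false.
  by apply/eqP => /(congr1 (@nat_of_ord _)) E; move: bs; rewrite /blk1 E /=; lia.
rewrite scale0r !mulNr => /eqP; rewrite -opprD oppr_eq0 addr_eq0 => /eqP E.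
by rewrite -scalerAr -scalerAl E scalerN opprK.
Qed.

Lemma stem2 : SmStem v T2 D2 G2 g.
Proof.
have pN (K : {set 'I_(tau T2)}) : (\prod_(u in K) (-1 : R)) * (\prod_(u in K) (-1 : R)) = 1.
  by rewrite -big_split /= big1 // => u _; rewrite mulrNN mulr1.
have oD2 := lft_open q blk e' _ oD.
case: SF => sF rF aF; split.
- move=> K u y Dy; have Dl : D1 (lf y) by [].
  rewrite /G2 (lf_refl t t' T3 tt); set z := lf y.
  have qne : qi T1 (lift ord0 u) != q by rewrite (inj_eq (qi_inj T1)).
  have E0 : F0 K (refl T1 (lift ord0 u) z) = if u \in K then - F0 K z else F0 K z.
    by rewrite /F0 sF // upKl.
  have E1 : F1 K (refl T1 (lift ord0 u) z) = if u \in K then - F1 K z else F1 K z.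
    apply: cf_inj => l; rewrite /F1 amapE reflE.
    have := Q1_par D1 q oD (qi T1 (lift ord0 u)) _ _ qne (rD (lift ord0 u)) (aF (up true K) l)
      (stem_par T1 D1 F (up true K) (lift ord0 u) l sF) z Dl.
    rewrite upKl => ->; case: ifP => _; last by rewrite mul1r amapE.
    by rewrite acoordN mulN1r [in RHS]mxE amapE.
  have EX : Xv (refl T2 u y) = Xv y.
    apply: eq_bigr => s bs; rewrite mxE ifF //; apply/eqP => /(congr1 (@nat_of_ord _)) E.
    by move: bs; rewrite /blk1 E /=; lia.
  rewrite E0 E1 EX; case: ifP => _ //.
  by rewrite mulrN scalerN opprD.
- move=> y Dy j jT; rewrite slice2 // /phi /aj /bj Xb_Xv mulr_sumr -big_split /=.
  apply: eq_bigr => K _; rewrite /G2 mulrDr; congr (_ + _).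
  by rewrite mulrA JK_Xv // -scalerAl -scalerAr mulrA.
- move=> K; apply: asm_add => //.
    by apply: (asm_lft q blk e e' eK e'K D1 oD rq); [exact: F0_asm|exact: F0_aev].
  have H := asm_Xb q blk e e' eK e'K D1 oD rq (fun s => vn v s) (F1 K) (F1_asm K) (F1_aev K).
  have := asm_mul D2 _ ((\prod_(u in K) (-1 : R)) *: 1) oD2 H.
  by apply: asm_ext => // y Dy; rewrite -scalerAl mul1r.
Qed.

Lemma step_wblk j s : blk s -> wc v T2 j s = - wJ v T2 j s.
Proof. by move=> bs; rewrite wcN //; move: bs; rewrite /blk1; lia. Qed.

Lemma step_wcomm j p s : inTorus T2 j -> ~~ blk p -> blk s ->
  wJ v T2 j p * wJ v T2 j s = wJ v T2 j s * wc v T2 j p.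
Proof.
move=> jT bp bs; have := wJ_cliff' v T2 j hv sT2 tN jT p s.
have -> : (p == s) = false by apply/eqP => E; rewrite E bs in bp.
by rewrite scale0r (step_wblk j s bs) mulrN => /eqP; rewrite addrC subr_eq0 => /eqP ->.
Qed.

Lemma reindex_e (V : nmodType) (H : 'I_(sdim T1) -> V) :
  \sum_(i | i != q) H i = \sum_(s | ~~ blk s) H (e s).
Proof.
rewrite (reindex_onto e e'); last by move=> i /e'K[].
apply: eq_bigl => s; case: (boolP (blk s)) => bs /=; last first.
  by have [-> ->] := eK s bs; rewrite eqxx.
apply/negP => /andP[eq /eqP E].
by have [nb _] := e'K _ eq; rewrite E bs in nb.
Qed.

Lemma wJ_e j x s : ~~ blk s -> wJ v T1 (setblk t t' j x) (e s) = wJ v T2 j s.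
Proof.
move=> bs; rewrite /wJ (val_e1 t t' T3 tt s bs) /=; case: (leqP s t) => st.
  by rewrite st ifT //; lia.
have st' : (t' < s)%N by move: bs; rewrite /blk1; lia.
rewrite !ifF; try lia.
have -> : (s - t' + t.+1 - t.+1)%N = (s - t'.+1).+1 by lia.
have hT : (s - t'.+1 < tau T2)%N by have := ltn_ord s; rewrite {2}sdim2 /tau /=; lia.
rewrite /Jc; apply: eq_bigr => k b; by rewrite (setblk_out t t' T3 tt sT tN j x (s - t'.+1)).
Qed.

(** Regularity is used on the slices with [J_1 = c v_(t+1)], for [c = 1] and [c = -1], the other
    [J_u] being fixed. Since [c^2 = 1], the equation is affine in [c], so its constant and linear
    parts vanish separately; they are the two equations of the pair. *)
Lemma reg_pair j : Treg v T1 (Om N T1 D1) g -> inTorus T2 j ->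
  pair_ok q blk e D1 (wJ v T2 j) (fun s => wc v T2 j s) 0 (aj j) (bj j).
Proof.
move=> Hg jT; have sa := aj_asm j; have sb := bj_asm j; have ea := aj_aev j; have eb := bj_aev j.
have tN1 : (t.+1 < N.+1)%N by rewrite ltnS (leq_trans tt).
pose J := v (Ordinal tN1).
have s0d : (t.+1 < sdim T2)%N by rewrite sdim2; lia.
pose s0 := Ordinal s0d; have bs0 : blk s0 by rewrite /blk1 /= ltnSn.
have wJ0 : wJ v T2 j s0 = J by rewrite /wJ /= tt /vn insubT.
pose zb (z : 'rV[R]_(sdim T1)) := z ord0 q *: bj j z.
have szb : asm D1 zb by exact: asm_coord.
pose P1 z := \sum_(s | ~~ blk s) wJ v T2 j s * pd (e s) (aj j) z.
pose P2 z := \sum_(s | ~~ blk s) wJ v T2 j s * (J * pd (e s) zb z).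
have JJ : J * J = -1.
  by have [_ vs _] := hv; apply: vs; rewrite -(inj_eq (@ord_inj _)).
have key (c : R) z : c ^+ 2 = 1 -> D1 z ->
    P1 z + c *: P2 z + c *: (J * (pd q (aj j) z + c *: (J * pd q zb z))) = 0.
  move=> c1 Dz; pose x (s : nat) : R := c * (s == t.+1)%:R.
  have xT : inTorus T1 (setblk t t' j x).
    apply: torus_setblk => //; rewrite (bigD1 (Ordinal tN1)) /=; last by rewrite ltnSn.
    rewrite /x eqxx mulr1 c1 big1 ?addr0 // => s /andP[_ ne].
    case: eqP => [E|_]; last by rewrite mulr0 expr0n.
    by case/eqP: ne; apply: ord_inj.
  have JcE : Jc v T1 (setblk t t' j x) 0 = c *: J.
    rewrite /Jc (bigD1 (Ordinal tN1)) /=; last by rewrite /inblock /tstep /= ltnSn.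
    rewrite mxE /= ltnSn tt /x eqxx mulr1 big1 ?addr0 // => s /andP[b ne].
    move: b; rewrite /inblock /tstep /= => b; rewrite mxE b.
    case: eqP => [E|_]; last by rewrite mulr0 scale0r.
    by case/eqP: ne; apply: ord_inj.
  have Oz : Om N T1 D1 (pt T1 (setblk t t' j x) z) by exists z; split => //; exists (setblk t t' j x).
  have [_] := Hg _ xT z Oz.
  have pdE' i : pd i (fun z => g (pt T1 (setblk t t' j x) z)) z = pd i (aj j) z + c *: (J * pd i zb z).
    rewrite (pd_ext D1 _ (fun z => aj j z + (c *: J) * zb z) i z oD _ Dz); last first.
      by move=> y Dy; rewrite slice1 // aj_setblk bj_setblk JcE.
    rewrite (pd_add D1) //; [|exact: asm_AC|by apply: asm_AC; exact: asm_mul].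
    by rewrite (pd_mul D1) //; [rewrite -scalerAl|exact: asm_AC].
  under eq_bigr do rewrite pdE'.
  rewrite (bigD1 q) //= (reindex_e _ (fun i => wJ v T1 (setblk t t' j x) i *
     (pd i (aj j) z + c *: (J * pd i zb z)))).
  have -> : wJ v T1 (setblk t t' j x) q = c *: J.
    rewrite /wJ ifF; last by rewrite q1E /= ltnn.
    by rewrite q1E /= subnn JcE.
  rewrite -scalerAl addrC => E0; rewrite -[RHS]E0; congr (_ + _).
  rewrite /P1 /P2 scaler_sumr -big_split /=; apply: eq_bigr => s bs.
  by rewrite wJ_e // mulrDr -scalerAr.
have two (a b : A) : a + b = 0 -> a - b = 0 -> a = 0 /\ b = 0.
  move=> H1 H2; have : 2%:R *: a = 0.
    have ab : a = b by apply/eqP; rewrite -subr_eq0 H2.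
    by rewrite scaler_nat mulr2n {2}ab.
  move=> /eqP; rewrite scaler_eq0 pnatr_eq0 /= => /eqP a0.
  by split => //; move: H1; rewrite a0 add0r.
have eqs z : D1 z -> P1 z = pd q zb z /\ P2 z + J * pd q (aj j) z = 0.
  move=> Dz; have K1 := key 1 z (expr1n _ _) Dz.
  have m1 : (-1 : R) ^+ 2 = 1 by rewrite sqrrN expr1n.
  have K2 := key (-1) z m1 Dz.
  have [H1 H2] : P1 z + J * (J * pd q zb z) = 0 /\ P2 z + J * pd q (aj j) z = 0.
    apply: two.
      by rewrite -[RHS]K1 !scale1r mulrDr addrACA [J * (J * _) + _]addrC.
    have abel (a b c d : A) : a + c - (b + d) = a - b - (d - c).
      by rewrite opprB opprD addrACA.
    by rewrite abel -[RHS]K2 !scaleN1r mulrDr mulrN.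
  by split => //; move: H1; rewrite mulrA JJ mulN1r => /eqP; rewrite subr_eq0 => /eqP.
split => // z Dz; split.
  have [E1 _] := eqs z Dz; apply: etrans E1 _.
  rewrite /zb (pd_coord D1) // eqxx addrC !scale1r.
  by rewrite -(aL_mul q D1) // scalerA -expr2.
pose u z := \sum_(s | ~~ blk s) wc v T2 j s * pd (e s) (bj j) z.
have su : asm D1 u.
  apply: (asm_ext D1 (fun z => \sum_(s <- [seq s <- index_enum _ | ~~ blk s]) wc v T2 j s * pd (e s) (bj j) z)) => //.
    by move=> y _; rewrite big_filter.
  by apply: asm_lin => // s; exact: asm_pd.
have sL := aL_asm q D1 oD rq _ sa ea.
apply: cf_inj => l; rewrite acoordN [in RHS]mxE.
(* Slices contain [z b] and not [b], so the second equation is first obtained multiplied by the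
   radial variable. *)
rewrite -mulN1r; apply: (eq_off_hyperplane D1 q oD (cf u l) (fun z => -1 * cf (aL q (aj j)) l z) z) => //.
- by move=> y Dy; exact: smooth_cont (su l) Dy.
- by move=> y Dy; apply: (CR_cont 0 D1) => //; apply: CR_scale => //; exact: sL.
move=> y Dy; have [_] := eqs y Dy.
(* [step_wcomm] moves [J] to the front and turns the coefficients into their conjugates. *)
have -> : P2 y = J * (y ord0 q *: u y).
  rewrite /P2 /u scaler_sumr mulr_sumr; apply: eq_bigr => s bs.
  have esq : (e s == q) = false by have [/negbTE] := eK s bs.
  rewrite (pd_coord D1) // esq scale0r addr0 mulrA -{1}wJ0 step_wcomm // wJ0 -mulrA.
  by rewrite -!scalerAr.
rewrite -(aL_mul q D1) // -mulrDr -scalerDr => /(congr1 (fun a => J * a)).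
move=> E2; have : y ord0 q *: (u y + aL q (aj j) y) = 0.
  by move: E2; rewrite mulrA JJ mulr0 mulN1r => /eqP; rewrite oppr_eq0 => /eqP.
move=> /(congr1 (fun a : A => acoord a ord0 l)); rewrite acoordZ acoordD acoord0 mxE [X in _ * X]mxE.
rewrite [in RHS]mxE mulrDr /cf => /eqP; rewrite addr_eq0 => /eqP ->.
by rewrite mulN1r mulrN.
Qed.

End stem.

End onestep.

(** * The Fueter chain *)

Lemma pd_scale {R : realType} {A : falgType R} {n} (D : set 'rV[R]_n) (c : R) (g : 'rV[R]_n -> A) i y :
  open D -> AC 1 D g -> D y -> pd i (fun y => c *: g y) y = c *: pd i g y.
Proof.
move=> oD Hg Dy; have := pd_mul D (c *: 1) g i y oD Hg Dy; rewrite -scalerAl mul1r => <-.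
by apply: (pd_ext D) => // z _; rewrite -scalerAl mul1r.
Qed.

Lemma lap_scale {R : realType} {A : falgType R} {n} (D : set 'rV[R]_n) (c : R) (g : 'rV[R]_n -> A) y :
  open D -> AC 2 D g -> D y ->
  \sum_i pd i (pd i (fun y => c *: g y)) y = c *: \sum_i pd i (pd i g) y.
Proof.
move=> oD Hg Dy; have Hg1 : AC 1 D g by move=> l; apply: CR_le (Hg l).
rewrite scaler_sumr; apply: eq_bigr => i _.
rewrite -(pd_scale D c (pd i g) i y oD (AC_pd 1 D g i oD Hg) Dy).
by apply: (pd_ext D _ _ i y oD _ Dy) => z Dz; exact: (pd_scale D c g i z oD Hg1 Dz).
Qed.

Section laprel.
Context {R : realType} {A : falgType R} {N : nat}.
Variable v : 'I_N.+1 -> A.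
Implicit Types (T : seq nat) (j : 'rV[R]_N.+1) (g : 'rV[R]_N.+1 -> A).

(** The products [J_K] are constant along a slice. The Laplacian of the stem can thus be read off
    the function, although the stem in [LapRel] is only known to exist. *)
Lemma lap_slice T D (G : stemT A T) g j y : open D -> (forall K, AC 2 D (G K)) ->
  represents v T D G g -> inTorus T j -> D y ->
  \sum_K JK v T j K * LapS A T G K y = \sum_i pd i (pd i (fun z => g (pt T j z))) y.
Proof.
move=> oD aG rG jT Dy.
rewrite (lap_ext D (fun z => g (pt T j z)) (fun z => \sum_K JK v T j K * G K z)) //; last first.
  by move=> z Dz; rewrite rG.
by rewrite (lap_lin D).
Qed.

Lemma LapRel_intro T D (G : stemT A T) g g' : open D -> SmStem v T D G g ->
  (forall j y, inTorus T j -> D y -> g' (pt T j y) = \sum_i pd i (pd i (fun z => g (pt T j z))) y) ->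
  LapRel v T D g g'.
Proof.
move=> oD [sG rG aG] H; exists G; split => //; first by move=> K; apply: asm_Ck => //; exact: asm_AC.
by move=> y Dy j jT; rewrite H // (lap_slice T D G g) // => K; exact: asm_AC.
Qed.

Lemma LapRel_det T D g1 g2 g1' g2' : open D -> LapRel v T D g1 g1' -> LapRel v T D g2 g2' ->
  (forall x, Om N T D x -> g1 x = g2 x) -> forall x, Om N T D x -> g1' x = g2' x.
Proof.
move=> oD [G1 [_ C1 r1 l1]] [G2' [_ C2 r2 l2]] H x [y [Dy [j [jT ->]]]].
have A1 K := Ck_AC D _ _ oD (C1 K); have A2 K := Ck_AC D _ _ oD (C2 K).
apply: etrans (etrans (l1 y Dy j jT) (lap_slice T D G1 g1 j y oD A1 r1 jT Dy)) _; apply/esym.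
apply: etrans (etrans (l2 y Dy j jT) (lap_slice T D G2' g2 j y oD A2 r2 jT Dy)) _; apply/esym.
apply: (lap_ext D) oD _ Dy => z Dz; apply: H; exists z; split => //; by exists j.
Qed.

Lemma LapIter_det T D n g1 g2 g1' g2' : open D -> LapIter v T D n g1 g1' -> LapIter v T D n g2 g2' ->
  (forall x, Om N T D x -> g1 x = g2 x) -> forall x, Om N T D x -> g1' x = g2' x.
Proof.
move=> oD; elim: n g1' g2' => [|n IH] g1' g2' /=; first by move=> -> ->.
move=> [h1 [I1 L1]] [h2 [I2 L2]] H; apply: LapRel_det L1 L2 _ => //; exact: IH.
Qed.

Lemma SmStem_scale T D (F : stemT A T) g (c : R) : open D -> SmStem v T D F g ->
  SmStem v T D (fun K y => c *: F K y) (fun x => c *: g x).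
Proof.
move=> oD [sF rF aF]; split.
- by move=> K u y Dy; rewrite sF //; case: ifP => _ //; rewrite scalerN.
- by move=> y Dy j jT; rewrite rF // scaler_sumr; apply: eq_bigr => K _; rewrite scalerAr.
- move=> K; have := asm_mul D _ (c *: 1) oD (aF K); apply: asm_ext => // y Dy.
  by rewrite -scalerAl mul1r.
Qed.

Lemma SmStem_ext T D (F : stemT A T) g g' : (forall x, Om N T D x -> g x = g' x) ->
  SmStem v T D F g -> SmStem v T D F g'.
Proof.
move=> H [sF rF aF]; split => // y Dy j jT; rewrite -rF //; apply/esym; apply: H.
by exists y; split => //; exists j.
Qed.

(** Two representations of a point of [Omega_D] have the same mirror coordinates and block norms.
    Their torus coordinates differ by signs, under which [D] is invariant. *)
Lemma om_D T D j y : sorted ltn T -> (t0 T <= N)%N -> inTorus T j ->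
  (forall (u : 'I_(tau T)) y, D y -> D (refl T u y)) -> Om N T D (pt T j y) -> D y.
Proof.
move=> sT tN jT rD [y' [Dy' [j' [jT' E]]]]; apply: (refl_signs T D y y') => //.
  move=> i it; have iN : (i < N.+1)%N by lia.
  have := congr1 (fun x : 'rV[R]_N.+1 => x ord0 (Ordinal iN)) E.
  by rewrite !pt_mirror // /= !rowat_ord.
move=> u; have bE k (w : 'rV[R]_(sdim T)) : inTorus T k ->
    \sum_(s < N.+1 | inblock T u s) (pt T k w) ord0 s ^+ 2 = w ord0 (qi T u) ^+ 2.
  move=> kT; rewrite (eq_bigr (fun s => w ord0 (qi T u) ^+ 2 * k ord0 s ^+ 2)) => [|s b].
    by rewrite -mulr_sumr [X in _ * X](kT u (ltn_ord u)) mulr1.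
  by rewrite (pt_block T k w u s sT b) exprMn.
have : y ord0 (qi T u) ^+ 2 = y' ord0 (qi T u) ^+ 2 by rewrite -(bE j) // E bE.
by move=> /eqP; rewrite eqf_sqr => /orP[/eqP|/eqP]; [left|right].
Qed.

End laprel.

Section chain.
Context {R : realType} {A : falgType R} {N : nat}.
Variable v : 'I_N.+1 -> A.
Hypothesis hv : clifford_basis v.
Variables (t t' : nat) (T3 : seq nat).
Notation T2 := (t' :: T3).
Notation T1 := (t :: t' :: T3).
Hypothesis sT : sorted ltn T1.
Hypothesis tN : (t' <= N)%N.
Variable D1 : set 'rV[R]_(sdim T1).
Hypothesis oD : open D1.
Hypothesis rD : forall (u : 'I_(tau T1)) y, D1 y -> D1 (refl T1 u y).
Implicit Types (j : 'rV[R]_N.+1) (g : 'rV[R]_N.+1 -> A).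

Local Notation q := (q1 t t' T3).
Local Notation blk := (blk1 t t' T3).
Local Notation e := (e1 t t' T3).
Local Notation e' := (e1' t t' T3).
Local Notation lf := (lft q blk e').
Local Notation D2 := [set y | D1 (lf y)].
Local Notation S := (Sop t t').
Local Notation aj := (aj v t t' T3).
Local Notation bj := (bj v t t' T3).

Let tt : (t < t')%N.
Proof. by move: sT => /= /andP[]. Qed.

Let sT2 : sorted ltn T2.
Proof. by move: sT => /= /andP[_]. Qed.

Let rq : forall z, D1 z -> D1 (rho q z).
Proof. by move=> z /(rD (@ord0 (size T3))). Qed.

Let eK := e1K t t' T3 tt.
Let e'K := e1'K t t' T3 tt.
Let oD2 := lft_open q blk e' _ oD.

Definition radial_stem (F : stemT A T1) : stemT A T1 := fun K => amap (radial_op q) (F K).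

Lemma radial_stem_SmStem F g : SmStem v T1 D1 F g -> SmStem v T1 D1 (radial_stem F) (S g).
Proof.
move=> SF; apply: (Sop_stem v T1 D1 F g (@ord0 (size T3)) sT oD rD _ SF).
exact: leq_trans tt tN.
Qed.

Lemma aj_radial F g j z : SmStem v T1 D1 F g -> D1 z -> aj (radial_stem F) j z = aL q (aj F j) z.
Proof.
move=> SF Dz; rewrite (aL_lin q D1) //; last first.
- by move=> K; exact: (F0_aev v t t' T3 D1 F g SF).
- by move=> K; exact: (F0_asm v t t' T3 D1 F g SF).
apply: eq_bigr => K _; congr (_ * _); apply: cf_inj => l; rewrite !amapE.
apply: (radial_op_even D1) => //; first exact: (F0_asm v t t' T3 D1 F g SF).
exact: (F0_aev v t t' T3 D1 F g SF).
Qed.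

(** On an odd component [radial_op] is [z L (F / z)], so after division by [z] it acts as [L]. *)
Lemma bj_radial F g j z : SmStem v T1 D1 F g -> D1 z -> bj (radial_stem F) j z = aL q (bj F j) z.
Proof.
move=> SF Dz; rewrite (aL_lin q D1) //; last first.
- by move=> K; exact: (F1_aev v t t' T3 D1 F g SF).
- by move=> K; exact: (F1_asm v t t' T3 D1 oD F g SF).
apply: eq_bigr => K _; congr (_ * _); apply: cf_inj => l; rewrite !amapE !cf_amap; apply/esym.
have sF : smooth D1 (cf (F (upK (size T3) true K)) l) by case: SF => _ _; apply.
have oF := Fodd v t t' T3 D1 F g SF K l.
have sQ := Q1_smooth D1 q oD _ sF oF; have eQ := Q1_parq D1 q _ oF.
have or : (-1 : R) = 1 \/ (-1 : R) = -1 by right.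
apply: (Q1_char D1 q oD) => //.
- exact: (radial_op_smooth D1 q oD rq _ _ or sF oF).
- exact: (radial_op_parq D1 q oD rq _ _ or sF oF).
- by move=> y Dy; apply: (smooth_cont D1) => //; exact: Lq_smooth.
- by move=> y Dy; rewrite (radial_op_odd D1).
Qed.

Lemma pair_ok_ext w w' k (a b a' b' : 'rV[R]_(sdim T1) -> A) : (forall z, D1 z -> a z = a' z) ->
  (forall z, D1 z -> b z = b' z) -> pair_ok q blk e D1 w w' k a b -> pair_ok q blk e D1 w w' k a' b'.
Proof.
move=> Ha Hb [sa sb ea eb H]; split.
- exact: asm_ext oD Ha sa.
- exact: asm_ext oD Hb sb.
- by apply/aevP => z Dz; rewrite -!Ha //; [have /aevP -> := ea|exact: rq].
- by apply/aevP => z Dz; rewrite -!Hb //; [have /aevP -> := eb|exact: rq].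
move=> z Dz; have [H1 H2] := H z Dz; split.
  rewrite -(aL_ext q D1 oD b b' z Hb Dz) -Hb // -H1; apply: eq_bigr => s _; congr (_ * _).
  by apply/esym; exact: (pd_ext D1).
rewrite -(aL_ext q D1 oD a a' z Ha Dz) -H2; apply: eq_bigr => s _; congr (_ * _).
by apply/esym; exact: (pd_ext D1).
Qed.

Variables (F : stemT A T1) (g : 'rV[R]_N.+1 -> A).
Hypothesis SF : SmStem v T1 D1 F g.
Hypothesis Hg : Treg v T1 (Om N T1 D1) g.

Local Notation Fk k := (iter k radial_stem F).
Local Notation gk k := (iter k S g).

Lemma chain_stem k : SmStem v T1 D1 (Fk k) (gk k).
Proof. by elim: k => //= k IH; exact: radial_stem_SmStem. Qed.

(** Regularity of [g] enters at [k = 0]; from then on the equations propagate by [pair_L]. *)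
Lemma chain_pair k j : inTorus T2 j ->
  pair_ok q blk e D1 (wJ v T2 j) (fun s => wc v T2 j s) k (aj (Fk k) j) (bj (Fk k) j).
Proof.
move=> jT; elim: k => [|k IH]; first exact: (reg_pair v hv t t' T3 sT tN D1 oD rD F g SF).
apply: pair_ok_ext (pair_L q blk e e' eK D1 oD rq _ _ k _ _ IH).
  by move=> z Dz; rewrite (aj_radial _ _ _ _ (chain_stem k)).
by move=> z Dz; rewrite (bj_radial _ _ _ _ (chain_stem k)).
Qed.

Lemma chain_slice k j y : inTorus T2 j -> D2 y ->
  gk k (pt T2 j y) = phi q blk e' (wJ v T2 j) (aj (Fk k) j) (bj (Fk k) j) y.
Proof. by move=> jT Dy; exact: (slice2 v t t' T3 sT tN D1 _ _ (chain_stem k)). Qed.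

Lemma chain_lap k j y : inTorus T2 j -> D2 y ->
  \sum_i pd i (pd i (fun y => gk k (pt T2 j y))) y =
  ((t' - t)%:R - k.*2.+1%:R) *: gk k.+1 (pt T2 j y).
Proof.
move=> jT Dy.
rewrite (lap_ext D2 _ (phi q blk e' (wJ v T2 j) (aj (Fk k) j) (bj (Fk k) j)) y oD2 _ Dy); last first.
  by move=> z Dz; exact: chain_slice.
rewrite (lap_phi q blk e e' eK e'K D1 oD rq _ _ (wJ_cliff v T2 j hv sT2 tN jT)
  (step_wblk v t t' T3 sT tN j) (fun p s => step_wcomm v hv t t' T3 sT tN j p s jT) k _ _ y (chain_pair k j jT) Dy).
rewrite (card_blk t t' T3 tt) (chain_slice k.+1) // /phi; congr (_ *: (_ + _ * _)).
  by rewrite (aj_radial _ _ _ _ (chain_stem k)).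
by rewrite (bj_radial _ _ _ _ (chain_stem k)).
Qed.

(** The factors [d - 2 i - 1] collected from [k] Laplacians, with [d = t' - t]. For [d = 2 n + 1]
    and [k = n] the product is [2^n n!]. *)
Definition fueter_coef (k : nat) : R := \prod_(i < k) ((t' - t)%:R - (i.*2.+1)%:R).

Lemma chain_iter k : LapIter v T2 D2 k g (fun x => fueter_coef k *: gk k x).
Proof.
elim: k => [|k IH] /=; first by apply/funext => x; rewrite /fueter_coef big_ord0 scale1r.
exists (fun x => fueter_coef k *: gk k x); split => //.
have Sk := SmStem_scale v T2 D2 _ _ (fueter_coef k) oD2 (stem2 v hv t t' T3 sT tN D1 oD rD _ _ (chain_stem k)).
apply: LapRel_intro oD2 Sk _ => j y jT Dy.
have sl : AC 2 D2 (fun y => gk k (pt T2 j y)).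
  apply: asm_AC; apply: (slice_asm v T2 D2) => //; exact: (stem2 v hv t t' T3 sT tN D1 oD rD _ _ (chain_stem k)).
apply/esym; apply: etrans (lap_scale D2 (fueter_coef k) _ y oD2 sl Dy) _.
apply: etrans (congr1 (fun a => fueter_coef k *: a) (chain_lap k j y jT Dy)) _.
by rewrite scalerA /fueter_coef big_ord_recr.
Qed.

Lemma D2_refl (u : 'I_(tau T2)) y : D2 y -> D2 (refl T2 u y).
Proof. by rewrite /= (lf_refl t t' T3 tt) => Dy; exact: rD. Qed.

Lemma chain_reg n : (t' - t)%N = n.*2.+1 -> Treg v T2 (Om N T2 D2) (fun x => fueter_coef n *: gk n x).
Proof.
move=> tn j jT y Oy; have Dy : D2 y by apply: (om_D T2 D2 j) => //; exact: D2_refl.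
have Sn := SmStem_scale v T2 D2 _ _ (fueter_coef n) oD2 (stem2 v hv t t' T3 sT tN D1 oD rD _ _ (chain_stem n)).
have sl := slice_asm v T2 D2 _ _ j oD2 Sn jT.
split; first by apply: (AC_derivable D2) => //; exact: asm_AC.
have ok := chain_pair n j jT; have [sa sb ea eb _] := ok.
have sp := asm_phi q blk e e' eK e'K D1 oD rq (wJ v T2 j) _ _ sa sb ea eb.
have dp := dirac_phi q blk e e' eK e'K D1 oD rq _ _ (wJ_cliff v T2 j hv sT2 tN jT)
  (step_wblk v t t' T3 sT tN j) (fun p s => step_wcomm v hv t t' T3 sT tN j p s jT) n _ _ y ok Dy.
rewrite (card_blk t t' T3 tt) tn subrr scale0r in dp.
transitivity (fueter_coef n *: \sum_s wJ v T2 j s * pd s (phi q blk e' (wJ v T2 j) (aj (Fk n) j) (bj (Fk n) j)) y);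
  last by rewrite dp scaler0.
rewrite scaler_sumr; apply: eq_bigr => i _; rewrite scalerAr; congr (_ * _).
rewrite -(pd_scale D2 (fueter_coef n) _ i y oD2 (asm_AC _ _ 1 sp) Dy).
by apply: (pd_ext D2 _ _ i y oD2 _ Dy) => z Dz; congr (_ *: _); exact: chain_slice.
Qed.

End chain.

(** * Domains and slices of two consecutive lists *)

Section geometry.
Context {R : realType} {A : falgType R} {N : nat}.
Variables (t t' : nat) (T3 : seq nat).
Notation T2 := (t' :: T3).
Notation T1 := (t :: t' :: T3).
Hypothesis sT : sorted ltn T1.
Hypothesis tN : (t' <= N)%N.
Variable D1 : set 'rV[R]_(sdim T1).
Hypothesis rD : forall (u : 'I_(tau T1)) y, D1 y -> D1 (refl T1 u y).
Implicit Types (j : 'rV[R]_N.+1).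

Local Notation q := (q1 t t' T3).
Local Notation blk := (blk1 t t' T3).
Local Notation e := (e1 t t' T3).
Local Notation e' := (e1' t t' T3).
Local Notation lf := (lft q blk e').
Local Notation D2 := [set y | D1 (lf y)].

Let tt : (t < t')%N.
Proof. by move: sT => /= /andP[]. Qed.

(* [(alpha, beta_1, beta') |-> (alpha + beta_1 J_1, beta')] *)
Definition extM j : 'M[R]_(sdim T1, sdim T2) :=
  \matrix_(i, s) (if blk s then (i == q)%:R * rowat j s else (i == e s)%:R).

Lemma extM_blk j (z : 'rV[R]_(sdim T1)) s : blk s -> (z *m extM j) ord0 s = z ord0 q * rowat j s.
Proof.
move=> bs; rewrite mxE (bigD1 q) //= big1 ?addr0 => [|i iq]; first by rewrite mxE bs eqxx mul1r.
by rewrite mxE bs (negbTE iq) mul0r mulr0.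
Qed.

Lemma extM_out j (z : 'rV[R]_(sdim T1)) s : ~~ blk s -> (z *m extM j) ord0 s = z ord0 (e s).
Proof.
move=> bs; rewrite mxE (bigD1 (e s)) //= big1 ?addr0 => [|i iq].
  by rewrite mxE (negbTE bs) eqxx mulr1.
by rewrite mxE (negbTE bs) (negbTE iq) mulr0.
Qed.

Lemma pt_extM j z : pt T2 j (z *m extM j) = pt T1 j z.
Proof.
apply: (pt1E t t' T3 tt sT j j) => // [k kt|s b|u].
- have k2 : (k < sdim T2)%N by rewrite sdim2; lia.
  have k1 : (k < sdim T1)%N by rewrite sdim1; lia.
  have bk : ~~ blk (Ordinal k2) by rewrite /blk1 /=; lia.
  rewrite (rowat_lt _ _ _ k2) (rowat_lt _ _ _ k1) extM_out //; congr (z _ _); apply: ord_inj.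
  by rewrite (val_e1 t t' T3 tt) //= kt.
- have s2 : (s < sdim T2)%N by rewrite sdim2; lia.
  by rewrite (rowat_lt _ _ _ s2) extM_blk // rowat_ord.
- have bu : ~~ blk (qi T2 u) by rewrite /blk1 /=; lia.
  rewrite extM_out //; congr (z _ _); apply: ord_inj; rewrite (val_e1 t t' T3 tt) //=.
  by rewrite /bump /= ifF; lia.
Qed.

(** Lifting back recovers [z] except that the radial coordinate becomes [|z_q|]; invariance of [D1]
    under reflections absorbs the sign. *)
Lemma D2_extM j z : inTorus T1 j -> D1 z -> D2 (z *m extM j).
Proof.
move=> jT Dz /=; apply: (refl_signs T1 D1 _ z) => //.
  move=> i it; have iq : i != q.
    by apply/eqP => E; move: it; rewrite E q1E /= ltnn.
  rewrite mxE (negbTE iq) extM_out; last by have [] := e1'K t t' T3 tt i iq.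
  by have [_ ->] := e1'K t t' T3 tt i iq.
move=> u; case: (unliftP (@ord0 (size T3)) u) => [u'|] ->.
  left; rewrite (lf_qi t t' T3 tt).
  have bu : ~~ blk (qi T2 u') by rewrite /blk1 /=; lia.
  rewrite extM_out //; congr (z _ _); apply: ord_inj; rewrite (val_e1 t t' T3 tt) //.
  by case: u' {bu} => k hk; rewrite /= /bump /= ifF; lia.
have E : rad blk (z *m extM j) ^+ 2 = z ord0 q ^+ 2.
  rewrite (rad1E t t' T3 _ N.+1) //.
  rewrite (eq_bigr (fun s : 'I_N.+1 => z ord0 q ^+ 2 * j ord0 s ^+ 2)) => [|s b].
    by rewrite -mulr_sumr [X in _ * X](jT 0%N) ?mulr1.
  have s2 : (s < sdim T2)%N by rewrite sdim2; lia.
  by rewrite (rowat_lt _ _ _ s2) extM_blk // rowat_ord exprMn.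
have -> : qi T1 (@ord0 (size T3)) = q by [].
by rewrite lftq; move/eqP: E; rewrite eqf_sqr => /orP[/eqP|/eqP]; [left|right].
Qed.

(** A slice for the longer list is a linear section of the slice for the shorter list with the same
    torus element, so analyticity follows by linear substitution. *)
Lemma LA_down (g : 'rV[R]_N.+1 -> A) j : inTorus T1 j -> open D1 ->
  LA _ D2 (fun y => g (pt T2 j y)) -> LA _ D1 (fun z => g (pt T1 j z)).
Proof.
move=> jT oD H; apply: (LA_ext _ D1 (fun z => g (pt T2 j (z *m extM j)))) => //.
  by move=> z _; rewrite pt_extM.
by apply: (LA_comp _ _ (extM j) D2 D1 (fun y => g (pt T2 j y)) H) => z Dz; exact: D2_extM.
Qed.

Lemma Om_step (v : 'I_N.+1 -> A) x : Om N T2 D2 x <-> Om N T1 D1 x.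
Proof.
split=> [[y [Dy [j [jT ->]]]]|[z [Dz [j [jT ->]]]]].
  have [x' [xT -> _]] := pt_lf v t t' T3 sT tN j y jT.
  by exists (lf y); split => //; exists (setblk t t' j x').
exists (z *m extM j); split; first exact: D2_extM.
exists j; split; last by rewrite pt_extM.
exact: (torus_tail t t' T3).
Qed.

End geometry.

(** Each [J_h] is taken to be the first basis vector of its block. *)
Lemma torus_ex (R : realType) (N : nat) (T : seq nat) : sorted ltn T -> (forall u, (u < tau T)%N -> (tstep T u < N)%N) ->
  exists j : 'rV[R]_N.+1, inTorus T j.
Proof.
move=> sT tN; exists (\row_s ([exists u : 'I_(tau T), s == (tstep T u).+1 :> nat])%:R) => h hT.
have hN : ((tstep T h).+1 < N.+1)%N by rewrite ltnS tN.
have lt u k : (u < k)%N -> (k < size T)%N -> (tstep T u < tstep T k)%N.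
  by move=> uk kT; apply: steps_lt => //; rewrite uk.
have hS : (h.+1 < size T)%N by move: hT; rewrite /tau; lia.
rewrite (bigD1 (Ordinal hN)) /=; last by apply/andP; split; [exact: ltnSn|exact: lt].
rewrite mxE (_ : [exists u, _]) ?expr1n; last by apply/existsP; exists (Ordinal hT).
rewrite big1 ?addr0 // => s /andP[b ne]; rewrite mxE; case: existsP => [[u /eqP E]|_]; last by rewrite expr0n.
case/eqP: ne; apply: ord_inj; rewrite /= E; congr (_.+1); congr (tstep T _).
have uS : (u < size T)%N by have := ltn_ord u; rewrite {2}/tau; lia.
move: b; rewrite /inblock E => /andP[b1 b2]; case: (ltngtP u h) => // uh.
- have := lt u h uh (ltnW hS); lia.
- move: (uh); rewrite leq_eqVlt => /orP[/eqP E1|h1]; first by move: b2; rewrite -E1 ltnn.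
  have := lt h.+1 u h1 uS; lia.
Qed.

(** * Induction over the absorbed blocks *)

Section step.
Context {R : realType} {A : falgType R} {N : nat}.
Variable v : 'I_N.+1 -> A.
Hypothesis hv : clifford_basis v.

(** Lists and domains are variables tied by equations: the types depend on the lists, and [drop h T]
    is a list with explicit head only up to a proved equality. *)
Lemma step_geom (T1 T2 : seq nat) (D1 : set 'rV[R]_(sdim T1)) (D2 : set 'rV[R]_(sdim T2)) :
  T1 = t0 T1 :: T2 -> T2 != [::] -> sorted ltn T1 -> (t0 T2 <= N)%N ->
  (forall y, D2 y = D1 (lift1 T1 T2 y)) -> open D1 ->
  (forall (u : 'I_(tau T1)) y, D1 y -> D1 (refl T1 u y)) ->
  [/\ open D2, forall (u : 'I_(tau T2)) y, D2 y -> D2 (refl T2 u y),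
    forall x, Om N T2 D2 x <-> Om N T1 D1 x &
    forall g : 'rV[R]_N.+1 -> A, (forall j, inTorus T2 j -> LA _ D2 (fun y => g (pt T2 j y))) ->
      forall j, inTorus T1 j -> LA _ D1 (fun z => g (pt T1 j z))].
Proof.
case: T1 D1 => [|t T] D1 E12 // T20 sT tN E2 oD rD.
have ET : T = T2 by case: E12.
subst T; case: T2 D2 T20 D1 E12 sT tN E2 oD rD => [//|t' T3] D2 _ D1 _ sT tN E2 oD rD.
have tt : (t < t')%N by move: sT => /= /andP[].
have -> : D2 = [set y | D1 (lft (q1 t t' T3) (blk1 t t' T3) (e1' t t' T3) y)].
  by apply/funext => y; rewrite E2 lift1E.
split.
- exact: lft_open.
- by move=> u y Dy; exact: (D2_refl t t' T3 sT D1 rD u y Dy).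
- by move=> x; exact: (Om_step t t' T3 sT tN D1 rD v).
- move=> g Hg j jT; apply: (LA_down t t' T3 sT tN D1 rD g j jT oD).
  by apply: Hg; exact: (torus_tail t t' T3).
Qed.

Lemma step_fueter (T1 T2 : seq nat) (D1 : set 'rV[R]_(sdim T1)) (D2 : set 'rV[R]_(sdim T2))
    (F : stemT A T1) (g : 'rV[R]_N.+1 -> A) (n : nat) :
  T1 = t0 T1 :: T2 -> T2 != [::] -> sorted ltn T1 -> (t0 T2 <= N)%N ->
  (forall y, D2 y = D1 (lift1 T1 T2 y)) -> open D1 ->
  (forall (u : 'I_(tau T1)) y, D1 y -> D1 (refl T1 u y)) ->
  SmStem v T1 D1 F g -> Treg v T1 (Om N T1 D1) g -> (t0 T2 - t0 T1)%N = n.*2.+1 ->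
  exists c : R, [/\ LapIter v T2 D2 n g (fun x => c *: iter n (Sop (t0 T1) (t0 T2)) g x),
    exists G, SmStem v T2 D2 G (fun x => c *: iter n (Sop (t0 T1) (t0 T2)) g x) &
    Treg v T2 (Om N T2 D2) (fun x => c *: iter n (Sop (t0 T1) (t0 T2)) g x)].
Proof.
case: T1 D1 F => [|t T] D1 F E12 // T20 sT tN E2 oD rD SF Hg tn.
have ET : T = T2 by case: E12.
subst T; case: T2 D2 T20 D1 F E12 sT tN E2 oD rD SF Hg tn => [//|t' T3] D2 _ D1 F _ sT tN E2 oD rD SF Hg tn.
have tt : (t < t')%N by move: sT => /= /andP[].
have -> : D2 = [set y | D1 (lft (q1 t t' T3) (blk1 t t' T3) (e1' t t' T3) y)].
  by apply/funext => y; rewrite E2 lift1E.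
have oD2 := lft_open (q1 t t' T3) (blk1 t t' T3) (e1' t t' T3) _ oD.
exists (fueter_coef t t' n); split.
- exact: (chain_iter v hv t t' T3 sT tN D1 oD rD F g SF Hg n).
- exists (fun K y => fueter_coef t t' n *: G2 v t t' T3 (iter n (radial_stem t t' T3) F) K y).
  apply: SmStem_scale => //; apply: (stem2 v hv t t' T3 sT tN D1 oD rD).
  exact: (chain_stem v t t' T3 sT tN D1 oD rD F g SF n).
- exact: (chain_reg v hv t t' T3 sT tN D1 oD rD F g SF Hg n tn).
Qed.

Lemma Treg_ext T (D : set 'rV[R]_(sdim T)) (F : stemT A T) g g' : sorted ltn T -> (t0 T <= N)%N ->
  open D -> (forall (u : 'I_(tau T)) y, D y -> D (refl T u y)) -> SmStem v T D F g' ->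
  (forall x, Om N T D x -> g' x = g x) -> Treg v T (Om N T D) g -> Treg v T (Om N T D) g'.
Proof.
move=> sT tN oD rD SF H Hg j jT y Oy; have Dy : D y by exact: om_D Oy.
have [_ eq] := Hg j jT y Oy; split.
  by apply: (AC_derivable D) => //; apply: asm_AC; exact: slice_asm SF jT.
rewrite -[RHS]eq; apply: eq_bigr => i _; congr (_ * _).
apply: (pd_ext D _ _ i y oD _ Dy) => z Dz; apply: H.
by exists z; split => //; exists j.
Qed.

End step.

Lemma liftD0 (R : realType) t T (y : 'rV[R]_(sdim (t :: T))) : liftD (t :: T) 0 y = y.
Proof.
apply/rowP => i; rewrite mxE /=; case: ifPn => it; first by rewrite rowat_ord.
rewrite subn0 -(rowat_ord _ y i); congr (rowat y _); lia.
Qed.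

Lemma hypercomplex_clifford (R : realType) (A : falgType R) (conj : A -> A) N (v : 'I_N.+1 -> A) :
  hypercomplex_basis conj v -> clifford_basis v.
Proof.
move=> [v0 vs va _ _]; split => // s s0; have [E1 E2] := vs s s0.
have E : conj (v s) = - v s by apply/eqP; rewrite -addr_eq0 addrC E1.
by move: E2; rewrite E mulrN => /eqP; rewrite eqr_oppLR => /eqP.
Qed.

(** The induction carries two stems of the same function: one for the current list, which feeds the
    next step, and one for [T]. The latter survives because the operator of the next block maps
    stems for [T] to stems for [T]. Agreement of all transforms is asserted on [Omega_D], the set on
    which they are determined. *)
Lemma fueter_chain (R : realType) (A : falgType R) (N : nat) (v : 'I_N.+1 -> A) (T : seq nat)
  (D : set 'rV[R]_(sdim T)) (n : nat -> nat) (f : 'rV[R]_N.+1 -> A) (F0 : stemT A T) sigma :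
  clifford_basis v -> is_steps N T -> (sigma <= tau T)%N ->
  (forall h, (1 <= h <= sigma)%N -> (tstep T h - tstep T h.-1)%N = (n h).*2.+1) ->
  open D -> (forall (u : 'I_(tau T)) y, D y -> D (refl T u y)) ->
  SmStem v T D F0 f -> Treg v T (Om N T D) f ->
  let T' := drop sigma T in let D' := Dh T D sigma in
  [/\ open D', forall (u : 'I_(tau T')) y, D' y -> D' (refl T' u y),
    forall x, Om N T' D' x <-> Om N T D x,
    forall g : 'rV[R]_N.+1 -> A, (forall j, inTorus T' j -> LA _ D' (fun y => g (pt T' j y))) ->
      forall j, inTorus T j -> LA _ D (fun z => g (pt T j z)) &
    exists g, [/\ FueterRel v T D n sigma f g, exists F, SmStem v T' D' F g,
      Treg v T' (Om N T' D') g, exists F, SmStem v T D F g &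
      forall g', FueterRel v T D n sigma f g' -> forall x, Om N T D x -> g' x = g x]].
Proof.
move=> hv [T0 sT lT]; have tN u : (u < size T)%N -> (tstep T u <= N)%N.
  move=> uT; rewrite -lT -nth_last; apply: (steps_le T) => //; lia.
elim: sigma => [|h IH] hT nT oD rD SF Hf.
  case: T D F0 T0 sT lT tN hT nT oD rD SF Hf => [//|t T] D F0 T0 sT lT tN hT nT oD rD SF Hf /=.
  have -> : Dh (t :: T) D 0 = D by apply/funext => y; rewrite /Dh /mkset liftD0.
  split => //; exists f; split => //; try by exists F0.
  by move=> g' ->.
have hT' : (h <= tau T)%N by exact: ltnW.
have nT' k : (1 <= k <= h)%N -> (tstep T k - tstep T k.-1)%N = (n k).*2.+1.
  by move=> /andP[k1 kh]; apply: nT; rewrite k1 leqW.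
have [oDh rDh OmE LAd [g [Fg [F1 SF1] Hg [F2 SF2] Ug]]] := IH hT' nT' oD rD SF Hf.
have hS : (h.+1 < size T)%N by move: hT; rewrite /tau; lia.
have Edrop : drop h T = t0 (drop h T) :: drop h.+1 T by rewrite t0_drop -drop_nth // ltnW.
have T2n : drop h.+1 T != [::] by rewrite -size_eq0 size_drop -lt0n subn_gt0.
have sTh : sorted ltn (drop h T) by exact: drop_sorted.
have tN2 : (t0 (drop h.+1 T) <= N)%N by rewrite t0_drop tN.
have E2 y := Dh_step R T D h y sT hS.
have [oD2 rD2 Om2 LA2] := step_geom v _ _ (Dh T D h) (Dh T D h.+1) Edrop T2n sTh tN2 E2 oDh rDh.
have dn : (t0 (drop h.+1 T) - t0 (drop h T))%N = (n h.+1).*2.+1.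
  by rewrite !t0_drop; apply: nT; rewrite /= leqnn.
have [c [LI SG RG]] := step_fueter v hv _ _ (Dh T D h) (Dh T D h.+1) F1 g (n h.+1)
  Edrop T2n sTh tN2 E2 oDh rDh SF1 Hg dn.
have OmE2 x : Om N (drop h.+1 T) (Dh T D h.+1) x <-> Om N T D x by rewrite Om2.
split => //; first by move=> g' Hg'; apply: LAd; exact: LA2.
exists (fun x => c *: iter (n h.+1) (Sop (t0 (drop h T)) (t0 (drop h.+1 T))) g x); split => //.
- by exists g.
- have hu : (h < tau T)%N by [].
  have hN : (tstep T h < N)%N by apply: leq_trans (tN h.+1 hS); apply: steps_lt => //; lia.
  (* The interval from [t_h] to [t_(h+1)] is also a torus block of the initial list, of 0-based
     index [h], so [Sop_stem] applies with [T] itself. *)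
  have S k : exists F, SmStem v T D F (iter k (Sop (t0 (drop h T)) (t0 (drop h.+1 T))) g).
    elim: k => [|k [F HF]]; first by exists F2.
    rewrite !t0_drop in HF *.
    by exists (fun K => amap (radial_op (qi T (Ordinal hu))) (F K)); exact: (Sop_stem v T D F _ (Ordinal hu)).
  by have [F HF] := S (n h.+1); exists (fun K y => c *: F K y); exact: SmStem_scale.
move=> g' [g1 [Fg1 LI']] x Ox.
apply: (LapIter_det v _ _ _ g1 g _ _ oD2 LI' LI); last by apply/OmE2.
by move=> x' /OmE2; exact: Ug.
Qed.

Theorem theorem7p6 (R : realType) (A : falgType R) (conj : A -> A)
  (N : nat) (v : 'I_N.+1 -> A) (T : seq nat) (D : set 'rV[R]_(sdim T))
  (sigma : nat) (n : nat -> nat) (f : 'rV[R]_N.+1 -> A) :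
  star_involution conj ->
  (exists x, SA conj x) ->
  (1 <= N)%N ->
  hypercomplex_basis conj v ->
  is_steps N T ->
  (sigma <= tau T)%N ->
  (forall h, (1 <= h <= sigma)%N -> (tstep T h - tstep T h.-1)%N = (n h).*2.+1) ->
  D_admissible N T D ->
  connected (Om N T D) ->
  SR v T D f ->
  (exists g, FueterRel v T D n sigma f g) /\
  (forall g, FueterRel v T D n sigma f g ->
     SR v (drop sigma T) (Dh T D sigma) g /\ Somega v T D g).
Proof.
move=> _ _ _ /hypercomplex_clifford hv st sigT nT [oD rD _] _ [[F [sF rF]] Hf].
have [T0 sT lT] := st.
have tN u : (u < size T)%N -> (tstep T u <= N)%N.
  by move=> uT; rewrite -lT -nth_last; apply: (steps_le T) => //; lia.
have sz : (0 < size T)%N by rewrite lt0n size_eq0.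
have t0N : (t0 T <= N)%N by rewrite -{1}(drop0 T) t0_drop tN.
have [j0 j0T] : exists j : 'rV[R]_N.+1, inTorus T j.
  apply: torus_ex => // u uT; apply: (@leq_trans (tstep T u.+1)).
    by apply: steps_lt => //; move: uT; rewrite /tau; lia.
  by apply: tN; move: uT; rewrite /tau; lia.
(* The given stem is arbitrary; analyticity of one slice of [f] makes all its components analytic,
   hence smooth. *)
have SF : SmStem v T D F f.
  split => // K; apply: LA_asm.
  exact: (stem_LA v T D F f j0 hv sT t0N j0T oD rD sF rF (reg_LA v T D f j0 hv sT t0N j0T oD Hf)).
have [oD' rD' OmE LAd [g [Fg [F1 SF1] Hg [F2 SF2] Ug]]] :=
  fueter_chain R A N v T D n f F sigma hv st sigT nT oD rD SF Hf.
split; first by exists g.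
(* An arbitrary transform [g'] agrees on [Omega_D] with the constructed [g], from which it receives
   its stems and its regularity. *)
move=> g' Fg'; have E := Ug g' Fg'.
have E' x : Om N (drop sigma T) (Dh T D sigma) x -> g' x = g x by move=> /OmE; exact: E.
have SF1' : SmStem v (drop sigma T) (Dh T D sigma) F1 g'.
  by apply: SmStem_ext SF1 => x Ox; rewrite E'.
have sT' : sorted ltn (drop sigma T) by exact: drop_sorted.
have tN' : (t0 (drop sigma T) <= N)%N by rewrite t0_drop tN //; move: sigT; rewrite /tau; lia.
have Hg' := Treg_ext v _ _ F1 g g' sT' tN' oD' rD' SF1' E' Hg.
split; first by split => //; exists F1; case: SF1'.
have [sF2 rF2 _] : SmStem v T D F2 g' by apply: SmStem_ext SF2 => x Ox; rewrite E.
(* Regularity for the last list makes [g'] analytic on its slices; [LAd] passes this to the slices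
   of [T], and [stem_LA] to the components of [F2]. *)
exists F2; split => // K; apply: LA_analytic.
apply: (stem_LA v T D F2 g' j0) => //; apply: LAd => // j jT.
exact: (reg_LA v _ _ g' j hv sT' tN' jT oD' Hg').
Qed.
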